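(* Let $H$, $h$, $g$ be as in the context and suppose that the assumptions (h-regularity), (g-structure), (H-growth), (H-smoothness) and (monotonicity), all formulated in the context, hold. Then, for all $\epsilon_1,\epsilon_2\in(0,1)$, the regularized system $$\begin{cases}-u-H+\epsilon_1(m+\Delta^{2N}m)+\epsilon_2(m-\Delta m)+\beta_{\epsilon_1}(m)=0,\\ m-\operatorname{div}(mD_pH)+(mD_{M_{ij}}H)_{x_ix_j}-1+\epsilon_1(u+\Delta^{2N}u)+\epsilon_2(u-\Delta u)=0\end{cases}$$ on $\mathbb{T}^d$, where $H,D_pH,D_{M_{ij}}H$ are evaluated at $(x,Du(x),D^2u(x),m(x),h(m)(x))$, admits a $C^\infty$ solution $(m,u)$ with $\inf_{\mathbb{T}^d}m>0$.
   Context: Setting. $\mathbb{T}^d=\mathbb{R}^d/\mathbb{Z}^d$, $d\ge1$; $\mathbb{E}$ is a fixed set, either $(0,\infty)$ or $[0,\infty)$. $\mathcal{M}_{ac}(\mathbb{T}^d)$ is the space of positive measures on $\mathbb{T}^d$ absolutely continuous with respect to Lebesgue measure; such a measure is identified with its density $m\in L^1(\mathbb{T}^d)$, $m\ge0$ a.e. Given are $H:\mathbb{T}^d\times\mathbb{R}^d\times\mathbb{R}^{d\times d}\times\mathbb{E}\times\mathbb{R}\to\mathbb{R}$, $(x,p,M,m,\theta)\mapsto H(x,p,M,m,\theta)$, a (possibly nonlinear) operator $h:\mathcal{M}_{ac}(\mathbb{T}^d)\to C(\mathbb{T}^d)$ ($h(m)$ is its value at the measure with density $m$), and a continuous function $g:\mathbb{T}^d\times\mathbb{E}\times\mathbb{R}\to\mathbb{R}$.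 $g(x,m,h(m))$ denotes $x\mapsto g(x,m(x),h(m)(x))$, and similarly for other functions. Repeated indices $i,j\in\{1,\dots,d\}$ are summed; $M_1:M_2=\operatorname{tr}(M_1M_2)$ for symmetric matrices. Conditions over $m\in\mathcal{M}_{ac}(\mathbb{T}^d)$ involving $g$ or $H$ are understood for densities with values in $\mathbb{E}$ a.e. Regularization data. $N\in\mathbb{N}$ satisfies $2N-4>\frac d2+1$, $q>d$, and for each $\epsilon_1\in(0,1)$, $\beta_{\epsilon_1}:(0,\infty)\to(-\infty,0]$ is a fixed non-decreasing $C^\infty$ function with $\beta_{\epsilon_1}(s)=0$ for $s\ge\epsilon_1$ and $\beta_{\epsilon_1}(s)=-s^{-q}$ for $0<s\le\epsilon_1/2$. (h-regularity) For all $\kappa>\frac d2+1$: $h(m)\in W^{\kappa,2}(\mathbb{T}^d)$ for every $m\in W^{\kappa,2}(\mathbb{T}^d)$ ($m\geq 0$), and $m\mapsto h(m)$ is a Fréchet differentiable map from (nonnegative elements of) $W^{\kappa,2}(\mathbb{T}^d)$ to $W^{\kappa,2}(\mathbb{T}^d)$. (g-structure) (1) There are functions $g_1,g_2$ with $g=g_1+g_2$ on $\mathbb{T}^d\times\mathbb{E}\times\mathbb{R}$ and $g_2(x,m(x),h(m)(x))\ge0$ for all $m\in\mathcal{M}_{ac}(\mathbb{T}^d)$. (2) There is $c>0$ with $\int_{\mathbb{T}^d} g_2(x,m,h(m))\,dx\le c\,(1+\int_{\mathbb{T}^d} m\,dx)$ for all $m\in\mathcal{M}_{ac}(\mathbb{T}^d)$.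 (3) For all $\delta>0$ there is $C_\delta>0$ with $\max\{\int_{\mathbb{T}^d} g_1(x,m,h(m))\,dx,\int_{\mathbb{T}^d} m\,dx\}\le\delta\int_{\mathbb{T}^d} m g_1(x,m,h(m))\,dx+C_\delta$ for all $m\in\mathcal{M}_{ac}(\mathbb{T}^d)$. (4) There is $R\ge0$ with $\int_{\mathbb{T}^d} mg_1(x,m,h(m))\,dx\ge-R$ for all $m\in\mathcal{M}_{ac}(\mathbb{T}^d)$. (H-growth) There are constants $\gamma>1$, $0\le\tau<1$, $C_1,C_2,C_3,C_4>0$ such that, with the given continuous function $g:\mathbb{T}^d\times\mathbb{E}\times\mathbb{R}\to\mathbb{R}$ (the same $g=g_1+g_2$ as in (g-structure)): (a) for all $(x,p,M,m,\theta)$, $-H+D_pH\cdot p+D_MH:M\ge\frac1{C_1}m^{-\tau}|p|^\gamma+C_2g(x,m,\theta)-C_1$, with $H$ and derivatives evaluated at $(x,p,M,m,\theta)$; (b) for all $(m,u)\in\mathcal{M}_{ac}(\mathbb{T}^d)\times W^{1,\gamma}(\mathbb{T}^d)$ with $D^2u$ a measurable function, $$-C_3\int_{\mathbb{T}^d} g(x,m,h(m))dx+\frac1{C_1}\int_{\mathbb{T}^d}|Du|^\gamma m^{-\tau}dx-C_1\le\int_{\mathbb{T}^d} H(x,Du,D^2u,m,h(m))dx\le-C_4\int_{\mathbb{T}^d} g(x,m,h(m))dx+C_1\Big(1+\int_{\mathbb{T}^d}|Du|^\gamma m^{-\tau}dx\Big).$$ (H-smoothness) $H$ is of class $C^\infty$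 on $\mathbb{T}^d\times\mathbb{R}^d\times\mathbb{R}^{d\times d}\times\mathbb{E}\times\mathbb{R}$. (monotonicity) For $(\eta,v)\in C^\infty(\mathbb{T}^d;\mathbb{E})\times C^\infty(\mathbb{T}^d)$ let $A(\eta,v)$ be the pair with components $-v-H(x,Dv,D^2v,\eta,h(\eta))$ and $\eta-\operatorname{div}(\eta D_pH(x,Dv,D^2v,\eta,h(\eta)))+(\eta D_{M_{ij}}H(x,Dv,D^2v,\eta,h(\eta)))_{x_ix_j}-1$. For all $(\eta,v),(\bar\eta,\bar v)\in C^\infty(\mathbb{T}^d;\mathbb{E})\times C^\infty(\mathbb{T}^d)$, $\big(A(\eta,v)-A(\bar\eta,\bar v),(\eta,v)-(\bar\eta,\bar v)\big)_{L^2(\mathbb{T}^d)\times L^2(\mathbb{T}^d)}\ge0$. *)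

(* Defs.v *)
From HB Require Import structures.
From mathcomp Require Import all_boot all_order all_algebra.
From mathcomp Require Import all_classical all_reals all_analysis.
Set Implicit Arguments.
Unset Strict Implicit.
Unset Printing Implicit Defensive.
Import Order.TTheory GRing.Theory Num.Theory.
Import numFieldNormedType.Exports.
Local Open Scope classical_set_scope.
Local Open Scope ring_scope.

(* A function on the torus T^d = R^d / Z^d is a Z^d-periodic function on
   'rV[R]_d; integrals over T^d are integrals over the unit cube. *)

Section Borel.
Context {R : realType} {d : nat}.

Definition coord_rV (i : 'I_d) (x : 'rV[R]_d) : R := x ord0 i.

Let rV_set0 : g_sigma_preimage coord_rV set0.
Proof. exact: sigma_algebra0. Qed.

Let rV_setC A : g_sigma_preimage coord_rV A -> g_sigma_preimage coord_rV (~` A).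
Proof. exact: sigma_algebraC. Qed.

Let rV_bigcup (F : _^nat) : (forall i, g_sigma_preimage coord_rV (F i)) ->
  g_sigma_preimage coord_rV (\bigcup_i (F i)).
Proof. exact: sigma_algebra_bigcup. Qed.

(* The sigma-algebra generated by the coordinates, i.e. the Borel sets. *)
HB.instance Definition _ :=
  @isMeasurable.Build (measure_tuple_display default_measure_display)
    'rV[R]_d (g_sigma_preimage coord_rV) rV_set0 rV_setC rV_bigcup.
End Borel.

Section CubeMeasure.
Context {R : realType}.

Lemma measurable_coord_rV d (i : 'I_d) :
  measurable_fun [set: 'rV[R]_d] (coord_rV i).
Proof.
move=> _ Y mY; rewrite setTI; apply: sub_sigma_algebra => /=.
rewrite -bigcup_seq/=; exists i => /=; first by rewrite mem_index_enum.
by exists Y => //; rewrite setTI.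
Qed.

Lemma measurable_fun_rVP d1 (T : measurableType d1) d (f : T -> 'rV[R]_d) :
  (forall i, measurable_fun [set: T] (coord_rV i \o f)) ->
  measurable_fun [set: T] f.
Proof.
move=> mf.
have sub : g_sigma_preimage (fun i => coord_rV i \o f) `<=` measurable.
  apply: smallest_sub; first exact: sigma_algebra_measurable.
  case: d f mf => [|n] f mf; first by rewrite big_ord0.
  rewrite -bigcup_mkord_ord; apply: bigcup_sub => i Ii.
  by move=> A [B mB <-]; exact: mf.
move: sub; rewrite g_sigma_preimage_comp => sub.
by move=> _ A mA; apply: sub; exists A.
Qed.

Definition cons_rV d (z : measurableTypeR R * 'rV[R]_d) : 'rV[R]_d.+1 :=
  row_mx ((z.1 : R)%:M : 'rV_1) z.2.

Lemma measurable_cons_rV d :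
  measurable_fun [set: measurableTypeR R * 'rV[R]_d] (@cons_rV d).
Proof.
apply: measurable_fun_rVP => i.
case: (@split_ordP 1 d i) => j ->.
  rewrite (_ : _ \o _ = fst); first exact: measurable_fst.
  by apply/funext => z /=; rewrite /coord_rV /cons_rV (@row_mxEl _ 1 1 d) mxE !ord1.
rewrite (_ : _ \o _ = coord_rV j \o snd).
  exact: (measurableT_comp (measurable_coord_rV j) measurable_snd).
by apply/funext => z /=; rewrite /coord_rV /cons_rV (@row_mxEr _ 1 1 d).
Qed.

HB.instance Definition _ d :=
  @isMeasurableFun.Build _ _ _ _ (@cons_rV d) (@measurable_cons_rV d).

(* Lebesgue measure on the unit cube [0, 1]^d. *)
Fixpoint cube_measure d : probability 'rV[R]_d R :=
  match d with
  | 0%N => \d_(0 : 'rV[R]_0)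
  | n.+1 => distribution (uniform_prob (@ltr01 R) \x cube_measure n)%E
              (@cons_rV n : {mfun _ >-> _})
  end.

End CubeMeasure.

Section Smooth.
Context {R : realType} {V : normedModType R}.

Definition iter_derive (vs : seq V) (f : V -> R) : V -> R :=
  foldr (fun v g => 'D_v g) f vs.

Definition smooth_open (U : set V) (f : V -> R) : Prop :=
  forall (vs : seq V) (x : V), U x ->
    {for x, continuous (iter_derive vs f)} /\
    forall v, derivable (iter_derive vs f) x v.

(* C^infty on a set that need not be open (here, a density variable ranging
   over [0, +oo[): local extension to a C^infty function on an open set. *)
Definition smooth_on (S : set V) (f : V -> R) : Prop :=
  forall x, S x -> exists (U : set V) (F : V -> R),
    [/\ open U, U x, smooth_open U F & forall y, U y -> S y -> f y = F y].

End Smooth.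

Section Torus.
Context {R : realType} {d : nat}.
Local Notation pt := 'rV[R]_d.
Local Notation field := ('rV[R]_d -> R).
Local Notation mu := (@cube_measure R d).

Definition zperiodic (T : Type) (f : pt -> T) : Prop :=
  forall x (i : 'I_d), f (x + delta_mx ord0 i) = f x.

Definition torus_smooth (f : field) : Prop :=
  zperiodic f /\ smooth_open setT f.

Definition torus_continuous (f : field) : Prop :=
  zperiodic f /\ continuous f.

Definition partial (i : 'I_d) (f : field) : field := 'D_(delta_mx ord0 i) f.

Definition partials (s : seq 'I_d) (f : field) : field := foldr partial f s.

Definition grad (f : field) (x : pt) : 'rV[R]_d := \row_i partial i f x.

Definition hess (f : field) (x : pt) : 'M[R]_d :=
  \matrix_(i, j) partials [:: i; j] f x.

Definition laplacian (f : field) : field :=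
  fun x => \sum_(i < d) partials [:: i; i] f x.

Definition enorm (p : 'rV[R]_d) : R := Num.sqrt (\sum_(i < d) p ord0 i ^+ 2).

(* v is the weak derivative of f on T^d along the directions listed in s. *)
Definition weak_partials (s : seq 'I_d) (f v : field) : Prop :=
  [/\ zperiodic v, v \in Lfun mu 1%E &
      forall phi : field, torus_smooth phi ->
        \int[mu]_x (f x * partials s phi x) =
        (-1) ^+ size s * \int[mu]_x (v x * phi x)].

(* An arbitrary representative of the weak derivative (0 if there is none). *)
Definition wpartials (s : seq 'I_d) (f : field) : field :=
  xget (cst 0) [set v | weak_partials s f v].

Definition wgrad (f : field) (x : pt) : 'rV[R]_d :=
  \row_i wpartials [:: i] f x.

Definition whess (f : field) (x : pt) : 'M[R]_d :=
  \matrix_(i, j) wpartials [:: i; j] f x.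

(* The Sobolev space W^{k,p}(T^d), for p >= 1. *)
Definition sobolev (k : nat) (p : R) (f : field) : Prop :=
  [/\ zperiodic f, f \in Lfun mu p%:E &
      forall s : seq 'I_d, (size s <= k)%N ->
        exists2 v, weak_partials s f v & v \in Lfun mu p%:E].

(* The norm of W^{k,2}(T^d): the L^2 norm of all derivatives of order <= k. *)
Definition sobolev2_norm (k : nat) (f : field) : R :=
  Num.sqrt (\sum_(j < k.+1) \sum_(s : j.-tuple 'I_d)
    \int[mu]_x (wpartials s f x ^+ 2)).

(* Densities of the elements of M_ac(T^d).  The representative is chosen Borel
   and nonnegative everywhere; it is determined up to a null set only. *)
Definition Mac (m : field) : Prop :=
  [/\ zperiodic m, mu.-integrable setT (EFin \o m) & forall x, 0 <= m x].

(* Likewise, a class of densities with values in E a.e. has representatives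
   with values in E everywhere. *)
Definition MacE (E : set R) (m : field) : Prop := Mac m /\ forall x, E (m x).

(* h : M_ac(T^d) -> C(T^d), as a function of the density: it depends only on
   the a.e. class of the density. *)
Definition Mac_operator (h : field -> field) : Prop :=
  (forall m, Mac m -> torus_continuous (h m)) /\
  (forall m m', Mac m -> Mac m' -> {ae mu, forall x, m x = m' x} -> h m = h m').

(* F : T^d x E x R -> R *)
Definition torus_coef (E : set R) (F : pt -> R -> R -> R) : Prop :=
  forall s t, E s -> zperiodic (fun x => F x s t).

Definition torus_continuous_coef (E : set R) (F : pt -> R -> R -> R) : Prop :=
  torus_coef E F /\
  {within [set z : pt * R * R | E z.1.2],
     continuous (fun z : pt * R * R => F z.1.1 z.1.2 z.2)}.

Definition at_density (F : pt -> R -> R -> R) (h : field -> field)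
  (m : field) : field := fun x => F x (m x) (h m x).

(* The integral of f over T^d is defined in [-oo, +oo]. *)
Definition has_integral (f : field) : Prop :=
  measurable_fun [set: pt] f /\
  ((\int[mu]_x ((EFin \o f)^\+ x) < +oo)%E \/
   (\int[mu]_x ((EFin \o f)^\- x) < +oo)%E).

Definition eint (f : field) : \bar R := (\int[mu]_x (f x)%:E)%E.

(* Frechet differentiability of h at every pt of the cone of nonnegative
   elements of W^{k,2}, relatively to that cone, with derivative L. *)
Definition frechet_W2 (k : nat) (h : field -> field) : Prop :=
  forall m, sobolev k 2 m -> (forall x, 0 <= m x) ->
  exists L : field -> field,
    [/\ forall f, sobolev k 2 f -> sobolev k 2 (L f),
        forall a f f', sobolev k 2 f -> sobolev k 2 f' ->
          {ae mu, forall x, L (fun y => a * f y + f' y) x = a * L f x + L f' x},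
        exists C, forall f, sobolev k 2 f ->
          sobolev2_norm k (L f) <= C * sobolev2_norm k f &
        forall eps : R, 0 < eps -> exists2 delta : R, 0 < delta &
          forall m', sobolev k 2 m' -> (forall x, 0 <= m' x) ->
            sobolev2_norm k (m' \- m) < delta ->
            sobolev2_norm k ((h m' \- h m) \- L (m' \- m))
              <= eps * sobolev2_norm k (m' \- m)].

Definition h_regularity (h : field -> field) : Prop :=
  forall k : nat, d%:R / 2 + 1 < k%:R :> R ->
    (forall m, sobolev k 2 m -> (forall x, 0 <= m x) -> sobolev k 2 (h m)) /\
    frechet_W2 k h.

(* Conditions on integrals are required whenever these integrals are defined
   in [-oo, +oo]. *)
Definition g_structure (E : set R) (h : field -> field)
    (g : pt -> R -> R -> R) : Prop :=
  exists g1 g2 : pt -> R -> R -> R,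
    [/\ torus_coef E g1 /\ torus_coef E g2,
        forall x s t, E s -> g x s t = g1 x s t + g2 x s t &
        forall m, MacE E m ->
          [/\ measurable_fun setT (at_density g1 h m),
              measurable_fun setT (at_density g2 h m) &
              {ae mu, forall x, 0 <= at_density g2 h m x}]] /\
    [/\ exists2 c : R, 0 < c & forall m, MacE E m ->
          (eint (at_density g2 h m) <= c%:E * (1 + eint m))%E,
        forall delta : R, 0 < delta -> exists2 C : R, 0 < C &
          forall m, MacE E m ->
            has_integral (at_density g1 h m) ->
            has_integral (fun x => m x * at_density g1 h m x) ->
            (maxe (eint (at_density g1 h m)) (eint m) <=
             delta%:E * eint (fun x => (m x * at_density g1 h m x)%R) + C%:E)%E &
        exists2 r : R, 0 <= r & forall m, MacE E m ->
            has_integral (fun x => m x * at_density g1 h m x) ->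
            ((- r)%:E <= eint (fun x => (m x * at_density g1 h m x)%R))%E].

Local Notation Ham := ('rV[R]_d -> 'rV[R]_d -> 'M[R]_d -> R -> R -> R).

Definition torus_Ham (E : set R) (H : Ham) : Prop :=
  forall p M s t, E s -> zperiodic (fun x => H x p M s t).

Definition DpH (H : Ham) (i : 'I_d) : Ham := fun x p M s t =>
  'D_(delta_mx ord0 i) (fun p' : 'rV[R]_d => H x p' M s t) p.

Definition DMH (H : Ham) (i j : 'I_d) : Ham := fun x p M s t =>
  'D_(delta_mx i j) (fun M' : 'M[R]_d => H x p M' s t) M.

(* s^{-tau} |p|^gamma in [0, +oo], with 0^{-tau} = +oo for tau > 0 and
   +oo * 0 = 0. *)
Definition growth_term (tau gamma : R) (s : R) (p : 'rV[R]_d) : \bar R :=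
  (((s `^ tau)%:E)^-1 * (enorm p `^ gamma)%:E)%E.

Definition H_growth (E : set R) (h : field -> field)
    (g : pt -> R -> R -> R) (H : Ham) : Prop :=
  exists gamma tau C1 C2 C3 C4 : R,
    [/\ 1 < gamma, 0 <= tau < 1 & [/\ 0 < C1, 0 < C2, 0 < C3 & 0 < C4]] /\
    (forall x p M s t, E s ->
      ((C1^-1)%:E * growth_term tau gamma s p + (C2 * g x s t - C1)%:E <=
       (- H x p M s t + \sum_(i < d) DpH H i x p M s t * p ord0 i
         + \sum_(i < d) \sum_(j < d) DMH H i j x p M s t * M i j)%:E)%E) /\
    (forall m u, MacE E m -> sobolev 1 gamma u ->
      (forall i j, exists v, weak_partials [:: i; j] u v) ->
      let G := at_density g h m in
      let Hmu := fun x => H x (wgrad u x) (whess u x) (m x) (h m x) in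
      let W := (\int[mu]_x growth_term tau gamma (m x) (wgrad u x))%E in
      has_integral G -> has_integral Hmu -> (- eint G +? W)%E ->
      (- (C3%:E * eint G) + (C1^-1)%:E * W - C1%:E <= eint Hmu)%E /\
      (eint Hmu <= - (C4%:E * eint G) + C1%:E * (1 + W))%E).

Definition H_smoothness (E : set R) (H : Ham) : Prop :=
  smooth_on [set z : pt * 'rV[R]_d * 'M[R]_d * R * R | E z.1.2]
    (fun z => H z.1.1.1.1 z.1.1.1.2 z.1.1.2 z.1.2 z.2).

(* x |-> F(x, Dv(x), D^2v(x), eta(x), h(eta)(x)) *)
Definition along (F : Ham) (h : field -> field) (eta v : field) : field :=
  fun x => F x (grad v x) (hess v x) (eta x) (h eta x).

Definition A1 (H : Ham) (h : field -> field) (eta v : field) : field :=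
  fun x => - v x - along H h eta v x.

Definition A2 (H : Ham) (h : field -> field) (eta v : field) : field :=
  fun x => eta x
    - \sum_(i < d) partial i (fun y => eta y * along (DpH H i) h eta v y) x
    + \sum_(i < d) \sum_(j < d)
        partials [:: j; i] (fun y => eta y * along (DMH H i j) h eta v y) x
    - 1.

Definition monotonicity (E : set R) (h : field -> field) (H : Ham) : Prop :=
  forall eta v eta' v' : field,
    torus_smooth eta -> (forall x, E (eta x)) -> torus_smooth v ->
    torus_smooth eta' -> (forall x, E (eta' x)) -> torus_smooth v' ->
    0 <= \int[mu]_x ((A1 H h eta v x - A1 H h eta' v' x) * (eta x - eta' x))
       + \int[mu]_x ((A2 H h eta v x - A2 H h eta' v' x) * (v x - v' x)).

(* beta_{e1} : (0, +oo) -> (-oo, 0] *)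
Definition penalty (q e1 : R) (b : R -> R) : Prop :=
  [/\ smooth_open [set s : R^o | 0 < s] b,
      forall s s', 0 < s -> s <= s' -> b s <= b s',
      forall s, 0 < s -> b s <= 0,
      forall s, e1 <= s -> b s = 0 &
      forall s, 0 < s -> s <= e1 / 2 -> b s = - s `^ (- q)].

Definition regularized_system (N : nat) (H : Ham) (h : field -> field)
    (b : R -> R) (e1 e2 : R) (m u : field) : Prop :=
  (forall x, A1 H h m u x
     + e1 * (m x + iter (2 * N)%N laplacian m x)
     + e2 * (m x - laplacian m x) + b (m x) = 0) /\
  (forall x, A2 H h m u x
     + e1 * (u x + iter (2 * N)%N laplacian u x)
     + e2 * (u x - laplacian u x) = 0).

End Torus.

(* Main.v *)
(* Work in the real orthonormal basis of Hartley functions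
   e_k(x) = cos(2 pi k.x) + sin(2 pi k.x), which diagonalizes the linear part
   e1 (1 + lap^(2N)) + e2 (1 - lap), with eigenvalues of order |k|^(4N).  On the
   span of finitely many e_k, restricted to the compact convex set of pairs
   (m, u) of bounded energy with m bounded below, monotonicity gives a solution
   of the variational inequality.  Testing it against (m - 1, u), the growth
   conditions bound the energy and the integral of the penalty, independently of
   the dimension; since q > d, the latter bounds m away from 0.  The solution is
   therefore interior and solves the projected system.  Along an ultrafilter,
   the approximations converge in W^{2N-1,2}, where h is continuous, hence in
   C^2, to a weak solution.  Regularity is bootstrapped on the coefficients,
   because the linear part gains more derivatives than the nonlinear terms and
   the Sobolev embedding lose. *)
Require Import Defs.
From HB Require Import structures.
From mathcomp Require Import all_boot all_order all_algebra.
From mathcomp Require Import all_classical all_reals all_analysis.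
From mathcomp Require finmap.
From mathcomp Require Import measurable_realfun zify ring lra.
Set Implicit Arguments.
Unset Strict Implicit.
Unset Printing Implicit Defensive.
Import Order.TTheory GRing.Theory Num.Theory.
Import numFieldNormedType.Exports.
Local Open Scope classical_set_scope.
Local Open Scope ring_scope.

(** * Differential calculus in coordinates *)

(** The hypotheses on [h] give continuity only between spaces W^{k,2} with k > d/2 + 1, so
    approximations must converge strongly there. The energy is comparable to the squared W^{2N,2}
    norm; one derivative is given up to turn coefficientwise convergence under this bound into
    strong convergence, which fixes the exponent 2N - 1. The condition 2N - 4 > d/2 + 1 makes that
    space embed into C^2, as the Hessian in H requires, and leaves the margin on which the bootstrap
    runs. The nonlinear terms are smooth only for m > 0, and the penalty is singular at 0: hence a
    variational inequality on a constraint set that keeps m away from 0, instead of an equation on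
    the whole finite-dimensional space. The second equation is kept in tested form, with all
    derivatives on the test function, so that its limits need only C^2 convergence of u and uniform
    convergence of m and h(m); the strong form is recovered once m and u are known to be smooth. *)

Lemma near_forall T (I : finType) (P : I -> T -> Prop) (F : set_system T) :
  Filter F -> (forall i, F (P i)) -> F (fun x => forall i, P i x).
Proof. by move=> FF H; exact: (@filter_forall T I P F FF H). Qed.

Section DeriveEps.
Context {R : realType} {V : normedModType R}.

(** A form of differentiability without quotient: the estimate holds on a full neighbourhood of 0, h
    = 0 included, so it can be composed with increments that vanish. *)
Lemma is_derive_epsP (f : V -> R) x v (l : R) :
  is_derive x v f l <->
  forall eps : R, 0 < eps -> \forall h \near (0 : R),
    `|f (x + h *: v) - f x - h * l| <= eps * `|h|.
Proof.
split=> [[df dl] eps e0|H].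
- have /eqaddoP /(_ eps e0) := derivable_nbhs df.
  rewrite dl; apply: filterS => h /=.
  by rewrite /shift /= !fctE /= opprD addrA (addrC (h *: v)).
- have C : (fun h => h^-1 *: ((f \o shift x) (h *: v) - f x)) @ 0^' --> l.
    apply/cvgrPdist_le => eps e0.
    have Hn := H eps e0.
    near=> h.
    have h0 : h != 0 by near: h; exact: nbhs_dnbhs_neq.
    have : `|f (x + h *: v) - f x - h * l| <= eps * `|h|.
      by near: h; exact: (nbhs_dnbhs Hn).
    rewrite /= (addrC (h *: v)) => Hh.
    rewrite -(ler_pM2r (_ : 0 < `|h|)) ?normr_gt0// -normrM.
    rewrite distrC in Hh; move: Hh; congr (`| _ | <= _).
    by rewrite mulrBl -mulrA; field.
  by split; [apply/cvg_ex; exists l|exact: cvg_lim].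
Unshelve. all: by end_near.
Qed.
End DeriveEps.

Section Partial.
Context {R : realType}.

Local Notation ei i := (delta_mx ord0 i).

Lemma is_derive_line (V : normedModType R) (F : V -> R) (z e : V) (t : R) :
  derivable F (z + t *: e) e ->
  is_derive t (1 : R) (fun s : R => F (z + s *: e)) ('D_e F (z + t *: e)).
Proof.
move=> /derivableP /is_derive_epsP H; apply/is_derive_epsP => eps e0.
apply: filterS (H eps e0) => h /=.
by rewrite scalerDl addrA -[h *: 1]/(h * 1) mulr1.
Qed.

Lemma MVT_line (V : normedModType R) (F : V -> R) (z e : V) (s : R) :
  (forall t : R, `|t| <= `|s| -> derivable F (z + t *: e) e) ->
  exists2 c : R, `|c| <= `|s| &
    F (z + s *: e) - F z = 'D_e F (z + c *: e) * s.
Proof.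
move=> dF; pose g (t : R) := F (z + t *: e).
have dg (t : R) : `|t| <= `|s| -> is_derive t (1 : R) g ('D_e F (z + t *: e)).
  by move=> ts; exact/is_derive_line/dF.
have cg a b : {subset `[a, b] <= [pred t : R | `|t| <= `|s|]} ->
    {within `[a, b], continuous g}.
  move=> ab; apply: derivable_within_continuous => t tab.
  by have [] := dg t (ab _ tab).
have g0 : F z = g 0 by rewrite /g scale0r addr0.
have [s0|s0|<-] := ltgtP 0 s; last first.
- by exists 0; rewrite ?normr0// scale0r addr0 subrr mulr0.
- have [||c cs] := @MVT R g (fun t => 'D_e F (z + t *: e)) s 0 s0.
  + move=> t; rewrite in_itv/= => /andP[st t0]; apply: dg.
    by rewrite !ltr0_norm// lerN2 ltW.
  + apply: cg => t; rewrite in_itv/= inE => /andP[st t0].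
    by rewrite (ltr0_norm s0) ler0_norm// lerN2.
  + move: cs; rewrite in_itv/= => /andP[sc c0] E; exists c.
      by rewrite !ltr0_norm// lerN2 ltW.
    by apply: oppr_inj; rewrite opprB g0 E sub0r mulrN.
- have [||c cs] := @MVT R g (fun t => 'D_e F (z + t *: e)) 0 s s0.
  + move=> t; rewrite in_itv/= => /andP[st t0]; apply: dg.
    by rewrite !gtr0_norm// ltW.
  + apply: cg => t; rewrite in_itv/= inE => /andP[st t0].
    by rewrite (gtr0_norm s0) ger0_norm.
  + move: cs; rewrite in_itv/= => /andP[sc c0] E; exists c.
      by rewrite !gtr0_norm// ltW.
    by rewrite g0 E subr0.
Qed.

Lemma row_sum_ei n (h : 'rV[R]_n) : h = \sum_i h ord0 i *: ei i.
Proof. exact: row_sum_delta. Qed.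

Lemma coord_le_norm n (h : 'rV[R]_n) i : `|h ord0 i| <= `|h|.
Proof.
rewrite [leRHS]/Num.Def.normr/= mx_normrE.
exact: (@le_bigmax _ _ _ _ (fun ij : 'I_1 * 'I_n => `|h ij.1 ij.2|) (ord0, i)).
Qed.

Lemma norm_le_coord n (h : 'rV[R]_n) (r : R) :
  0 <= r -> (forall i, `|h ord0 i| <= r) -> `|h| <= r.
Proof.
move=> r0 H; rewrite [leLHS]/Num.Def.normr/= mx_normrE.
by apply/bigmax_leP; split => // -[i j] _; rewrite (ord1 i).
Qed.

(* The increment along h is split along the coordinates, one at a time. *)
Lemma C1_taylor n (F : 'rV[R]_n -> R) (O : set 'rV[R]_n) y :
  open O -> O y ->
  (forall z i, O z -> derivable F z (ei i)) ->
  (forall i, {for y, continuous (partial i F)}) ->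
  forall eps : R, 0 < eps -> \forall h \near (0 : 'rV[R]_n),
    `|F (y + h) - F y - \sum_i h ord0 i * partial i F y|
      <= eps * \sum_i `|h ord0 i|.
Proof.
move=> oO Oy dF cF eps e0.
have : \forall z \near y, O z /\ forall i, `|partial i F z - partial i F y| <= eps.
  apply: filterI; first exact: open_nbhs_nbhs.
  apply: near_forall => i.
  by have /cvgrPdist_le /(_ eps e0) := cF i; apply: filterS => z; rewrite distrC.
move=> /nbhs_ballP[r /= r0 Hr].
have nr : \forall h \near (0 : 'rV[R]_n), `|h| < r by exact: nbhs0_lt.
near=> h.
have hr : `|h| < r by near: h.
pose part k : 'rV[R]_n := \row_i (if (i < k)%N then h ord0 i else 0).
have part_le (t : 'rV[R]_n) :
    (forall i, `|t ord0 i| <= `|h ord0 i|) -> O (y + t) /\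
    forall i, `|partial i F (y + t) - partial i F y| <= eps.
  move=> th; apply: Hr; rewrite -ball_normE /ball_/= opprD addNKr normrN.
  apply: le_lt_trans hr; apply: norm_le_coord => // i.
  exact: le_trans (th i) (coord_le_norm _ _).
have E : F (y + h) - F y = \sum_(k < n) (F (y + part k.+1) - F (y + part k)).
  have -> : F (y + h) = F (y + part n).
    by congr (F (y + _)); apply/rowP => i; rewrite mxE ltn_ord.
  have -> : F y = F (y + part 0%N).
    rewrite -[in LHS](addr0 y); congr (F (y + _)); apply/rowP => i.
    by rewrite !mxE.
  rewrite -(telescope_sumr (fun k => F (y + part k))) // big_mkord.
  by [].
rewrite E -sumrB mulr_sumr.
apply: le_trans (ler_norm_sum _ _ _) _; apply: ler_sum => k _.
have partS : part k.+1 = part k + h ord0 k *: ei k.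
  apply/rowP => i; rewrite !mxE eqxx/= ltnS leq_eqVlt.
  have [->|ik] := eqVneq i k; first by rewrite eqxx/= ltnn add0r mulr1.
  rewrite -val_eqE in ik.
  by rewrite (negbTE ik)/= mulr0 addr0.
have Q (c : R) : `|c| <= `|h ord0 k| ->
    forall i, `|(part k + c *: ei k) ord0 i| <= `|h ord0 i|.
  move=> ch i; rewrite !mxE eqxx/=.
  have [->|ik] := eqVneq i k; first by rewrite ltnn add0r mulr1.
  by rewrite mulr0 addr0; case: ifP => // _; rewrite normr0.
have [c ch] : exists2 c : R, `|c| <= `|h ord0 k| &
    F (y + part k + h ord0 k *: ei k) - F (y + part k) =
    'D_(ei k) F (y + part k + c *: ei k) * h ord0 k.
  apply: MVT_line => t th; apply: dF; rewrite -addrA.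
  by have [] := part_le _ (Q t th).
rewrite partS addrA => ->.
rewrite mulrC -mulrBr normrM mulrC ler_wpM2r//.
rewrite -addrA.
by have [_ /(_ k)] := part_le _ (Q c ch).
Unshelve. all: by end_near.
Qed.

Lemma is_derive_chain (V : normedModType R) n (F : 'rV[R]_n -> R)
    (O : set 'rV[R]_n) (X : V -> 'rV[R]_n) (dX : 'rV[R]_n) x v :
  open O -> O (X x) ->
  (forall z i, O z -> derivable F z (ei i)) ->
  (forall i, {for X x, continuous (partial i F)}) ->
  (forall i, is_derive x v (fun z => X z ord0 i) (dX ord0 i)) ->
  is_derive x v (F \o X) (\sum_i dX ord0 i * partial i F (X x)).
Proof.
move=> oO Ox dF cF hX; apply/is_derive_epsP => eps e0.
(* Per unit of h, [C] bounds the l^1 size of the increment of [X], and [D] bounds the l^1 size of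
   the gradient of [F]. The remainders of [F] and of [X] get eps / 2 each; the final 1 keeps both
   constants positive when n = 0. *)
pose C := \sum_i `|dX ord0 i| + \sum_(i < n) 1 + 1.
pose D := \sum_(i < n) `|partial i F (X x)| + 1.
have C0 : 0 < C by rewrite ltr_wpDl// addr_ge0// sumr_ge0.
have D0 : 0 < D by rewrite ltr_wpDl// sumr_ge0.
have T := C1_taylor oO Ox dF cF (_ : 0 < eps / 2 / C).
have {T} T : \forall h \near (0 : 'rV[R]_n), `|F (X x + h) - F (X x) -
    \sum_i h ord0 i * partial i F (X x)| <= eps / 2 / C * \sum_i `|h ord0 i|.
  by apply: T; rewrite !divr_gt0.
have U : \forall h \near (0 : R), forall i,
    `|X (x + h *: v) ord0 i - X x ord0 i - h * dX ord0 i|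
     <= Num.min 1 (eps / 2 / D) * `|h|.
  apply: near_forall => i; have /is_derive_epsP := hX i; apply.
  by rewrite lt_min ltr01 !divr_gt0.
have incr : \forall h \near (0 : R), forall i,
    `|X (x + h *: v) ord0 i - X x ord0 i| <= `|h| * (`|dX ord0 i| + 1).
  apply: filterS U => h Uh i.
  rewrite -(subrK (h * dX ord0 i) (_ - X x ord0 i)).
  rewrite (le_trans (ler_normD _ _))// mulrDr mulr1 addrC lerD ?normrM//.
  by rewrite (le_trans (Uh i))// ler_piMl// ge_min lexx.
have cX : (fun h : R => X (x + h *: v) - X x) @ 0 --> (0 : 'rV[R]_n).
  apply/cvgrPdist_le => r r0.
  have nr : \forall h \near (0 : R), `|h| <= r / C.
    by apply: nbhs0_le; exact: divr_gt0.
  near=> h; rewrite sub0r normrN; apply: norm_le_coord; first exact: ltW.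
  move=> i; rewrite !mxE.
  have -> : X (x + h *: v) ord0 i + - X x ord0 i = X (x + h *: v) ord0 i - X x ord0 i by [].
  apply: (@le_trans _ _ (`|h| * (`|dX ord0 i| + 1))).
    by move: i; near: h.
  apply: (@le_trans _ _ (`|h| * C)).
    rewrite ler_wpM2l// /C lerD2r; apply: (@le_trans _ _ (\sum_i `|dX ord0 i|)).
      by rewrite (bigD1 i)//= lerDl sumr_ge0.
    by rewrite lerDl sumr_ge0.
  by rewrite -ler_pdivlMr//; near: h.
have T2 := cX _ T.
near=> h.
have Uh : forall i, `|X (x + h *: v) ord0 i - X x ord0 i - h * dX ord0 i|
     <= Num.min 1 (eps / 2 / D) * `|h| by near: h.
have Ih : forall i, `|X (x + h *: v) ord0 i - X x ord0 i| <= `|h| * (`|dX ord0 i| + 1).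
  by near: h.
have : `|F (X x + (X (x + h *: v) - X x)) - F (X x) -
    \sum_i (X (x + h *: v) - X x) ord0 i * partial i F (X x)|
    <= eps / 2 / C * \sum_i `|(X (x + h *: v) - X x) ord0 i|.
  by near: h.
rewrite [X x + _]addrC subrK => Th.
rewrite /= -(subrK (\sum_i (X (x + h *: v) - X x) ord0 i * partial i F (X x))
  (_ - F (X x))) -addrA (le_trans (ler_normD _ _))//.
rewrite (splitr eps) mulrDl lerD//.
  apply: (le_trans Th); rewrite -!mulrA ler_wpM2l; last 2 first.
  - exact: ltW.
  - rewrite ler_wpM2l ?invr_ge0// ler_pdivrMl//.
    apply: (@le_trans _ _ (\sum_i `|h| * (`|dX ord0 i| + 1))).
      by apply: ler_sum => i _; rewrite !mxE; exact: Ih.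
    rewrite -mulr_sumr mulrC ler_wpM2r// big_split/= /C.
    by rewrite lerDl.
  by [].
rewrite mulr_sumr -sumrB (le_trans (ler_norm_sum _ _ _))//.
apply: (@le_trans _ _ (\sum_(i < n) eps / 2 / D * `|h| * `|partial i F (X x)|)).
  apply: ler_sum => i _; rewrite mulrA -mulrBl normrM ler_wpM2r// !mxE.
  by rewrite (le_trans (Uh i))// ler_wpM2r// ge_min lexx orbT.
rewrite -mulr_sumr mulrAC ler_wpM2r//.
rewrite mulrAC ler_pdivrMr// ler_wpM2l//; first by rewrite ltW// divr_gt0.
by rewrite /D lerDl.
Unshelve. all: by end_near.
Qed.

End Partial.

(** * Functions of class C^j and their composition *)

Section Ck.
Context {R : realType}.
Local Notation ei i := (delta_mx ord0 i).

(** Only partials along the coordinate axes are used, so a derivative is again a scalar function and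
    induction on j applies. Derivatives along arbitrary vectors are recovered in
    [Ck_smooth_open]. *)
Fixpoint Ck n (j : nat) (f : 'rV[R]_n -> R) : Prop :=
  continuous f /\
  if j is j'.+1 then
    forall i, (forall x, derivable f x (ei i)) /\ Ck j' (partial i f)
  else True.

Lemma Ck_continuous n j (f : 'rV[R]_n -> R) : Ck j f -> continuous f.
Proof. by case: j => [|j] []. Qed.

Lemma Ck_leq n j l (f : 'rV[R]_n -> R) : (l <= j)%N -> Ck j f -> Ck l f.
Proof.
elim: l j f => [j f _ /Ck_continuous //|l IH [//|j] f lj [cf H]].
by split=> // i; have [df Cf] := H i; split=> //; exact: IH Cf.
Qed.

Lemma Ck_derivable n j (f : 'rV[R]_n -> R) i x :
  Ck j.+1 f -> derivable f x (ei i).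
Proof. by case=> _ /(_ i)[]. Qed.

Lemma Ck_partial n j (f : 'rV[R]_n -> R) i : Ck j.+1 f -> Ck j (partial i f).
Proof. by case=> _ /(_ i)[]. Qed.

Lemma Ck_partials n j (f : 'rV[R]_n -> R) s :
  Ck (size s + j) f -> Ck j (partials s f).
Proof.
elim: s j => [//|i s IH] j H /=; apply: Ck_partial; apply: IH.
by rewrite addnS.
Qed.

Lemma Ck_cst n j (c : R) : Ck j (fun _ : 'rV[R]_n => c).
Proof.
elim: j c => [|j IH] c; split => //; try exact: cst_continuous.
move=> i; split; first by move=> x; exact: derivable_cst.
rewrite (_ : partial i _ = fun=> 0); first exact: IH.
by apply/funext => x; rewrite /partial derive_cst.
Qed.

Lemma partialD n (f g : 'rV[R]_n -> R) i :
  (forall x, derivable f x (ei i)) -> (forall x, derivable g x (ei i)) ->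
  partial i (fun x => f x + g x) = fun x => partial i f x + partial i g x.
Proof. by move=> df dg; apply/funext => x; exact: (deriveD (df x) (dg x)). Qed.

Lemma partialM n (f g : 'rV[R]_n -> R) i :
  (forall x, derivable f x (ei i)) -> (forall x, derivable g x (ei i)) ->
  partial i (fun x => f x * g x) =
    fun x => f x * partial i g x + g x * partial i f x.
Proof. by move=> df dg; apply/funext => x; exact: (deriveM (df x) (dg x)). Qed.

Lemma CkD n j (f g : 'rV[R]_n -> R) :
  Ck j f -> Ck j g -> Ck j (fun x => f x + g x).
Proof.
elim: j f g => [|j IH] f g [cf df] [cg dg].
  by split=> // x; apply: continuousD; [exact: cf|exact: cg].
split; first by move=> x; apply: continuousD; [exact: cf|exact: cg].
move=> i; have [dfi Cfi] := df i; have [dgi Cgi] := dg i; split.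
  by move=> x; apply: derivableD.
by rewrite partialD//; exact: IH.
Qed.

Lemma CkM n j (f g : 'rV[R]_n -> R) :
  Ck j f -> Ck j g -> Ck j (fun x => f x * g x).
Proof.
elim: j f g => [|j IH] f g Cf Cg.
  by split=> // x; apply: continuousM; [exact: (Ck_continuous Cf)|exact: (Ck_continuous Cg)].
have [cf df] := Cf; have [cg dg] := Cg.
split; first by move=> x; apply: continuousM; [exact: cf|exact: cg].
move=> i; have [dfi Cfi] := df i; have [dgi Cgi] := dg i; split.
  by move=> x; apply: derivableM.
by rewrite partialM//; apply: CkD; apply: IH => //; exact: Ck_leq (leqnSn _) _.
Qed.

Lemma CkZ n j (c : R) (f : 'rV[R]_n -> R) : Ck j f -> Ck j (fun x => c * f x).
Proof. by move=> Cf; apply: CkM => //; exact: Ck_cst. Qed.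

Lemma CkN n j (f : 'rV[R]_n -> R) : Ck j f -> Ck j (fun x => - f x).
Proof.
move=> Cf; rewrite (_ : (fun x => - f x) = fun x => (-1) * f x); first exact: CkZ.
by apply/funext => x; rewrite mulN1r.
Qed.

Lemma CkB n j (f g : 'rV[R]_n -> R) :
  Ck j f -> Ck j g -> Ck j (fun x => f x - g x).
Proof. by move=> Cf Cg; apply: CkD => //; exact: CkN. Qed.

Lemma Ck_sum n j I (r : seq I) (f : I -> 'rV[R]_n -> R) :
  (forall i, Ck j (f i)) -> Ck j (fun x => \sum_(i <- r) f i x).
Proof.
move=> Cf; elim: r => [|i r IH].
  rewrite (_ : (fun x => _) = fun=> 0); first exact: Ck_cst.
  by apply/funext => x; rewrite big_nil.
rewrite (_ : (fun x => _) = fun x => f i x + \sum_(i <- r) f i x).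
  exact: CkD.
by apply/funext => x; rewrite big_cons.
Qed.

Lemma continuous_rowP (T : topologicalType) n (X : T -> 'rV[R]_n) (x : T) :
  (forall i, {for x, continuous (fun z => X z ord0 i)}) ->
  {for x, continuous X}.
Proof.
move=> H; apply/cvgrPdist_le => r r0.
have : \forall z \near x, forall i, `|X x ord0 i - X z ord0 i| <= r.
  by apply: near_forall => i; have /cvgrPdist_le /(_ r r0) := H i.
apply: filterS => z Hz; apply: norm_le_coord; first exact: ltW.
by move=> i; rewrite !mxE; exact: Hz.
Qed.

Lemma continuous_coord n (i : 'I_n) : continuous (fun z : 'rV[R]_n => z ord0 i).
Proof. exact: coord_continuous. Qed.

Lemma is_derive_coord n (i : 'I_n) (x v : 'rV[R]_n) :
  is_derive x v (fun z : 'rV[R]_n => z ord0 i) (v ord0 i).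
Proof.
apply/is_derive_epsP => eps e0; near=> h.
rewrite !mxE [X in `|X|](_ : _ = 0); last by ring.
by rewrite normr0 mulr_ge0// ltW.
Unshelve. all: by end_near.
Qed.

Lemma Ck_coord n j (i : 'I_n) : Ck j (fun z : 'rV[R]_n => z ord0 i).
Proof.
case: j => [|j]; split=> //; try exact: continuous_coord.
move=> k; split=> [x|]; first by have [] := is_derive_coord i x (ei k).
rewrite (_ : partial k _ = fun=> (ei k : 'rV[R]_n) ord0 i); first exact: Ck_cst.
by apply/funext => x; have [_ <-] := is_derive_coord i x (ei k).
Qed.

(** The Hamiltonian and the penalty are smooth only for positive densities, hence the domain [O].
    Quantifying over all iterated partials makes the property stable under [partial], on which the
    induction of [Ck_comp] rests. *)
Definition smooth_part n (O : set 'rV[R]_n) (F : 'rV[R]_n -> R) : Prop :=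
  forall s y, O y -> {for y, continuous (partials s F)} /\
    forall i, derivable (partials s F) y (ei i).

Lemma smooth_part_partial n (O : set 'rV[R]_n) F i :
  smooth_part O F -> smooth_part O (partial i F).
Proof.
move=> H s y Oy; have := H (rcons s i) y Oy.
by rewrite /partials -cats1 foldr_cat.
Qed.

Lemma is_derive_partial_chain n (V : normedModType R) (F : 'rV[R]_n -> R)
    (O : set 'rV[R]_n) (X : V -> 'rV[R]_n) x v (dX : 'rV[R]_n) :
  open O -> smooth_part O F -> O (X x) ->
  (forall i, is_derive x v (fun z => X z ord0 i) (dX ord0 i)) ->
  is_derive x v (F \o X) (\sum_i dX ord0 i * partial i F (X x)).
Proof.
move=> oO sF Ox dX'; apply: (is_derive_chain oO) => //.
- by move=> z i Oz; have [_ /(_ i)] := sF [::] z Oz.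
- by move=> i; have [] := sF [:: i] _ Ox.
Qed.

Lemma Ck_comp n m j (F : 'rV[R]_m -> R) (O : set 'rV[R]_m)
    (X : 'rV[R]_n -> 'rV[R]_m) :
  open O -> smooth_part O F -> (forall x, O (X x)) ->
  (forall a, Ck j (fun x => X x ord0 a)) -> Ck j (F \o X).
Proof.
move=> oO + OX; elim: j F => [|j IH] F sF CX.
  split=> // x; apply: continuous_comp.
    by apply: continuous_rowP => i; exact: (Ck_continuous (CX i)).
  by have [] := sF [::] _ (OX x).
have cX : continuous (F \o X).
  move=> x; apply: continuous_comp.
    by apply: continuous_rowP => i; exact: (Ck_continuous (CX i)).
  by have [] := sF [::] _ (OX x).
split=> // i.
have D x : is_derive x (ei i) (F \o X)
    (\sum_a (\row_a partial i (fun x => X x ord0 a) x) ord0 a * partial a F (X x)).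
  apply: (is_derive_partial_chain oO) => // a; rewrite mxE.
  by apply: derivableP; exact: Ck_derivable (CX a).
split; first by move=> x; have [] := D x.
rewrite (_ : partial i _ = fun x => \sum_a partial i (fun x => X x ord0 a) x *
    (partial a F \o X) x); last first.
  apply/funext => x; have [_] := D x; rewrite /partial => ->.
  by apply: eq_bigr => a _; rewrite mxE.
apply: Ck_sum => a; apply: CkM; first exact: Ck_partial.
apply: IH; first exact: smooth_part_partial.
by move=> b; exact: Ck_leq (leqnSn _) (CX b).
Qed.

Lemma iter_derive_partials n (s : seq 'I_n) (f : 'rV[R]_n -> R) :
  iter_derive [seq ei i | i <- s] f = partials s f.
Proof. by rewrite /iter_derive /partials foldr_map. Qed.

Lemma smooth_open_part n (O : set 'rV[R]_n) F :
  smooth_open O F -> smooth_part O F.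
Proof.
move=> H s y Oy; have := H [seq ei i | i <- s] y Oy.
by rewrite iter_derive_partials => -[].
Qed.

Lemma Ck_smooth_part n (F : 'rV[R]_n -> R) :
  (forall j, Ck j F) -> smooth_part setT F.
Proof.
move=> H s y _; split=> [|i].
  by have /Ck_partials := H (size s + 0)%N => /Ck_continuous; exact.
by have /Ck_partials := H (size s + 1)%N => /Ck_derivable; exact.
Qed.

Lemma smooth_open_Ck n j (f : 'rV[R]_n -> R) : smooth_open setT f -> Ck j f.
Proof.
move=> /smooth_open_part; elim: j f => [|j IH] f sf.
  by split=> // x; have [] := sf [::] x I.
split; first by move=> x; have [] := sf [::] x I.
move=> i; split; first by move=> x; have [_] := sf [::] x I; exact.
exact/IH/smooth_part_partial.
Qed.

(** By the chain rule applied to the identity map, a derivative along any vector is a linear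
    combination of coordinate partials, so iterated derivatives along arbitrary vectors remain of
    class C^j for all j. *)
Lemma Ck_smooth_open n (f : 'rV[R]_n -> R) :
  (forall j, Ck j f) -> smooth_open setT f.
Proof.
have D g (v : 'rV[R]_n) : (forall j, Ck j g) -> forall x,
    is_derive x v g (\sum_i v ord0 i * partial i g x).
  move=> Cg x; apply: (is_derive_partial_chain openT (X := id)) => //.
    exact: Ck_smooth_part.
  by move=> i; exact: is_derive_coord.
move=> Cf vs; have {Cf} : forall j, Ck j (iter_derive vs f).
  elim: vs => [//|v vs IH] j /=.
  rewrite (_ : 'D_v _ = fun x => \sum_i v ord0 i * partial i (iter_derive vs f) x).
    apply: Ck_sum => i; apply: CkZ; apply: Ck_partial; exact: IH.
  by apply/funext => x; have [_ ->] := D _ v IH x.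
move=> C x _; split; first exact: (Ck_continuous (C 0%N)).
by move=> v; have [] := D _ v C x.
Qed.

Lemma comp_linear_quotient (V W : normedModType R) (dec : W -> V) (F : V -> R) e y :
  (forall (a : R) u v, dec (a *: u + v) = a *: dec u + dec v) ->
  (fun h : R => h^-1 *: (((F \o dec) \o shift y) (h *: e) - (F \o dec) y)) =
  (fun h : R => h^-1 *: ((F \o shift (dec y)) (h *: dec e) - F (dec y))).
Proof. by move=> lin; apply/funext => h /=; rewrite lin. Qed.

Lemma derive_comp_linear (V W : normedModType R) (dec : W -> V) (F : V -> R) e y :
  (forall (a : R) u v, dec (a *: u + v) = a *: dec u + dec v) ->
  'D_e (F \o dec) y = 'D_(dec e) F (dec y).
Proof. by move=> lin; rewrite /derive comp_linear_quotient. Qed.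

Lemma derivable_comp_linear (V W : normedModType R) (dec : W -> V) (F : V -> R) e y :
  (forall (a : R) u v, dec (a *: u + v) = a *: dec u + dec v) ->
  derivable F (dec y) (dec e) -> derivable (F \o dec) y e.
Proof. by move=> lin dF; rewrite /derivable (comp_linear_quotient F e y lin). Qed.

(** A linear [dec] turns the derivative along e into the derivative along [dec e]. This moves
    smoothness from a product space, or from the scalars, to row vectors, where the calculus of
    partials is available. *)
Lemma smooth_open_comp_linear (V : normedModType R) n (dec : 'rV[R]_n -> V)
    (O : set V) (F : V -> R) :
  (forall (a : R) u v, dec (a *: u + v) = a *: dec u + dec v) ->
  continuous dec -> smooth_open O F -> smooth_part (dec @^-1` O) (F \o dec).
Proof.
move=> lin cdec sF s y Oy.
have -> : partials s (F \o dec) = iter_derive [seq dec (ei i) | i <- s] F \o dec.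
  elim: s => [//|i s IH] /=.
  by rewrite IH; apply/funext => z; rewrite /partial derive_comp_linear.
have [cF dF] := sF [seq dec (ei i) | i <- s] _ Oy; split.
  by apply: continuous_comp => //; exact: cdec.
by move=> i; exact: derivable_comp_linear.
Qed.

Lemma eq_iter_derive (V : normedModType R) (U : set V) (f g : V -> R) vs :
  open U -> (forall x, U x -> f x = g x) ->
  forall x, U x -> iter_derive vs f x = iter_derive vs g x.
Proof.
move=> oU fg; elim: vs => [//|v vs IH] x Ux /=.
apply: near_eq_derive; have : nbhs x U by exact: open_nbhs_nbhs.
by apply: filterS => z; exact: IH.
Qed.

(** On an open set the local extension coincides with f near each point, hence has the same iterated
    derivatives there. *)
Lemma smooth_on_open (V : normedModType R) (S : set V) (f : V -> R) :
  open S -> smooth_on S f -> smooth_open S f.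
Proof.
move=> oS H vs x Sx; have [U [F [oU Ux sF fF]]] := H x Sx.
have oUS : open (U `&` S) by exact: openI.
have E := eq_iter_derive vs oUS (fun y => fun h : (U `&` S) y => fF y h.1 h.2).
have nE : \forall y \near x, iter_derive vs F y = iter_derive vs f y.
  have : nbhs x (U `&` S) by exact: open_nbhs_nbhs.
  by apply: filterS => y /E.
have [cF dF] := sF vs x Ux; split.
  rewrite /prop_for /continuous_at (E x (conj Ux Sx)).
  by apply: cvg_trans cF; exact: near_eq_cvg.
by move=> v; apply: near_eq_derivable (dF v).
Qed.

End Ck.

(** * Uniform limits of functions and of their derivatives *)

Section UniformLimit.
Context {R : realType}.
Local Notation ei i := (delta_mx ord0 i).

(** An arbitrary filter is allowed because sequences, one-sided limits t -> 0+ and ultrafilters on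
    nat all occur. *)
Definition ucvg T X (F : set_system T) (f : T -> X -> R) (g : X -> R) : Prop :=
  forall eps : R, 0 < eps -> \forall t \near F, forall x, `|f t x - g x| <= eps.

Lemma ucvg_cvg T X (F : set_system T) {FF : Filter F} (f : T -> X -> R) g x :
  ucvg F f g -> f^~ x @ F --> g x.
Proof.
move=> H; apply/cvgrPdist_le => eps /H; apply: filterS => t /(_ x).
by rewrite distrC.
Qed.

Lemma ucvg_continuous T (X : topologicalType) (F : set_system T)
    {FF : ProperFilter F} (f : T -> X -> R) (g : X -> R) :
  ucvg F f g -> (forall t, continuous (f t)) -> continuous g.
Proof.
move=> H cf x; apply/cvgrPdist_le => eps e0.
have e3 : 0 < eps / 3 by rewrite divr_gt0.
have [t Ht] := @filter_ex _ _ FF _ (H _ e3).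
have /cvgrPdist_le /(_ _ e3) := cf t x; apply: filterS => z Hz.
have E : g x - g z = (g x - f t x) + (f t x - f t z) + (f t z - g z) by ring.
have -> : eps = eps / 3 + eps / 3 + eps / 3 by field.
rewrite E (le_trans (ler_normD _ _))// lerD// (le_trans (ler_normD _ _))// lerD//.
by rewrite distrC.
Qed.

(** Pointwise convergence of the functions suffices: the mean value theorem for each approximation
    transfers the uniform control of the derivatives to the increments. *)
Lemma is_derive_ucvg T (F : set_system T) {FF : ProperFilter F}
    (V : normedModType R) (f : T -> V -> R) (f0 g : V -> R) v x :
  (forall t y, derivable (f t) y v) ->
  (forall y, f^~ y @ F --> f0 y) ->
  ucvg F (fun t => 'D_v (f t)) g -> {for x, continuous g} ->
  is_derive x v f0 (g x).
Proof.
move=> df cf cdf cg; apply/is_derive_epsP => eps e0.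
have e2 : 0 < eps / 2 by rewrite divr_gt0.
have cgv : {for (0 : R), continuous (fun h : R => g (x + h *: v))}.
  apply: continuous_comp; last by rewrite scale0r addr0.
  apply: cvgD; first exact: cvg_cst.
  by apply: cvgZl => //; exact: cvg_id.
have /nbhs_ballP[r /= r0 Hr] : \forall h \near (0 : R), `|g (x + h *: v) - g x| <= eps / 2.
  have /cvgrPdist_le /(_ _ e2) := cgv; apply: filterS => h.
  by rewrite scale0r addr0 distrC.
have nr : \forall h \near (0 : R), `|h| < r by exact: nbhs0_lt.
(* The index t is chosen after h: the pointwise errors at x and at x + h v together stay below eta
   while h is fixed, and eta is then sent to 0. *)
apply: filterS nr => h hr; apply/ler_addgt0Pr => eta eta0.
have eta2 : 0 < eta / 2 by rewrite divr_gt0.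
have /cvgrPdist_le /(_ _ eta2) N1 := cf (x + h *: v).
have /cvgrPdist_le /(_ _ eta2) N2 := cf x.
have N3 := cdf _ e2.
have [t [/= t1 [t2 t3]]] := @filter_ex _ _ FF _ (filterI N1 (filterI N2 N3)).
have [c ch E] : exists2 c : R, `|c| <= `|h| &
    f t (x + h *: v) - f t x = 'D_v (f t) (x + c *: v) * h.
  by apply: MVT_line => s _; exact: df.
have -> : f0 (x + h *: v) - f0 x - h * g x =
    (f0 (x + h *: v) - f t (x + h *: v)) - (f0 x - f t x) +
    h * (('D_v (f t) (x + c *: v) - g (x + c *: v)) + (g (x + c *: v) - g x)).
  have -> : f t (x + h *: v) = f t x + 'D_v (f t) (x + c *: v) * h by rewrite -E [RHS]addrC subrK.
  by ring.
rewrite addrC (le_trans (ler_normD _ _))// lerD//.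
  rewrite normrM mulrC ler_wpM2r// (splitr eps) (le_trans (ler_normD _ _))// lerD//.
  apply: Hr; rewrite -ball_normE /ball_/= sub0r normrN.
  exact: le_lt_trans hr.
by rewrite (splitr eta) (le_trans (ler_normB _ _))// lerD.
Qed.

Lemma Ck_ucvg T (F : set_system T) {FF : ProperFilter F} n j
    (f : T -> 'rV[R]_n -> R) (G : seq 'I_n -> 'rV[R]_n -> R) :
  (forall t, forall l, Ck l (f t)) ->
  (forall s, (size s <= j)%N -> ucvg F (fun t => partials s (f t)) (G s)) ->
  forall s l, (size s + l <= j)%N -> Ck l (G s) /\ G s = partials s (G [::]).
Proof.
move=> Cf UG.
have cG s : (size s <= j)%N -> continuous (G s).
  move=> sj; apply: (ucvg_continuous (UG s sj)) => t.
  by apply: (@Ck_continuous _ _ 0%N); apply: Ck_partials.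
have D s i x : (size s < j)%N -> is_derive x (ei i) (G s) (G (i :: s) x).
  move=> sj; apply: (@is_derive_ucvg _ F FF _ (fun t => partials s (f t))).
  - move=> t y; apply: (@Ck_derivable _ _ 0%N); apply: Ck_partials.
    exact: Cf.
  - by move=> y; exact: (ucvg_cvg (UG s (ltnW sj))).
  - exact: (UG (i :: s)).
  - exact: cG.
have P s i : (size s < j)%N -> partial i (G s) = G (i :: s).
  by move=> sj; apply/funext => x; have [_] := D s i x sj.
move=> s l slj; split.
  elim: l s slj => [|l IH] s slj.
    by split=> //; apply: cG; rewrite -(addn0 (size s)).
  have sj : (size s < j)%N by rewrite (leq_trans _ slj)// addnS ltnS leq_addr.
  split; first by apply: cG; exact: ltnW.
  move=> i; split; first by move=> x; have [] := D s i x sj.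
  by rewrite P//; apply: IH; rewrite /= addSnnS.
elim: s slj => [//|i s IH] slj /=.
rewrite -IH; last by rewrite (leq_trans _ slj)//= leq_add2r.
by rewrite P// (leq_trans _ slj)//= leq_addr.
Qed.

End UniformLimit.

(** * Borel measurability and periodic functions *)

Section CountableMeasurable.
Context d (T : measurableType d) (I : countType).

Lemma measurable_forall (P : I -> set T) :
  (forall i, measurable (P i)) -> measurable [set x | forall i, P i x].
Proof.
move=> mP.
rewrite (_ : [set _ | _] =
    \bigcap_(k : nat) if unpickle k is Some i then P i else setT).
  by apply: bigcapT_measurable => k; case: unpickle.
apply/seteqP; split=> x /= H; first by move=> k _; case: unpickle.
by move=> i; have := H (pickle i) Logic.I; rewrite pickleK.
Qed.

Lemma measurable_exists (P : I -> set T) :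
  (forall i, measurable (P i)) -> measurable [set x | exists i, P i x].
Proof.
move=> mP; rewrite -[X in measurable X]setCK; apply: measurableC.
rewrite (_ : ~` _ = [set x | forall i, (~` P i) x]).
  by apply: measurable_forall => i; exact: measurableC.
apply/seteqP; split=> x /=; first by move=> H i Pi; apply: H; exists i.
by move=> H [i]; exact: H.
Qed.

End CountableMeasurable.

Section Measurability.
Context {R : realType}.

Lemma measurable_ball_rV n (c : 'rV[R]_n) (e : R) : 0 < e -> measurable (ball c e).
Proof.
move=> e0.
have -> : ball c e = [set x | forall i, (coord_rV i @^-1` ball (c ord0 i) e) x].
  apply/seteqP; split=> x /=; first by move=> [_ bx] i; exact: bx.
  by move=> H; split=> // i j; rewrite (ord1 i); exact: H.
apply: measurable_forall => i.
rewrite -[X in measurable X]setTI; apply: (measurable_coord_rV i) => //.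
by apply: open_measurable; exact: ball_open.
Qed.

(** The sigma-algebra is generated by the coordinates, so an open set is written as a countable
    union of sup-norm balls with rational centre and radius 1 / (k + 1); the balls not contained in
    [U] are replaced by the empty set. *)
Lemma open_measurable_rV n (U : set 'rV[R]_n) : open U -> measurable U.
Proof.
move=> oU.
pose c (q : 'rV[rat]_n) : 'rV[R]_n := map_mx (fun x => ratr x) q.
pose e (k : nat) : R := k.+1%:R^-1.
have -> : U = [set x | exists p : 'rV[rat]_n * nat,
    (if `[< ball (c p.1) (e p.2) `<=` U >] then ball (c p.1) (e p.2) else set0) x].
  apply/seteqP; split=> x /=; last first.
    by move=> [p]; case: ifPn => // /asboolP H /H.
  move=> Ux; have /nbhs_ballP[r /= r0 xr] : nbhs x U by exact: open_nbhs_nbhs.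
  have [k kr] : exists k, e k < r / 2.
    have r2 : 0 < r / 2 by rewrite divr_gt0.
    have [k _ /(_ k (leqnn _)) /=] := near_infty_natSinv_lt (PosNum r2).
    by exists k.
  have ek0 : 0 < e k by rewrite invr_gt0.
  have Q i : exists q : rat, `|x ord0 i - ratr q| < e k.
    have /rat_in_itvoo[q] : x ord0 i - e k < x ord0 i + e k by lra.
    rewrite in_itv/= => /andP[q1 q2]; exists q.
    by rewrite ltr_distlC; apply/andP; split; lra.
  pose q := \row_i projT1 (cid (Q i)).
  have Eq i : c q ord0 i = ratr (projT1 (cid (Q i))) by rewrite !mxE.
  exists (q, k) => /=; case: ifPn => [_|/asboolP[]].
    split=> // i j; rewrite (ord1 i) Eq; case: cid => /= z.
    by rewrite -ball_normE /ball_/= distrC.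
  move=> y [_ by_]; apply: xr; split=> // i j; rewrite (ord1 i).
  have := by_ ord0 j; rewrite Eq; case: cid => /= z.
  rewrite -!ball_normE /ball_/= => xz zy.
  rewrite (_ : x ord0 j - y ord0 j = (x ord0 j - ratr z) + (ratr z - y ord0 j)).
    by rewrite (le_lt_trans (ler_normD _ _))// (splitr r) ltrD// (lt_trans _ kr).
  by ring.
apply: measurable_exists => p; case: ifP => // _.
by apply: measurable_ball_rV; rewrite invr_gt0.
Qed.

Lemma measurable_fun_comp_open d (T : measurableType d) n (O : set 'rV[R]_n)
    (F : 'rV[R]_n -> R) (X : T -> 'rV[R]_n) :
  open O -> (forall y, O y -> {for y, continuous F}) -> (forall x, O (X x)) ->
  (forall i, measurable_fun setT (fun x => X x ord0 i)) ->
  measurable_fun setT (F \o X).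
Proof.
move=> oO cF OX mX; apply: (measurability _ (measurable_realfun.RGenOpens.measurableE R)).
move=> _ [_ [a [b ->] <-]]; rewrite setTI comp_preimage.
have -> : X @^-1` (F @^-1` `]a, b[) = X @^-1` (O `&` F @^-1` `]a, b[).
  by apply/seteqP; split=> x /=; [move=> H; split|case].
rewrite -[X in measurable X]setTI; apply: (measurable_fun_rVP mX) => //.
apply: open_measurable_rV; rewrite openE => y [Oy /= Fy].
apply: filterI; first exact: open_nbhs_nbhs.
by apply: (cF y Oy); apply: open_nbhs_nbhs; split=> //; exact: interval_open.
Qed.

Lemma continuous_measurable_rV n (f : 'rV[R]_n -> R) :
  continuous f -> measurable_fun setT f.
Proof.
move=> cf; apply: (@measurable_fun_comp_open _ _ _ setT f id) => //.
- exact: openT.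
- by move=> y _; exact: cf.
- exact: measurable_coord_rV.
Qed.

End Measurability.

Section Periodic.
Context {R : realType}.

Lemma zperiodicM n (f : 'rV[R]_n -> R) x (i : 'I_n) (k : int) :
  zperiodic f -> f (x + k%:~R *: delta_mx ord0 i) = f x.
Proof.
move=> pf.
have N x0 (m : nat) : f (x0 + m%:R *: delta_mx ord0 i) = f x0.
  elim: m => [|m IH]; first by rewrite scale0r addr0.
  by rewrite -(addn1 m) natrD scalerDl scale1r addrA pf.
case: k => m; first exact: N.
rewrite NegzE mulrNz scaleNr -[in RHS](subrK (m.+1%:R *: delta_mx ord0 i) x).
by rewrite N.
Qed.

Lemma zperiodic_int n (f : 'rV[R]_n -> R) x (k : 'rV[int]_n) :
  zperiodic f -> f (x + map_mx (fun z => z%:~R) k) = f x.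
Proof.
move=> pf; rewrite [X in f (x + X)]row_sum_ei.
elim/big_rec: _ x => [x|i y _ IH x]; first by rewrite addr0.
by rewrite addrA IH mxE zperiodicM.
Qed.

Definition unit_cube n : set 'rV[R]_n := [set x | forall i, x ord0 i \in `[0, 1]%R].

Lemma unit_cube_compact n : compact (@unit_cube n).
Proof.
exact: (@rV_compact R n (fun=> `[0, 1]%classic) (fun=> @segment_compact R 0 1)).
Qed.

Lemma zperiodic_cube n (x : 'rV[R]_n) : exists2 y, unit_cube y &
  exists k : 'rV[int]_n, x = y + map_mx (fun z => z%:~R) k.
Proof.
pose k := \row_i Num.floor (x ord0 i).
exists (x - map_mx (fun z => z%:~R) k); last by exists k; rewrite subrK.
move=> i; rewrite !mxE in_itv/= subr_ge0 real_floor_le//=.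
by rewrite lerBlDl ltW//; have := real_floorD1_gt (num_real (x ord0 i)); rewrite intrD.
Qed.

Lemma periodic_bounded n (f : 'rV[R]_n -> R) :
  torus_continuous f -> exists C : R, forall x, `|f x| <= C.
Proof.
move=> [pf cf].
have cc : compact (f @` unit_cube (n := n)).
  apply: continuous_compact; last exact: unit_cube_compact.
  exact: continuous_subspaceT.
have [M [_ HM]] := compact_bounded cc.
exists (M + 1) => x; have [y yc [k ->]] := zperiodic_cube x.
rewrite (zperiodic_int _ _ pf); apply: (HM (M + 1)); first by rewrite ltrDl.
by exists y.
Qed.

End Periodic.

Section CubeIntegral.
Context {R : realType}.
Local Notation mu := (@cube_measure R _).
Local Notation ei i := (delta_mx ord0 i).

Lemma integral_cubeS n (F : 'rV[R]_n.+1 -> \bar R) :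
  measurable_fun setT F -> (forall x, 0 <= F x)%E ->
  (\int[mu]_x F x =
   \int[(uniform_prob (@ltr01 R) \x cube_measure n)%E]_z F (cons_rV z))%E.
Proof. by move=> mF F0; exact: ge0_integral_distribution. Qed.

Lemma rowDE n (u v : 'rV[R]_n) i : (u + v) ord0 i = u ord0 i + v ord0 i.
Proof. by rewrite mxE. Qed.

Lemma rowZE n (h : R) (v : 'rV[R]_n) i : (h *: v) ord0 i = h * v ord0 i.
Proof. by rewrite mxE. Qed.

Lemma cons_rVl n (z : measurableTypeR R * 'rV[R]_n) (j : 'I_1) :
  cons_rV z ord0 (lshift n j) = z.1.
Proof. by rewrite /cons_rV (@row_mxEl _ 1 1 n) !mxE !ord1. Qed.

Lemma cons_rVr n (z : measurableTypeR R * 'rV[R]_n) j :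
  cons_rV z ord0 (rshift 1 j) = z.2 ord0 j.
Proof. by rewrite /cons_rV (@row_mxEr _ 1 1 n). Qed.

Lemma cons_rVD0 n (t h : R) (y : 'rV[R]_n) :
  cons_rV (t + h, y) = cons_rV (t, y) + h *: ei ord0.
Proof.
apply/rowP => i; rewrite rowDE rowZE [delta_mx _ _ _ _]mxE.
case: (@split_ordP 1 n i) => j ->.
  rewrite !cons_rVl /= (_ : lshift n j == ord0) ?mulr1//.
  by rewrite ord1; apply/eqP/val_inj.
rewrite !cons_rVr.
have -> : (rshift 1 j == ord0 :> 'I_n.+1) = false by [].
by rewrite andbF mulr0 addr0.
Qed.

Lemma cons_rVDr n (t : R) (y v : 'rV[R]_n) :
  cons_rV (t, y + v) = cons_rV (t, y) + cons_rV (0, v).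
Proof.
apply/rowP => i; rewrite [RHS]mxE; case: (@split_ordP 1 n i) => j ->.
  by rewrite !cons_rVl /= addr0.
by rewrite !cons_rVr mxE.
Qed.

Lemma cons_rV_delta n (j : 'I_n) (h : R) :
  cons_rV (0, h *: ei j) = h *: ei (rshift 1 j).
Proof.
apply/rowP => i; rewrite [RHS]mxE [delta_mx _ _ _ _]mxE.
case: (@split_ordP 1 n i) => k ->.
  by rewrite cons_rVl /= eq_lrshift ?andbF mulr0.
by rewrite cons_rVr !mxE eq_rshift.
Qed.

Lemma continuous_cons_rV n (t : R) : continuous (fun y : 'rV[R]_n => cons_rV (t, y)).
Proof.
move=> x; apply: continuous_rowP => i; case: (@split_ordP 1 n i) => k ->.
  rewrite (_ : (fun z => _) = fun=> t); first exact: cst_continuous.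
  by apply/funext => z; rewrite cons_rVl.
rewrite (_ : (fun z => _) = fun z : 'rV[R]_n => z ord0 k); first exact: continuous_coord.
by apply/funext => z; rewrite cons_rVr.
Qed.

Lemma is_derive_affine n (f : 'rV[R]_n -> R) (m : nat) (A : 'rV[R]_m -> 'rV[R]_n) y v w :
  (forall h : R, A (y + h *: v) = A y + h *: w) ->
  derivable f (A y) w -> is_derive y v (f \o A) ('D_w f (A y)).
Proof.
move=> hA /derivableP /is_derive_epsP H; apply/is_derive_epsP => eps e0.
by apply: filterS (H eps e0) => h /=; rewrite hA.
Qed.

Lemma integral_FTC01 (f g : R -> R) (C : R) :
  (forall t, is_derive t (1 : R) g (f t)) -> continuous f -> g 1 = g 0 ->
  (forall t, 0 <= f t + C) ->
  (\int[uniform_prob (@ltr01 R)]_t (f t + C)%:E = C%:E)%E.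
Proof.
move=> dg cf g10 f0.
have cfC : continuous (fun t => f t + C).
  by move=> t; apply: cvgD; [exact: cf|exact: cvg_cst].
rewrite (@integral_uniform _ 0 1 ltr01 (fun t => (f t + C)%:E)); last 2 first.
- by apply/measurable_EFinP; exact: continuous_measurable_fun.
- by move=> t; rewrite lee_fin.
have dG t : is_derive t (1 : R) (fun t => g t + C * t) (f t + C).
  have -> : f t + C = f t + (C *: 1 + t *: 0) by rewrite scaler0 addr0 [C *: 1]mulr1.
  exact: is_deriveD.
rewrite (@continuous_FTC2 R (fun t => f t + C) (fun t => g t + C * t) 0 1 ltr01).
- by rewrite subr0 invr1 mul1e mulr1 mulr0 addr0 g10 -EFinB addrAC subrr add0r.
- exact: continuous_subspaceT.
- have cG : continuous (fun t => g t + C * t).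
    move=> t; apply: differentiable_continuous; apply/derivable1_diffP.
    by have [] := dG t.
  split; first by move=> t _; have [] := dG t.
  + by apply: cvg_at_right_filter; exact: cG.
  + by apply: cvg_at_left_filter; exact: cG.
- by move=> t _; rewrite derive1E; have [] := dG t.
Qed.

(** Induction on the dimension. Along the first axis, that variable is integrated first and
    periodicity kills the boundary terms; for another axis the first coordinate is frozen. The shift
    by [C] keeps the integrand nonnegative, so Tonelli applies without prior integrability. *)
Lemma integral_partial_shift n (f : 'rV[R]_n -> R) i (C : R) :
  zperiodic f -> (forall x, derivable f x (ei i)) -> continuous (partial i f) ->
  (forall x, 0 <= partial i f x + C) ->
  (\int[mu]_x (partial i f x + C)%:E = C%:E)%E.
Proof.
elim: n f i => [|n IH] f i; first by case: i.
move=> pf df cf f0.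
have cfC : continuous (fun x => partial i f x + C).
  by move=> x; apply: continuousD; [exact: cf|exact: cst_continuous].
have mf : measurable_fun setT (fun x => (partial i f x + C)%:E).
  by apply/measurable_EFinP; exact: continuous_measurable_rV.
rewrite integral_cubeS//.
have mfc : measurable_fun setT
    (fun z : measurableTypeR R * 'rV[R]_n => (partial i f (cons_rV z) + C)%:E).
  exact: (measurableT_comp mf (@measurable_cons_rV R n)).
case: (@split_ordP 1 n i) => j ij.
- rewrite (fubini_tonelli2 _ _ _) //=; last by move=> z; rewrite lee_fin.
  have i0 : i = ord0 by rewrite ij ord1; exact/val_inj.
  rewrite /fubini_G (eq_integral (fun=> C%:E)).
    rewrite integral_cst// -[RHS]mule1; congr (_ * _)%E.
    exact: probability_setT.
  move=> y _.
  pose A (t : R) := cons_rV (t, y).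
  have AE (t : R) : A t = A 0 + t *: ei ord0 by rewrite /A -cons_rVD0 add0r.
  apply: (@integral_FTC01 (fun t => partial i f (A t)) (fun t => f (A t))).
  + move=> t.
    have H (h : R) : A (t + h *: 1) = A t + h *: ei i.
      by rewrite /A -[h *: 1]/(h * 1) mulr1 cons_rVD0 i0.
    have /derivableP/is_derive_epsP D := df (A t).
    apply/is_derive_epsP => eps e0.
    by apply: filterS (D eps e0) => h /=; rewrite H.
  + move=> t; apply: continuous_comp; last exact: cf.
    rewrite (_ : A = fun t => A 0 + t *: ei ord0); last exact/funext.
    apply: cvgD; first exact: cvg_cst.
    by apply: cvgZl => //; exact: cvg_id.
  + by rewrite [in LHS]AE scale1r pf.
  + by [].
- rewrite (fubini_tonelli1 _ _ _) //=; last by move=> z; rewrite lee_fin.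
  rewrite /fubini_F (eq_integral (fun=> C%:E)).
    rewrite integral_cst// -[RHS]mule1; congr (_ * _)%E.
    exact: probability_setT.
  move=> t _.
  pose A (y : 'rV[R]_n) := cons_rV (t, y).
  have AE y (h : R) : A (y + h *: ei j) = A y + h *: ei i.
    by rewrite /A cons_rVDr cons_rV_delta ij.
  have D y : is_derive y (ei j) (f \o A) (partial i f (A y)).
    by apply: is_derive_affine => //; exact: AE.
  have E y : partial i f (A y) = partial j (f \o A) y by have [_ <-] := D y.
  under eq_integral => y _ do rewrite -/(A y) E.
  apply: IH.
  + move=> y k; rewrite /= /A cons_rVDr.
    by have := cons_rV_delta k 1; rewrite !scale1r => ->; rewrite pf.
  + by move=> y; have [] := D y.
  + rewrite (_ : partial j _ = partial i f \o A); last by apply/funext => y; rewrite /= E.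
    by move=> y; apply: continuous_comp; [exact: continuous_cons_rV|exact: cf].
  + by move=> y; rewrite -E.
Qed.

Definition obox n (a b : 'I_n -> R) : set 'rV[R]_n :=
  [set x | forall i, a i < x ord0 i < b i].

Lemma measurable_obox n (a b : 'I_n -> R) : measurable (obox a b).
Proof.
apply: measurable_forall => i.
rewrite (_ : (fun x => _) = coord_rV i @^-1` `]a i, b i[).
  by rewrite -[X in measurable X]setTI; exact: measurable_coord_rV.
by apply/seteqP; split=> x /=; rewrite in_itv.
Qed.

Lemma uniform_prob_itv (a b : R) : 0 <= a -> a <= b -> b <= 1 ->
  uniform_prob (@ltr01 R) `]a, b[ = (b - a)%:E.
Proof.
move=> a0 ab b1; rewrite /uniform_prob integral_uniform_pdf setIidl; last first.
  move=> x /=; rewrite !in_itv/= => /andP[ax xb].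
  by rewrite (le_trans a0 (ltW ax)) (le_trans (ltW xb) b1).
rewrite (eq_integral (fun=> 1%:E)); last first.
  move=> x; rewrite inE/= in_itv/= => /andP[ax xb].
  rewrite /uniform_pdf (le_trans a0 (ltW ax)) (le_trans (ltW xb) b1)/=.
  by rewrite subr0 invr1.
rewrite integral_cst//= mul1e lebesgue_measure_itv/= lte_fin.
case: ltP => [_|ba]; first by rewrite EFinB.
by rewrite (le_anti (_ : a <= b <= a)) ?subrr// ab ba.
Qed.

Lemma cube_measure_obox n (a b : 'I_n -> R) :
  (forall i, 0 <= a i) -> (forall i, a i <= b i) -> (forall i, b i <= 1) ->
  mu (obox a b) = (\prod_i (b i - a i))%:E.
Proof.
elim: n a b => [|n IH] a b a0 ab b1.
  rewrite big_ord0 (_ : obox a b = setT) ?probability_setT//.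
  by apply/seteqP; split=> x // _ [].
rewrite big_ord_recl EFinM /=.
transitivity ((uniform_prob (@ltr01 R) \x cube_measure n)%E
   (`]a ord0, b ord0[ `*` obox (a \o lift ord0) (b \o lift ord0))).
  rewrite /distribution /pushforward /=; congr (_ _).
  apply/seteqP; split=> [[t y]|[t y]] /=.
    move=> H; split=> /=.
      have := H ord0; rewrite in_itv/= (_ : ord0 = lshift n (ord0 : 'I_1)); last exact/val_inj.
      by rewrite cons_rVl.
    move=> i; have := H (rshift 1 i); rewrite cons_rVr /=.
    by rewrite (_ : rshift 1 i = lift ord0 i)//; exact/val_inj.
  rewrite in_itv/= => -[t01 H] i; case: (@split_ordP 1 n i) => j ->.
    rewrite cons_rVl (_ : lshift n j = ord0)//.
    by rewrite ord1; exact/val_inj.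
  by have := H j; rewrite cons_rVr /= (_ : rshift 1 j = lift ord0 j)//; exact/val_inj.
rewrite product_measure1E//=; last exact: measurable_obox.
have E := IH (a \o lift ord0) (b \o lift ord0)
  (fun k => a0 _) (fun k => ab _) (fun k => b1 _).
by rewrite uniform_prob_itv// E.
Qed.

Lemma ae_open_cube n : {ae mu, forall x : 'rV[R]_n, forall i, 0 < x ord0 i < 1}.
Proof.
exists (~` obox (fun=> 0) (fun=> 1)); split.
- by apply: measurableC; exact: measurable_obox.
- rewrite probability_setC; last exact: measurable_obox.
  rewrite cube_measure_obox// big1 ?subee// => i _; exact: subr0.
- by move=> x /=.
Qed.

End CubeIntegral.

(** * Integration on the torus *)

Section Integrable.
Context {R : realType} {d : nat}.
Local Notation mu := (@cube_measure R d).
Local Notation ei i := (delta_mx ord0 i).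
Implicit Types f g : 'rV[R]_d -> R.

Definition integrableR f := mu.-integrable setT (EFin \o f).
Definition Int f : R := \int[mu]_x f x.

Lemma Rint_measurable f : integrableR f -> measurable_fun setT f.
Proof. by move=> /integrableP[/measurable_EFinP]. Qed.

Lemma Rint_bounded f (C : R) :
  measurable_fun setT f -> (forall x, `|f x| <= C) -> integrableR f.
Proof.
move=> mf fC; apply: measurable_bounded_integrable => //.
  by apply: (le_lt_trans (probability_le1 mu measurableT)); rewrite ltry.
exists C; split => [|M CM x _ /=]; first exact: num_real.
exact: le_trans (fC x) (ltW CM).
Qed.

Lemma Rint_cst (c : R) : integrableR (fun=> c).
Proof. by apply: (@Rint_bounded _ `|c|). Qed.

Lemma RintD f g : integrableR f -> integrableR g -> integrableR (fun x => f x + g x).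
Proof. by move=> If Ig; exact: (integrableD measurableT If Ig). Qed.

Lemma RintZ (c : R) f : integrableR f -> integrableR (fun x => c * f x).
Proof. by move=> If; exact: (integrableZl measurableT c If). Qed.

Lemma RintN f : integrableR f -> integrableR (fun x => - f x).
Proof.
move=> /(RintZ (-1)); rewrite /integrableR; congr (mu.-integrable _ _).
by apply/funext => x /=; rewrite mulN1r.
Qed.

Lemma RintB f g : integrableR f -> integrableR g -> integrableR (fun x => f x - g x).
Proof. by move=> If /RintN; exact: RintD. Qed.

Lemma Rint_sum I (r : seq I) (F : I -> 'rV[R]_d -> R) :
  (forall i, integrableR (F i)) -> integrableR (fun x => \sum_(i <- r) F i x).
Proof.
move=> IF; elim: r => [|i r IH].
  rewrite (_ : (fun x => _) = fun=> 0); first exact: Rint_cst.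
  by apply/funext => x; rewrite big_nil.
rewrite (_ : (fun x => _) = fun x => F i x + \sum_(i <- r) F i x).
  exact: RintD.
by apply/funext => x; rewrite big_cons.
Qed.

Lemma Rint_le f g :
  measurable_fun setT f -> (forall x, `|f x| <= g x) -> integrableR g -> integrableR f.
Proof.
move=> mf fg Ig; apply: (le_integrable measurableT _ _ Ig).
  exact/measurable_EFinP.
move=> x _ /=; rewrite lee_fin (le_trans (fg x))//; exact: ler_norm.
Qed.

Lemma Rint_abs f : integrableR f -> integrableR (fun x => `|f x|).
Proof. by move=> If; exact: (integrable_norm If). Qed.

Lemma Rint_mulb f g (C : R) : integrableR f -> measurable_fun setT g ->
  (forall x, `|g x| <= C) -> integrableR (fun x => f x * g x).
Proof.
move=> If mg gC; apply: (@Rint_le _ (fun x => C * `|f x|)).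
- by apply: measurable_funM => //; exact: Rint_measurable.
- by move=> x; rewrite normrM mulrC ler_wpM2r.
- exact/RintZ/Rint_abs.
Qed.

Lemma IntD f g : integrableR f -> integrableR g -> Int (fun x => f x + g x) = Int f + Int g.
Proof. by move=> If Ig; exact: RintegralD. Qed.

Lemma IntB f g : integrableR f -> integrableR g -> Int (fun x => f x - g x) = Int f - Int g.
Proof. by move=> If Ig; exact: RintegralB. Qed.

Lemma IntZ (c : R) f : integrableR f -> Int (fun x => c * f x) = c * Int f.
Proof. by move=> If; exact: RintegralZl. Qed.

Lemma Int_cst (c : R) : Int (fun=> c) = c.
Proof. by rewrite /Int Rintegral_cst//= probability_setT mulr1. Qed.

Lemma Int_sum I (r : seq I) (F : I -> 'rV[R]_d -> R) :
  (forall i, integrableR (F i)) ->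
  Int (fun x => \sum_(i <- r) F i x) = \sum_(i <- r) Int (F i).
Proof.
move=> IF; elim: r => [|i r IH].
  rewrite big_nil (_ : (fun x => _) = fun=> 0) ?Int_cst//.
  by apply/funext => x; rewrite big_nil.
rewrite (_ : (fun x => _) = fun x => F i x + \sum_(i <- r) F i x).
  by rewrite IntD// ?IH ?big_cons//; exact: Rint_sum.
by apply/funext => x; rewrite big_cons.
Qed.

Lemma Int_le f g : integrableR f -> integrableR g -> (forall x, f x <= g x) -> Int f <= Int g.
Proof. by move=> If Ig fg; apply: le_Rintegral. Qed.

Lemma Int_ge0 f : (forall x, 0 <= f x) -> 0 <= Int f.
Proof. by move=> f0; apply: Rintegral_ge0. Qed.

Lemma Int_norm f : integrableR f -> `|Int f| <= Int (fun x => `|f x|).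
Proof. by move=> If; exact: le_normr_Rintegral. Qed.

Lemma Int_norm_le f (C : R) : integrableR f -> (forall x, `|f x| <= C) -> `|Int f| <= C.
Proof.
move=> If fC; apply: le_trans (Int_norm If) _; rewrite -[leRHS]Int_cst.
by apply: Int_le => //; [exact: Rint_abs|exact: Rint_cst].
Qed.

Lemma Int_ae_eq f g : measurable_fun setT f -> measurable_fun setT g ->
  {ae mu, forall x, f x = g x} -> Int f = Int g.
Proof.
move=> mf mg fg; congr fine; apply: ae_eq_integral => //.
- exact/measurable_EFinP.
- exact/measurable_EFinP.
- by apply: filterS fg => x fgx _; rewrite fgx.
Qed.

Lemma Int_ae_le f g : integrableR f -> integrableR g ->
  {ae mu, forall x, f x <= g x} -> Int f <= Int g.
Proof.
move=> If Ig fg.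
have mm : measurable_fun setT (fun x => Num.min (f x) (g x)).
  by apply: measurable_minr; exact: Rint_measurable.
rewrite (@Int_ae_eq f (fun x => Num.min (f x) (g x))); first last.
- by apply: filterS fg => x fgx; rewrite min_l.
- exact: mm.
- exact: Rint_measurable.
apply: Int_le => // [|x]; last by rewrite ge_min lexx orbT.
apply: (@Rint_le _ (fun x => `|f x| + `|g x|)) => //.
  move=> x; rewrite /Num.min; case: ifP => _; first by rewrite lerDl.
  by rewrite lerDr.
by apply: RintD; exact: Rint_abs.
Qed.

Lemma torus_measurable f : torus_continuous f -> measurable_fun setT f.
Proof. by move=> [_ cf]; exact: continuous_measurable_rV. Qed.

Lemma torus_Rint f : torus_continuous f -> integrableR f.
Proof.
move=> tf; have [C fC] := periodic_bounded tf.
by apply: (@Rint_bounded _ C) => //; exact: torus_measurable.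
Qed.

Lemma Rint_mult f g : integrableR f -> torus_continuous g -> integrableR (fun x => f x * g x).
Proof.
move=> If tg; have [C gC] := periodic_bounded tg.
by apply: (@Rint_mulb _ _ C) => //; exact: torus_measurable.
Qed.

Lemma torus_cst (c : R) : torus_continuous (fun _ : 'rV[R]_d => c).
Proof. by split=> //; exact: cst_continuous. Qed.

Lemma torusD f g : torus_continuous f -> torus_continuous g ->
  torus_continuous (fun x => f x + g x).
Proof.
move=> [pf cf] [pg cg]; split; first by move=> x i; rewrite pf pg.
by move=> x; apply: continuousD; [exact: cf|exact: cg].
Qed.

Lemma torusM f g : torus_continuous f -> torus_continuous g ->
  torus_continuous (fun x => f x * g x).
Proof.
move=> [pf cf] [pg cg]; split; first by move=> x i; rewrite pf pg.
by move=> x; apply: continuousM; [exact: cf|exact: cg].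
Qed.

Lemma torusZ (c : R) f : torus_continuous f -> torus_continuous (fun x => c * f x).
Proof. by move=> tf; apply: torusM => //; exact: torus_cst. Qed.

Lemma torusN f : torus_continuous f -> torus_continuous (fun x => - f x).
Proof.
move=> [pf cf]; split; first by move=> x i; rewrite pf.
by move=> x; apply: continuousN; exact: cf.
Qed.

Lemma torusB f g : torus_continuous f -> torus_continuous g ->
  torus_continuous (fun x => f x - g x).
Proof. by move=> tf tg; apply: torusD => //; exact: torusN. Qed.

Lemma torus_sum I (r : seq I) (F : I -> 'rV[R]_d -> R) :
  (forall i, torus_continuous (F i)) ->
  torus_continuous (fun x => \sum_(i <- r) F i x).
Proof.
move=> IF; elim: r => [|i r IH].
  rewrite (_ : (fun x => _) = fun=> 0); first exact: torus_cst.
  by apply/funext => x; rewrite big_nil.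
rewrite (_ : (fun x => _) = fun x => F i x + \sum_(i <- r) F i x).
  exact: torusD.
by apply/funext => x; rewrite big_cons.
Qed.

Lemma zperiodic_partial f i : zperiodic f -> zperiodic (partial i f).
Proof.
move=> pf x j; rewrite /partial /derive.
set F := fun h => _; set G := fun h => _; suff -> : F = G by [].
by apply/funext => h; rewrite /F /G /= addrA !pf.
Qed.

Lemma zperiodic_partials f s : zperiodic f -> zperiodic (partials s f).
Proof. by move=> pf; elim: s => //= i s; exact: zperiodic_partial. Qed.

Lemma torus_partials j f s : zperiodic f -> Ck j f -> (size s <= j)%N ->
  torus_continuous (partials s f).
Proof.
move=> pf Cf sj; split; first exact: zperiodic_partials.
by apply: (@Ck_continuous _ _ 0%N); apply: Ck_partials; rewrite addn0; exact: Ck_leq Cf.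
Qed.

Lemma Ck_torus j f : zperiodic f -> Ck j f -> torus_continuous f.
Proof. by move=> pf Cf; split=> //; exact: Ck_continuous Cf. Qed.

Lemma Int_partial f i : zperiodic f -> Ck 1%N f -> Int (partial i f) = 0.
Proof.
move=> pf Cf.
have tf : torus_continuous (partial i f) by apply: (@torus_partials 1%N f [:: i]).
have [C HC] := periodic_bounded tf.
have := @integral_partial_shift R d f i C pf _ tf.2 _.
have H1 x : derivable f x (ei i) by exact: Ck_derivable Cf.
have H2 x : 0 <= partial i f x + C.
  by have := HC x; rewrite ler_norml => /andP[]; lra.
move=> /(_ H1 H2) /(congr1 fine) /= E.
have : Int (fun x => partial i f x + C) = C by exact: E.
rewrite IntD; [|exact: torus_Rint|exact: Rint_cst].
by rewrite Int_cst => H; apply: (addIr C); rewrite add0r.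
Qed.

Lemma torus_by_parts f g i : zperiodic f -> zperiodic g -> Ck 1%N f -> Ck 1%N g ->
  Int (fun x => f x * partial i g x) = - Int (fun x => partial i f x * g x).
Proof.
move=> pf pg Cf Cg.
have pfg : zperiodic (fun x => f x * g x) by move=> x j; rewrite pf pg.
have := Int_partial i pfg (CkM Cf Cg).
have tf := Ck_torus pf Cf; have tg := Ck_torus pg Cg.
have tpf : torus_continuous (partial i f) by apply: (@torus_partials 1%N f [:: i]).
have tpg : torus_continuous (partial i g) by apply: (@torus_partials 1%N g [:: i]).
rewrite partialM; last 2 first.
- by move=> x; exact: Ck_derivable Cf.
- by move=> x; exact: Ck_derivable Cg.
rewrite IntD; last 2 first.
- by apply: torus_Rint; exact: torusM.
- by apply: torus_Rint; exact: torusM.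
move=> /eqP; rewrite addr_eq0 => /eqP ->; congr (- Int _).
by apply/funext => x; rewrite mulrC.
Qed.

(** Derivatives are moved one at a time, outermost first, which reverses their order; no symmetry of
    mixed partials is invoked. *)
Lemma torus_by_parts_seq f g s : zperiodic f -> zperiodic g ->
  Ck (size s) f -> Ck (size s) g ->
  Int (fun x => f x * partials s g x) =
  (-1) ^+ size s * Int (fun x => partials (rev s) f x * g x).
Proof.
elim: s f => [|i s IH] f pf pg Cf Cg; first by rewrite expr0 mul1r.
rewrite /= torus_by_parts//; first last.
- by apply: Ck_partials; rewrite addn1.
- by apply: Ck_leq Cf.
- exact: zperiodic_partials.
rewrite IH//; first last.
- exact: Ck_leq (leqnSn _) Cg.
- exact: Ck_partial.
- exact: zperiodic_partial.
rewrite exprS mulN1r mulNr; congr (- (_ * Int _)); apply/funext => x.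
by rewrite rev_cons /partials -cats1 foldr_cat.
Qed.

Lemma Int_ge_box f (x0 : 'rV[R]_d) (r c : R) :
  zperiodic f -> integrableR f -> (forall x, 0 <= f x) -> 0 < r -> r <= 2^-1 -> 0 <= c ->
  (forall x : 'rV[R]_d, (forall i, `|x ord0 i - x0 ord0 i| <= r) -> c <= f x) ->
  c * r ^+ d <= Int f.
Proof.
move=> pf If f0 r0 r2 c0 Hc.
have [y yc [k xk]] := zperiodic_cube x0.
(* The measure sees only the unit cube: in each coordinate the side of length r starts or ends at y,
   whichever stays inside [0, 1]. This is possible because r <= 1/2. *)
pose a i : R := if y ord0 i <= 2^-1 then y ord0 i else y ord0 i - r.
pose b i := a i + r.
have yc' i : 0 <= y ord0 i <= 1 by have := yc i; rewrite in_itv.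
have a0 i : 0 <= a i.
  by rewrite /a; have /andP[? ?] := yc' i; have [?|?] := leP (y ord0 i) 2^-1; lra.
have ab i : a i <= b i by rewrite /b; lra.
have b1 i : b i <= 1.
  by rewrite /b /a; have /andP[? ?] := yc' i; have [?|?] := leP (y ord0 i) 2^-1; lra.
have mo := measurable_obox a b.
have near x : obox a b x -> c <= f x.
  move=> ox; rewrite -(zperiodic_int x k pf); apply: Hc => i.
  rewrite xk !mxE opprD addrACA subrr addr0.
  have /andP[] := ox i; rewrite /b /a ler_norml.
  by case: ifP => _ ? ?; apply/andP; split; lra.
have Ic : integrableR (fun x => c * \1_(obox a b) x).
  apply: (@Rint_bounded _ c) => [|x].
    apply: measurable_funM => //; exact: measurable_indic.
  by rewrite normrM ger0_norm// indicE; case: (_ \in _); rewrite ?normr1 ?normr0 ?mulr1 ?mulr0.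
have <- : Int (fun x => c * \1_(obox a b) x) = c * r ^+ d.
  rewrite IntZ; last first.
    apply: (@Rint_bounded _ 1) => [|x]; first exact: measurable_indic.
    by rewrite indicE; case: (_ \in _); rewrite ?normr1 ?normr0.
  congr (c * _); transitivity (fine (mu (obox a b))).
    by rewrite /Int /Rintegral integral_indic// setIT.
  rewrite cube_measure_obox//=.
  rewrite (eq_bigr (fun=> r)); last by move=> i _; rewrite /b; ring.
  by rewrite prodr_const card_ord.
apply: Int_le => // x; rewrite indicE.
by have [/set_mem/near|] := boolP (x \in _); rewrite ?mulr1 ?mulr0.
Qed.

Lemma Int_eq0 f : torus_continuous f -> (forall x, 0 <= f x) -> Int f = 0 ->
  forall x, f x = 0.
Proof.
move=> tf f0 If0 x; apply/eqP; rewrite eq_le f0 andbT leNgt; apply/negP => fx.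
have fx2 : 0 < f x / 2 by rewrite divr_gt0.
have /nbhs_ballP[r /= r0 Hr] : \forall z \near x, f x / 2 <= f z.
  have /cvgrPdist_le /(_ _ fx2) := tf.2 x; apply: filterS => z.
  by rewrite ler_norml => /andP[_]; lra.
pose r' := Num.min (r / 2) 2^-1.
have r'0 : 0 < r' by rewrite lt_min divr_gt0//= invr_gt0.
have r'r : r' < r by rewrite (le_lt_trans (_ : _ <= r / 2))// ?ge_min ?lexx//; lra.
have : f x / 2 * r' ^+ d <= Int f.
  apply: (@Int_ge_box f x) => //; [exact: tf.1|exact: torus_Rint| | |].
  - by rewrite ge_min lexx orbT.
  - exact: ltW.
  - move=> z Hz; apply: Hr; rewrite -ball_normE /ball_/= distrC.
    apply: le_lt_trans r'r; apply: norm_le_coord; first exact: ltW.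
    by move=> i; rewrite !mxE; exact: Hz.
by rewrite If0 leNgt mulr_gt0// exprn_gt0.
Qed.

Lemma torus_ae_eq0 f : torus_continuous f -> {ae mu, forall x, f x = 0} ->
  forall x, f x = 0.
Proof.
move=> tf H x; apply/eqP; rewrite -normr_eq0; apply/eqP; move: x.
have tn : torus_continuous (fun x => `|f x|).
  split; first by move=> x i; rewrite tf.1.
  by move=> x; apply: (continuous_comp (tf.2 x)); exact: norm_continuous.
apply: (@Int_eq0 (fun x => `|f x|)) => //.
rewrite (@Int_ae_eq _ (fun=> 0)) ?Int_cst//.
  exact: torus_measurable.
by apply: filterS H => x ->; rewrite normr0.
Qed.

End Integrable.

(** * Hartley series *)

Section Hartley.
Context {R : realType} {d : nat}.
Local Notation mu := (@cube_measure R d).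
Local Notation ei i := (delta_mx ord0 i).
Local Notation freq := 'rV[int]_d.
Implicit Types (k l : freq) (x : 'rV[R]_d) (f g : 'rV[R]_d -> R).

Definition phase k x : R := 2 * pi * \sum_i (k ord0 i)%:~R * x ord0 i.

(* The Hartley functions cos (2 pi k.x) + sin (2 pi k.x), k in Z^d, are a real
   orthonormal basis of L^2(T^d), and d_i maps the k-th one to 2 pi k_i times
   the (-k)-th one. *)
Definition hartley k x : R := cos (phase k x) + sin (phase k x).

Lemma phaseD k x y : phase k (x + y) = phase k x + phase k y.
Proof.
rewrite /phase -mulrDr -big_split/=; congr (_ * _).
by apply: eq_bigr => i _; rewrite mxE mulrDr.
Qed.

Lemma phaseZ k x (h : R) : phase k (h *: x) = h * phase k x.
Proof.
rewrite /phase mulrCA; congr (_ * _); rewrite mulr_sumr.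
by apply: eq_bigr => i _; rewrite mxE mulrCA.
Qed.

Lemma phase_ei k i : phase k (ei i) = 2 * pi * (k ord0 i)%:~R.
Proof.
rewrite /phase (bigD1 i)//= mxE !eqxx mulr1 big1 ?addr0// => j ji.
by rewrite mxE (negbTE ji) andbF mulr0.
Qed.

Lemma phaseN k x : phase (- k) x = - phase k x.
Proof.
rewrite /phase -mulrN; congr (_ * _); rewrite -sumrN.
by apply: eq_bigr => i _; rewrite mxE mulrNz mulNr.
Qed.

Lemma phaseDl k l x : phase (k + l) x = phase k x + phase l x.
Proof.
rewrite /phase -mulrDr -big_split/=; congr (_ * _).
by apply: eq_bigr => i _; rewrite mxE intrD mulrDl.
Qed.

Lemma hartley0 : hartley 0 = fun=> 1.
Proof.
apply/funext => x; rewrite /hartley /phase big1 ?mulr0 ?cos0 ?sin0 ?addr0//.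
by move=> i _; rewrite mxE mul0r.
Qed.

Lemma hartley_bound k x : `|hartley k x| <= 2.
Proof.
rewrite (le_trans (ler_normD _ _))// -[leRHS]/(1 + 1) lerD//.
  by rewrite ler_norml cos_geN1 cos_le1.
by rewrite ler_norml sin_geN1 sin_le1.
Qed.

Lemma cos_sin_int (a : R) (z : int) :
  cos (a + 2 * pi * z%:~R) = cos a /\ sin (a + 2 * pi * z%:~R) = sin a.
Proof.
have E (n : nat) : 2 * pi * n%:R = (pi *+ 2 *+ n) :> R.
  by rewrite -[RHS]mulr_natr -[pi *+ 2]mulr_natl.
have N (b : R) (n : nat) :
    cos (b + 2 * pi * n%:R) = cos b /\ sin (b + 2 * pi * n%:R) = sin b.
  by rewrite E (periodicn (@cosD2pi R)) (periodicn (@sinD2pi R)).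
case: z => n; first exact: N.
rewrite NegzE mulrNz; have [] := N (a + 2 * pi * - n.+1%:R) n.+1.
by rewrite -addrA -mulrDr addNr mulr0 addr0 => -> ->.
Qed.

Lemma zperiodic_hartley k : zperiodic (hartley k).
Proof.
move=> x i; rewrite /hartley phaseD phase_ei.
by have [-> ->] := cos_sin_int (phase k x) (k ord0 i).
Qed.

Lemma is_derive_hartley k x v :
  is_derive x v (hartley k) (phase k v * hartley (- k) x).
Proof.
have D (t : R) : is_derive t (1 : R) (fun t => cos t + sin t) (cos t - sin t).
  by rewrite addrC; exact: is_deriveD.
apply/is_derive_epsP => eps e0.
have [p0|p0] := eqVneq (phase k v) 0.
  near=> h; rewrite /hartley phaseD phaseZ p0 mul0r !mulr0 subr0.
  by rewrite addr0 subrr normr0 mulr_ge0// ltW.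
have e1 : 0 < eps / `|phase k v| by rewrite divr_gt0// normr_gt0.
have /is_derive_epsP /(_ _ e1) H := D (phase k x).
have C : (fun h : R => h * phase k v) @ 0 --> (0 : R).
  rewrite -[X in _ --> X](mul0r (phase k v)).
  by apply: cvgMl; exact: cvg_id.
have N : \forall h \near (0 : R), `|cos (phase k x + (h * phase k v) *: 1) +
    sin (phase k x + (h * phase k v) *: 1) - (cos (phase k x) + sin (phase k x)) -
    h * phase k v * (cos (phase k x) - sin (phase k x))|
    <= eps / `|phase k v| * `|h * phase k v| by exact: (C _ H).
apply: filterS N => h Hh.
rewrite /hartley phaseN cosN sinN phaseD phaseZ (mulrA h (phase k v)).
move: Hh; rewrite -![_ *: 1]/(_ * 1) !mulr1 => Hh.
apply: (le_trans Hh).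
have -> : eps / `|phase k v| * `|h * phase k v| = eps * `|h|; last by [].
by rewrite (normrM h (phase k v)); field; rewrite normr_eq0.
Unshelve. all: by end_near.
Qed.

Lemma partial_hartley k i :
  partial i (hartley k) = fun x => 2 * pi * (k ord0 i)%:~R * hartley (- k) x.
Proof.
by apply/funext => x; have [_] := is_derive_hartley k x (ei i); rewrite phase_ei.
Qed.

Lemma continuous_hartley k : continuous (hartley k).
Proof.
have cp : continuous (phase k).
  apply: (@Ck_continuous _ _ 0%N); apply: CkZ; apply: Ck_sum => i.
  by apply: CkZ; exact: Ck_coord.
move=> x; apply: (@continuousD _ _ _ (cos \o phase k) (sin \o phase k)).
  by apply: continuous_comp; [exact: cp|exact: continuous_cos].
by apply: continuous_comp; [exact: cp|exact: continuous_sin].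
Qed.

Lemma Ck_hartley j k : Ck j (hartley k).
Proof.
elim: j k => [|j IH] k; split=> //; try exact: continuous_hartley.
move=> i; split; first by move=> x; have [] := is_derive_hartley k x (ei i).
by rewrite partial_hartley; apply: CkZ; exact: IH.
Qed.

Lemma torus_hartley k : torus_continuous (hartley k).
Proof. by split; [exact: zperiodic_hartley|exact: continuous_hartley]. Qed.

Lemma smooth_hartley k : torus_smooth (hartley k).
Proof.
by split; [exact: zperiodic_hartley|apply: Ck_smooth_open => j; exact: Ck_hartley].
Qed.

(** The product-to-sum formula yields both the orthonormality of the system and the stability of
    [trigpoly] under products. *)
Lemma hartleyM k l x : hartley k x * hartley l x =
  (hartley (k - l) x + hartley (l - k) x + hartley (k + l) x
   - hartley (- (k + l)) x) / 2.
Proof.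
rewrite /hartley -[l - k]opprB !phaseN !phaseDl phaseN !cosN !sinN.
by rewrite !cosB !sinB !cosD !sinD; field.
Qed.

(** If some k_i is nonzero, [hartley k] is a nonzero multiple of a partial derivative of
    [hartley (- k)], whose integral vanishes by periodicity. *)
Lemma Int_hartley k : Int (hartley k) = (k == 0)%:R.
Proof.
have [->|k0] := eqVneq k 0; first by rewrite hartley0 Int_cst.
have [i ki] : exists i, k ord0 i != 0.
  apply/existsP; apply: contraNT k0; rewrite negb_exists => /forallP H.
  by apply/eqP/rowP => i; rewrite mxE; apply/eqP; rewrite -[_ == _]negbK; exact: H.
have := Int_partial i (zperiodic_hartley (- k)) (Ck_hartley 1 (- k)).
rewrite partial_hartley opprK IntZ; last exact/torus_Rint/torus_hartley.
move=> /eqP; rewrite mulf_eq0 => /orP[|/eqP//].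
rewrite !mulf_eq0 pnatr_eq0/= mxE mulrNz oppr_eq0 intr_eq0 (negbTE ki) orbF.
by rewrite gt_eqF// pi_gt0.
Qed.

Lemma Int_hartleyM k l :
  Int (fun x => hartley k x * hartley l x) = (k == l)%:R.
Proof.
have T m := torus_Rint (torus_hartley m).
have -> : (fun x => hartley k x * hartley l x) =
    fun x => 2^-1 * (hartley (k - l) x + hartley (l - k) x + hartley (k + l) x
   - hartley (- (k + l)) x).
  by apply/funext => x; rewrite hartleyM mulrC.
have T1 := RintD (T (k - l)) (T (l - k)).
have T2 := RintD T1 (T (k + l)).
rewrite IntZ; last exact: RintB.
rewrite IntB// IntD// IntD// !Int_hartley oppr_eq0 addrK.
rewrite -[l - k]opprB oppr_eq0 subr_eq0.
by case: (k == l) => /=; rewrite ?addr0 ?mulr0//; field.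
Qed.

(** An inductive presentation of finite Hartley sums, so that closure under products is a double
    induction based on [hartleyM]. *)
Inductive trigpoly : ('rV[R]_d -> R) -> Prop :=
| trig0 : trigpoly (fun=> 0)
| trigS c k p : trigpoly p -> trigpoly (fun x => c * hartley k x + p x).

Lemma trigpoly_torus p : trigpoly p -> torus_continuous p.
Proof.
elim=> [|c k q _ IH]; first exact: torus_cst.
by apply: torusD => //; apply: torusZ; exact: torus_hartley.
Qed.

Lemma trigpolyD p q : trigpoly p -> trigpoly q -> trigpoly (fun x => p x + q x).
Proof.
move=> + Tq; elim=> [|c k r _ IH].
  by rewrite (_ : (fun x => _) = q)//; apply/funext => x; rewrite add0r.
rewrite (_ : (fun x => _) = fun x => c * hartley k x + (r x + q x)).
  exact: trigS.
by apply/funext => x; rewrite addrA.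
Qed.

Lemma trigpolyZ c p : trigpoly p -> trigpoly (fun x => c * p x).
Proof.
elim=> [|a k r _ IH].
  rewrite (_ : (fun x => _) = fun=> 0); first exact: trig0.
  by apply/funext => x; rewrite mulr0.
rewrite (_ : (fun x => _) = fun x => (c * a) * hartley k x + c * r x).
  exact: trigS.
by apply/funext => x; rewrite mulrDr mulrA.
Qed.

Lemma trigpoly_hartley c k : trigpoly (fun x => c * hartley k x).
Proof.
rewrite (_ : (fun x => _) = fun x => c * hartley k x + 0); first exact/trigS/trig0.
by apply/funext => x; rewrite addr0.
Qed.

Lemma trigpoly_cst c : trigpoly (fun=> c).
Proof.
rewrite (_ : (fun=> c) = fun x => c * hartley 0 x); first exact: trigpoly_hartley.
by apply/funext => x; rewrite hartley0 mulr1.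
Qed.

Lemma trigpolyM p q : trigpoly p -> trigpoly q -> trigpoly (fun x => p x * q x).
Proof.
move=> + Tq; elim=> [|c k r _ IH].
  rewrite (_ : (fun x => _) = fun=> 0); first exact: trig0.
  by apply/funext => x; rewrite mul0r.
rewrite (_ : (fun x => _) = fun x => c * (hartley k x * q x) + r x * q x); last first.
  by apply/funext => x; rewrite mulrDl mulrA.
apply: trigpolyD => //; apply: trigpolyZ.
elim: Tq => [|a l s _ IHs].
  rewrite (_ : (fun x => _) = fun=> 0); first exact: trig0.
  by apply/funext => x; rewrite mulr0.
rewrite (_ : (fun x => _) = fun x => a / 2 * hartley (k - l) x +
   (a / 2 * hartley (l - k) x + (a / 2 * hartley (k + l) x +
   (- (a / 2) * hartley (- (k + l)) x + hartley k x * s x)))).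
  by do 4 apply: trigS.
by apply/funext => x; rewrite mulrDr (mulrC a) mulrA hartleyM; field.
Qed.

Lemma trigpolyX p n : trigpoly p -> trigpoly (fun x => p x ^+ n).
Proof.
move=> Tp; elim: n => [|n IH]; first exact: trigpoly_cst.
rewrite (_ : (fun x => _) = fun x => p x * p x ^+ n); first exact: trigpolyM.
by apply/funext => x; rewrite exprS.
Qed.

Lemma trigpoly_prod I (r : seq I) (F : I -> 'rV[R]_d -> R) :
  (forall i, trigpoly (F i)) -> trigpoly (fun x => \prod_(i <- r) F i x).
Proof.
move=> TF; elim: r => [|i r IH].
  rewrite (_ : (fun x => _) = fun=> 1); first exact: trigpoly_cst.
  by apply/funext => x; rewrite big_nil.
rewrite (_ : (fun x => _) = fun x => F i x * \prod_(i <- r) F i x).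
  exact: trigpolyM.
by apply/funext => x; rewrite big_cons.
Qed.

Definition coef f k : R := Int (fun x => f x * hartley k x).

Lemma Rint_coef f k : integrableR f -> integrableR (fun x => f x * hartley k x).
Proof. by move=> If; apply: Rint_mult => //; exact: torus_hartley. Qed.

Lemma coef0_trigpoly f p : integrableR f -> (forall k, coef f k = 0) -> trigpoly p ->
  Int (fun x => f x * p x) = 0.
Proof.
move=> If f0; elim=> [|c k q Tq IH].
  rewrite (_ : (fun x => _) = fun=> 0) ?Int_cst//.
  by apply/funext => x; rewrite mulr0.
rewrite (_ : (fun x => _) = fun x => c * (f x * hartley k x) + f x * q x); last first.
  by apply/funext => x; rewrite mulrDr mulrCA.
rewrite IntD ?IntZ ?IH ?addr0.
- by have := f0 k; rewrite /coef => ->; rewrite mulr0.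
- exact: Rint_coef.
- by apply: RintZ; exact: Rint_coef.
- by apply: Rint_mult => //; exact: trigpoly_torus.
Qed.

Lemma Int_dct (F : nat -> 'rV[R]_d -> R) f g :
  (forall n, measurable_fun setT (F n)) -> measurable_fun setT f ->
  (forall x, F^~ x @ \oo --> f x) -> integrableR g ->
  (forall n x, `|F n x| <= g x) -> (fun n => Int (F n)) @ \oo --> Int f.
Proof.
move=> mF mf Ff Ig Fg.
have [|||||_ _ H] := @dominated_convergence _ _ R mu setT measurableT
  (fun n x => (F n x)%:E) (EFin \o f) (EFin \o g).
- by move=> n; exact/measurable_EFinP.
- exact/measurable_EFinP.
- by apply: aeW => x _; apply: cvg_EFin; [exact: nearW|exact: Ff].
- exact: Ig.
- by apply: aeW => x n _ /=; rewrite lee_fin.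
have If : integrableR f.
  apply: (@Rint_le _ _ _ g) => // x.
  have cn : (fun n => `|F n x|) @ \oo --> `|f x| by apply: cvg_norm; exact: Ff.
  rewrite -(cvg_lim _ cn)//; apply: limr_le; first by apply/cvg_ex; exists `|f x|.
  exact: nearW.
rewrite /Int /Rintegral; apply: fine_cvg; rewrite fineK//.
exact: (integrable_fin_num measurableT If).
Qed.

Lemma bernoulli_ge (t : R) n : 0 <= t <= 1 -> 1 - n%:R * t <= (1 - t) ^+ n.
Proof.
move=> /andP[t0 t1]; elim: n => [|n IH]; first by rewrite mul0r subr0 expr0.
rewrite exprS -natr1 -subr_ge0.
have H : 0 <= (1 - t) * ((1 - t) ^+ n - (1 - n%:R * t)).
  by rewrite mulr_ge0 ?subr_ge0.
have N : 0 <= n%:R * t ^+ 2 by rewrite mulr_ge0 ?sqr_ge0.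
by move: H N; rewrite expr2; nra.
Qed.

Lemma bernoulli_le (t : R) n : 0 <= t <= 1 -> (1 - t) ^+ n * (1 + n%:R * t) <= 1.
Proof.
move=> /andP[t0 t1].
have B : 1 + n%:R * t <= (1 + t) ^+ n.
  elim: n => [|n IH]; first by rewrite mul0r addr0 expr0.
  rewrite exprS -natr1.
  have H : 0 <= (1 + t) * ((1 + t) ^+ n - (1 + n%:R * t)).
    by rewrite mulr_ge0 ?subr_ge0 ?addr_ge0.
  have N : 0 <= n%:R * t ^+ 2 by rewrite mulr_ge0 ?sqr_ge0.
  by move: H N; rewrite expr2; nra.
apply: (@le_trans _ _ ((1 - t) ^+ n * (1 + t) ^+ n)).
  by rewrite ler_wpM2l// exprn_ge0// subr_ge0.
by rewrite -exprMn exprn_ile1//; nra.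
Qed.

(* These polynomials tend to the indicator of y < 1/2, which turns trigonometric
   polynomials into indicators of boxes. *)
Definition step_poly (n : nat) (y : R) : R := (1 - y ^+ n.+1) ^+ (n.+1 * 2 ^ n.+1).

Lemma step_poly_bound n y : 0 <= y <= 1 -> 0 <= step_poly n y <= 1.
Proof.
move=> /andP[y0 y1].
have h : 0 <= 1 - y ^+ n.+1 <= 1.
  by rewrite subr_ge0 exprn_ile1//= lerBlDr lerDl exprn_ge0.
by rewrite /step_poly exprn_ge0 ?exprn_ile1 ?(andP h).1 ?(andP h).2.
Qed.

(** With t = y^(n+1), the exponent times t equals (n+1) (2y)^(n+1). For y >= 1/2 this is at least
    n+1, and (1 - t)^p <= 1 / (1 + p t) tends to 0; the factor n+1 settles the endpoint 1/2. For y <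
    1/2 it tends to 0, and Bernoulli's inequality gives the limit 1. *)
Lemma step_poly_cvg y : 0 <= y <= 1 ->
  (fun n => step_poly n y) @ \oo --> ((y < 2^-1)%R%:R : R).
Proof.
move=> /[dup] y01 /andP[y0 y1].
have t01 n : 0 <= y ^+ n.+1 <= 1 by rewrite exprn_ge0//= exprn_ile1.
case: ltP => hy /=; last first.
  have c0 : (fun n : nat => (n.+1%:R^-1 : R)) @ \oo --> (0 : R) by exact: cvg_harmonic.
  apply: (squeeze_cvgr _ (cvg_cst 0) c0); apply: nearW => n.
  rewrite (andP (step_poly_bound n y01)).1/=.
  have := bernoulli_le (n.+1 * 2 ^ n.+1) (t01 n); rewrite -/(step_poly n y) => B.
  rewrite -[leRHS]mul1r ler_pdivlMr//.
  apply: le_trans B; rewrite ler_wpM2l ?(andP (step_poly_bound n y01)).1//.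
  rewrite natrM natrX -mulrA -exprMn.
  have : 1 <= (2 * y) ^+ n.+1 by rewrite exprn_ege1//; lra.
  by rewrite -(ler_pM2l (_ : 0 < n.+1%:R :> R))// mulr1 => /le_trans; apply; lra.
(* In (2y)^(n+1) = w^(n+1) w^(n+1), one factor absorbs n+1, since (n+1) w^(n+1) <= 1 / (1 - w), and
   the other tends to 0. *)
pose w := Num.sqrt (2 * y).
have w0 : 0 <= w by exact: sqrtr_ge0.
have w2 : w ^+ 2 = 2 * y by rewrite sqr_sqrtr// mulr_ge0.
have w1 : w < 1 by rewrite -(@ltr_pXn2r _ 2)// ?nnegrE// expr1n w2; lra.
have c1 : (fun n => 1 - (1 - w)^-1 * w ^+ n.+1) @ \oo --> (1 : R).
  rewrite -[X in _ --> X]subr0 -(mulr0 (1 - w)^-1).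
  apply: cvgB; first exact: cvg_cst.
  apply: cvgMr; rewrite (cvg_shiftS (fun n => w ^+ n)).
  by apply: cvg_expr; rewrite ger0_norm.
have c2 : (fun _ : nat => 1 : R) @ \oo --> (1 : R) by exact: cvg_cst.
apply: (squeeze_cvgr _ c1 c2); apply: nearW => n.
rewrite (andP (step_poly_bound n y01)).2 andbT.
apply: le_trans (bernoulli_ge (n.+1 * 2 ^ n.+1) (t01 n)).
rewrite natrM natrX -mulrA -exprMn -w2 lerD2l lerN2 -exprM mulnC exprM expr2 mulrA.
rewrite ler_wpM2r ?exprn_ge0// -[leRHS]mul1r ler_pdivlMr ?subr_gt0//.
have := @bernoulli_le (1 - w) n.+1; rewrite subKr => B.
have {}B := B _; have : w ^+ n.+1 * (1 + n.+1%:R * (1 - w)) <= 1.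
  by apply: B; rewrite subr_ge0 ltW//= lerBlDr lerDl.
rewrite (_ : _ * (1 + _) = w ^+ n.+1 + n.+1%:R * w ^+ n.+1 * (1 - w)); last by ring.
by move/(le_trans _); apply; rewrite lerDr exprn_ge0.
Qed.

(** For 0 <= t < 1 and 0 < x_i < 1 this is below 1/2 exactly when x_i > t. A product of two sines of
    frequency 1/2 is 1-periodic, hence a trigonometric polynomial of frequency at most 1. *)
Definition arc (t : R) (i : 'I_d) x : R :=
  2^-1 - sin (pi * (x ord0 i - t)) * sin (pi * x ord0 i) / 2.

Lemma arc01 t i x : 0 <= arc t i x <= 1.
Proof.
have : `|sin (pi * (x ord0 i - t)) * sin (pi * x ord0 i)| <= 1.
  rewrite normrM mulr_ile1// ler_norml sin_geN1 sin_le1//.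
by rewrite ler_norml /arc => /andP[? ?]; apply/andP; split; lra.
Qed.

Lemma arc_lt t i x : 0 <= t < 1 -> 0 < x ord0 i < 1 ->
  (arc t i x < 2^-1) = (t < x ord0 i).
Proof.
move=> /andP[t0 t1] /andP[x0 x1]; have p0 := pi_gt0 R.
have s0 : 0 < sin (pi * x ord0 i).
  by apply: sin_gt0_pi; rewrite mulr_gt0//= -[ltRHS]mulr1 ltr_pM2l.
have E : (arc t i x < 2^-1) = (0 < sin (pi * (x ord0 i - t))).
  by rewrite /arc ltrBlDr ltrDl pmulr_lgt0 ?invr_gt0// pmulr_lgt0.
rewrite E; case: (ltP t (x ord0 i)) => h.
  apply: sin_gt0_pi; rewrite mulr_gt0 ?subr_gt0//= -[ltRHS]mulr1 ltr_pM2l//; lra.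
apply/negbTE; rewrite -leNgt -oppr_ge0 -sinN -mulrN opprB.
apply: sin_ge0_pi; apply/andP; split.
  by rewrite mulr_ge0// ?subr_ge0// ltW.
by rewrite -[leRHS]mulr1 ler_pM2l//; lra.
Qed.

Lemma trigpoly_arc t i : trigpoly (arc t i).
Proof.
pose e : freq := delta_mx ord0 i.
have pe x : phase e x = 2 * pi * x ord0 i.
  rewrite /phase (bigD1 i)//= mxE !eqxx mul1r big1 ?addr0// => j ji.
  by rewrite mxE (negbTE ji) andbF mul0r.
rewrite (_ : arc t i = fun x => (2^-1 - cos (pi * t) / 4) +
   ((cos (pi * t) + sin (pi * t)) / 8 * hartley e x +
    (cos (pi * t) - sin (pi * t)) / 8 * hartley (- e) x)).
  apply: trigpolyD; first exact: trigpoly_cst.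
  by apply: trigpolyD; exact: trigpoly_hartley.
apply/funext => x; rewrite /hartley phaseN cosN sinN pe /arc.
have -> : 2 * pi * x ord0 i = pi * x ord0 i + pi * x ord0 i by ring.
rewrite cosD sinD mulrBr sinB.
have := cos2Dsin2 (pi * x ord0 i); set c := cos (_ * x _ _); set s := sin (_ * x _ _).
set C := cos _; set S := sin _ => H.
have -> : c * c = 1 - s * s by rewrite -H; ring.
by field.
Qed.

Lemma Int_open_box_eq0 f (t : 'I_d -> R) : integrableR f ->
  (forall k, coef f k = 0) -> (forall i, 0 <= t i < 1) ->
  Int (fun x => f x * \1_[set x : 'rV[R]_d | forall i, t i < x ord0 i] x) = 0.
Proof.
move=> If f0 t01.
pose A := [set x | forall i, t i < x ord0 i] : set 'rV[R]_d.
have mA : measurable A.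
  apply: measurable_forall => i.
  rewrite (_ : (fun x => _) = coord_rV i @^-1` `]t i, +oo[).
    by rewrite -[X in measurable X]setTI; exact: measurable_coord_rV.
  by apply/seteqP; split=> x /=; rewrite in_itv/= andbT.
pose p n x := \prod_i step_poly n (arc (t i) i x).
pose l x := \prod_i ((arc (t i) i x < 2^-1)%R%:R : R).
have cp x : (fun n => p n x) @ \oo --> l x.
  rewrite /p /l; elim: (index_enum _) => [|i r IH].
    under eq_fun do rewrite big_nil.
    by rewrite big_nil; exact: cvg_cst.
  under eq_fun do rewrite big_cons.
  by rewrite big_cons; apply: cvgM => //; apply: step_poly_cvg; exact: arc01.
have tp n : trigpoly (p n).
  apply: trigpoly_prod => i; apply: trigpolyX.
  rewrite (_ : (fun x => _) = fun x => 1 + (-1) * arc (t i) i x ^+ n.+1).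
    by apply: trigpolyD; [exact: trigpoly_cst|apply: trigpolyZ; apply: trigpolyX; exact: trigpoly_arc].
  by apply/funext => x; rewrite mulN1r.
have p1 n x : `|p n x| <= 1.
  rewrite ger0_norm /p.
    by apply: prodr_ile1 => i _; exact: step_poly_bound (arc01 _ _ _).
  by apply: prodr_ge0 => i _; exact: (andP (step_poly_bound n (arc01 (t i) i x))).1.
have mf := Rint_measurable If.
have ml : measurable_fun setT l.
  apply: (measurable_fun_cvg (fun n => torus_measurable (trigpoly_torus (tp n)))).
  by move=> x _; exact: cp.
have lim0 : (fun n => Int (fun x => f x * p n x)) @ \oo --> Int (fun x => f x * l x).
  apply: (@Int_dct _ _ (fun x => `|f x|)).
  - by move=> n; apply: measurable_funM => //; exact: torus_measurable (trigpoly_torus (tp n)).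
  - exact: measurable_funM.
  - by move=> x; apply: cvgMr; exact: cp.
  - exact: Rint_abs.
  - by move=> n x; rewrite normrM ler_piMr.
have <- : Int (fun x => f x * l x) = Int (fun x => f x * \1_A x).
  apply: Int_ae_eq.
  - exact: measurable_funM.
  - by apply: measurable_funM => //; exact: measurable_indic.
  apply: filterS (@ae_open_cube R d) => x x01; congr (_ * _).
  rewrite indicE /l.
  rewrite (eq_bigr (fun i => (t i < x ord0 i)%R%:R)); last first.
    by move=> i _; rewrite arc_lt.
  have [/set_mem xA|xA] := boolP (x \in A).
    by rewrite big1// => i _; rewrite xA.
  have [i xi] : exists i, ~~ (t i < x ord0 i).
    apply/existsP; rewrite -negb_forall; apply: contra xA => /forallP xA.
    exact/mem_set.
  by rewrite (bigD1 i)//= (negbTE xi) mul0r.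
apply/esym/(cvg_unique _ _ lim0) => //.
rewrite (_ : (fun n => _) = fun=> 0); first exact: cvg_cst.
by apply/funext => n; exact: coef0_trigpoly.
Qed.

(** A pi-system. The thresholds range over all reals so that the whole sigma-algebra of R^d is
    generated, although the measure sees only the unit cube. *)
Definition quadrants : set (set 'rV[R]_d) :=
  [set A | exists t : 'I_d -> R, A = [set x : 'rV[R]_d | forall i, t i < x ord0 i]].

Lemma measurable_quadrants : @measurable _ 'rV[R]_d = <<s quadrants >>.
Proof.
apply/seteqP; split; last first.
  apply: smallest_sub; first exact: sigma_algebra_measurable.
  move=> _ [t ->]; apply: measurable_forall => i.
  rewrite (_ : (fun x => _) = coord_rV i @^-1` `]t i, +oo[).
    by rewrite -[X in measurable X]setTI; exact: measurable_coord_rV.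
  by apply/seteqP; split=> x /=; rewrite in_itv/= andbT.
move=> A mA.
have H : measurable_fun setT (id : g_sigma_algebraType quadrants -> 'rV[R]_d).
  apply: measurable_fun_rVP => i.
  apply: (measurability _ (measurable_realfun.RGenOInfty.measurableE R)).
  move=> _ [_ [a ->] <-]; rewrite setTI.
  rewrite (_ : _ @^-1` _ = \bigcup_(n : nat)
     [set x : 'rV[R]_d | forall j, (if j == i then a else - n%:R) < x ord0 j]).
    apply: bigcupT_measurable => n; apply: sub_sigma_algebra.
    by exists (fun j => if j == i then a else - n%:R).
  apply/seteqP; split=> x /=; rewrite in_itv/= andbT; last first.
    by move=> [n _ /(_ i)]; rewrite eqxx.
  move=> ax.
  have [n nx] : exists n : nat, forall j, `|x ord0 j| < n%:R.
    have [n /andP[_ nx]] : exists n : nat, 0 <= `|x| < n%:R.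
      by exists (Num.bound `|x|); rewrite normr_ge0 archi_boundP.
    by exists n => j; exact: le_lt_trans (coord_le_norm _ _) nx.
  exists n => // j; case: eqP => [->//|_].
  by have := nx j; rewrite ltr_norml => /andP[].
by have := H measurableT A mA; rewrite setTI.
Qed.

(** Up to null sets, negative thresholds may be raised to 0, and a threshold that is at least 1
    leaves nothing; this reduces to thresholds in [0, 1). *)
Lemma Int_quadrant_eq0 f (t : 'I_d -> R) : integrableR f ->
  (forall k, coef f k = 0) ->
  Int (fun x => f x * \1_[set x : 'rV[R]_d | forall i, t i < x ord0 i] x) = 0.
Proof.
move=> If f0; have mf := Rint_measurable If.
have mq s : measurable [set x : 'rV[R]_d | forall i, s i < x ord0 i].
  by rewrite measurable_quadrants; apply: sub_sigma_algebra; exists s.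
have mfq s : measurable_fun setT (fun x => f x * \1_[set x : 'rV[R]_d | forall i, s i < x ord0 i] x).
  by apply: measurable_funM => //; exact: measurable_indic.
have [t1|] := pselect (forall i, t i < 1).
  rewrite -(@Int_open_box_eq0 f (fun i => Num.max 0 (t i)))//; last first.
    by move=> i; rewrite le_max lexx/= gt_max ltr01 t1.
  apply: Int_ae_eq => //.
  apply: filterS (@ae_open_cube R d) => x x01; rewrite !indicE; congr (_ * (nat_of_bool _)%:R).
  apply/idP/idP => /set_mem /= H; apply/mem_set => i /=.
    by rewrite gt_max H (andP (x01 i)).1.
  by apply: le_lt_trans (H i); rewrite le_max lexx orbT.
move=> /existsNP[i /negP]; rewrite -leNgt => ti.
rewrite -[RHS](@Int_cst R d 0); apply: Int_ae_eq => //.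
apply: filterS (@ae_open_cube R d) => x x01; rewrite indicE memNset ?mulr0//= => /(_ i).
by move=> h; have /andP[_ x1] := x01 i; lra.
Qed.

(** Completeness of the Hartley system in L^1: the integral of f vanishes on quadrants by dominated
    convergence of trigonometric polynomials, then on all measurable sets by Dynkin's theorem. *)
Lemma coef_eq0_ae f : integrableR f -> (forall k, coef f k = 0) ->
  {ae mu, forall x, f x = 0}.
Proof.
move=> If f0; have mf := Rint_measurable If.
have mfi A : measurable A -> measurable_fun setT (fun x => f x * \1_A x).
  by move=> mA; apply: measurable_funM => //; exact: measurable_indic.
have Ifi A : measurable A -> integrableR (fun x => f x * \1_A x).
  move=> mA; apply: (@Rint_mulb _ _ f (\1_A : _ -> R) 1) => //.
  by move=> x; rewrite indicE; case: (_ \in _); rewrite ?normr1 ?normr0.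
have P A : measurable A -> Int (fun x => f x * \1_A x) = 0.
  rewrite measurable_quadrants => mA; move: A mA.
  apply: (dynkin_induction measurable_quadrants).
  - move=> _ _ [s ->] [t ->]; exists (fun i => Num.max (s i) (t i)).
    apply/seteqP; split=> x /=; first by move=> [h1 h2] i; rewrite gt_max h1 h2.
    by move=> H; split=> i; have := H i; rewrite gt_max => /andP[].
  - rewrite -[RHS](f0 0) /coef hartley0; congr Int; apply/funext => x.
    by rewrite indicT.
  - by move=> _ [t ->]; exact: Int_quadrant_eq0.
  - move=> A mA HA.
    rewrite (_ : (fun x => _) = fun x => f x - f x * \1_A x).
      rewrite IntB//; last exact: Ifi.
      rewrite HA subr0 -[RHS](f0 0) /coef hartley0; congr Int; apply/funext => x.
      by rewrite mulr1.
    apply/funext => x; rewrite !indicE in_setC; case: (x \in A) => /=.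
      by rewrite mulr0 mulr1 subrr.
    by rewrite mulr0 mulr1 subr0.
  - move=> F mF tF HF.
    have mU n : measurable (\big[setU/set0]_(i < n) F i).
      by apply: bigsetU_measurable => i _; exact: mF.
    have FU n : Int (fun x => f x * \1_(\big[setU/set0]_(i < n) F i) x) = 0.
      elim: n => [|n IH].
        rewrite (_ : (fun x => _) = fun=> 0) ?Int_cst//.
        by apply/funext => x; rewrite big_ord0 indic0 mulr0.
      rewrite (_ : (fun x => _) = fun x =>
          f x * \1_(\big[setU/set0]_(i < n) F i) x + f x * \1_(F n) x).
        by rewrite IntD ?IH ?HF ?addr0//; exact: Ifi.
      apply/funext => x; rewrite big_ord_recr/= -mulrDr; congr (_ * _).
      have D : (\big[setU/set0]_(i < n) F i) `&` F n = set0.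
        rewrite -bigcup_mkord setI_bigcupl bigcup0// => i /= ni.
        have /trivIsetP/(_ i n Logic.I Logic.I) := tF; apply.
        by rewrite (ltn_eqF ni).
      rewrite !indicE in_setU; have [xn|xn] := boolP (x \in F n).
        rewrite orbT memNset ?add0r// => xU.
        have : (\big[setU/set0]_(i < n) F i `&` F n) x by split=> //; exact: set_mem.
        by rewrite D.
      by rewrite orbF addr0.
    suff L : (fun n => Int (fun x => f x * \1_(\big[setU/set0]_(i < n) F i) x))
        @ \oo --> Int (fun x => f x * \1_(\bigcup_k F k) x).
      apply/esym/(cvg_unique _ _ L) => //.
      rewrite (_ : (fun n => _) = fun=> 0); first exact: cvg_cst.
      exact/funext.
    apply: (@Int_dct _ _ (fun x => `|f x|)).
    + by move=> n; exact: mfi.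
    + by apply: mfi; exact: bigcupT_measurable.
    + move=> x; apply: cvgMr.
      have [[k _ Fk]|nF] := pselect ((\bigcup_k F k) x).
        rewrite indicE mem_set; last by exists k.
        apply: cvg_near_cst; exists k.+1 => // n /= kn.
        rewrite indicE mem_set// -bigcup_mkord; by exists k.
      rewrite indicE memNset//; apply: cvg_near_cst; apply: nearW => n.
      rewrite indicE memNset// -bigcup_mkord => -[k _ Fk]; apply: nF; by exists k.
    + exact: Rint_abs.
    + move=> n x; rewrite normrM ler_piMr// indicE.
      by case: (_ \in _); rewrite ?normr1 ?normr0.
have := @integral_ae_eq _ _ _ mu setT measurableT (fun=> 0%E) (EFin \o f) If
  (measurable_cst _).
have Q E : E `<=` setT -> measurable E ->
    (\int[mu]_(x in E) (EFin \o f) x = \int[mu]_(x in E) 0)%E.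
  move=> _ mE; rewrite integral0 integral_mkcond.
  have := P E mE; rewrite /Int /Rintegral => H.
  rewrite (eq_integral (fun x => (f x * \1_E x)%:E)); last first.
    move=> x _; rewrite /patch indicE; case: (x \in E); rewrite ?mulr1 ?mulr0//.
  rewrite -[LHS]fineK ?H//; apply: integrable_fin_num => //.
  exact: Ifi.
move=> /(_ Q) [N [mN N0 HN]]; exists N; split=> // x /= fx; apply: HN => /= H.
by apply: fx; have [] := H I.
Qed.

Lemma coef_inj f g : torus_continuous f -> torus_continuous g ->
  (forall k, coef f k = coef g k) -> f = g.
Proof.
move=> tf tg fg.
have tfg := torusB tf tg.
have H : forall x, f x - g x = 0.
  apply: (@torus_ae_eq0 _ _ (fun x => f x - g x)) => //.
  apply: coef_eq0_ae; first exact: torus_Rint.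
  move=> k; rewrite /coef.
  rewrite (_ : (fun x => _) = fun x => f x * hartley k x - g x * hartley k x).
    by rewrite IntB ?[X in X - _]fg ?subrr//; apply: Rint_coef; exact: torus_Rint.
  by apply/funext => x; rewrite mulrBl.
by apply/funext => x; apply/eqP; rewrite -subr_eq0 H.
Qed.

End Hartley.

(** * Finite sums over the lattice *)

Section FiniteSums.
Context {R : realType}.

Lemma sum_subset_le (T : eqType) (A B : seq T) (F : T -> R) :
  (forall x, 0 <= F x) -> uniq A -> {subset A <= B} ->
  \sum_(x <- A) F x <= \sum_(x <- B) F x.
Proof.
move=> F0; elim: A B => [|x A IH] B; first by rewrite big_nil sumr_ge0.
move=> /= /andP[xA uA] sAB.
have xB : x \in B by apply: sAB; rewrite mem_head.
rewrite big_cons (perm_big _ (perm_to_rem xB))/= big_cons lerD2l; apply: IH => // y yA.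
have yB : y \in B by apply: sAB; rewrite inE yA orbT.
move: (perm_mem (perm_to_rem xB) y); rewrite yB inE => /esym/orP[/eqP yx|//].
by move: xA; rewrite -yx yA.
Qed.

Lemma cauchy_schwarz_sum (T : Type) (A : seq T) (a b : T -> R) :
  (\sum_(x <- A) a x * b x) ^+ 2 <=
  (\sum_(x <- A) a x ^+ 2) * (\sum_(x <- A) b x ^+ 2).
Proof.
set Q := \sum_(x <- A) a x * b x; set P := \sum_(x <- A) a x ^+ 2.
set S := \sum_(x <- A) b x ^+ 2.
have P0 : 0 <= P by apply: sumr_ge0 => x _; exact: sqr_ge0.
(* The nonnegative sum of squares behind the inequality. It carries an extra factor P, so the case P
   = 0 is treated apart. *)
have E : \sum_(x <- A) (P * b x - Q * a x) ^+ 2 = P * (P * S - Q ^+ 2).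
  rewrite (eq_bigr (fun x => P ^+ 2 * b x ^+ 2 + ((- 2 * P * Q) * (a x * b x) +
    Q ^+ 2 * a x ^+ 2))); last by move=> x _; ring.
  rewrite !big_split/= -!mulr_sumr -/P -/Q -/S; ring.
have H : 0 <= P * (P * S - Q ^+ 2) by rewrite -E; apply: sumr_ge0 => x _; exact: sqr_ge0.
move: P0; rewrite le_eqVlt => /predU1P[P0|P0]; last first.
  by rewrite -subr_ge0 -(pmulr_rge0 _ P0).
suff -> : Q = 0 by rewrite -P0 mul0r expr0n.
have : P = 0 by []; rewrite /P /Q; elim: (A) => [|x B IH].
  by rewrite !big_nil.
rewrite !big_cons => /eqP; rewrite paddr_eq0 ?sqr_ge0 ?sumr_ge0//; last first.
  by move=> y _; exact: sqr_ge0.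
by rewrite sqrf_eq0 => /andP[/eqP-> /eqP/IH->]; rewrite mul0r addr0.
Qed.

(** Telescoping of (y + 1)^-(p+1) <= y^-p - (y + 1)^-p for y >= 1, which amounts to y^p (y + 2) <=
    (y + 1)^(p+1); a discrete substitute for comparison with an integral. *)
Lemma sum_inv_pow_le (p n : nat) (b : R) : (0 < p)%N -> 1 <= b ->
  \sum_(i < n) (b + i.+1%:R) ^- p.+1 <= b ^- p.
Proof.
move=> p0 b1.
have key (y : R) : 1 <= y -> (y + 1) ^- p.+1 + (y + 1) ^- p <= y ^- p.
  move=> y1; have y0 : 0 < y by lra.
  have y10 : 0 < y + 1 by lra.
  have K : y ^+ p * (y + 2) <= (y + 1) ^+ p.+1.
    elim: p p0 => [//|[|q] IH] _; first by rewrite expr1 expr2; lra.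
    rewrite exprS -mulrA (exprS (y + 1)).
    apply: (@le_trans _ _ (y * (y + 1) ^+ q.+2)).
      by rewrite ler_wpM2l ?IH// ltW.
    by apply: ler_wpM2r; [apply: exprn_ge0; lra|lra].
  have -> : (y + 1) ^- p.+1 + (y + 1) ^- p = (y + 2) / (y + 1) ^+ p.+1.
    by rewrite exprS; field; rewrite ?expf_neq0 ?gt_eqF.
  by rewrite ler_pdivrMr ?exprn_gt0// mulrC ler_pdivlMr ?exprn_gt0// mulrC.
elim: n b b1 => [|n IH] b b1; first by rewrite big_ord0 invr_ge0 exprn_ge0//; lra.
rewrite big_ord_recl/=; apply: le_trans (key b b1); rewrite lerD2l.
apply: le_trans (IH (b + 1) _); last by lra.
apply: ler_sum => i _; rewrite (_ : b + 1 + i.+1%:R = b + i.+2%:R)//.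
by rewrite -[i.+2]add1n natrD; ring.
Qed.

Definition int_range (n : nat) : seq int :=
  [seq Posz i | i <- iota 0 n] ++ [seq Negz i | i <- iota 0 n].

Lemma mem_int_range n (z : int) : (`|z| < n)%N -> z \in int_range n.
Proof.
rewrite mem_cat; case: z => i /= zn.
  by rewrite map_f// mem_iota.
by rewrite orbC map_f// mem_iota add0n; exact: leq_trans zn.
Qed.

Lemma sum_int_range (p n : nat) (b : R) : (0 < p)%N -> 1 <= b ->
  \sum_(z <- int_range n) (b + `|z%:~R|) ^- p.+1 <= 4 * b ^- p.
Proof.
move=> p0 b1; have b0 : 0 < b by lra.
have Ep : b ^- p.+1 <= b ^- p.
  by rewrite lef_pV2 ?posrE ?exprn_gt0// ler_weXn2l.
have iota_ord : iota 0 n = index_iota 0 n by rewrite /index_iota subn0.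
have H m : \sum_(i < m) (b + i%:R) ^- p.+1 <= 2 * b ^- p.
  case: m => [|m]; first by rewrite big_ord0 mulr_ge0// invr_ge0 exprn_ge0// ltW.
  rewrite big_ord_recl addr0 mulr2n mulrDl mul1r lerD//.
  exact: le_trans (sum_inv_pow_le m p0 b1).
have -> : 4 * b ^- p = 2 * b ^- p + 2 * b ^- p by rewrite -mulrDl; congr (_ * _); ring.
rewrite big_cat/= !big_map lerD//.
  by rewrite iota_ord big_mkord; apply: le_trans (H n); apply: ler_sum => i _; rewrite ger0_norm.
apply: (@le_trans _ _ (b ^- p)).
  rewrite iota_ord big_mkord.
  apply: le_trans (sum_inv_pow_le n p0 b1); apply: ler_sum => i _.
  by rewrite NegzE mulrNz normrN ger0_norm.
by rewrite ler_peMl ?invr_ge0 ?exprn_ge0 ?ltW//; lra.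
Qed.

Fixpoint int_box (n d : nat) : seq (seq int) :=
  if d is d'.+1 then [seq z :: l | l <- int_box n d', z <- int_range n] else [:: [::]].

Lemma mem_int_box n (l : seq int) : all (fun z => (`|z| < n)%N) l ->
  l \in int_box n (size l).
Proof.
elim: l => [//|z l IH] /= /andP[zn ln].
by apply/allpairsP; exists (l, z); rewrite /= IH// mem_int_range.
Qed.

(** Summing over one coordinate, with the others frozen in the offset, costs a factor 4 and lowers
    the exponent by one; the spare power leaves 1 / a. The offset a is general because the induction
    changes it. *)
Lemma sum_int_box n d (a : R) : 1 <= a ->
  \sum_(l <- int_box n d) (a + \sum_(z <- l) `|z%:~R|) ^- d.+1 <= 4 ^+ d / a.
Proof.
elim: d a => [|d IH] a a1.
  by rewrite big_seq1 big_nil addr0 expr0 div1r expr1.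
rewrite /= big_allpairs_dep/=.
apply: (@le_trans _ _ (\sum_(l <- int_box n d) 4 * (a + \sum_(z <- l) `|z%:~R|) ^- d.+1)).
  apply: ler_sum => l _.
  have s0 : 0 <= \sum_(z <- l) `|z%:~R : R| by apply: sumr_ge0.
  apply: le_trans (@sum_int_range d.+1 n (a + \sum_(z <- l) `|z%:~R|) isT _); last by lra.
  by apply: ler_sum => z _; rewrite big_cons [X in a + X]addrC addrA.
rewrite -mulr_sumr exprS -mulrA ler_wpM2l//; exact: IH.
Qed.

End FiniteSums.

(** * Weighted norms of Hartley coefficients *)

Section Weights.
Context {R : realType} {d : nat}.
Local Notation freq := 'rV[int]_d.
Implicit Types (k : freq) (A : seq freq).

Definition wt k : R := 1 + \sum_i `|(k ord0 i)%:~R|.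

Lemma wt_ge1 k : 1 <= wt k.
Proof. by rewrite /wt lerDl sumr_ge0. Qed.

Lemma wt_gt0 k : 0 < wt k.
Proof. exact: lt_le_trans (wt_ge1 k). Qed.

Lemma wtN k : wt (- k) = wt k.
Proof. by congr (1 + _); apply: eq_bigr => i _; rewrite mxE mulrNz normrN. Qed.

Lemma wt_coord k i : `|(k ord0 i)%:~R| <= wt k :> R.
Proof.
rewrite /wt (bigD1 i)//= addrCA lerDl addr_ge0// sumr_ge0//.
Qed.

(** Frequencies are encoded as lists of integers, so that the sum can be taken one coordinate at a
    time; any finite set of them fits in a box, and the bound does not depend on the size of the
    box. *)
Lemma sum_wt_le A : uniq A -> \sum_(k <- A) wt k ^- d.+1 <= 4 ^+ d :> R.
Proof.
move=> uA.
pose enc k := [seq k ord0 i | i <- enum 'I_d].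
have enc_inj : injective enc.
  move=> k l /eq_in_map H; apply/rowP => i; apply: H; exact: mem_enum.
have sz k : size (enc k) = d by rewrite size_map size_enum_ord.
have [n Hn] : exists n, forall k, k \in A -> enc k \in int_box n d.
  pose M k := \max_(i < d) `|k ord0 i|%N.
  exists (\max_(k <- A) M k).+1 => k kA; rewrite -[X in int_box _ X](sz k).
  apply: mem_int_box; apply/allP => z /mapP[i _ ->]; rewrite ltnS.
  apply: (@leq_trans (M k)); last exact: (@leq_bigmax_seq _ A xpredT M k kA isT).
  exact: (@leq_bigmax _ (fun i => `|k ord0 i|%N) i).
have E k : wt k ^- d.+1 = (1 + \sum_(z <- enc k) `|z%:~R|) ^- d.+1 :> R.
  by rewrite /enc big_map big_enum.
rewrite (eq_bigr _ (fun k _ => E k)) -(big_map enc xpredT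
  (fun l => (1 + \sum_(z <- l) `|z%:~R : R|) ^- d.+1)).
have := sum_int_box n d (lexx (1 : R)); rewrite divr1; apply: le_trans.
apply: sum_subset_le.
- move=> l; rewrite invr_ge0 exprn_ge0// addr_ge0// sumr_ge0//.
- by rewrite map_inj_uniq.
- by move=> l /mapP[k kA ->]; exact: Hn.
Qed.

(* The square of the W^{s,2} norm, read on the Hartley coefficients c, is <= C;
   finite sums avoid summability issues. *)
Definition Wle (s : nat) (c : freq -> R) (C : R) : Prop :=
  forall A, uniq A -> \sum_(k <- A) wt k ^+ (2 * s) * c k ^+ 2 <= C.

Lemma Wle_ge0 s c C : Wle s c C -> 0 <= C.
Proof. by move=> /(_ [::] isT); rewrite big_nil. Qed.

Lemma Wle_leq s r c C : (r <= s)%N -> Wle s c C -> Wle r c C.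
Proof.
move=> rs H A uA; apply: le_trans (H A uA); apply: ler_sum => k _.
by rewrite ler_wpM2r ?sqr_ge0// ler_weXn2l ?wt_ge1// leq_mul2l.
Qed.

Lemma Wle_le s c C C' : C <= C' -> Wle s c C -> Wle s c C'.
Proof. by move=> CC' H A uA; exact: le_trans (H A uA) CC'. Qed.

Lemma WleD s c c' C C' : Wle s c C -> Wle s c' C' ->
  Wle s (fun k => c k + c' k) (2 * C + 2 * C').
Proof.
move=> H H' A uA.
apply: (@le_trans _ _ (\sum_(k <- A) (2 * (wt k ^+ (2 * s) * c k ^+ 2) +
   2 * (wt k ^+ (2 * s) * c' k ^+ 2)))).
  apply: ler_sum => k _.
  have w0 : 0 <= wt k ^+ (2 * s) by rewrite exprn_ge0// ltW// wt_gt0.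
  have := mulr_ge0 w0 (sqr_ge0 (c k - c' k)); rewrite !expr2; nra.
by rewrite big_split/= -!mulr_sumr lerD// ler_wpM2l// ?H// H'.
Qed.

Lemma WleZ s c C (a : R) : Wle s c C -> Wle s (fun k => a * c k) (a ^+ 2 * C).
Proof.
move=> H A uA; apply: le_trans (ler_wpM2l (sqr_ge0 a) (H A uA)).
by rewrite mulr_sumr; apply: ler_sum => k _; rewrite exprMn mulrCA.
Qed.

(** An initial segment of the enumeration of the countable type of frequencies. The segments are
    nested and exhaust all frequencies; their order is unrelated to the size of k. *)
Definition modes (n : nat) : seq freq := pmap pickle_inv (iota 0 n).

Lemma mem_modes n k : (k \in modes n) = (pickle k < n)%N.
Proof.
rewrite /modes mem_pmap; apply/mapP/idP => [[i]|kn].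
  rewrite mem_iota add0n => /= iin E.
  by have := pickle_invK (T := freq) i; rewrite -E /= => ->.
by exists (pickle k); rewrite ?mem_iota ?pickleK_inv.
Qed.

Lemma modes_uniq n : uniq (modes n).
Proof. by apply: (pmap_uniq (@pickle_invK _)); exact: iota_uniq. Qed.

Lemma modes_cat n m : (n <= m)%N -> exists B, [/\ modes m = modes n ++ B, uniq B &
  forall k, k \in B -> k \notin modes n].
Proof.
move=> nm; exists (pmap pickle_inv (iota n (m - n))).
have E : modes m = modes n ++ pmap pickle_inv (iota n (m - n)).
  by rewrite /modes -pmap_cat -iotaD subnKC.
split=> //; first by apply: (pmap_uniq (@pickle_invK _)); exact: iota_uniq.
move=> k kB; have := modes_uniq m; rewrite E cat_uniq => /and3P[_ /hasPn H _].
exact: H.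
Qed.

Lemma modes_sub A : exists n, {subset A <= modes n}.
Proof.
exists (\max_(k <- A) pickle k).+1 => k kA; rewrite mem_modes ltnS.
exact: (@leq_bigmax_seq _ A xpredT _ k kA isT).
Qed.

(** A finite set whose sum is within eps of the supremum of all finite sums leaves at most eps to
    any disjoint set. *)
Lemma sum_tail_small (a : freq -> R) C : (forall k, 0 <= a k) ->
  (forall A, uniq A -> \sum_(k <- A) a k <= C) ->
  forall eps : R, 0 < eps -> exists n0, forall A, uniq A ->
    (forall k, k \in A -> k \notin modes n0) -> \sum_(k <- A) a k <= eps.
Proof.
move=> a0 aC eps e0.
pose S := [set r : R | exists2 A, uniq A & r = \sum_(k <- A) a k].
have S0 : has_sup S.
  split; first by exists 0; exists [::]; rewrite ?big_nil.
  by exists C => r [A uA ->]; exact: aC.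
have [r [A0 uA0 ->] Hr] := sup_adherent e0 S0.
have [n sub] := modes_sub A0; exists n => A uA HA.
have : \sum_(k <- A0 ++ A) a k <= sup S.
  apply: (ub_le_sup S0.2); exists (A0 ++ A) => //.
  rewrite cat_uniq uA0 uA andbT /=; apply/hasPn => k kA; apply/negP => kA0.
  by have := HA k kA; rewrite sub.
by rewrite big_cat/=; lra.
Qed.

(** Cauchy-Schwarz between wt^s |c| and wt^-(s - j): the squares of the latter are summable because
    2 (s - j) >= d + 1, with sum at most 4^d. This is the Sobolev embedding read on coefficients. *)
Lemma weighted_sum_le s j c C A : (d.+1 + 2 * j <= 2 * s)%N -> Wle s c C -> uniq A ->
  \sum_(k <- A) wt k ^+ j * `|c k| <= Num.sqrt C * 2 ^+ d.
Proof.
move=> dsj H uA; have C0 := Wle_ge0 H.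
have js : (j <= s)%N by lia.
have E k : wt k ^+ j * `|c k| = (wt k ^+ s * `|c k|) * (wt k ^- (s - j)).
  have -> : wt k ^+ s = wt k ^+ j * wt k ^+ (s - j) by rewrite -exprD subnKC.
  by rewrite [X in X / _]mulrAC mulfK ?expf_neq0// gt_eqF ?wt_gt0.
rewrite (eq_bigr _ (fun k _ => E k)) -(@ler_pXn2r _ 2)// ?nnegrE; last 2 first.
- apply: sumr_ge0 => k _; rewrite -E mulr_ge0// exprn_ge0//.
  exact: ltW (wt_gt0 k).
- by rewrite mulr_ge0 ?sqrtr_ge0// exprn_ge0.
apply: le_trans (cauchy_schwarz_sum _ _ _) _.
rewrite exprMn sqr_sqrtr// -exprM mulnC exprM; apply: ler_pM.
- by apply: sumr_ge0 => k _; exact: sqr_ge0.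
- by apply: sumr_ge0 => k _; exact: sqr_ge0.
- apply: le_trans (H A uA); apply: ler_sum => k _.
  by rewrite exprMn -exprM mulnC real_normK ?num_real.
- rewrite (_ : 2 ^+ 2 = 4); last by rewrite expr2; ring.
  apply: le_trans (sum_wt_le uA); apply: ler_sum => k _.
  rewrite -exprVn -exprM exprVn lef_pV2 ?posrE ?exprn_gt0 ?wt_gt0//.
  by rewrite ler_weXn2l ?wt_ge1//; lia.
Qed.

End Weights.

(** * Synthesis of functions from coefficients and Sobolev embedding *)

Section Synthesis.
Context {R : realType} {d : nat}.
Local Notation freq := 'rV[int]_d.
Local Notation ei i := (delta_mx ord0 i).
Implicit Types (k : freq) (A : seq freq) (c : freq -> R).

Definition hsign (n : nat) k : freq := if odd n then - k else k.

(** The real Fourier multiplier of [partials s]. Each derivative of a Hartley function negates its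
    frequency, hence the alternating sign [hsign]. *)
Fixpoint hcoef (s : seq 'I_d) k : R :=
  if s is i :: s' then hcoef s' k * (2 * pi * (hsign (size s') k ord0 i)%:~R) else 1.

Lemma partials_hartley s k :
  partials s (hartley k) = fun x => hcoef s k * hartley (hsign (size s) k) x :> R.
Proof.
elim: s => [|i s IH]; first by apply/funext => x; rewrite mul1r.
rewrite /= IH; apply/funext => x.
have D := is_derive_hartley (hsign (size s) k) x (ei i).
have -> : partial i (fun x => hcoef s k * hartley (hsign (size s) k) x) x =
    hcoef s k * 'D_(ei i) (hartley (hsign (size s) k)) x.
  by rewrite /partial (deriveZ (hcoef s k)).
have [_ ->] := D; rewrite phase_ei mulrA; congr (_ * hartley _ x).
by rewrite /hsign /=; case: (odd _) => /=; rewrite ?opprK.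
Qed.

Lemma hcoef_le s k : `|hcoef s k| <= (2 * pi) ^+ size s * wt k ^+ size s.
Proof.
have p0 := pi_gt0 R.
elim: s => [|i s IH] /=; first by rewrite mul1r normr1.
have E : (2 * pi) ^+ (size s).+1 * wt k ^+ (size s).+1 =
   ((2 * pi) ^+ size s * wt k ^+ size s) * (2 * pi * wt k) :> R.
  by rewrite !exprS; ring.
rewrite E normrM ler_pM// normrM ger0_norm; last by rewrite mulr_ge0// ltW.
apply: ler_wpM2l; first by rewrite mulr_ge0// ltW.
apply: (le_trans (wt_coord _ i)).
by rewrite /hsign; case: (odd _); rewrite ?wtN.
Qed.

Lemma partials_hartley_le s k (x : 'rV[R]_d) :
  `|partials s (hartley k) x| <= 2 * (2 * pi) ^+ size s * wt k ^+ size s.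
Proof.
rewrite partials_hartley normrM -[leRHS]mulrA [leRHS]mulrC.
by rewrite ler_pM// ?hartley_bound// hcoef_le.
Qed.

Definition psum A c : 'rV[R]_d -> R := fun x => \sum_(k <- A) c k * hartley k x.

Lemma Ck_psum j A c : Ck j (psum A c).
Proof. by apply: Ck_sum => k; apply: CkZ; exact: Ck_hartley. Qed.

Lemma zperiodic_psum A c : zperiodic (psum A c).
Proof. by move=> x i; apply: eq_bigr => k _; rewrite zperiodic_hartley. Qed.

Lemma torus_psum A c : torus_continuous (psum A c).
Proof. by apply: (@Ck_torus _ _ 0%N); [exact: zperiodic_psum|exact: Ck_psum]. Qed.

Lemma partial_lincomb T (A : seq T) (c : T -> R) (f : T -> 'rV[R]_d -> R) i :
  (forall t, Ck 1 (f t)) ->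
  partial i (fun x => \sum_(t <- A) c t * f t x) =
  fun x => \sum_(t <- A) c t * partial i (f t) x.
Proof.
move=> Cf; have df t x : derivable (fun x => c t * f t x) x (ei i).
  by apply: derivableZ; exact: Ck_derivable (Cf t).
elim: A => [|t A IH].
  apply/funext => x; rewrite big_nil /partial (_ : (fun x => _) = cst 0).
    by rewrite derive_cst.
  by apply/funext => y; rewrite big_nil.
rewrite (_ : (fun x => _) = fun x => c t * f t x + \sum_(t <- A) c t * f t x); last first.
  by apply/funext => x; rewrite big_cons.
rewrite partialD.
- rewrite IH; apply/funext => x; rewrite big_cons; congr (_ + _).
  exact: (deriveZ (c t) (Ck_derivable (Cf t))).
- exact: df.
- move=> x; apply: (@Ck_derivable _ _ 0%N); apply: Ck_sum => t0; exact: CkZ.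
Qed.

Lemma partials_psum s A c :
  partials s (psum A c) = fun x => \sum_(k <- A) c k * partials s (hartley k) x.
Proof.
elim: s => [//|i s IH] /=; rewrite IH partial_lincomb//.
move=> k; apply: Ck_partials; exact: Ck_hartley.
Qed.

Lemma coef_psum A c k : uniq A -> coef (psum A c) k = if k \in A then c k else 0.
Proof.
move=> uA; rewrite /coef.
rewrite (_ : (fun x => _) = fun x => \sum_(l <- A) c l * (hartley l x * hartley k x)).
  rewrite Int_sum; last first.
    move=> l; apply: RintZ; apply: torus_Rint.
    by apply: torusM; exact: torus_hartley.
  rewrite (eq_bigr (fun l => c l * (l == k)%:R)); last first.
    move=> l _; rewrite IntZ ?Int_hartleyM//; apply: torus_Rint.
    by apply: torusM; exact: torus_hartley.
  case: ifP => kA; last first.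
    rewrite big_seq big1// => l lA; case: eqP => [lk|_]; last by rewrite mulr0.
    by rewrite -lk lA in kA.
  rewrite (bigD1_seq k)//= eqxx mulr1 big1 ?addr0// => l lk.
  by rewrite (negbTE lk) mulr0.
by apply/funext => x; rewrite /psum mulr_suml; apply: eq_bigr => l _; rewrite mulrA.
Qed.

Lemma sum_psum_le (lam : freq -> R) A A' c : (forall k, 0 <= lam k) -> uniq A -> uniq A' ->
  \sum_(k <- A') lam k * coef (psum A c) k ^+ 2 <= \sum_(k <- A) lam k * c k ^+ 2.
Proof.
move=> lam0 uA uA'.
rewrite (eq_bigr (fun k => if k \in A then lam k * c k ^+ 2 else 0)); last first.
  by move=> k _; rewrite coef_psum//; case: ifP => // _; rewrite expr0n mulr0.
rewrite -big_mkcond -big_filter; apply: sum_subset_le.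
- by move=> k; rewrite mulr_ge0 ?sqr_ge0.
- exact: filter_uniq.
- by move=> k; rewrite mem_filter => /andP[].
Qed.

Lemma ucvg_cauchy X (u : nat -> X -> R) :
  (forall eps : R, 0 < eps -> exists n0, forall n m x, (n0 <= n)%N -> (n <= m)%N ->
     `|u m x - u n x| <= eps) ->
  ucvg \oo u (fun x => lim (u n x @[n --> \oo])).
Proof.
move=> H.
have C x : cvg (u n x @[n --> \oo]).
  apply: cauchy_cvg; apply: cauchy_exP => eps e0.
  have e2 : 0 < eps / 2 by rewrite divr_gt0.
  have [n0 Hn] := H _ e2; exists (u n0 x); exists n0 => // m /= nm.
  rewrite -ball_normE /ball_/= distrC (le_lt_trans (Hn n0 m x (leqnn _) nm))//; lra.
move=> eps e0; have [n0 Hn] := H _ e0; exists n0 => // n /= nn x.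
rewrite distrC.
have L : (fun m => `|u m x - u n x|) @ \oo --> `|lim (u n x @[n --> \oo]) - u n x|.
  by apply: cvg_norm; apply: cvgB => //; exact: cvg_cst.
rewrite -(cvg_lim _ L)//; apply: limr_le; first by apply/cvg_ex; eexists; exact: L.
by exists n => // m /= nm; exact: Hn.
Qed.

Lemma ucvg_Int T (F : set_system T) {FF : ProperFilter F}
    (u : T -> 'rV[R]_d -> R) (f : 'rV[R]_d -> R) :
  (forall t, integrableR (u t)) -> integrableR f -> ucvg F u f ->
  (fun t => Int (u t)) @ F --> Int f.
Proof.
move=> Iu If uf; apply/cvgrPdist_le => eps e0.
apply: filterS (uf eps e0) => t H.
rewrite distrC -IntB//; apply: Int_norm_le => //; exact: RintB.
Qed.

Lemma ucvg_mulr T X (F : set_system T) {FF : Filter F} (u : T -> X -> R) (f g : X -> R) (M : R) :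
  (forall x, `|g x| <= M) -> ucvg F u f ->
  ucvg F (fun t x => u t x * g x) (fun x => f x * g x).
Proof.
move=> gM uf eps e0.
have M1 : 0 < `|M| + 1 by rewrite ltr_wpDl.
have e1 : 0 < eps / (`|M| + 1) by rewrite divr_gt0.
apply: filterS (uf _ e1) => t H x; rewrite -mulrBl normrM.
apply: (@le_trans _ _ (eps / (`|M| + 1) * (`|M| + 1))); last by rewrite divfK// gt_eqF.
by rewrite ler_pM// (le_trans (gM x))// (le_trans (ler_norm M))// lerDl.
Qed.

(** The weighted absolute sums converge, so the derivatives of the partial sums up to order j are
    uniformly Cauchy, and their limits are derivatives of the limit. The bound, linear in the square
    root of [C], later turns small coefficients into uniform smallness. *)
Lemma synthesis s j c C : (d.+1 + 2 * j <= 2 * s)%N -> Wle s c C ->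
  exists f, [/\ zperiodic f, Ck j f, (forall k, coef f k = c k),
    (forall t, (size t <= j)%N ->
      ucvg \oo (fun n => partials t (psum (modes n) c)) (partials t f)) &
    (forall t x, (size t <= j)%N ->
      `|partials t f x| <= 2 * (2 * pi) ^+ size t * (Num.sqrt C * 2 ^+ d))].
Proof.
move=> dsj H.
pose G t x : R := lim (partials t (psum (modes n) c) x @[n --> \oo]).
have UG t : (size t <= j)%N -> ucvg \oo (fun n => partials t (psum (modes n) c)) (G t).
  move=> tj; apply: ucvg_cauchy => eps e0.
  pose M : R := 2 * (2 * pi) ^+ size t.
  have M0 : 0 < M by rewrite mulr_gt0// exprn_gt0// mulr_gt0// pi_gt0.
  have dst : (d.+1 + 2 * size t <= 2 * s)%N by lia.
  have a0 k : 0 <= wt k ^+ size t * `|c k|.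
    by rewrite mulr_ge0// exprn_ge0// ltW// wt_gt0.
  have e1 : 0 < eps / M by rewrite divr_gt0.
  have [n0 Hn] := sum_tail_small a0 (fun A uA => weighted_sum_le dst H uA) e1.
  exists n0 => n m x nn nm.
  have [B [-> uB HB]] := @modes_cat d n m nm.
  rewrite !partials_psum big_cat/= addrAC subrr add0r.
  have HB0 : \sum_(k <- B) wt k ^+ size t * `|c k| <= eps / M.
    apply: Hn => // k kB; have := HB k kB; rewrite !mem_modes -!leqNgt.
    exact: leq_trans.
  apply: (@le_trans _ _ (M * \sum_(k <- B) wt k ^+ size t * `|c k|)).
    rewrite mulr_sumr (le_trans (ler_norm_sum _ _ _))//; apply: ler_sum => k _.
    rewrite normrM mulrC mulrA ler_wpM2r//; exact: partials_hartley_le.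
  by rewrite mulrC -ler_pdivlMr.
have K := @Ck_ucvg R nat \oo (@eventually_filter) d j (fun n => psum (modes n) c) G
  (fun n l => Ck_psum l (modes n) c) UG.
have E t : (size t <= j)%N -> G t = partials t (G [::]).
  by move=> tj; have [] := K t 0%N; rewrite ?addn0.
have per : zperiodic (G [::]).
  by move=> x i; rewrite /G /=; under eq_fun do rewrite zperiodic_psum.
have CG : Ck j (G [::]) by have [] := K [::] j.
have tG := Ck_torus per CG.
exists (G [::]); split => //.
- move=> k.
  have [M HM] := periodic_bounded (torus_hartley (R := R) k).
  have L : (fun n => coef (psum (modes n) c) k) @ \oo --> coef (G [::]) k.
    apply: (ucvg_Int (fun n => Rint_coef k (torus_Rint (torus_psum (modes n) c)))
      (Rint_coef k (torus_Rint tG))).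
    exact: (ucvg_mulr HM (UG [::] isT)).
  rewrite -(cvg_lim _ L)//; apply: lim_near_cst => //.
  exists (pickle k).+1 => // n /= kn.
  have := coef_psum c k (modes_uniq n); rewrite mem_modes kn; exact.
- by move=> t tj; rewrite -E//; exact: UG.
- move=> t x tj; rewrite -E//.
  have L : (fun n => `|partials t (psum (modes n) c) x|) @ \oo --> `|G t x|.
    by apply: cvg_norm; exact: (ucvg_cvg (UG t tj)).
  rewrite -(cvg_lim _ L)//; apply: limr_le; first by apply/cvg_ex; eexists; exact: L.
  apply: nearW => n; rewrite partials_psum (le_trans (ler_norm_sum _ _ _))//.
  have dst : (d.+1 + 2 * size t <= 2 * s)%N by lia.
  have W := weighted_sum_le dst H (modes_uniq n).
  apply: (@le_trans _ _ (2 * (2 * pi) ^+ size t *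
     \sum_(k <- modes n) wt k ^+ size t * `|c k|)); last first.
    by rewrite ler_wpM2l// mulr_ge0// exprn_ge0// mulr_ge0// pi_ge0.
  rewrite mulr_sumr; apply: ler_sum => k _.
  rewrite normrM mulrC mulrA ler_wpM2r//; exact: partials_hartley_le.
Qed.

(** A continuous function is determined by its coefficients, hence equals the function synthesized
    from them. *)
Lemma sobolev_embedding s j f C : (d.+1 + 2 * j <= 2 * s)%N ->
  torus_continuous f -> Wle s (coef f) C ->
  [/\ Ck j f, (forall t, (size t <= j)%N ->
      ucvg \oo (fun n => partials t (psum (modes n) (coef f))) (partials t f)) &
    (forall t x, (size t <= j)%N ->
      `|partials t f x| <= 2 * (2 * pi) ^+ size t * (Num.sqrt C * 2 ^+ d))].
Proof.
move=> dsj tf H; have [g [pg Cg gf Ug Bg]] := synthesis dsj H.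
have E : f = g by apply: coef_inj => //; exact: Ck_torus Cg.
by rewrite -E in Cg Ug Bg; split.
Qed.

End Synthesis.

(** * Sobolev spaces *)

Section SquareIntegrable.
Context {R : realType} {d : nat}.
Local Notation mu := (@cube_measure R d).
Implicit Types f g v : 'rV[R]_d -> R.

Lemma Lfun2P f : measurable_fun setT f -> integrableR (fun x => f x ^+ 2) ->
  f \in Lfun mu 2%:E.
Proof.
move=> mf If; rewrite inE; apply/andP; split; rewrite inE//=.
rewrite /finite_norm unlock poweR_lty//.
have I : integrableR (fun x => `|f x| `^ 2).
  by under [X in integrableR X]eq_fun do rewrite powR_mulrn// real_normK ?num_real//.
by have := integrable_lty measurableT I.
Qed.

Lemma bounded_Lfun f (C r : R) : 1 <= r -> measurable_fun setT f ->
  (forall x, `|f x| <= C) -> f \in Lfun mu r%:E.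
Proof.
move=> r1 mf fC; rewrite inE; apply/andP; split; rewrite inE//=.
rewrite /finite_norm unlock poweR_lty//.
have C0 : 0 <= C by exact: le_trans (fC 0).
have I : integrableR (fun x => `|f x| `^ r).
  apply: (@Rint_bounded _ _ _ (C `^ r)).
    by apply: (measurableT_comp (measurable_powR _)); exact: measurableT_comp.
  move=> x; rewrite ger0_norm ?powR_ge0// ge0_ler_powR ?nnegrE//.
  exact: le_trans r1.
by have := integrable_lty measurableT I.
Qed.

Lemma Lfun2_measurable f : f \in Lfun mu 2%:E -> measurable_fun setT f.
Proof. by rewrite inE => /andP[+ _]; rewrite inE. Qed.

Lemma Rint_sqr_mul f g : measurable_fun setT f -> measurable_fun setT g ->
  integrableR (fun x => f x ^+ 2) -> integrableR (fun x => g x ^+ 2) ->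
  integrableR (fun x => f x * g x).
Proof.
move=> mf mg If Ig; apply: (@Rint_le _ _ _ (fun x => f x ^+ 2 + g x ^+ 2)).
- exact: measurable_funM.
- move=> x; rewrite ler_norml; have := sqr_ge0 (f x - g x).
  have := sqr_ge0 (f x + g x); rewrite !expr2 => *; apply/andP; split; nra.
- exact: RintD.
Qed.

Lemma Rint_sqr f : measurable_fun setT f -> integrableR (fun x => f x ^+ 2) ->
  integrableR f.
Proof.
move=> mf If; apply: (@Rint_le _ _ _ (fun x => 1 + f x ^+ 2)) => //.
  move=> x; rewrite ler_norml; have := sqr_ge0 (f x - 1).
  have := sqr_ge0 (f x + 1); rewrite !expr2 => *; apply/andP; split; nra.
by apply: RintD => //; exact: Rint_cst.
Qed.

Lemma Rint_sqrD f g : measurable_fun setT f -> measurable_fun setT g ->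
  integrableR (fun x => f x ^+ 2) -> integrableR (fun x => g x ^+ 2) ->
  integrableR (fun x => (f x + g x) ^+ 2).
Proof.
move=> mf mg If Ig.
rewrite (_ : (fun x => _) = fun x => f x ^+ 2 + (2 * (f x * g x) + g x ^+ 2)).
  by apply: RintD => //; apply: RintD => //; apply: RintZ; exact: Rint_sqr_mul.
by apply/funext => x; rewrite !expr2; ring.
Qed.

Lemma Rint_sqrN f : integrableR (fun x => f x ^+ 2) ->
  integrableR (fun x => (- f x) ^+ 2).
Proof. by move=> If; under [X in integrableR X]eq_fun do rewrite sqrrN. Qed.

Lemma Int_fatou (F : nat -> 'rV[R]_d -> R) f C n0 :
  (forall n, integrableR (F n)) -> measurable_fun setT f ->
  (forall n x, 0 <= F n x) -> (forall x, 0 <= f x) ->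
  {ae mu, forall x, (F n x) @[n --> \oo] --> f x} ->
  (forall n, (n0 <= n)%N -> Int (F n) <= C) -> integrableR f /\ Int f <= C.
Proof.
move=> IF mf F0 f0 Ff FC.
have mF n : measurable_fun setT (fun x => (F n x)%:E).
  by apply/measurable_EFinP; exact: Rint_measurable (IF n).
pose G n x := (F (n + n0)%N x)%:E.
have B : (\int[mu]_x (f x)%:E <= C%:E)%E.
  apply: (@le_trans _ _ (\int[mu]_x limn_einf (G^~ x))%E).
    apply: ae_ge0_le_integral => //.
    - by move=> x _; rewrite lee_fin.
    - exact/measurable_EFinP.
    - move=> x _; rewrite limn_einf_lim; apply: lime_ge; first exact: is_cvg_einfs.
      by apply: nearW => n; apply: le_ereal_inf_tmp => _ [m _ <-]; rewrite lee_fin.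
    - rewrite /limn_einf; apply: measurableT_comp => //.
      apply: (measurable_fun_limn_esup (f := fun n x => (- G n x)%E)) => n.
      by apply: measurableT_comp => //; exact: mF.
    - apply: filterS Ff => x Fx _.
      have : (G n x @[n --> \oo] --> (f x)%:E)%E.
        apply: cvg_EFin; first exact: nearW.
        by rewrite (cvg_shiftn n0 (fun n => F n x)).
      by move=> /cvg_limn_einf_sup[-> _].
  apply: (@le_trans _ _ (limn_einf (fun n => \int[mu]_x G n x))%E).
    apply: fatou => //; first by move=> n; exact: mF.
    by move=> n x _; rewrite lee_fin.
  rewrite limn_einf_lim; apply: lime_le; first exact: is_cvg_einfs.
  apply: nearW => n; apply: (@le_trans _ _ (\int[mu]_x G n x)%E).
    by apply: ereal_inf_lbound; exists n => //=.
  rewrite -(fineK (integrable_fin_num measurableT (IF (n + n0)%N))) lee_fin.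
  by apply: FC; rewrite leq_addl.
have If : integrableR f.
  apply/integrableP; split; first exact/measurable_EFinP.
  apply: le_lt_trans (ltry C); apply: le_trans B; rewrite le_eqVlt; apply/orP; left.
  by apply/eqP/eq_integral => x _ /=; rewrite ger0_norm.
split=> //; rewrite -lee_fin fineK//; exact: integrable_fin_num.
Qed.

(** Riesz-Fischer: along a subsequence with L^2 increments at most 2^-j the increments are summable
    in L^1, so it converges almost everywhere; Fatou's lemma then gives L^2 convergence of the whole
    sequence. *)
Lemma L2_complete (p : nat -> 'rV[R]_d -> R) :
  (forall n, torus_continuous (p n)) ->
  (forall eps : R, 0 < eps -> exists n0, forall n m, (n0 <= n)%N -> (n0 <= m)%N ->
     Int (fun x => (p n x - p m x) ^+ 2) <= eps) ->
  exists v, [/\ zperiodic v, measurable_fun setT v,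
    integrableR (fun x => v x ^+ 2) &
    forall eps : R, 0 < eps -> exists n0, forall n, (n0 <= n)%N ->
     Int (fun x => (v x - p n x) ^+ 2) <= eps].
Proof.
move=> tp Cp.
have tsq n m : integrableR (fun x => (p n x - p m x) ^+ 2).
  by apply: torus_Rint; under [X in torus_continuous X]eq_fun do rewrite expr2;
    apply: torusM; apply: torusB.
have N (j : nat) : {n0 | forall n m, (n0 <= n)%N -> (n0 <= m)%N ->
     Int (fun x => (p n x - p m x) ^+ 2) <= 4 ^- j}.
  by apply: cid; apply: Cp; rewrite invr_gt0 exprn_gt0.
pose nn j := ((\max_(i < j.+1) sval (N i)) + j)%N.
have nnP j n m : (nn j <= n)%N -> (nn j <= m)%N ->
    Int (fun x => (p n x - p m x) ^+ 2) <= 4 ^- j.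
  have h : (sval (N j) <= nn j)%N.
    rewrite /nn (leq_trans _ (leq_addr _ _))//.
    exact: (@leq_bigmax _ (fun i : 'I_j.+1 => sval (N i)) ord_max).
  by move=> nj mj; apply: (svalP (N j)); exact: leq_trans h _.
have nnS j : (nn j <= nn j.+1)%N.
  rewrite /nn leq_add// [X in (_ <= X)%N]big_ord_recr/= leq_max; apply/orP; left.
  by apply: eq_leq; apply: eq_bigr.
have jnn j : (j <= nn j)%N by rewrite leq_addl.
pose a j := p (nn j).
have ta j : torus_continuous (a j) by exact: tp.
pose D j x := `|a j.+1 x - a j x|.
have ID j : integrableR (D j) by apply: Rint_abs; apply: torus_Rint; exact: torusB.
have ID_le j : Int (D j) <= 2 ^- j.
  have t0 : 0 < 2 ^+ j :> R by rewrite exprn_gt0.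
  (* The pointwise inequality 2 |y| <= 2^j y^2 + 2^-j replaces Cauchy-Schwarz for integrals. *)
  apply: (@le_trans _ _ (Int (fun x => 2^-1 * (2 ^+ j * (a j.+1 x - a j x) ^+ 2 + 2 ^- j)))).
    apply: Int_le => // [|x].
      by apply: RintZ; apply: RintD; [apply: RintZ; exact: tsq|exact: Rint_cst].
    rewrite /D; set y := a _ _ - _; rewrite -[y ^+ 2]real_normK ?num_real//.
    set z := `|y|; have := sqr_ge0 (2 ^+ j * z - 1).
    rewrite -(pmulr_rge0 _ (_ : 0 < 2 ^- j :> R)) ?invr_gt0// => H.
    have : 2 ^- j * (2 ^+ j * z - 1) ^+ 2 = 2 ^+ j * z ^+ 2 - 2 * z + 2 ^- j.
      by field; rewrite gt_eqF.
    by move=> E; rewrite E in H; lra.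
  rewrite IntZ; last by apply: RintD; [apply: RintZ; exact: tsq|exact: Rint_cst].
  rewrite IntD; [|by apply: RintZ; exact: tsq|exact: Rint_cst].
  rewrite Int_cst IntZ; last exact: tsq.
  have := nnP j (nn j.+1) (nn j) (nnS j) (leqnn _).
  rewrite -(ler_pM2l t0) => H.
  have E : 2 ^+ j * 4 ^- j = 2 ^- j :> R.
    rewrite (_ : 4 = 2 * 2); last by ring.
    by rewrite exprMn; field; rewrite gt_eqF.
  by rewrite E in H; rewrite ler_pdivrMl//; lra.
pose T x := (\sum_(0 <= j <oo) (D j x)%:E)%E.
have mD j : measurable_fun setT (fun x => (D j x)%:E).
  by apply/measurable_EFinP; exact: Rint_measurable (ID j).
have D0 j x : (0 <= (D j x)%:E)%E by rewrite lee_fin normr_ge0.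
have IT : mu.-integrable setT T.
  apply/integrableP; split; first exact: ge0_emeasurable_sum.
  under eq_integral => x _ do rewrite gee0_abs ?nneseries_ge0//.
  rewrite integral_nneseries//; apply: le_lt_trans (ltry 2).
  apply: lime_le; first by apply: is_cvg_nneseries => n _ _; exact: integral_ge0.
  apply: nearW => n; rewrite big_mkord.
  apply: (@le_trans _ _ (\sum_(j < n) (2 ^- j)%:E)%E).
    apply: lee_sum => j _; rewrite -(fineK (integrable_fin_num measurableT (ID j))) lee_fin.
    exact: ID_le.
  rewrite sumEFin lee_fin.
  have -> : \sum_(j < n) (2 ^- j : R) = 2 - 2 * 2 ^- n.
    elim: (n) => [|m IH]; first by rewrite big_ord0 expr0 invr1; ring.
    rewrite big_ord_recr/= IH exprS; field; by rewrite expf_neq0.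
  by rewrite lerBlDr lerDl mulr_ge0// invr_ge0 exprn_ge0.
(* The upper limit is defined at every point, measurable and periodic, whereas the limit itself is
   only known to exist almost everywhere. *)
pose v x := fine (limn_esup (fun j => (a j x)%:E)).
have av : {ae mu, forall x, a j x @[j --> \oo] --> v x}.
  apply: filterS (integrable_ae measurableT IT) => x /(_ Logic.I) Tx.
  have cs : cvgn (series (fun j => a j.+1 x - a j x)).
    apply: normed_cvg.
    rewrite (_ : [normed series _] = fun n => \sum_(0 <= j < n) D j x)//.
    apply: nondecreasing_is_cvgn.
      by apply/nondecreasing_seqP => n; rewrite big_nat_recr//= lerDl normr_ge0.
    exists (fine (T x)) => _ [n _ <-]; rewrite -lee_fin fineK//.
    rewrite -sumEFin; apply: nneseries_lim_ge => j _ _; exact: D0.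
  have : cvgn (a^~ x).
    have -> : a^~ x = fun n => a 0%N x + series (fun j => a j.+1 x - a j x) n.
      apply/funext => n; rewrite seriesEnat/= telescope_sumr//; ring.
    by apply: is_cvgD => //; exact: is_cvg_cst.
  move=> /cvg_ex[l al]; rewrite /v.
  have : ((a j x)%:E @[j --> \oo] --> l%:E)%E by apply: cvg_EFin => //; exact: nearW.
  by move=> /cvg_limn_einf_sup[_ ->].
have mv : measurable_fun setT v.
  apply: (measurableT_comp (fine_measurable measurableT)).
  apply: measurable_fun_limn_esup => n.
  by apply/measurable_EFinP; exact: torus_measurable.
have pv : zperiodic v.
  move=> x i; rewrite /v; congr (fine (limn_esup _)); apply/funext => j.
  by rewrite (ta j).1.
have F n n0 (eps : R) : (forall m, (n0 <= m)%N -> Int (fun x => (p m x - p n x) ^+ 2) <= eps) ->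
    integrableR (fun x => (v x - p n x) ^+ 2) /\ Int (fun x => (v x - p n x) ^+ 2) <= eps.
  move=> H; apply: (@Int_fatou (fun j x => (a j x - p n x) ^+ 2) _ _ n0).
  - by move=> j; exact: tsq.
  - apply: measurable_funX; apply: measurable_funB => //; exact: torus_measurable.
  - by move=> j x; exact: sqr_ge0.
  - by move=> x; exact: sqr_ge0.
  - apply: filterS av => x ax.
    under eq_fun do rewrite expr2; rewrite expr2.
    by apply: cvgM; apply: cvgB => //; exact: cvg_cst.
  - by move=> j n0j; apply: H; exact: leq_trans n0j (jnn j).
exists v; split=> //.
  have [n0 Hn] := Cp 1 ltr01.
  have [If _] := F n0 n0 1 (fun m h => Hn m n0 h (leqnn _)).
  rewrite (_ : (fun x => _) = fun x => ((v x - p n0 x) + p n0 x) ^+ 2).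
    apply: Rint_sqrD => //; first by apply: measurable_funB => //; exact: torus_measurable.
      exact: torus_measurable.
    by apply: torus_Rint; under [X in torus_continuous X]eq_fun do rewrite expr2;
      apply: torusM.
  by apply/funext => x; rewrite subrK.
move=> eps e0; have [n0 Hn] := Cp eps e0; exists n0 => n n0n.
by have [] := F n n0 eps (fun m h => Hn m n h n0n).
Qed.

End SquareIntegrable.

Section Sobolev.
Context {R : realType} {d : nat}.
Local Notation mu := (@cube_measure R d).
Local Notation freq := 'rV[int]_d.
Implicit Types (f g v w : 'rV[R]_d -> R) (s t : seq 'I_d) (k : freq).

Lemma torus_smooth_Ck f j : torus_smooth f -> Ck j f.
Proof. by move=> [_ sf]; exact: smooth_open_Ck. Qed.

Lemma torus_smooth_continuous f : torus_smooth f -> torus_continuous f.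
Proof. by move=> sf; split; [exact: sf.1|exact: (Ck_continuous (torus_smooth_Ck 0%N sf))]. Qed.

Lemma Ck_torus_smooth f : zperiodic f -> (forall j, Ck j f) -> torus_smooth f.
Proof. by move=> pf Cf; split=> //; exact: Ck_smooth_open. Qed.

Lemma weak_integrable s f v : weak_partials s f v -> integrableR v.
Proof. by move=> [_ /Lfun1_integrable]. Qed.

Lemma weak_partialsP s f v phi : weak_partials s f v -> torus_smooth phi ->
  Int (fun x => f x * partials s phi x) = (-1) ^+ size s * Int (fun x => v x * phi x).
Proof. by move=> [_ _]; exact. Qed.

(** Hartley functions are admissible test functions, so the difference of two weak derivatives has
    only zero coefficients. *)
Lemma weak_partials_unique s f v w : weak_partials s f v -> weak_partials s f w ->
  {ae mu, forall x, v x = w x}.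
Proof.
move=> wv ww; have Iv := weak_integrable wv; have Iw := weak_integrable ww.
have : {ae mu, forall x, v x - w x = 0}.
  apply: coef_eq0_ae; first exact: RintB.
  move=> k; rewrite /coef.
  rewrite (_ : (fun x => _) = fun x => v x * hartley k x - w x * hartley k x); last first.
    by apply/funext => x; rewrite mulrBl.
  rewrite IntB; [|exact: Rint_coef..].
  have := weak_partialsP wv (smooth_hartley k).
  rewrite (weak_partialsP ww (smooth_hartley k)) => /(mulfI _) -> //.
    by rewrite subrr.
  by rewrite signr_eq0.
by apply: filterS => x /eqP; rewrite subr_eq0 => /eqP.
Qed.

Lemma weak_partials_wpartials s f v : weak_partials s f v ->
  weak_partials s f (wpartials s f).
Proof. by move=> wv; exact: (xgetPex (cst 0) (ex_intro _ v wv)). Qed.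

Lemma torus_Lfun f (r : R) : 1 <= r -> torus_continuous f -> f \in Lfun mu r%:E.
Proof.
move=> r1 tf; have [C fC] := periodic_bounded tf.
by apply: (@bounded_Lfun _ _ _ C) => //; exact: torus_measurable.
Qed.

Lemma Ck_weak_partials s f : zperiodic f -> Ck (size s) f ->
  weak_partials s f (partials (rev s) f).
Proof.
move=> pf Cf.
have tp : torus_continuous (partials (rev s) f).
  by apply: torus_partials Cf _; rewrite ?size_rev.
split; first exact: tp.1.
  exact: torus_Lfun.
move=> phi sphi; apply: torus_by_parts_seq => //; first exact: sphi.1.
exact: torus_smooth_Ck.
Qed.

Lemma Ck_sobolev j (r : R) f : 1 <= r -> zperiodic f -> Ck j f -> sobolev j r f.
Proof.
move=> r1 pf Cf; split=> //; first exact/torus_Lfun/Ck_torus/Cf.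
move=> s sj; exists (partials (rev s) f).
  by apply: Ck_weak_partials => //; exact: Ck_leq Cf.
by apply: torus_Lfun => //; apply: torus_partials Cf _; rewrite ?size_rev.
Qed.

Lemma wpartials_sqr j s f : sobolev j 2 f -> (size s <= j)%N ->
  weak_partials s f (wpartials s f) /\
  integrableR (fun x => wpartials s f x ^+ 2).
Proof.
move=> [_ _ H] sj; have [v wv v2] := H s sj.
have ww := weak_partials_wpartials wv; split=> //.
have mw := Rint_measurable (weak_integrable ww).
have mv := Lfun2_measurable v2.
have I2 := Lfun2_integrable_sqr v2.
have E : {ae mu, forall x, wpartials s f x ^+ 2 = v x ^+ 2}.
  by apply: filterS (weak_partials_unique ww wv) => x ->.
apply/integrableP; split; first by apply/measurable_EFinP; exact: measurable_funX.
move/integrableP : I2 => [_]; apply: le_lt_trans; rewrite le_eqVlt; apply/orP; left.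
apply/eqP; apply: ae_eq_integral => //.
- by apply: measurableT_comp => //; apply/measurable_EFinP; exact: measurable_funX.
- by apply: measurableT_comp => //; apply/measurable_EFinP; exact: measurable_funX.
- by apply: filterS E => x Ex _ /=; rewrite Ex.
Qed.

Lemma Int_wpartials_sqr s f v : weak_partials s f v ->
  Int (fun x => wpartials s f x ^+ 2) = Int (fun x => v x ^+ 2).
Proof.
move=> wv; have ww := weak_partials_wpartials wv; apply: Int_ae_eq.
- by apply: measurable_funX; exact: Rint_measurable (weak_integrable ww).
- by apply: measurable_funX; exact: Rint_measurable (weak_integrable wv).
- by apply: filterS (weak_partials_unique ww wv) => x ->.
Qed.

Lemma Int_sqr_psum A (c : freq -> R) : uniq A ->
  Int (fun x => psum A c x ^+ 2) = \sum_(k <- A) c k ^+ 2.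
Proof.
move=> uA.
rewrite (_ : (fun x => _) = fun x => \sum_(k <- A) c k * (psum A c x * hartley k x)).
  rewrite Int_sum; last by move=> k; apply: RintZ; apply: Rint_coef; exact/torus_Rint/torus_psum.
  rewrite big_seq [RHS]big_seq; apply: eq_bigr => k kA.
  rewrite IntZ; last by apply: Rint_coef; exact/torus_Rint/torus_psum.
  by have := coef_psum c k uA; rewrite /coef kA => ->.
by apply/funext => x; rewrite expr2 [X in _ * X]/psum mulr_sumr; apply: eq_bigr => k _; rewrite mulrCA.
Qed.

Lemma bessel f A : measurable_fun setT f -> integrableR (fun x => f x ^+ 2) -> uniq A ->
  \sum_(k <- A) coef f k ^+ 2 <= Int (fun x => f x ^+ 2).
Proof.
move=> mf I2 uA; have If := Rint_sqr mf I2.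
set p := psum A (coef f); have tp : torus_continuous p := torus_psum _ _.
have fp : Int (fun x => f x * p x) = \sum_(k <- A) coef f k ^+ 2.
  rewrite (_ : (fun x => _) = fun x => \sum_(k <- A) coef f k * (f x * hartley k x)).
    rewrite Int_sum; last by move=> k; apply: RintZ; exact: Rint_coef.
    by apply: eq_bigr => k _; rewrite IntZ//; exact: Rint_coef.
  by apply/funext => x; rewrite /p /psum mulr_sumr; apply: eq_bigr => k _; rewrite mulrCA.
have Ifp : integrableR (fun x => f x * p x) by exact: Rint_mult.
have Ip2 : integrableR (fun x => p x ^+ 2).
  by apply: torus_Rint; under [X in torus_continuous X]eq_fun do rewrite expr2; apply: torusM.
have : 0 <= Int (fun x => (f x - p x) ^+ 2) by apply: Int_ge0 => x; exact: sqr_ge0.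
rewrite (_ : (fun x => (f x - p x) ^+ 2) = fun x => f x ^+ 2 + ((-2) * (f x * p x) + p x ^+ 2)).
  rewrite IntD//; last by apply: RintD => //; exact: RintZ.
  rewrite IntD//; last exact: RintZ.
  rewrite IntZ// fp Int_sqr_psum//; lra.
by apply/funext => x; rewrite !expr2; ring.
Qed.

Lemma coef_weak s f v k : integrableR f -> weak_partials s f v ->
  coef v k ^+ 2 = hcoef s k ^+ 2 * coef f (hsign (size s) k) ^+ 2.
Proof.
move=> If wv; have := weak_partialsP wv (smooth_hartley k).
rewrite partials_hartley -/(coef v k) => /(congr1 (fun y => y ^+ 2)).
rewrite (_ : ((-1) ^+ size s * coef v k) ^+ 2 = coef v k ^+ 2); last first.
  by rewrite exprMn sqrr_sign mul1r.
move=> <-.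
rewrite -exprMn; congr (_ ^+ 2); rewrite /coef -IntZ; last exact: Rint_coef.
by congr Int; apply/funext => x; rewrite mulrCA.
Qed.

Lemma hcoef_nseq j (i : 'I_d) k :
  hcoef (nseq j i) k ^+ 2 = (2 * pi) ^+ (2 * j) * (k ord0 i)%:~R ^+ (2 * j) :> R.
Proof.
elim: j => [|j IH]; first by rewrite muln0 !expr0 expr1n mulr1.
have E2 (y : R) : y ^+ (2 + 2 * j) = y ^+ 2 * y ^+ (2 * j) by rewrite exprD.
rewrite /= exprMn IH size_nseq mulnS !E2 (exprMn _ (2 * pi)).
have -> : ((hsign j k ord0 i)%:~R : R) ^+ 2 = (k ord0 i)%:~R ^+ 2.
  by rewrite /hsign; case: (odd j); rewrite ?mxE ?mulrNz ?sqrrN.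
by ring.
Qed.

Lemma wt_pow_le j k :
  wt k ^+ (2 * j) <= (d.+1)%:R ^+ (2 * j) * (1 + \sum_i (k ord0 i)%:~R ^+ (2 * j)) :> R.
Proof.
(* M is the maximum of 1 and the |k_i|: then wt k <= (d + 1) M, while M^(2j) is 1 or one of the
   terms of the sum. *)
have [M [M1 kM MS]] : exists M : R, [/\ 1 <= M, forall i, `|(k ord0 i)%:~R| <= M &
    M ^+ (2 * j) <= 1 + \sum_i (k ord0 i)%:~R ^+ (2 * j)].
  have S0 : 0 <= \sum_i ((k ord0 i)%:~R : R) ^+ (2 * j).
    by apply: sumr_ge0 => i _; rewrite exprM exprn_ge0// sqr_ge0.
  have [H|/existsNP[i0 /negP]] := pselect (forall i, `|(k ord0 i)%:~R : R| <= 1).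
    by exists 1; split=> //; rewrite expr1n lerDl.
  rewrite -ltNge => ki0.
  have [i _ Hi] := @arg_maxP _ _ _ i0 xpredT (fun i => `|(k ord0 i)%:~R : R|) isT.
  exists `|(k ord0 i)%:~R|; split.
  - by apply: ltW; apply: lt_le_trans ki0 _; exact: Hi.
  - by move=> l; exact: Hi.
  - rewrite exprM real_normK ?num_real// -exprM (bigD1 i)//= addrCA lerDl.
    by rewrite addr_ge0// sumr_ge0// => l _; rewrite exprM exprn_ge0// sqr_ge0.
apply: (@le_trans _ _ ((d.+1)%:R ^+ (2 * j) * M ^+ (2 * j))); last first.
  by rewrite ler_wpM2l// exprn_ge0.
rewrite -exprMn lerXn2r ?nnegrE ?mulr_ge0//; first exact: le_trans (wt_ge1 k).
  exact: le_trans M1.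
rewrite /wt -natr1 mulrDl mul1r addrC lerD//.
rewrite (le_trans (ler_sum _ (fun i _ => kM i)))// sumr_const card_ord.
by rewrite mulr_natl.
Qed.

(** By [wt_pow_le], f and its pure derivatives of order j along the axes suffice. Bessel's
    inequality for these d + 1 functions accounts for one power of d + 1 and the comparison of
    weights for the other 2j. *)
Lemma sobolev_coef j f : sobolev j 2 f ->
  Wle j (coef f) ((d.+1)%:R ^+ (2 * j).+1 * sobolev2_norm j f ^+ 2).
Proof.
move=> sf; have [pf f2 _] := sf.
have mf := Lfun2_measurable f2; have If2 := Lfun2_integrable_sqr f2.
have If := Rint_sqr mf If2.
set N2 := sobolev2_norm j f ^+ 2.
have N2E : N2 = \sum_(l < j.+1) \sum_(s : l.-tuple 'I_d) Int (fun x => wpartials s f x ^+ 2).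
  rewrite /N2 /sobolev2_norm sqr_sqrtr//.
  by apply: sumr_ge0 => l _; apply: sumr_ge0 => s _; apply: Int_ge0 => x; exact: sqr_ge0.
have HN s : (size s <= j)%N -> Int (fun x => wpartials s f x ^+ 2) <= N2.
  move=> sj; rewrite N2E (bigD1 (Ordinal (sj : (size s < j.+1)%N)))//=.
  rewrite (bigD1 (in_tuple s))//= -addrA lerDl addr_ge0//.
    by apply: sumr_ge0 => t _; apply: Int_ge0 => x; exact: sqr_ge0.
  by apply: sumr_ge0 => l _; apply: sumr_ge0 => t _; apply: Int_ge0 => x; exact: sqr_ge0.
have B s A : (size s <= j)%N -> uniq A ->
    \sum_(k <- A) hcoef s k ^+ 2 * coef f (hsign (size s) k) ^+ 2 <= N2.
  move=> sj uA; have [ws w2] := wpartials_sqr sf sj.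
  apply: le_trans (HN s sj); apply: le_trans (bessel _ w2 uA).
    by apply: ler_sum => k _; rewrite (coef_weak _ If ws).
  exact: Rint_measurable (weak_integrable ws).
move=> A uA.
have hinj l : injective (@hsign d l).
  by move=> k k'; rewrite /hsign; case: (odd l) => // /oppr_inj.
have hK l : involutive (@hsign d l).
  by move=> k; rewrite /hsign; case: (odd l); rewrite ?opprK.
have Bi i : \sum_(k <- A) ((k ord0 i)%:~R : R) ^+ (2 * j) * coef f k ^+ 2 <= N2.
  have uA' : uniq [seq hsign j k | k <- A] by rewrite map_inj_uniq.
  have := B (nseq j i) _ _ uA'; rewrite size_nseq => /(_ (leqnn _)).
  apply: le_trans; rewrite big_map; apply: ler_sum => k _.
  rewrite hK hcoef_nseq ler_wpM2r ?sqr_ge0//.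
  have -> : ((hsign j k ord0 i)%:~R : R) ^+ (2 * j) = (k ord0 i)%:~R ^+ (2 * j).
    by rewrite !exprM /hsign; case: (odd j); rewrite ?mxE ?mulrNz ?sqrrN.
  rewrite ler_peMl ?exprn_ege1//; first by rewrite exprM exprn_ge0// sqr_ge0.
  by have := pi_ge2 R; lra.
have B0 : \sum_(k <- A) coef f k ^+ 2 <= N2.
  have := B [::] A isT uA; apply: le_trans; apply: ler_sum => k _.
  by rewrite /= expr1n mul1r.
apply: (@le_trans _ _ (\sum_(k <- A) (d.+1)%:R ^+ (2 * j) *
    (coef f k ^+ 2 + \sum_i ((k ord0 i)%:~R : R) ^+ (2 * j) * coef f k ^+ 2))).
  apply: ler_sum => k _; rewrite -mulr_suml -[X in X + _]mul1r -mulrDl mulrA.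
  by rewrite ler_wpM2r ?sqr_ge0// wt_pow_le.
rewrite -mulr_sumr exprSr -mulrA ler_wpM2l ?exprn_ge0// big_split/= exchange_big/=.
rewrite -natr1 mulrDl mul1r addrC lerD//.
rewrite (le_trans (ler_sum _ (fun i _ => Bi i)))// sumr_const card_ord.
by rewrite mulr_natl.
Qed.

Lemma Ck_Wle j f : zperiodic f -> Ck j f -> exists C, Wle j (coef f) C.
Proof.
move=> pf Cf; eexists; apply: sobolev_coef; apply: Ck_sobolev => //.
by rewrite ler1n.
Qed.

(** Integrates |f| <= f^2 / (2 eps) + eps / 2 in place of Cauchy-Schwarz. *)
Lemma Int_norm_small f (eps : R) : measurable_fun setT f ->
  integrableR (fun x => f x ^+ 2) -> 0 < eps ->
  Int (fun x => f x ^+ 2) <= eps ^+ 2 -> Int (fun x => `|f x|) <= eps.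
Proof.
move=> mf If e0 H.
apply: (@le_trans _ _ (Int (fun x => (2 * eps)^-1 * f x ^+ 2 + eps / 2))).
  apply: Int_le.
  - exact/Rint_abs/Rint_sqr.
  - by apply: RintD; [exact: RintZ|exact: Rint_cst].
  - move=> x; rewrite -[f x ^+ 2]real_normK ?num_real//; set z := `|f x|.
    have z2 := sqr_ge0 (z - eps).
    have e20 : 0 < (2 * eps)^-1 by rewrite invr_gt0 mulr_gt0.
    have := mulr_ge0 (ltW e20) z2.
    have -> : (2 * eps)^-1 * (z - eps) ^+ 2 = (2 * eps)^-1 * z ^+ 2 + eps / 2 - z.
      by field; rewrite gt_eqF.
    by rewrite subr_ge0.
rewrite IntD ?Int_cst ?IntZ//; [|exact: RintZ|exact: Rint_cst].
have -> : eps = eps / 2 + eps / 2 by field.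
rewrite lerD//; last by rewrite -splitr.
rewrite -splitr ler_pdivrMl ?mulr_gt0//; apply: (le_trans H).
by rewrite (_ : 2 * eps * (eps / 2) = eps ^+ 2)//; field.
Qed.

Lemma Int_sqr_partials_psum s A (c : freq -> R) : uniq A ->
  Int (fun x => partials s (psum A c) x ^+ 2) =
  \sum_(k <- A) hcoef s k ^+ 2 * c k ^+ 2.
Proof.
move=> uA.
have hK : involutive (@hsign d (size s)).
  by move=> k; rewrite /hsign; case: (odd _); rewrite ?opprK.
have uA' : uniq [seq hsign (size s) k | k <- A].
  by rewrite map_inj_uniq//; exact: inv_inj.
rewrite (_ : (fun x => _) = fun x => psum [seq hsign (size s) k | k <- A]
    (fun l => c (hsign (size s) l) * hcoef s (hsign (size s) l)) x ^+ 2).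
  rewrite Int_sqr_psum// big_map; apply: eq_bigr => k _.
  by rewrite hK exprMn mulrC.
apply/funext => x; congr (_ ^+ 2); rewrite partials_psum /psum big_map.
by apply: eq_bigr => k _; rewrite partials_hartley hK mulrA.
Qed.

Definition sobolev_const (j : nat) : R :=
  \sum_(l < j.+1) \sum_(s : l.-tuple 'I_d) 2 * (2 * pi) ^+ (2 * l).

(** The weak derivative is the L^2 limit of the derivatives of the partial sums, which are Cauchy by
    orthonormality. The condition d + 1 <= 2j makes the partial sums themselves converge uniformly
    to f, so the test identity passes to the limit. *)
Lemma Wle_weak_partials j f C s : (d.+1 <= 2 * j)%N -> torus_continuous f ->
  Wle j (coef f) C -> (size s <= j)%N ->
  exists v, [/\ weak_partials s f v, v \in Lfun mu 2%:E &
    Int (fun x => v x ^+ 2) <= 2 * (2 * pi) ^+ (2 * size s) * C].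
Proof.
move=> dj tf H sj; set c := coef f.
have pi1 : 0 <= 2 * pi :> R by rewrite mulr_ge0// pi_ge0.
have C0 := Wle_ge0 H.
pose p n := partials (rev s) (psum (modes n) c).
have tp n : torus_continuous (p n).
  by apply: (torus_partials (zperiodic_psum _ _) (Ck_psum (size s) _ _)); rewrite size_rev.
have hle A : \sum_(k <- A) hcoef (rev s) k ^+ 2 * c k ^+ 2 <=
    (2 * pi) ^+ (2 * size s) * \sum_(k <- A) wt k ^+ (2 * j) * c k ^+ 2.
  rewrite mulr_sumr; apply: ler_sum => k _; rewrite mulrA ler_wpM2r ?sqr_ge0//.
  have := @hcoef_le R d (rev s) k; rewrite size_rev => Hk.
  rewrite -[hcoef _ _ ^+ 2]real_normK ?num_real//.
  apply: (@le_trans _ _ (((2 * pi) ^+ size s * wt k ^+ size s) ^+ 2)).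
    by rewrite lerXn2r ?nnegrE ?(le_trans _ Hk).
  rewrite exprMn -!exprM !(mulnC _ 2) ler_wpM2l ?exprn_ge0//.
  by rewrite ler_weXn2l ?wt_ge1// leq_mul2l.
have Ip A : uniq A -> Int (fun x => partials (rev s) (psum A c) x ^+ 2) <=
    (2 * pi) ^+ (2 * size s) * \sum_(k <- A) wt k ^+ (2 * j) * c k ^+ 2.
  by move=> uA; rewrite Int_sqr_partials_psum// hle.
have a0 k : 0 <= wt k ^+ (2 * j) * c k ^+ 2.
  by rewrite mulr_ge0 ?sqr_ge0// exprn_ge0// ltW// wt_gt0.
have E0 : 0 < (2 * pi) ^+ (2 * size s) :> R by rewrite exprn_gt0// mulr_gt0// pi_gt0.
have cau (eps : R) : 0 < eps -> exists n0, forall n m, (n0 <= n)%N -> (n <= m)%N ->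
    Int (fun x => (p m x - p n x) ^+ 2) <= eps.
  move=> e0; have e1 : 0 < eps / (2 * pi) ^+ (2 * size s) by rewrite divr_gt0.
  have [n0 Hn] := sum_tail_small a0 H e1; exists n0 => n m n0n nm.
  have [B [EB uB HB]] := @modes_cat d n m nm.
  rewrite (_ : (fun x => _) = fun x => partials (rev s) (psum B c) x ^+ 2).
    apply: le_trans (Ip B uB) _; rewrite mulrC -ler_pdivlMr//; apply: Hn => // k kB.
    by have := HB k kB; rewrite !mem_modes -!leqNgt; exact: leq_trans.
  apply/funext => x; congr (_ ^+ 2); rewrite /p EB !partials_psum big_cat/=.
  by rewrite addrAC subrr add0r.
have [|v [pv mv v2 Hv]] := L2_complete tp.
  move=> eps /cau[n0 Hn]; exists n0 => n m n0n n0m.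
  have [nm|mn] := leqP n m; last exact: Hn n0m (ltnW mn).
  rewrite (_ : (fun x => _) = fun x => (p m x - p n x) ^+ 2); first exact: Hn.
  by apply/funext => x; rewrite -sqrrN opprB.
have mp n := torus_measurable (tp n).
have Ip2 n : integrableR (fun x => p n x ^+ 2).
  by apply: torus_Rint; under [X in torus_continuous X]eq_fun do rewrite expr2; apply: torusM.
have Ivp n : integrableR (fun x => (v x - p n x) ^+ 2).
  by apply: Rint_sqrD => //; [exact: measurableT_comp|exact: Rint_sqrN].
have mvp n : measurable_fun setT (fun x => v x - p n x) by exact: measurable_funB.
have Iv := Rint_sqr mv v2.
exists v; split; last first.
- apply/ler_addgt0Pr => eps e0; have e2 : 0 < eps / 2 by rewrite divr_gt0.
  have [n0 /(_ n0 (leqnn _)) Hn] := Hv _ e2.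
  apply: (@le_trans _ _ (Int (fun x => 2 * (v x - p n0 x) ^+ 2 + 2 * p n0 x ^+ 2))).
    apply: Int_le => // [|x].
      by apply: RintD; exact: RintZ.
    by have := sqr_ge0 (v x - 2 * p n0 x); rewrite !expr2; lra.
  rewrite IntD; [|exact: RintZ..]; rewrite !IntZ//.
  have := Ip (modes n0) (modes_uniq n0).
  have := ler_wpM2l (ltW E0) (H (modes n0) (modes_uniq n0)); lra.
- exact: Lfun2P.
split=> //; first by apply/Lfun1_integrable.
move=> phi sphi.
have tphi := torus_smooth_continuous sphi.
have tphis : torus_continuous (partials s phi).
  exact: (torus_partials sphi.1 (torus_smooth_Ck (size s) sphi)).
have dj0 : (d.+1 + 2 * 0 <= 2 * j)%N by rewrite muln0 addn0.
have [_ U _] := sobolev_embedding dj0 tf H.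
have L1 : (fun n => Int (fun x => psum (modes n) c x * partials s phi x)) @ \oo -->
    Int (fun x => f x * partials s phi x).
  have [M HM] := periodic_bounded tphis.
  apply: ucvg_Int.
  - by move=> n; apply: Rint_mult => //; exact/torus_Rint/torus_psum.
  - by apply: Rint_mult => //; exact: torus_Rint.
  - exact: (ucvg_mulr HM (U [::] isT)).
have L2 : (fun n => (-1) ^+ size s * Int (fun x => p n x * phi x)) @ \oo -->
    (-1) ^+ size s * Int (fun x => v x * phi x).
  apply: cvgMr; have [M HM] := periodic_bounded tphi.
  apply/cvgrPdist_le => eps e0.
  have M1 : 0 < `|M| + 1 by rewrite ltr_wpDl.
  have e1 : 0 < eps / (`|M| + 1) by rewrite divr_gt0.
  have [n0 Hn] := Hv _ (exprn_gt0 2 e1); exists n0 => // n /= n0n.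
  rewrite -IntB; [|exact: Rint_mult|by apply: Rint_mult => //; exact: torus_Rint].
  have Ivpn : integrableR (fun x => v x - p n x) by apply: RintB => //; exact: torus_Rint.
  apply: (@le_trans _ _ (Int (fun x => (`|M| + 1) * `|v x - p n x|))).
    apply: le_trans (Int_norm _) _.
      by apply: RintB; apply: Rint_mult => //; exact: torus_Rint.
    apply: Int_le.
    + by apply: Rint_abs; apply: RintB; apply: Rint_mult => //; exact: torus_Rint.
    + by apply: RintZ; exact: Rint_abs.
    + move=> x; rewrite -mulrBl normrM mulrC ler_wpM2r//.
      by rewrite (le_trans (HM x))// (le_trans (ler_norm M))// lerDl.
  rewrite IntZ; last exact: Rint_abs.
  rewrite -ler_pdivlMl// mulrC; apply: Int_norm_small => //; exact: Hn.
apply: (cvg_unique _ L1) => //.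
rewrite (_ : (fun n => Int _) = fun n => (-1) ^+ size s * Int (fun x => p n x * phi x))//.
apply/funext => n; apply: torus_by_parts_seq.
- exact: zperiodic_psum.
- exact: sphi.1.
- exact: Ck_psum.
- exact: torus_smooth_Ck.
Qed.

Lemma Wle_sobolev j f C : (d.+1 <= 2 * j)%N -> torus_continuous f ->
  Wle j (coef f) C ->
  sobolev j 2 f /\ sobolev2_norm j f <= Num.sqrt (sobolev_const j * C).
Proof.
move=> dj tf H; split.
  split; [exact: tf.1|by apply: torus_Lfun => //; rewrite ler1n|].
  move=> s sj; have [v [wv v2 _]] := Wle_weak_partials dj tf H sj.
  by exists v.
apply: ler_wsqrtr; rewrite /sobolev_const mulr_suml; apply: ler_sum => l _.
rewrite mulr_suml; apply: ler_sum => s _.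
have sl : (size s <= j)%N by rewrite size_tuple -ltnS.
have [v [wv v2 Hv]] := Wle_weak_partials dj tf H sl.
by rewrite -/(Int _) (Int_wpartials_sqr wv); move: Hv; rewrite size_tuple.
Qed.

Lemma weak_partialsB s f g v w : integrableR f -> integrableR g ->
  weak_partials s f v -> weak_partials s g w ->
  weak_partials s (f \- g) (v \- w).
Proof.
move=> If Ig wv ww; have [pv v1 Hv] := wv; have [pw w1 Hw] := ww.
have Iv := weak_integrable wv; have Iw := weak_integrable ww.
split; first by move=> x i /=; rewrite pv pw.
  by apply/Lfun1_integrable; exact: RintB.
move=> phi sphi.
have tphi := torus_smooth_continuous sphi.
have tphis : torus_continuous (partials s phi).
  exact: (torus_partials sphi.1 (torus_smooth_Ck (size s) sphi)).
rewrite -/(Int _) -/(Int (fun x => (v \- w) x * _)).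
rewrite (_ : (fun x => _ * partials _ _ _) =
    fun x => f x * partials s phi x - g x * partials s phi x); last first.
  by apply/funext => x /=; rewrite mulrBl.
rewrite [in RHS](_ : (fun x => _) = fun x => v x * phi x - w x * phi x); last first.
  by apply/funext => x /=; rewrite mulrBl.
rewrite !IntB; try exact: Rint_mult.
by rewrite (weak_partialsP wv)// (weak_partialsP ww)// mulrBr.
Qed.

Lemma sobolevB j f g : sobolev j 2 f -> sobolev j 2 g -> sobolev j 2 (f \- g).
Proof.
move=> [pf f2 Hf] [pg g2 Hg].
have L2B u u' : u \in Lfun mu 2%:E -> u' \in Lfun mu 2%:E -> (u \- u') \in Lfun mu 2%:E.
  move=> u2 u'2; have mu1 := Lfun2_measurable u2; have mu2 := Lfun2_measurable u'2.
  apply: Lfun2P; first exact: measurable_funB.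
  apply: (@Rint_sqrD _ _ u (fun x => - u' x)) => //.
  - exact: measurableT_comp.
  - exact: Lfun2_integrable_sqr.
  - by apply: Rint_sqrN; exact: Lfun2_integrable_sqr.
split; [by move=> x i /=; rewrite pf pg|exact: L2B|].
move=> s sj; have [v wv v2] := Hf s sj; have [w ww w2] := Hg s sj.
exists (v \- w); last exact: L2B.
apply: weak_partialsB => //.
  by apply: Rint_sqr; [exact: Lfun2_measurable|exact: Lfun2_integrable_sqr].
by apply: Rint_sqr; [exact: Lfun2_measurable|exact: Lfun2_integrable_sqr].
Qed.

End Sobolev.

(** * Monotone variational inequalities *)

Section VariationalInequality.
Import finmap.
Context {R : realType}.

Definition simplex n : set 'rV[R]_n :=
  [set l | (forall i, 0 <= l ord0 i) /\ \sum_i l ord0 i = 1].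

Lemma simplex_compact n : compact (@simplex n).
Proof.
apply: (subclosed_compact _ (@rV_compact R n (fun=> `[0, 1]%classic)
  (fun=> @segment_compact R 0 1))).
  have -> : @simplex n = (\bigcap_(i in [set: 'I_n]) (fun l : 'rV[R]_n => l ord0 i) @^-1` [set y | 0 <= y])
     `&` (fun l : 'rV[R]_n => \sum_i l ord0 i) @^-1` [set 1].
    by apply/seteqP; split=> l /= [h1 h2]; split=> // i; [move=> _|]; exact: h1.
  apply: closedI.
    apply: closed_bigI => i _; apply: closed_comp; last exact: closed_ge.
    by move=> l _; exact: continuous_coord.
  apply: closed_comp; last exact: closed_eq.
  move=> l _; apply: (@Ck_continuous _ _ 0%N); apply: Ck_sum => i; exact: Ck_coord.
move=> l [l0 l1] i /=; rewrite in_itv/= l0/= -l1 (bigD1 i)//= lerDl.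
by apply: sumr_ge0 => j _; exact: l0.
Qed.

(* The minimizer over the simplex of the squared negative part y of A l has
   y = 0: otherwise moving l towards y / |y| decreases it, since y A y >= 0. *)
Lemma monotone_game n (A : 'I_n.+1 -> 'I_n.+1 -> R) :
  (forall i j, 0 <= A i j + A j i) ->
  exists2 l, @simplex n.+1 l & forall i, 0 <= \sum_j A i j * l ord0 j.
Proof.
move=> A0.
pose Ax (l : 'rV[R]_n.+1) i := \sum_j A i j * l ord0 j.
pose y l i := Num.max 0 (- Ax l i).
pose phi l := \sum_i y l i ^+ 2.
have cphi : continuous phi.
  have cAx i : continuous (Ax ^~ i).
    apply: (@Ck_continuous _ _ 0%N); apply: Ck_sum => j; apply: CkZ; exact: Ck_coord.
  have cy i : Ck 0 (fun l => y l i ^+ 2).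
    have c1 : Ck 0 (fun l => y l i).
      split=> // l; apply: (@continuous_max _ _ (fun=> 0 : R^o) (fun l => - Ax l i : R^o)).
        exact: cst_continuous.
      by apply: continuousN; exact: cAx.
    by rewrite (_ : (fun l => _) = fun l => y l i * y l i); [exact: CkM|apply/funext].
  by apply: (@Ck_continuous _ _ 0%N); apply: Ck_sum => i; exact: cy.
have S0 : @simplex n.+1 !=set0.
  exists (\row_i (i == ord0)%:R); split=> [i|]; first by rewrite mxE.
  rewrite (bigD1 ord0)//= mxE eqxx big1 ?addr0// => i i0.
  by rewrite mxE (negbTE i0).
have [l /set_mem [l0 l1] lmin] := EVT_min_rV S0 (@simplex_compact n.+1)
  (continuous_subspaceT cphi).
exists l => // i; rewrite leNgt; apply/negP => Ai.
have y0 j : 0 <= y l j by rewrite le_max lexx.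
have yi : 0 < y l i by rewrite lt_max oppr_gt0 Ai orbT.
pose Y := \sum_j y l j.
have Y0 : 0 < Y by rewrite /Y (bigD1 i)//= ltr_pwDl// sumr_ge0.
pose v : 'rV[R]_n.+1 := \row_j (y l j / Y - l ord0 j).
have AxD t j : Ax (l + t *: v) j = Ax l j + t * Ax v j.
  rewrite /Ax mulr_sumr -big_split/=; apply: eq_bigr => k _.
  by rewrite !mxE; ring.
pose S := \sum_j y l j * Ax v j; pose Q := \sum_j Ax v j ^+ 2.
have Q0 : 0 <= Q by apply: sumr_ge0 => j _; exact: sqr_ge0.
have phi0 : 0 < phi l.
  by rewrite /phi (bigD1 i)//= ltr_pwDl ?exprn_gt0// sumr_ge0// => j _; exact: sqr_ge0.
have yAx j : y l j * Ax l j = - y l j ^+ 2.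
  by rewrite /y /Num.max; case: ifP => h; [rewrite expr2; ring|rewrite expr2 !mul0r oppr0].
have yAy : 0 <= \sum_j \sum_k y l j * A j k * y l k.
  have E : \sum_j \sum_k y l j * A j k * y l k = \sum_j \sum_k y l j * A k j * y l k.
    rewrite exchange_big/=; apply: eq_bigr => j _; apply: eq_bigr => k _.
    by ring.
  have : 0 <= \sum_j \sum_k y l j * (A j k + A k j) * y l k.
    by apply: sumr_ge0 => j _; apply: sumr_ge0 => k _; rewrite !mulr_ge0.
  rewrite (eq_bigr (fun j => \sum_k y l j * A j k * y l k + \sum_k y l j * A k j * y l k)).
    by rewrite big_split/= -E; lra.
  by move=> j _; rewrite -big_split/=; apply: eq_bigr => k _; ring.
have SE : phi l <= S.
  have -> : S = Y^-1 * (\sum_j \sum_k y l j * A j k * y l k) + phi l.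
    rewrite mulr_sumr -big_split/=; apply: eq_bigr => j _.
    rewrite -[y l j ^+ 2]opprK -yAx /Ax !mulr_sumr -sumrB; apply: eq_bigr => k _.
    by rewrite mxE; field; rewrite gt_eqF.
  by rewrite lerDr mulr_ge0// invr_ge0 ltW.
have S_gt0 : 0 < S by exact: lt_le_trans SE.
(* Since t Q <= S, the quadratic term t^2 Q is at most t S, less than the first-order decrease 2 t
   S; t <= 1 keeps l + t v in the simplex. *)
pose t := Num.min 1 (S / (Q + 1)).
have Q1 : 0 < Q + 1 by lra.
have t0 : 0 < t by rewrite lt_min ltr01 divr_gt0.
have t1 : t <= 1 by rewrite ge_min lexx.
have tQ : t * Q <= S.
  apply: (@le_trans _ _ (S / (Q + 1) * Q)).
    by rewrite ler_wpM2r// ge_min lexx orbT.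
  by rewrite mulrAC ler_pdivrMr// ler_wpM2l ?ltW//; lra.
have inS : l + t *: v \in @simplex n.+1.
  apply/mem_set; split=> [j|].
    rewrite !mxE (_ : _ + _ = (1 - t) * l ord0 j + t * (y l j / Y)); last by ring.
    by rewrite addr_ge0// mulr_ge0 ?divr_ge0 ?subr_ge0 ?(ltW t0) ?(ltW Y0)// l0.
  rewrite (eq_bigr (fun j => (1 - t) * l ord0 j + t / Y * y l j)); last first.
    by move=> j _; rewrite !mxE; ring.
  by rewrite big_split/= -!mulr_sumr l1 -/Y divfK ?gt_eqF//; ring.
have := lmin _ inS; apply/negP; rewrite -ltNge.
apply: (@le_lt_trans _ _ (\sum_j (y l j - t * Ax v j) ^+ 2)).
  apply: ler_sum => j _; rewrite {1}/y AxD.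
  have yl : - Ax l j <= y l j by rewrite le_max lexx orbT.
  rewrite /Num.max; case: ifP => h; last by rewrite expr2 mul0r sqr_ge0.
  rewrite lerXn2r ?nnegrE ?(ltW h)//; last by lra.
  by apply: le_trans (ltW h) _; lra.
have -> : \sum_j (y l j - t * Ax v j) ^+ 2 = phi l - 2 * t * S + t * (t * Q).
  rewrite /phi /S /Q !mulr_sumr -sumrB -big_split/=.
  by apply: eq_bigr => j _; ring.
have : t * (t * Q) <= t * S by rewrite ler_wpM2l// ltW.
have : 0 < t * S by exact: mulr_gt0.
lra.
Qed.

(** Convexity through finite combinations, the form in which [monotone_game] delivers its weights;
    segments are the case of two points. *)
Definition convex_hull_closed (V : lmodType R) (K : set V) : Prop :=
  forall n (l : 'rV[R]_n) (w : 'I_n -> V), simplex l -> (forall i, K (w i)) ->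
    K (\sum_i l ord0 i *: w i).

Lemma convex_segment (V : lmodType R) (K : set V) z w (t : R) :
  convex_hull_closed K -> K z -> K w -> 0 <= t <= 1 -> K (z + t *: (w - z)).
Proof.
move=> cK Kz Kw /andP[t0 t1].
have := cK 2 (\row_i (if i == ord0 then 1 - t else t)) (fun i => if i == ord0 then z else w).
rewrite !big_ord_recl !big_ord0 !mxE/= addr0.
have -> : (1 - t) *: z + t *: w = z + t *: (w - z).
  by rewrite scalerBl scale1r scalerBr -addrA [- _ + _]addrC.
apply; last by move=> i; case: ifP.
split; first by move=> i; rewrite mxE; case: ifP => _ //; rewrite subr_ge0.
by rewrite !big_ord_recl big_ord0 !mxE/= addr0 subrK.
Qed.

(** Minty's argument. The sets of z in K with 0 <= F w (w - z) are closed in a compact set. For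
    finitely many points W i, a common element is the convex combination given by [monotone_game]
    for the matrix F (W i) (W i - W j), whose symmetric part has nonnegative entries by
    monotonicity. For z common to all these sets, w is replaced by z + t (w - z) and t -> 0+;
    continuity of F in its first argument enters only there. *)
Lemma variational_inequality (V : normedModType R) (K : set V) (F : V -> V -> R) :
  K !=set0 -> compact K -> convex_hull_closed K ->
  (forall z, K z -> forall (a : R) u v, F z (a *: u + v) = a * F z u + F z v) ->
  (forall z, K z -> continuous (F z)) ->
  (forall z w, K z -> K w -> 0 <= F z (z - w) - F w (z - w)) ->
  (forall z w, K z -> K w -> F (z + t *: (w - z)) (w - z) @[t --> 0^'+] --> F z (w - z)) ->
  exists2 z, K z & forall w, K w -> 0 <= F z (w - z).
Proof.
move=> [z0 Kz0] cK convK linF contF monoF hemiF.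
have F0 z : K z -> F z 0 = 0.
  move=> Kz; have := linF z Kz 1 0 0; rewrite scaler0 addr0 mul1r => /eqP.
  by rewrite -subr_eq0 opprD addNKr oppr_eq0 => /eqP.
have FZ z (a : R) u : K z -> F z (a *: u) = a * F z u.
  by move=> Kz; rewrite -[a *: u]addr0 linF// F0// addr0.
have FD z u v : K z -> F z (u + v) = F z u + F z v.
  by move=> Kz; rewrite -[u]scale1r linF// mul1r scale1r.
have FN z u : K z -> F z (- u) = - F z u.
  by move=> Kz; rewrite -scaleN1r FZ// mulN1r.
have Fsum z (I : Type) (r : seq I) (G : I -> V) : K z ->
    F z (\sum_(i <- r) G i) = \sum_(i <- r) F z (G i).
  by move=> Kz; elim/big_rec2: _ => [|i x y _ <-]; [exact: F0|exact: FD].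
pose f w : set V := [set z | K z /\ 0 <= F w (w - z)].
have cK' := cK; rewrite compact_In0 in cK'.
have [|D' sD'|z Hz] := cK' V K f.
- exists (fun w => [set z | 0 <= F w (w - z)]) => w Kw; last by [].
  apply: (@closed_comp _ _ (fun z => F w (w - z)) [set y : R | 0 <= y]); last exact: closed_ge.
  move=> z _; apply: (@continuous_comp _ _ _ (fun z => w - z) (F w)); last exact: contF.
  by apply: (@continuousB _ _ _ (cst w) id); [exact: cst_continuous|].
- have [s Es] : exists s : seq V, forall w, (w \in D') = (w \in s) by exists (enum_fset D').
  case: s Es => [|w0 s] Es.
    by exists z0 => w /=; rewrite Es.
  pose W (i : 'I_(size s).+1) := nth 0 (w0 :: s) i.
  have KW i : K (W i).
    by apply/set_mem; apply: sD'; rewrite Es /W mem_nth.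
  have [|l sl Hl] := @monotone_game _ (fun i j => F (W i) (W i - W j)).
    move=> i j; have := monoF _ _ (KW i) (KW j).
    by rewrite -[W j - W i]opprB FN.
  exists (\sum_i l ord0 i *: W i) => w /=; rewrite Es => ws; split; first exact: convK.
  have [i wi] : exists i, w = W i.
    have iw : (index w (w0 :: s) < (size s).+1)%N by rewrite -[X in (_ < X)%N]/(size (w0 :: s)) index_mem.
    by exists (Ordinal iw); rewrite /W/= nth_index.
  have := Hl i; rewrite wi; congr (0 <= _).
  have -> : W i - \sum_j l ord0 j *: W j = \sum_j l ord0 j *: (W i - W j).
    under [RHS]eq_bigr do rewrite scalerBr.
    by rewrite sumrB -scaler_suml sl.2 scale1r.
  by rewrite Fsum//; apply: eq_bigr => j _; rewrite FZ// mulrC.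
have Kz : K z by have [] := Hz z0 Kz0.
exists z => // w Kw.
have L := hemiF z w Kz Kw.
rewrite -(cvg_lim _ L)//; apply: limr_ge; first by apply/cvg_ex; eexists; exact: L.
near=> t.
have t0 : 0 < t by near: t; exact: nbhs_right_gt.
have t1 : t <= 1 by near: t; exact: nbhs_right_le.
have Kt : K (z + t *: (w - z)) by apply: convex_segment => //; rewrite (ltW t0) t1.
have [_ +] := Hz _ Kt; have -> : z + t *: (w - z) - z = t *: (w - z) by rewrite addrC addKr.
by rewrite FZ// pmulr_rge0.
Unshelve. all: by end_near.
Qed.

End VariationalInequality.

(** * The Hamiltonian along a pair (m, u) *)

Section Jets.
Context {R : realType} {d : nat}.
Local Notation ei i := (delta_mx ord0 i).
Local Notation Ham := ('rV[R]_d -> 'rV[R]_d -> 'M[R]_d -> R -> R -> R).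
Implicit Types (F H : Ham) (v m th : 'rV[R]_d -> R).

Lemma eq_continuous_for (T U : topologicalType) (f g : T -> U) x :
  f =1 g -> {for x, continuous f} -> {for x, continuous g}.
Proof. by move=> /funext ->. Qed.

Lemma continuous_pairing (S T U : topologicalType) (f : S -> T) (g : S -> U) :
  continuous f -> continuous g -> continuous (fun z => (f z, g z)).
Proof. by move=> cf cg z; apply: cvg_pair; [exact: cf|exact: cg]. Qed.

Lemma continuous_mxP (T : topologicalType) a b (X : T -> 'M[R]_(a, b)) (x : T) :
  (forall i j, {for x, continuous (fun z => X z i j)}) ->
  {for x, continuous X}.
Proof.
move=> H; apply/cvgrPdist_le => r r0.
have : \forall z \near x, forall ij : 'I_a * 'I_b, `|X x ij.1 ij.2 - X z ij.1 ij.2| <= r.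
  by apply: near_forall => -[i j]; have /cvgrPdist_le /(_ r r0) := H i j.
apply: filterS => z Hz; rewrite [leLHS]/Num.Def.normr/= mx_normrE.
by apply/bigmax_leP; split => [|ij _]; [exact: ltW|rewrite !mxE; exact: Hz].
Qed.

Lemma gradE v x i : grad v x ord0 i = partial i v x.
Proof. exact: mxE. Qed.

Lemma hessE v x i j : hess v x i j = partials [:: i; j] v x.
Proof. exact: mxE. Qed.

Definition jet_dim := (d + (d + (d * d + (1 + 1))))%N.

(* The arguments of H are flattened into one row vector, on which the chain rule
   Ck_comp is available. *)
Definition jet (x p : 'rV[R]_d) (M : 'M[R]_d) (s t : R) : 'rV[R]_jet_dim :=
  row_mx x (row_mx p (row_mx (mxvec M) (row_mx (s%:M : 'rV_1) (t%:M : 'rV_1)))).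

Definition ham_jet F (z : 'rV[R]_jet_dim) : R :=
  let z1 := rsubmx z in let z2 := rsubmx z1 in let z3 := rsubmx z2 in
  F (lsubmx z) (lsubmx z1) (vec_mx (lsubmx z2)) (lsubmx z3 ord0 ord0) (rsubmx z3 ord0 ord0).

Definition jet_density (z : 'rV[R]_jet_dim) : R :=
  lsubmx (rsubmx (rsubmx (rsubmx z))) ord0 ord0.

Definition positive_jets : set 'rV[R]_jet_dim := [set z | 0 < jet_density z].

Lemma ham_jetE F x p M s t : ham_jet F (jet x p M s t) = F x p M s t.
Proof.
by rewrite /ham_jet /jet !(row_mxKr, row_mxKl) mxvecK !mxE !eqxx !mulr1n.
Qed.

Lemma jet_densityE x p M s t : jet_density (jet x p M s t) = s.
Proof. by rewrite /jet_density /jet !(row_mxKr, row_mxKl) mxE eqxx mulr1n. Qed.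

Lemma jet_surj z : exists x p M s t, z = jet x p M s t.
Proof.
exists (lsubmx z), (lsubmx (rsubmx z)), (vec_mx (lsubmx (rsubmx (rsubmx z)))),
  (jet_density z), (rsubmx (rsubmx (rsubmx (rsubmx z))) ord0 ord0).
rewrite /jet vec_mxK.
have scalarK (A : 'rV[R]_1) : (A ord0 ord0)%:M = A.
  by apply/rowP => i; rewrite !ord1 mxE eqxx mulr1n.
by rewrite /jet_density !scalarK !hsubmxK.
Qed.

Lemma jet_lin (a : R) x p M s t x' p' M' s' t' :
  a *: jet x p M s t + jet x' p' M' s' t' =
  jet (a *: x + x') (a *: p + p') (a *: M + M') (a * s + s') (a * t + t').
Proof.
rewrite /jet !scale_row_mx !add_row_mx linearP/=; do 4! congr row_mx.
  by apply/rowP => i; rewrite !ord1 !mxE eqxx !mulr1n.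
by apply/rowP => i; rewrite !ord1 !mxE eqxx !mulr1n.
Qed.

Lemma open_positive_jets : open positive_jets.
Proof.
apply: (@open_comp _ _ jet_density [set y : R | 0 < y]); last exact: open_gt.
move=> z _; rewrite /jet_density; under eq_fun do rewrite !mxE.
exact: continuous_coord.
Qed.

Definition ham_smooth F := smooth_part positive_jets (ham_jet F).

(** Positive densities form an open set, contained in either choice of [E]; on it, smoothness by
    local extension becomes ordinary smoothness. *)
Lemma smooth_on_ham (E : set R) H : (forall s, 0 < s -> E s) ->
  H_smoothness E H -> ham_smooth H.
Proof.
move=> EP sH.
pose S := [set z : 'rV[R]_d * 'rV[R]_d * 'M[R]_d * R * R | 0 < z.1.2].
pose G (z : 'rV[R]_d * 'rV[R]_d * 'M[R]_d * R * R) :=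
  H z.1.1.1.1 z.1.1.1.2 z.1.1.2 z.1.2 z.2.
have oS : open S.
  apply: (@open_comp _ _ (fun z => z.1.2) [set y : R | 0 < y]); last exact: open_gt.
  move=> z _; apply: (@continuous_comp _ _ _ fst snd); first exact: cvg_fst.
  exact: cvg_snd.
have sG : smooth_open S G.
  apply: smooth_on_open => // z Sz; have [U [F [oU Uz sF FE]]] := sH z (EP _ Sz).
  by exists U, F; split=> // y Uy Sy; apply: FE => //; exact: EP.
pose dec (z : 'rV[R]_jet_dim) : 'rV[R]_d * 'rV[R]_d * 'M[R]_d * R * R :=
  (lsubmx z, lsubmx (rsubmx z), vec_mx (lsubmx (rsubmx (rsubmx z))),
   lsubmx (rsubmx (rsubmx (rsubmx z))) ord0 ord0, rsubmx (rsubmx (rsubmx (rsubmx z))) ord0 ord0).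
apply: (@smooth_open_comp_linear _ _ _ dec S G _ _ sG).
  move=> a u v; rewrite /dec/=; congr (_, _, _, _, _); rewrite ?linearP//= ?mxE//.
have cl a b : continuous (@lsubmx R 1 a b).
  move=> z; apply: continuous_rowP => i.
  by apply: eq_continuous_for (@continuous_coord _ _ (lshift b i) z) => y; rewrite mxE.
have cr a b : continuous (@rsubmx R 1 a b).
  move=> z; apply: continuous_rowP => i.
  by apply: eq_continuous_for (@continuous_coord _ _ (rshift a i) z) => y; rewrite mxE.
have cv : continuous (@vec_mx R d d).
  move=> z; apply: continuous_mxP => i j.
  by apply: eq_continuous_for (@continuous_coord _ _ (mxvec_index i j) z) => y; rewrite mxE.
rewrite /dec; do ?apply: continuous_pairing.
- exact: cl.
- by move=> z; apply: (@continuous_comp _ _ _ rsubmx lsubmx); [exact: cr|exact: cl].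
- move=> z; apply: (@continuous_comp _ _ _ (lsubmx \o rsubmx \o rsubmx) (@vec_mx R d d)); last exact: cv.
  apply: (@continuous_comp _ _ _ (rsubmx \o rsubmx) lsubmx); last exact: cl.
  by apply: (@continuous_comp _ _ _ rsubmx rsubmx); exact: cr.
- by under eq_fun do rewrite !mxE; exact: continuous_coord.
- by under eq_fun do rewrite !mxE; exact: continuous_coord.
Qed.

Lemma partial_ham_jet F G (e : 'rV[R]_jet_dim) k :
  e = ei k ->
  (forall x p M s t, 'D_e (ham_jet F) (jet x p M s t) = G x p M s t) ->
  partial k (ham_jet F) = ham_jet G.
Proof.
move=> -> H; apply/funext => z; have [x [p [M [s [t ->]]]]] := jet_surj z.
by rewrite ham_jetE -H.
Qed.

Lemma ham_smooth_Dp H i : ham_smooth H -> ham_smooth (DpH H i).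
Proof.
move=> sH.
rewrite /ham_smooth.
suff <- : partial (rshift d (lshift _ i)) (ham_jet H) = ham_jet (DpH H i).
  exact: smooth_part_partial.
apply: (@partial_ham_jet _ _ (jet 0 (ei i) 0 0 0)).
  by rewrite /jet linear0 !raddf0 !row_mx0 -delta_mx_lshift -delta_mx_rshift.
move=> x p M s t; rewrite /DpH /derive.
suff -> : (fun a : R => a^-1 *: ((ham_jet H \o shift (jet x p M s t)) (a *: jet 0 (ei i) 0 0 0)
    - ham_jet H (jet x p M s t))) =
  (fun a : R => a^-1 *: (((fun p' => H x p' M s t) \o shift p) (a *: ei i) - H x p M s t)) by [].
by apply/funext => a /=; rewrite jet_lin !scaler0 !mulr0 !add0r !ham_jetE.
Qed.

Lemma ham_smooth_DM H i j : ham_smooth H -> ham_smooth (DMH H i j).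
Proof.
move=> sH; rewrite /ham_smooth.
suff <- : partial (rshift d (rshift d (lshift _ (mxvec_index i j)))) (ham_jet H) =
    ham_jet (DMH H i j).
  exact: smooth_part_partial.
apply: (@partial_ham_jet _ _ (jet 0 0 (delta_mx i j) 0 0)).
  by rewrite /jet mxvec_delta !raddf0 !row_mx0 -delta_mx_lshift -!delta_mx_rshift.
move=> x p M s t; rewrite /DMH /derive.
suff -> : (fun a : R => a^-1 *: ((ham_jet H \o shift (jet x p M s t)) (a *: jet 0 0 (delta_mx i j) 0 0)
    - ham_jet H (jet x p M s t))) =
  (fun a : R => a^-1 *: (((fun M' => H x p M' s t) \o shift M) (a *: delta_mx i j) - H x p M s t)) by [].
by apply/funext => a /=; rewrite jet_lin !scaler0 !mulr0 !add0r !ham_jetE.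
Qed.

Lemma torus_Ham_Dp (E : set R) H i : torus_Ham E H -> torus_Ham E (DpH H i).
Proof.
move=> tH p M s t Es x k; rewrite /DpH; congr ('D__ _ _).
by apply/funext => p'; exact: tH.
Qed.

Lemma torus_Ham_DM (E : set R) H i j : torus_Ham E H -> torus_Ham E (DMH H i j).
Proof.
move=> tH p M s t Es x k; rewrite /DMH; congr ('D__ _ _).
by apply/funext => p'; exact: tH.
Qed.

Lemma zperiodic_ham (E : set R) F m v w th : torus_Ham E F -> (forall x, E (m x)) ->
  zperiodic m -> zperiodic v -> zperiodic w -> zperiodic th ->
  zperiodic (fun x => F x (grad v x) (hess w x) (m x) (th x)).
Proof.
move=> tF Em pm pv pw pt x i.
rewrite pm pt (_ : grad v _ = grad v x); last first.
  by apply/rowP => k; rewrite !mxE (zperiodic_partial _ pv).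
rewrite (_ : hess w _ = hess w x); last first.
  apply/matrixP => k l; apply: etrans (hessE _ _ _ _) (etrans _ (esym (hessE _ _ _ _))).
  exact: (@zperiodic_partials _ _ w [:: k; l] pw x i).
exact: tF.
Qed.

Lemma jet_coordP a :
  [\/ exists b, forall x p M s t, jet x p M s t ord0 a = x ord0 b,
      exists b, forall x p M s t, jet x p M s t ord0 a = p ord0 b,
      exists k l, forall x p M s t, jet x p M s t ord0 a = M k l |
      (forall x p M s t, jet x p M s t ord0 a = s) \/
      (forall x p M s t, jet x p M s t ord0 a = t)].
Proof.
rewrite /jet; case: (split_ordP a) => b ->.
  by constructor 1; exists b => x p M s t; rewrite row_mxEl.
case: (split_ordP b) => c ->.
  by constructor 2; exists c => x p M s t; rewrite row_mxEr row_mxEl.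
case: (split_ordP c) => e ->.
  case/mxvec_indexP: e => k l.
  by constructor 3; exists k, l => x p M s t; rewrite 2!row_mxEr row_mxEl mxvecE.
constructor 4; case: (split_ordP e) => f ->; rewrite (ord1 f); [left|right] => x p M s t.
  by rewrite 3!row_mxEr row_mxEl mxE eqxx mulr1n.
by rewrite 4!row_mxEr mxE eqxx mulr1n.
Qed.

Lemma Ck_jet j m v th a : Ck j m -> Ck j.+2 v -> Ck j th ->
  Ck j (fun x => jet x (grad v x) (hess v x) (m x) (th x) ord0 a).
Proof.
move=> Cm Cv Ct.
have [[b jE]|[b jE]|[k [l jE]]|[jE|jE]] := jet_coordP a; under eq_fun do rewrite jE //.
- exact: Ck_coord.
- by under eq_fun do rewrite mxE; apply: Ck_partial; exact: Ck_leq Cv.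
- by under eq_fun do rewrite mxE; apply: (@Ck_partials _ _ _ _ [:: k; l]).
- exact: Cm.
- exact: Ct.
Qed.

Lemma Ck_ham j F m v th : ham_smooth F -> (forall x, 0 < m x) ->
  Ck j m -> Ck j.+2 v -> Ck j th ->
  Ck j (fun x => F x (grad v x) (hess v x) (m x) (th x)).
Proof.
move=> sF m0 Cm Cv Ct.
rewrite (_ : (fun x => _) = ham_jet F \o fun x => jet x (grad v x) (hess v x) (m x) (th x)); last first.
  by apply/funext => x /=; rewrite ham_jetE.
apply: (Ck_comp open_positive_jets sF).
  by move=> x; rewrite /positive_jets/= jet_densityE.
by move=> a; exact: Ck_jet.
Qed.

(** F is continuous on O, but not uniformly. Compactness of the unit cube, in its near-covering
    form, makes the local estimates uniform there, and periodicity extends them to the whole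
    space. *)
Lemma ucvg_comp_torus (T : Type) (U : set_system T) {FU : Filter U} n
    (F : 'rV[R]_n -> R) (O : set 'rV[R]_n) (X : 'rV[R]_d -> 'rV[R]_n) (Y : T -> 'rV[R]_d -> 'rV[R]_n) :
  (forall y, O y -> {for y, continuous F}) -> (forall x, O (X x)) -> continuous X ->
  (forall i, ucvg U (fun t x => Y t x ord0 i) (fun x => X x ord0 i)) ->
  zperiodic (F \o X) -> (\forall t \near U, zperiodic (F \o Y t)) ->
  ucvg U (fun t => F \o Y t) (F \o X).
Proof.
move=> cF OX cX YX pX pY eps e0.
have K := @unit_cube_compact R d.
rewrite compact_near_coveringP in K.
have H : \forall t \near U, @unit_cube R d `<=` [set x | `|F (Y t x) - F (X x)| <= eps].
  apply: K => x _.
  have e2 : 0 < eps / 2 by rewrite divr_gt0.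
  have /cvgrPdist_le /(_ _ e2) /nbhs_ballP[r /= r0 Hr] := cF _ (OX x).
  have r2 : 0 < r / 2 by rewrite divr_gt0.
  have r4 : 0 < r / 4 by rewrite divr_gt0.
  have nx : \forall x' \near x, `|X x - X x'| <= r / 4.
    by have /cvgrPdist_le /(_ _ r4) := cX x.
  have nt : \forall t \near U, forall i y, `|Y t y ord0 i - X y ord0 i| <= r / 2.
    by apply: near_forall => i; exact: YX.
  exists ([set x' | `|X x - X x'| <= r / 4], [set t | forall i y, `|Y t y ord0 i - X y ord0 i| <= r / 2]) => //=.
  case=> x' t [/= hx ht].
  have h1 : `|F (X x) - F (X x')| <= eps / 2.
    by apply: Hr; rewrite -ball_normE/=; apply: le_lt_trans hx _; lra.
  have h2 : `|F (X x) - F (Y t x')| <= eps / 2.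
    apply: Hr; rewrite -ball_normE/=.
    have -> : X x - Y t x' = (X x - X x') - (Y t x' - X x') by rewrite opprB addrA subrK.
    apply: (@le_lt_trans _ _ (r / 4 + r / 2)); last by lra.
    apply: le_trans (ler_normB _ _) _; apply: lerD => //.
    by apply: norm_le_coord => [|i]; [exact: ltW|rewrite !mxE; exact: ht].
  have -> : F (Y t x') - F (X x') = (F (X x) - F (X x')) - (F (X x) - F (Y t x')) by lra.
  by apply: le_trans (ler_normB _ _) _; lra.
apply: filterS (filterI H pY) => t [Ht pt] x.
have [y Cy [k ->]] := zperiodic_cube x.
by rewrite (zperiodic_int _ _ pt) (zperiodic_int _ _ pX); exact: Ht.
Qed.

Lemma ucvg_ham (E : set R) (T : Type) (U : set_system T) {FU : Filter U} F m v th
    (mt vt tht : T -> 'rV[R]_d -> R) :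
  (forall s, 0 < s -> E s) -> torus_Ham E F -> ham_smooth F -> (forall x, 0 < m x) ->
  torus_continuous m -> zperiodic v -> Ck 2 v -> torus_continuous th ->
  (\forall t \near U, [/\ forall x, 0 < mt t x, zperiodic (mt t), zperiodic (vt t) & zperiodic (tht t)]) ->
  ucvg U mt m -> (forall s, (size s <= 2)%N -> ucvg U (fun t => partials s (vt t)) (partials s v)) ->
  ucvg U tht th ->
  ucvg U (fun t x => F x (grad (vt t) x) (hess (vt t) x) (mt t x) (tht t x))
    (fun x => F x (grad v x) (hess v x) (m x) (th x)).
Proof.
move=> EP tF sF m0 [pm cm] pv Cv [pth cth] P um uv uth.
have jE (w l r : 'rV[R]_d -> R) : (fun x => F x (grad w x) (hess w x) (l x) (r x)) =
    ham_jet F \o (fun x => jet x (grad w x) (hess w x) (l x) (r x)).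
  by apply/funext => x /=; rewrite ham_jetE.
rewrite jE (_ : (fun t x => _) = fun t =>
    ham_jet F \o (fun x => jet x (grad (vt t) x) (hess (vt t) x) (mt t x) (tht t x))); last first.
  by apply/funext => t; rewrite -jE.
apply: (@ucvg_comp_torus _ _ _ _ _ positive_jets).
- by move=> y Oy; have [] := sF [::] y Oy.
- by move=> x; rewrite /positive_jets/= jet_densityE.
- move=> x; apply: continuous_rowP => a; apply: (@Ck_continuous _ _ 0%N).
  exact: Ck_jet.
- move=> a eps e0.
  have [[b E1]|[b E1]|[k [l E1]]|[E1|E1]] := jet_coordP a.
  + by near=> t => x; rewrite 2!E1 subrr normr0 ltW.
  + have := uv [:: b] isT eps e0; apply: filterS => t H x.
    by rewrite 2!E1 2!gradE; exact: H.
  + have := uv [:: k; l] isT eps e0; apply: filterS => t H x.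
    rewrite (E1 x (grad (vt t) x)) (E1 x (grad v x)).
    by move: (H x); congr (`|_ - _| <= _); apply/esym; exact: hessE.
  + by have := um eps e0; apply: filterS => t H x; rewrite 2!E1; exact: H.
  + by have := uth eps e0; apply: filterS => t H x; rewrite 2!E1; exact: H.
- by rewrite -jE; apply: (zperiodic_ham tF) => // x; exact: EP.
- apply: filterS P => t [h1 h2 h3 h4].
  by rewrite -jE; apply: (zperiodic_ham tF) => // x; exact: EP.
Unshelve. all: by end_near.
Qed.
End Jets.

(** * Sums and products of uniform limits *)

Section UniformAlgebra.
Context {R : realType} (T X : Type) (U : set_system T) {FU : Filter U}.
Implicit Types (f : T -> X -> R) (g : X -> R).

Lemma ucvg_cst g : ucvg U (fun=> g) g.
Proof. by move=> e e0; apply: nearW => t x; rewrite subrr normr0 ltW. Qed.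

Lemma ucvgD f f' g g' : ucvg U f g -> ucvg U f' g' ->
  ucvg U (fun t x => f t x + f' t x) (fun x => g x + g' x).
Proof.
move=> h h' e e0; have e2 : 0 < e / 2 by rewrite divr_gt0.
apply: filterS2 (h _ e2) (h' _ e2) => t H H' x.
rewrite (_ : _ - _ = (f t x - g x) + (f' t x - g' x)); last by ring.
by apply: le_trans (ler_normD _ _) _; rewrite (splitr e) lerD.
Qed.

Lemma ucvgN f g : ucvg U f g -> ucvg U (fun t x => - f t x) (fun x => - g x).
Proof.
move=> h e e0; apply: filterS (h _ e0) => t H x.
by rewrite -opprD normrN; exact: H.
Qed.

Lemma ucvgB f f' g g' : ucvg U f g -> ucvg U f' g' ->
  ucvg U (fun t x => f t x - f' t x) (fun x => g x - g' x).
Proof. by move=> h h'; apply: ucvgD => //; exact: ucvgN. Qed.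

Lemma ucvg_sum (I : Type) (r : seq I) (f : I -> T -> X -> R) (g : I -> X -> R) :
  (forall i, ucvg U (f i) (g i)) ->
  ucvg U (fun t x => \sum_(i <- r) f i t x) (fun x => \sum_(i <- r) g i x).
Proof.
move=> h; elim: r => [|i r IH] e e0.
  by apply: nearW => t x; rewrite !big_nil subrr normr0 ltW.
apply: filterS (ucvgD (h i) IH e0) => t H x.
by rewrite 2!big_cons; exact: (H x).
Qed.

Lemma ucvgM f f' g g' (M : R) : (forall x, `|g x| <= M) -> (forall x, `|g' x| <= M) ->
  ucvg U f g -> ucvg U f' g' ->
  ucvg U (fun t x => f t x * f' t x) (fun x => g x * g' x).
Proof.
move=> gM gM' h h' e e0.
pose M1 := `|M| + 1.
have M0 : 0 < M1 by rewrite ltr_wpDl.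
have MM : M <= M1 by rewrite /M1; have := ler_norm M; lra.
(* With both factors approximated to within e', the error is at most e'^2 + 2 M1 e', hence at most
   e' (2 M1 + 1) because e' <= 1. *)
pose e' := Num.min 1 (e / (2 * M1 + 1)).
have D0 : 0 < 2 * M1 + 1 by lra.
have e'0 : 0 < e' by rewrite lt_min ltr01 divr_gt0.
have e'1 : e' <= 1 by rewrite ge_min lexx.
have L4 : e' * (2 * M1 + 1) <= e by rewrite -ler_pdivlMr// ge_min lexx orbT.
move: (e') e'0 e'1 L4 => c c0 c1 L4.
apply: filterS2 (h _ c0) (h' _ c0) => t H H' x.
rewrite (_ : _ - _ = (f t x - g x) * (f' t x - g' x) +
  ((f t x - g x) * g' x + g x * (f' t x - g' x))); last by ring.
have L1 : `|(f t x - g x) * (f' t x - g' x)| <= c.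
  rewrite normrM -[c]mulr1; apply: ler_pM; rewrite ?normr_ge0//.
  by apply: (le_trans (H' x)); exact: c1.
have L2 : `|(f t x - g x) * g' x| <= c * M1.
  by rewrite normrM; apply: ler_pM => //; exact: le_trans (gM' x) MM.
have L3 : `|g x * (f' t x - g' x)| <= c * M1.
  by rewrite normrM mulrC; apply: ler_pM => //; exact: le_trans (gM x) MM.
apply: le_trans (ler_normD _ _) _.
have L5 := ler_normD ((f t x - g x) * g' x) (g x * (f' t x - g' x)).
lra.
Qed.

End UniformAlgebra.

(** * Spectrum of the regularizing operator *)

Section Spectrum.
Context {R : realType} {d : nat}.
Local Notation freq := 'rV[int]_d.
Implicit Types (f g m u : 'rV[R]_d -> R) (k : freq).

Lemma fcoefD f g k : integrableR f -> integrableR g ->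
  coef (fun x => f x + g x) k = coef f k + coef g k.
Proof.
move=> If Ig; rewrite /coef -IntD; try exact: Rint_coef.
by congr Int; apply/funext => x; rewrite mulrDl.
Qed.

Lemma fcoefZ (c : R) f k : integrableR f -> coef (fun x => c * f x) k = c * coef f k.
Proof.
move=> If; rewrite /coef -IntZ; last exact: Rint_coef.
by congr Int; apply/funext => x; rewrite mulrA.
Qed.

Lemma fcoefN f k : integrableR f -> coef (fun x => - f x) k = - coef f k.
Proof.
move=> If; rewrite -mulN1r -fcoefZ//; congr coef.
by apply/funext => x; rewrite mulN1r.
Qed.

Lemma fcoefB f g k : integrableR f -> integrableR g ->
  coef (fun x => f x - g x) k = coef f k - coef g k.
Proof. by move=> If Ig; rewrite fcoefD ?fcoefN//; exact: RintN. Qed.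

Lemma partialsB j s f g : (size s <= j)%N -> Ck j f -> Ck j g ->
  partials s (fun x => f x - g x) = fun x => partials s f x - partials s g x.
Proof.
elim: s => [//|i s IH] /= sj Cf Cg; rewrite IH ?(ltnW sj)//.
apply/funext => x; apply: deriveB.
  by apply: (@Ck_derivable _ _ 0%N); apply: Ck_partials; rewrite addn1; exact: Ck_leq Cf.
by apply: (@Ck_derivable _ _ 0%N); apply: Ck_partials; rewrite addn1; exact: Ck_leq Cg.
Qed.

Lemma Wle_coefB s f g C C' : integrableR f -> integrableR g ->
  Wle s (coef f) C -> Wle s (coef g) C' ->
  Wle s (coef (fun x => f x - g x)) (2 * C + 2 * C').
Proof.
move=> If Ig Wf Wg.
rewrite (_ : coef _ = fun k => coef f k + (-1) * coef g k).
  by apply: WleD => //; have := WleZ (-1) Wg; rewrite sqrrN expr1n mul1r.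
by apply/funext => k; rewrite fcoefB// mulN1r.
Qed.

Definition lap_eig k : R := \sum_i (2 * pi * (k ord0 i)%:~R) ^+ 2.

Lemma coef_laplacian f k : zperiodic f -> Ck 2 f ->
  coef (laplacian f) k = - lap_eig k * coef f k.
Proof.
move=> pf Cf.
have It i : integrableR (partials [:: i; i] f).
  by apply: torus_Rint; exact: torus_partials pf Cf _.
transitivity (\sum_i coef (partials [:: i; i] f) k).
  rewrite /coef -Int_sum; last by move=> i; exact: Rint_coef.
  by congr Int; apply/funext => x; rewrite /laplacian mulr_suml.
rewrite /lap_eig -sumrN mulr_suml; apply: eq_bigr => i _.
rewrite /coef.
have -> : (fun x => partials [:: i; i] f x * hartley k x) =
  fun x => hartley k x * partials [:: i; i] f x by apply/funext => x; rewrite mulrC.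
have IBP : Int (fun x => hartley k x * partials [:: i; i] f x) =
    (-1) ^+ 2 * Int (fun x => partials [:: i; i] (hartley k) x * f x) :=
  torus_by_parts_seq (s := [:: i; i]) (zperiodic_hartley k) pf (Ck_hartley 2 k) Cf.
apply: (etrans IBP); rewrite expr2 mulN1r opprK mul1r -IntZ; last first.
  exact/Rint_coef/torus_Rint/(Ck_torus pf Cf).
have -> : partials [:: i; i] (hartley k) =
    fun x => hcoef [:: i; i] k * hartley (hsign 2 k) x := partials_hartley [:: i; i] k.
congr Int; apply/funext => x.
by rewrite /hsign /= /hsign /= mxE rmorphN/=; ring.
Qed.

Lemma Ck_laplacian j f : Ck j.+2 f -> Ck j (laplacian f).
Proof. by move=> Cf; apply: Ck_sum => i; apply: (@Ck_partials _ _ _ _ [:: i; i]). Qed.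

Lemma zperiodic_laplacian f : zperiodic f -> zperiodic (laplacian f).
Proof.
move=> pf x i; apply: eq_bigr => j _.
exact: (@zperiodic_partials _ _ f [:: j; j] pf x i).
Qed.

Lemma Ck_iter_laplacian n j f : (forall l, Ck l f) -> Ck j (iter n laplacian f).
Proof. by move=> Cf; elim: n j => [//|n IH] j /=; apply: Ck_laplacian. Qed.

Lemma zperiodic_iter_laplacian n f : zperiodic f -> zperiodic (iter n laplacian f).
Proof. by move=> pf; elim: n => [//|n IH] /=; exact: zperiodic_laplacian. Qed.

Lemma coef_iter_laplacian n f k : zperiodic f -> (forall j, Ck j f) ->
  coef (iter n laplacian f) k = (- lap_eig k) ^+ n * coef f k.
Proof.
move=> pf Cf; elim: n => [|n IH]; first by rewrite mul1r.
rewrite iterS coef_laplacian ?IH ?exprS ?mulrA//.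
  exact: zperiodic_iter_laplacian.
exact: Ck_iter_laplacian.
Qed.

Lemma lap_eig_ge0 k : 0 <= lap_eig k.
Proof. by apply: sumr_ge0 => i _; exact: sqr_ge0. Qed.

(** The exponent 2N is even, so the sign of the Laplacian disappears from its power and both
    summands are nonnegative. *)
Definition reg_eig (N : nat) (e1 e2 : R) k : R :=
  e1 * (1 + lap_eig k ^+ (2 * N)) + e2 * (1 + lap_eig k).

(** This bound has two uses: the energy dominates the squared W^{2N,2} norm, and division by an
    eigenvalue gains 4N derivatives. *)
Lemma reg_eig_ge N e1 e2 k : 0 <= e1 -> 0 <= e2 ->
  e1 * wt k ^+ (2 * (2 * N)) <= d.+1%:R ^+ (2 * (2 * N)).+1 * reg_eig N e1 e2 k.
Proof.
move=> e10 e20.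
have L : wt k ^+ (2 * (2 * N)) <= d.+1%:R ^+ (2 * (2 * N)).+1 * (1 + lap_eig k ^+ (2 * N)).
  apply: le_trans (wt_pow_le _ _) _.
  rewrite exprSr -mulrA; apply: ler_wpM2l; first exact: exprn_ge0.
  have H : \sum_i (k ord0 i)%:~R ^+ (2 * (2 * N)) <= \sum_(i < d) lap_eig k ^+ (2 * N).
    apply: ler_sum => i _; rewrite exprM; apply: lerXn2r; rewrite ?nnegrE ?sqr_ge0 ?lap_eig_ge0//.
    rewrite /lap_eig (bigD1 i)//=.
    have : 0 <= \sum_(j < d | j != i) (2 * pi * (k ord0 j)%:~R : R) ^+ 2.
      by apply: sumr_ge0 => j _; exact: sqr_ge0.
    have : (k ord0 i)%:~R ^+ 2 <= (2 * pi * (k ord0 i)%:~R : R) ^+ 2.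
      rewrite [leRHS]exprMn ler_peMl ?sqr_ge0// -[leLHS](expr1n _ 2) lerXn2r ?nnegrE//.
        by rewrite mulr_ge0 ?pi_ge0.
      have := pihalf_ge1 R; lra.
    lra.
  rewrite sumr_const card_ord -mulr_natl in H.
  have h0 : 0 <= lap_eig k ^+ (2 * N) by rewrite exprn_ge0 ?lap_eig_ge0.
  rewrite -natr1 mulrDl mul1r.
  have : 0 <= d%:R :> R by [].
  nra.
apply: (@le_trans _ _ (e1 * (d.+1%:R ^+ (2 * (2 * N)).+1 * (1 + lap_eig k ^+ (2 * N))))).
  exact: ler_wpM2l.
rewrite mulrCA; apply: ler_wpM2l; first exact: exprn_ge0.
by rewrite /reg_eig lerDl mulr_ge0// addr_ge0// lap_eig_ge0.
Qed.

Lemma reg_eig_gt0 N e1 e2 k : 0 < e1 -> 0 < e2 -> 0 < reg_eig N e1 e2 k.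
Proof.
move=> e10 e20; apply: addr_gt0; apply: mulr_gt0 => //; rewrite ltr_pwDl//.
  by rewrite exprn_ge0 ?lap_eig_ge0.
exact: lap_eig_ge0.
Qed.

Lemma coef_reg N e1 e2 f k : zperiodic f -> (forall j, Ck j f) ->
  coef (fun x => e1 * (f x + iter (2 * N) laplacian f x) + e2 * (f x - laplacian f x)) k =
  reg_eig N e1 e2 k * coef f k.
Proof.
move=> pf Cf.
have If : integrableR f by exact/torus_Rint/(Ck_torus pf (Cf 0%N)).
have Il : integrableR (laplacian f).
  by apply/torus_Rint/(@Ck_torus _ _ 0%N); [exact: zperiodic_laplacian|exact: Ck_laplacian].
have Ii : integrableR (iter (2 * N) laplacian f).
  apply/torus_Rint/(@Ck_torus _ _ 0%N); first exact: zperiodic_iter_laplacian.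
  exact: Ck_iter_laplacian.
rewrite fcoefD; last 2 first.
- by apply: RintZ; exact: RintD.
- by apply: RintZ; exact: RintB.
rewrite !fcoefZ; [|exact: RintB|exact: RintD].
rewrite fcoefB// fcoefD// coef_iter_laplacian// coef_laplacian// exprM sqrrN -exprM.
by rewrite /reg_eig; ring.
Qed.

End Spectrum.

(** * The penalty as a superposition operator *)

Section Penalty.
Context {R : realType} {d : nat} (b : R -> R).
Hypothesis sb : smooth_open [set s : R^o | 0 < s] b.
Implicit Types (m : 'rV[R]_d -> R).

(** The penalty is read on row vectors of length 1, so that [Ck_comp] and [ucvg_comp_torus] apply to
    it. *)
Let scalar_dec (z : 'rV[R]_1) : R^o := z ord0 ord0.

Let positive_scalars : set 'rV[R]_1 := [set z | 0 < z ord0 ord0].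

Let open_positive_scalars : open positive_scalars.
Proof.
apply: (@open_comp _ _ (fun z : 'rV[R]_1 => z ord0 ord0) [set y : R | 0 < y]).
  by move=> z _; exact: continuous_coord.
exact: open_gt.
Qed.

Let smooth_scalar : smooth_part positive_scalars (b \o scalar_dec).
Proof.
apply: (@smooth_open_comp_linear _ R^o _ scalar_dec _ _ _ _ sb).
  by move=> a u v; rewrite /scalar_dec !mxE.
by move=> z; exact: continuous_coord.
Qed.

Let scalarE m : b \o m = (b \o scalar_dec) \o (fun x => (m x)%:M).
Proof. by apply/funext => x /=; rewrite /scalar_dec mxE eqxx mulr1n. Qed.

Lemma Ck_penalty j m : (forall x, 0 < m x) -> Ck j m -> Ck j (b \o m).
Proof.
move=> m0 Cm; rewrite scalarE; apply: (Ck_comp open_positive_scalars smooth_scalar).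
  by move=> x; rewrite /positive_scalars/= mxE eqxx mulr1n.
by move=> a; rewrite (ord1 a); under eq_fun do rewrite mxE eqxx mulr1n.
Qed.

Lemma ucvg_penalty (T : Type) (U : set_system T) {FU : Filter U} m
    (mt : T -> 'rV[R]_d -> R) : (forall x, 0 < m x) -> torus_continuous m ->
  (forall t, zperiodic (mt t)) -> ucvg U mt m ->
  ucvg U (fun t => b \o mt t) (b \o m).
Proof.
move=> m0 [pm cm] pmt um; rewrite scalarE.
rewrite (_ : (fun t => b \o mt t) = fun t => (b \o scalar_dec) \o (fun x => (mt t x)%:M)); last first.
  by apply/funext => t; exact: scalarE.
apply: (@ucvg_comp_torus _ _ _ _ _ _ _ positive_scalars).
- by move=> y Oy; have [] := smooth_scalar [::] Oy.
- by move=> x; rewrite /positive_scalars/= mxE eqxx mulr1n.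
- move=> x; apply: continuous_rowP => i; rewrite (ord1 i).
  by apply: eq_continuous_for (cm x) => y; rewrite mxE eqxx mulr1n.
- move=> i e e0; apply: filterS (um _ e0) => t Ht x.
  by rewrite (ord1 i) 2!mxE eqxx !mulr1n; exact: Ht.
- by rewrite -scalarE => x i /=; rewrite pm.
- by apply: nearW => t; rewrite -scalarE => x i /=; rewrite pmt.
Qed.

End Penalty.

(** * Continuity of the operator h *)

Section Operator.
Context {R : realType} {d : nat} (h : ('rV[R]_d -> R) -> 'rV[R]_d -> R).
Hypotheses (hop : Mac_operator h) (hreg : h_regularity h).
Implicit Types (m : 'rV[R]_d -> R).

Lemma torus_Mac m : torus_continuous m -> (forall x, 0 <= m x) -> Mac m.
Proof. by move=> tm m0; split=> //; [have [] := tm|exact: torus_Rint]. Qed.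

Lemma torus_operator m : torus_continuous m -> (forall x, 0 <= m x) -> torus_continuous (h m).
Proof. by move=> tm m0; apply: hop.1; exact: torus_Mac. Qed.

Lemma half_dim s : d%:R / 2 + 1 < s%:R :> R -> (d.+1 <= 2 * s)%N.
Proof.
move=> ds; rewrite -(ler_nat R) natrM -natr1; lra.
Qed.

Lemma operator_Wle s m C : d%:R / 2 + 1 < s%:R :> R -> torus_continuous m ->
  (forall x, 0 <= m x) -> Wle s (coef m) C -> exists C', Wle s (coef (h m)) C'.
Proof.
move=> ds tm m0 Wm; have [sm _] := Wle_sobolev (half_dim ds) tm Wm.
by eexists; apply: sobolev_coef; exact: (hreg ds).1.
Qed.

Lemma sobolev_Rint s f : sobolev s (2 : R) f -> @integrableR R d f.
Proof.
by move=> [_ f2 _]; apply: Rint_sqr; [exact: Lfun2_measurable|exact: Lfun2_integrable_sqr].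
Qed.

(** Differentiability at m with tolerance 1 bounds h(mt) - h(m) in W^{s,2} by the norms of f = mt -
    m and of its image under the bounded derivative; the Sobolev embedding makes the bound uniform
    in x. *)
Lemma operator_ucvg (T : Type) (U : set_system T) {FU : Filter U} s m C
    (mt : T -> 'rV[R]_d -> R) : d%:R / 2 + 1 < s%:R :> R ->
  torus_continuous m -> (forall x, 0 <= m x) -> Wle s (coef m) C ->
  (forall t, torus_continuous (mt t)) -> (forall t x, 0 <= mt t x) ->
  (forall t, exists C, Wle s (coef (mt t)) C) ->
  (forall eps : R, 0 < eps -> \forall t \near U, Wle s (coef (fun x => mt t x - m x)) eps) ->
  ucvg U (fun t => h (mt t)) (h m).
Proof.
move=> ds tm m0 Wm tmt mt0 Wmt W e e0.
have ds' := half_dim ds.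
have [sm _] := Wle_sobolev ds' tm Wm.
have [hs fr] := hreg ds.
have [L [Ls _ [CL HL] Hfr]] := fr m sm m0.
have [delta dl0 Hd] := Hfr 1 ltr01.
pose K : R := d.+1%:R ^+ (2 * s).+1.
have K0 : 0 < K by rewrite exprn_gt0.
pose S : R := @sobolev_const R d s.
have S0 : 0 <= S.
  apply: sumr_ge0 => i _; apply: sumr_ge0 => j _.
  by rewrite mulr_ge0// exprn_ge0// mulr_ge0// pi_ge0.
(* [K] converts W^{s,2} norms to coefficients and [S] converts back; the factor 2 comes from
   squaring a sum. Thus the coefficients of h(mt) - h(m) are bounded by Q S eta, at most a^2, and a
   is chosen so that the embedding constant 2 * 2^d times a is e. *)
pose Q := 2 * K * (1 + CL ^+ 2).
have Q0 : 0 <= Q by rewrite mulr_ge0 ?mulr_ge0 ?(ltW K0)// addr_ge0// sqr_ge0.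
pose M := Q * S + S + 1.
have M0 : 0 < M by rewrite ltr_wpDl// addr_ge0// mulr_ge0.
pose a := e / 2 ^+ d.+1.
have a0 : 0 < a by rewrite divr_gt0// exprn_gt0.
pose eta := Num.min (a ^+ 2) (delta ^+ 2 / 2) / M.
have eta0 : 0 < eta by rewrite divr_gt0// lt_min exprn_gt0//= divr_gt0// exprn_gt0.
have eM1 : M * eta <= a ^+ 2.
  by rewrite /eta mulrC divfK ?gt_eqF// ge_min lexx.
have eM2 : M * eta <= delta ^+ 2 / 2.
  by rewrite /eta mulrC divfK ?gt_eqF// ge_min lexx orbT.
have SM : S * eta <= M * eta.
  by rewrite ler_wpM2r ?(ltW eta0)// /M -addrA addrCA lerDl addr_ge0// mulr_ge0.
have QM : Q * (S * eta) <= M * eta.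
  by rewrite mulrA ler_wpM2r ?(ltW eta0)// /M -addrA lerDl addr_ge0.
apply: filterS (W _ eta0) => t Wt x.
pose f := mt t \- m.
have [Ct Wmtt] := Wmt t.
have [smt _] := Wle_sobolev ds' (tmt t) Wmtt.
have [sf nf] := Wle_sobolev ds' (torusB (tmt t) tm) Wt.
have Se0 : 0 <= S * eta by rewrite mulr_ge0// ltW.
have nf2 : sobolev2_norm s f ^+ 2 <= S * eta.
  by rewrite -(sqr_sqrtr Se0) lerXn2r ?nnegrE ?sqrtr_ge0.
have nfd : sobolev2_norm s f < delta.
  rewrite ltNge; apply/negP => hd.
  have : delta ^+ 2 <= sobolev2_norm s f ^+ 2.
    by rewrite lerXn2r ?nnegrE ?sqrtr_ge0 ?(ltW dl0).
  have : 0 < delta ^+ 2 by rewrite exprn_gt0.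
  by move=> ? ?; lra.
pose r := (h (mt t) \- h m) \- L f.
have nr : sobolev2_norm s r <= sobolev2_norm s f.
  by rewrite -[leRHS]mul1r; apply: Hd => //; exact: mt0.
have shd : sobolev s 2 (h (mt t) \- h m).
  by apply: sobolevB; apply: hs => //; exact: mt0.
have sr : sobolev s 2 r by apply: sobolevB => //; exact: Ls.
have Wr := sobolev_coef sr; have WL := sobolev_coef (Ls _ sf).
have Wg : Wle s (coef (fun x => h (mt t) x - h m x)) (a ^+ 2).
  rewrite (_ : coef _ = fun k => coef r k + coef (L f) k); last first.
    apply/funext => k; rewrite -fcoefD; [|exact: sobolev_Rint sr|exact: sobolev_Rint (Ls _ sf)].
    by congr coef; apply/funext => y; rewrite /r /= subrK.
  apply: Wle_le (WleD Wr WL); rewrite -/K.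
  have h1 : sobolev2_norm s r ^+ 2 <= S * eta.
    by apply: le_trans nf2; rewrite lerXn2r ?nnegrE ?sqrtr_ge0.
  have h2 : sobolev2_norm s (L f) ^+ 2 <= CL ^+ 2 * (S * eta).
    apply: (@le_trans _ _ ((CL * sobolev2_norm s f) ^+ 2)).
      rewrite lerXn2r ?nnegrE ?sqrtr_ge0//; last exact: HL.
      by apply: le_trans (HL _ sf); exact: sqrtr_ge0.
    by rewrite exprMn; apply: ler_wpM2l; [exact: sqr_ge0|exact: nf2].
  apply: le_trans eM1; apply: le_trans QM.
  have -> : Q * (S * eta) = 2 * (K * (S * eta)) + 2 * (K * (CL ^+ 2 * (S * eta))).
    by rewrite /Q; ring.
  by rewrite lerD// ler_wpM2l// ler_wpM2l// ltW.
have tg : torus_continuous (fun x => h (mt t) x - h m x).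
  by apply: torusB; apply: torus_operator => //; exact: mt0.
have dj : (d.+1 + 2 * 0 <= 2 * s)%N by rewrite muln0 addn0.
have [_ _ /(_ [::] x isT)] := sobolev_embedding dj tg Wg.
rewrite /= expr0 mulr1 sqrtr_sqr (gtr0_norm a0) => H; apply: le_trans H _.
have p0 : 0 < 2 ^+ d :> R by rewrite exprn_gt0.
rewrite (_ : 2 * (a * 2 ^+ d) = e)// /a exprS; field; exact: lt0r_neq0.
Qed.

End Operator.

(** * Weak form of the system *)

Section Forms.
Context {R : realType} {d : nat} (E : set R)
  (H : 'rV[R]_d -> 'rV[R]_d -> 'M[R]_d -> R -> R -> R)
  (h : ('rV[R]_d -> R) -> 'rV[R]_d -> R) (b : R -> R).
Hypotheses (EP : forall s, 0 < s -> E s) (tH : torus_Ham E H) (sH : ham_smooth H)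
  (hop : Mac_operator h) (hreg : h_regularity h)
  (sb : smooth_open [set s : R^o | 0 < s] b).
Implicit Types (m u psi : 'rV[R]_d -> R).

Lemma torus_along F m u : torus_Ham E F -> ham_smooth F -> torus_continuous m ->
  (forall x, 0 < m x) -> zperiodic u -> Ck 2 u -> torus_continuous (along F h m u).
Proof.
move=> tF sF tm m0 pu Cu.
have th : torus_continuous (h m) by apply: (torus_operator hop) => // x; exact: ltW.
split.
  by apply: (zperiodic_ham tF) => //; [move=> x; exact: EP|exact: tm.1|exact: th.1].
apply: (@Ck_continuous _ _ 0%N); apply: (Ck_ham sF m0) => //; split=> //; [exact: tm.2|exact: th.2].
Qed.

(** The first equation without its linear regularization, which is diagonal on coefficients and
    handled separately. *)
Definition reduced1 m u : 'rV[R]_d -> R := fun x => A1 H h m u x + b (m x).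

(* The second equation tested against psi, with its derivatives moved to psi. *)
Definition weak2_density m u psi : 'rV[R]_d -> R :=
  fun x => (m x - 1) * psi x
    + \sum_i m x * along (DpH H i) h m u x * partial i psi x
    + \sum_i \sum_j m x * along (DMH H i j) h m u x * partials [:: i; j] psi x.

Definition weak2 m u psi : R := Int (weak2_density m u psi).

Lemma torus_reduced1 m u : torus_continuous m -> (forall x, 0 < m x) ->
  zperiodic u -> Ck 2 u -> torus_continuous (reduced1 m u).
Proof.
move=> tm m0 pu Cu; apply: torusD.
  by apply: torusB; [apply: torusN; exact: Ck_torus Cu|exact: torus_along].
split; first by move=> x i; rewrite (tm.1 x i).
apply: (@Ck_continuous _ _ 0%N); apply: (Ck_penalty sb m0).
by split=> //; exact: tm.2.
Qed.

Lemma torus_weak2 m u psi : torus_continuous m -> (forall x, 0 < m x) ->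
  zperiodic u -> Ck 2 u -> zperiodic psi -> Ck 2 psi ->
  torus_continuous (weak2_density m u psi).
Proof.
move=> tm m0 pu Cu pp Cp; apply: torusD; first apply: torusD.
- by apply: torusM; [apply: torusB => //; exact: torus_cst|exact: Ck_torus Cp].
- apply: torus_sum => i; apply: torusM; last exact: (torus_partials (s := [:: i]) pp Cp).
  exact: torusM tm (torus_along (torus_Ham_Dp i tH) (ham_smooth_Dp i sH) tm m0 pu Cu).
- apply: torus_sum => i; apply: torus_sum => j.
  apply: torusM; last exact: (torus_partials (s := [:: i; j]) pp Cp).
  exact: torusM tm (torus_along (torus_Ham_DM i j tH) (ham_smooth_DM i j sH) tm m0 pu Cu).
Qed.

Section Limit.
Context (T : Type) (U : set_system T) {FU : ProperFilter U} (s : nat) (m u : 'rV[R]_d -> R)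
  (mt ut : T -> 'rV[R]_d -> R) (C : R).
Hypotheses (ds : d%:R / 2 + 1 < s%:R :> R) (ds2 : (d.+1 + 2 * 2 <= 2 * s)%N).
Hypotheses (tm : torus_continuous m) (tu : torus_continuous u) (m0 : forall x, 0 < m x)
  (Wm : Wle s (coef m) C) (Wu : Wle s (coef u) C).
Hypotheses (tmt : forall t, torus_continuous (mt t)) (tut : forall t, torus_continuous (ut t))
  (mt0 : forall t x, 0 < mt t x)
  (Wmt : forall t, exists C, Wle s (coef (mt t)) C)
  (Wut : forall t, exists C, Wle s (coef (ut t)) C)
  (mtm : forall eps : R, 0 < eps -> \forall t \near U, Wle s (coef (fun x => mt t x - m x)) eps)
  (utu : forall eps : R, 0 < eps -> \forall t \near U, Wle s (coef (fun x => ut t x - u x)) eps).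

Let Wucvg f (ft : T -> 'rV[R]_d -> R) Cf r :
  torus_continuous f -> Wle s (coef f) Cf -> (forall t, torus_continuous (ft t)) ->
  (forall t, exists C, Wle s (coef (ft t)) C) ->
  (forall eps : R, 0 < eps -> \forall t \near U, Wle s (coef (fun x => ft t x - f x)) eps) ->
  (size r <= 2)%N -> ucvg U (fun t => partials r (ft t)) (partials r f).
Proof.
move=> tf Wf tft Wft W sr e e0.
pose K : R := 2 * (2 * pi) ^+ size r * 2 ^+ d.
have K0 : 0 < K by rewrite !mulr_gt0 ?exprn_gt0// mulr_gt0// pi_gt0.
have eK0 : 0 < (e / K) ^+ 2 by rewrite exprn_gt0// divr_gt0.
apply: filterS (W _ eK0) => t Wt x.
have [Ct Wftt] := Wft t.
have [Cf2 _ _] := sobolev_embedding ds2 tf Wf.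
have [Cft2 _ _] := sobolev_embedding ds2 (tft t) Wftt.
have [_ _ /(_ r x sr)] := sobolev_embedding ds2 (torusB (tft t) tf) Wt.
have eK : 0 <= e / K by rewrite divr_ge0 ?ltW.
rewrite (partialsB sr Cft2 Cf2) sqrtr_sqr (ger0_norm eK) => L; apply: (le_trans L).
rewrite (_ : 2 * (2 * pi) ^+ size r * (e / K * 2 ^+ d) = e / K * K); last by rewrite /K; ring.
by rewrite divfK ?gt_eqF.
Qed.

Let Cu2 : Ck 2 u. Proof. by have [] := sobolev_embedding ds2 tu Wu. Qed.

Let Cut2 t : Ck 2 (ut t).
Proof. by have [C' W] := Wut t; have [] := sobolev_embedding ds2 (tut t) W. Qed.

Let um : ucvg U mt m. Proof. exact: (Wucvg (r := [::]) tm Wm). Qed.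

Let along_ucvg F : torus_Ham E F -> ham_smooth F ->
  ucvg U (fun t => along F h (mt t) (ut t)) (along F h m u).
Proof.
move=> tF sF.
apply: (ucvg_ham EP tF sF m0 tm tu.1 Cu2) => //.
- by apply: (torus_operator hop) => // x; exact: ltW.
- apply: nearW => t; split=> //; [exact: (tmt t).1|exact: (tut t).1|].
  by apply: (torus_operator hop _ _).1 => // x; exact: ltW.
- by move=> r sr; exact: (Wucvg tu Wu).
- apply: (operator_ucvg hop hreg ds tm _ Wm) => //; first by move=> x; exact: ltW.
  by move=> t x; exact: ltW.
Qed.

(** The filter is arbitrary because this serves twice: for hemicontinuity of the Galerkin form along
    segments, and for the passage to the limit along the ultrafilter. *)
Lemma reduced1_cvg k :
  (fun t => coef (reduced1 (mt t) (ut t)) k) @ U --> coef (reduced1 m u) k.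
Proof.
apply: ucvg_Int.
- move=> t; apply: Rint_coef; apply: torus_Rint.
  by apply: torus_reduced1; [exact: tmt|exact: mt0|exact: (tut t).1|exact: Cut2].
- apply: Rint_coef; apply: torus_Rint.
  by apply: torus_reduced1; [exact: tm|exact: m0|exact: tu.1|exact: Cu2].
apply: (ucvg_mulr (M := 2)); first exact: hartley_bound.
apply: ucvgD; last by apply: (ucvg_penalty sb) => // t; exact: (tmt t).1.
apply: ucvgB; last exact: along_ucvg.
by apply: ucvgN; exact: (Wucvg (r := [::]) tu Wu).
Qed.

Lemma weak2_cvg psi : zperiodic psi -> Ck 2 psi ->
  (fun t => weak2 (mt t) (ut t) psi) @ U --> weak2 m u psi.
Proof.
move=> pp Cp; apply: ucvg_Int.
- move=> t; apply: torus_Rint.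
  by apply: torus_weak2; [exact: tmt|exact: mt0|exact: (tut t).1|exact: Cut2|exact: pp|exact: Cp].
- apply: torus_Rint.
  by apply: torus_weak2; [exact: tm|exact: m0|exact: tu.1|exact: Cu2|exact: pp|exact: Cp].
have mulp f ft p : torus_continuous p -> ucvg U ft f ->
    ucvg U (fun t x => ft t x * p x) (fun x => f x * p x).
  by move=> tp; have [M HM] := periodic_bounded tp; exact: ucvg_mulr.
have mulm F : torus_Ham E F -> ham_smooth F ->
    ucvg U (fun t x => mt t x * along F h (mt t) (ut t) x) (fun x => m x * along F h m u x).
  move=> tF sF.
  have [M1 HM1] := periodic_bounded tm.
  have [M2 HM2] := periodic_bounded (torus_along tF sF tm m0 tu.1 Cu2).
  apply: (ucvgM (M := Num.max M1 M2)) => //; last exact: along_ucvg.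
    by move=> x; rewrite le_max HM1.
  by move=> x; rewrite le_max HM2 orbT.
apply: ucvgD; first apply: ucvgD.
- apply: mulp; first exact: Ck_torus Cp.
  by apply: ucvgB => //; exact: ucvg_cst.
- apply: ucvg_sum => i; apply: mulp; first exact: (torus_partials (s := [:: i]) pp Cp).
  by apply: mulm; [exact: torus_Ham_Dp|exact: ham_smooth_Dp].
- apply: ucvg_sum => i; apply: ucvg_sum => j.
  apply: mulp; first exact: (torus_partials (s := [:: i; j]) pp Cp).
  by apply: mulm; [exact: torus_Ham_DM|exact: ham_smooth_DM].
Qed.

End Limit.

End Forms.

(** * The tested form for smooth pairs *)

Section Smooth.
Context {R : realType} {d : nat} (E : set R)
  (H : 'rV[R]_d -> 'rV[R]_d -> 'M[R]_d -> R -> R -> R)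
  (h : ('rV[R]_d -> R) -> 'rV[R]_d -> R) (b : R -> R).
Hypotheses (EP : forall s, 0 < s -> E s) (tH : torus_Ham E H) (sH : ham_smooth H)
  (hop : Mac_operator h) (hreg : h_regularity h)
  (sb : smooth_open [set s : R^o | 0 < s] b).
Implicit Types (m u psi : 'rV[R]_d -> R).

(** A smooth m lies in every W^{s,2}, hence so does h(m); s = d + 2 + j exceeds d/2 + 1 and gives an
    embedding into C^j. *)
Lemma operator_Ck m j : zperiodic m -> (forall j, Ck j m) -> (forall x, 0 <= m x) -> Ck j (h m).
Proof.
move=> pm Cm m0.
have tm : torus_continuous m := Ck_torus pm (Cm 0%N).
pose s := (d + 2 + j)%N.
have ds : d%:R / 2 + 1 < s%:R :> R.
  rewrite /s !natrD; have : 0 <= d%:R :> R by []; have : 0 <= j%:R :> R by []; lra.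
have [C W] := Ck_Wle pm (Cm s).
have [C' W'] := operator_Wle hreg ds tm m0 W.
have th := torus_operator hop tm m0.
by have [|] := @sobolev_embedding _ _ s j _ _ _ th W'; first by rewrite /s; lia.
Qed.

(** Undoes the integrations by parts. The mixed derivatives in [A2] occur in the reversed order that
    [torus_by_parts_seq] produces. *)
Lemma weak2_A2 m u psi : (forall j, Ck j m) -> zperiodic m -> (forall x, 0 < m x) ->
  (forall j, Ck j u) -> zperiodic u -> (forall j, Ck j psi) -> zperiodic psi ->
  weak2 H h m u psi = Int (fun x => A2 H h m u x * psi x) /\
  torus_continuous (A2 H h m u).
Proof.
move=> Cm pm m0 Cu pu Cp pp.
have tm : torus_continuous m := Ck_torus pm (Cm 0%N).
have Ch j : Ck j (h m) by apply: operator_Ck => // x; exact: ltW.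
have CF F j : ham_smooth F -> Ck j (fun x => m x * along F h m u x).
  by move=> sF; apply: CkM => //; exact: Ck_ham.
have PF F : torus_Ham E F -> zperiodic (fun x => m x * along F h m u x).
  move=> tF x i; rewrite pm; congr (_ * _).
  apply: (zperiodic_ham tF) => //; first by move=> y; exact: EP.
  by apply: (torus_operator hop _ _).1 => // y; exact: ltW.
have tp : torus_continuous psi := Ck_torus pp (Cp 0%N).
have S1 i := ham_smooth_Dp i sH. have S2 i j := ham_smooth_DM i j sH.
have T1 i := torus_Ham_Dp i tH. have T2 i j := torus_Ham_DM i j tH.
pose F1 i := fun x => m x * along (DpH H i) h m u x.
pose F2 i j := fun x => m x * along (DMH H i j) h m u x.
have t1 i : torus_continuous (partial i (F1 i)).
  exact: (torus_partials (j := 1) (s := [:: i]) (PF _ (T1 i)) (CF _ 1%N (S1 i)) isT).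
have t2 i j : torus_continuous (partials [:: j; i] (F2 i j)).
  exact: (torus_partials (j := 2) (s := [:: j; i]) (PF _ (T2 i j)) (CF _ 2%N (S2 i j)) isT).
have tA : torus_continuous (A2 H h m u).
  apply: torusB; last exact: torus_cst.
  apply: torusD; first exact: torusB tm (torus_sum _ t1).
  by apply: torus_sum => i; exact: torus_sum _ (t2 i).
split=> //.
have Rm f : torus_continuous f -> integrableR (fun x => f x * psi x).
  by move=> tf; apply: Rint_mult => //; exact: torus_Rint.
have R1 i : integrableR (fun x => F1 i x * partial i psi x).
  apply: Rint_mult; first exact: torus_Rint (Ck_torus (PF _ (T1 i)) (CF _ 0%N (S1 i))).
  exact: (torus_partials (j := 1) (s := [:: i]) pp).
have R2 i j : integrableR (fun x => F2 i j x * partials [:: i; j] psi x).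
  apply: Rint_mult; first exact: torus_Rint (Ck_torus (PF _ (T2 i j)) (CF _ 0%N (S2 i j))).
  exact: (torus_partials (j := 2) (s := [:: i; j]) pp).
have R0 : integrableR (fun x => (m x - 1) * psi x).
  by apply: Rm; apply: torusB => //; exact: torus_cst.
transitivity (Int (fun x => (m x - 1) * psi x)
  + \sum_i Int (fun x => F1 i x * partial i psi x)
  + \sum_i \sum_j Int (fun x => F2 i j x * partials [:: i; j] psi x)).
  have Q1 : integrableR (fun x => \sum_i F1 i x * partial i psi x) by exact: Rint_sum.
  have Q2 i : integrableR (fun x => \sum_j F2 i j x * partials [:: i; j] psi x).
    by apply: Rint_sum => j; exact: R2.
  transitivity (Int (fun x => (m x - 1) * psi x + \sum_i F1 i x * partial i psi x
      + \sum_i \sum_j F2 i j x * partials [:: i; j] psi x)); first by [].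
  rewrite IntD; [|exact: RintD|by apply: Rint_sum => i; exact: Q2].
  rewrite IntD// Int_sum// Int_sum; last exact: Q2.
  by congr (_ + _); apply: eq_bigr => i _; rewrite Int_sum// => j; exact: R2.
transitivity (Int (fun x => (m x - 1) * psi x)
  - \sum_i Int (fun x => partial i (F1 i) x * psi x)
  + \sum_i \sum_j Int (fun x => partials [:: j; i] (F2 i j) x * psi x)).
  congr (_ + _ + _).
    rewrite -sumrN; apply: eq_bigr => i _.
    exact: torus_by_parts (PF _ (T1 i)) pp (CF _ 1%N (S1 i)) (Cp 1%N).
  apply: eq_bigr => i _; apply: eq_bigr => j _.
  have IBP := torus_by_parts_seq (s := [:: i; j]) (PF _ (T2 i j)) pp (CF _ 2%N (S2 i j)) (Cp 2%N).
  by apply: (etrans IBP); rewrite expr2 mulN1r opprK mul1r.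
rewrite (_ : (fun x => A2 H h m u x * psi x) = fun x => (m x - 1) * psi x
  - \sum_i partial i (F1 i) x * psi x
  + \sum_i \sum_j partials [:: j; i] (F2 i j) x * psi x); last first.
  apply/funext => x; rewrite -mulr_suml.
  under [X in _ + X]eq_bigr do rewrite -mulr_suml.
  rewrite -mulr_suml /A2; set a := \sum_i _; set c := \sum_i _.
  by move: a c => a c; ring.
rewrite IntD; last 2 first.
- by apply: RintB => //; apply: Rint_sum => i; exact: Rm.
- by apply: Rint_sum => i; apply: Rint_sum => j; exact: Rm.
rewrite IntB//; last by apply: Rint_sum => i; exact: Rm.
rewrite Int_sum; last by move=> i; exact: Rm.
rewrite Int_sum; last by move=> i; apply: Rint_sum => j; exact: Rm.
by congr (_ + _); apply: eq_bigr => i _; rewrite Int_sum// => j; exact: Rm.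
Qed.

(** For smooth pairs the tested form is the pairing with the strong operator, to which the
    monotonicity hypothesis applies; the nondecreasing penalty adds a nonnegative term. *)
Lemma forms_monotone m u m' u' : monotonicity E h H ->
  (forall s s', 0 < s -> s <= s' -> b s <= b s') ->
  torus_smooth m -> (forall x, 0 < m x) -> torus_smooth u ->
  torus_smooth m' -> (forall x, 0 < m' x) -> torus_smooth u' ->
  0 <= Int (fun x => (reduced1 H h b m u x - reduced1 H h b m' u' x) * (m x - m' x))
     + (weak2 H h m u (fun x => u x - u' x) - weak2 H h m' u' (fun x => u x - u' x)).
Proof.
move=> mono bmono sm m0 su sm' m0' su'.
have Cm j : Ck j m := torus_smooth_Ck j sm.
have Cu j : Ck j u := torus_smooth_Ck j su.
have Cm' j : Ck j m' := torus_smooth_Ck j sm'.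
have Cu' j : Ck j u' := torus_smooth_Ck j su'.
have tm : torus_continuous m := torus_smooth_continuous sm.
have tm' : torus_continuous m' := torus_smooth_continuous sm'.
have tu : torus_continuous u := torus_smooth_continuous su.
have tu' : torus_continuous u' := torus_smooth_continuous su'.
have Cp j : Ck j (fun x => u x - u' x) by exact: CkB.
have pp : zperiodic (fun x => u x - u' x) by move=> x i; rewrite (tu.1 x i) (tu'.1 x i).
have [-> tA] := weak2_A2 Cm tm.1 m0 Cu tu.1 Cp pp.
have [-> tA'] := weak2_A2 Cm' tm'.1 m0' Cu' tu'.1 Cp pp.
have := mono m u m' u' sm (fun x => EP (m0 x)) su sm' (fun x => EP (m0' x)) su'.
rewrite -/(Int _) -/(Int _) => mono'.
have tp := torusB tu tu'; have tmm := torusB tm tm'.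
rewrite -IntB; [|by apply/torus_Rint/torusM..].
rewrite (_ : (fun x => A2 H h m u x * _ - _) =
    fun x => (A2 H h m u x - A2 H h m' u' x) * (u x - u' x)); last first.
  by apply/funext => x; exact: esym (mulrBl _ _ _).
apply: (le_trans mono'); rewrite lerD2r.
have tr := torus_reduced1 EP tH sH hop sb tm m0 tu.1 (Cu 2%N).
have tr' := torus_reduced1 EP tH sH hop sb tm' m0' tu'.1 (Cu' 2%N).
have ta := torusB (torusN tu) (torus_along EP hop tH sH tm m0 tu.1 (Cu 2%N)).
have ta' := torusB (torusN tu') (torus_along EP hop tH sH tm' m0' tu'.1 (Cu' 2%N)).
apply: Int_le.
- by apply: torus_Rint; apply: torusM => //; exact: torusB.
- by apply: torus_Rint; apply: torusM => //; exact: torusB.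
move=> x; rewrite /reduced1.
suff : 0 <= (b (m x) - b (m' x)) * (m x - m' x) by lra.
have [le|/ltW le] := leP (m x) (m' x).
  by rewrite mulr_le0// subr_le0//; exact: bmono.
by rewrite mulr_ge0// subr_ge0//; exact: bmono.
Qed.

End Smooth.

(** * A priori bounds *)

Section Coercivity.
Context {R : realType} {d : nat} (E : set R)
  (H : 'rV[R]_d -> 'rV[R]_d -> 'M[R]_d -> R -> R -> R)
  (h : ('rV[R]_d -> R) -> 'rV[R]_d -> R) (g : 'rV[R]_d -> R -> R -> R).
Local Notation mu := (@cube_measure R d).
Hypotheses (EP : forall s, 0 < s -> E s) (tH : torus_Ham E H) (sH : ham_smooth H)
  (hop : Mac_operator h)
  (g_cont : torus_continuous_coef E g) (g_str : g_structure E h g)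
  (H_grow : H_growth E h g H).
Implicit Types (m u f : 'rV[R]_d -> R).

Lemma eintE f : integrableR f -> eint f = (Int f)%:E.
Proof.
move=> If; rewrite /eint /Int /Rintegral fineK//.
by apply: integrable_fin_num.
Qed.

Lemma Rint_has_integral f : integrableR f -> has_integral f.
Proof.
move=> If; split; first exact: Rint_measurable.
by left; apply: integrable_lty => //; exact: integrable_funepos.
Qed.

Lemma torus_at_density m : torus_continuous m -> (forall x, 0 < m x) ->
  torus_continuous (at_density g h m).
Proof.
move=> tm m0.
have th : torus_continuous (h m) by apply: (torus_operator hop tm) => x; exact: ltW.
have [pg cg] := g_cont.
split.
  move=> x i; rewrite /at_density (tm.1 x i) (th.1 x i).
  exact: (pg (m x) (h m x) (EP (m0 x))).
pose S := [set z : 'rV[R]_d * R * R | 0 < z.1.2].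
have oS : open S.
  apply: (@open_comp _ _ (fun z : 'rV[R]_d * R * R => z.1.2) [set y : R | 0 < y]); last exact: open_gt.
  move=> z _; apply: (@continuous_comp _ _ _ fst snd); first exact: cvg_fst.
  exact: cvg_snd.
have cS : {in S, continuous (fun z : 'rV[R]_d * R * R => g z.1.1 z.1.2 z.2)}.
  rewrite -continuous_open_subspace//; apply: continuous_subspaceW cg.
  by move=> z /=; exact: EP.
move=> x; apply: (@continuous_comp _ _ _ (fun x => (x, m x, h m x))
  (fun z : 'rV[R]_d * R * R => g z.1.1 z.1.2 z.2)).
  apply: continuous_pairing; last exact: th.2.
  by apply: continuous_pairing; [move=> y; exact: cvg_id|exact: tm.2].
by apply: cS; apply/mem_set; exact: m0.
Qed.

(** With delta = a / c, the integral of m g1 times a absorbs that of g1 times c, up to a constant.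
    The integral of g2 grows at most linearly in that of m, and m g2 has the good sign. *)
Lemma g_bounds (a c : R) : 0 < a -> 0 < c -> exists2 C : R, 0 <= C &
  forall m, torus_continuous m -> (forall x, 0 < m x) ->
    - C - C * Int m <= a * Int (fun x => m x * at_density g h m x)
      - c * Int (at_density g h m).
Proof.
move=> a0 c0.
have [g1 [g2 [[_ gE Hg] [[k k0 Hk] Hd [r r0 Hr]]]]] := g_str.
have dl0 : 0 < a / c by rewrite divr_gt0.
have [D D0 HD] := Hd _ dl0.
exists (c * D + c * k); first by rewrite addr_ge0// mulr_ge0// ltW.
move=> m tm m0.
have Mm : MacE E m.
  by split; [apply: torus_Mac => // x; exact: ltW|move=> x; exact: EP].
have [m1 m2 g20] := Hg m Mm.
have Im : integrableR m := torus_Rint tm.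
have tg := torus_at_density tm m0.
(* Integrability along m is derived: g2 is nonnegative almost everywhere with a finite bound on its
   integral, and g1 is the difference between the continuous g and g2. *)
have I2 : integrableR (at_density g2 h m).
  apply/integrableP; split; first exact/measurable_EFinP.
  apply: (@le_lt_trans _ _ (eint (at_density g2 h m))).
    rewrite /eint (ae_eq_integral (fun x => (at_density g2 h m x)%:E))//.
    - apply: measurableT_comp => //; exact/measurable_EFinP.
    - exact/measurable_EFinP.
    - by apply: filterS g20 => x g0 _ /=; rewrite ger0_norm.
  apply: le_lt_trans (Hk m Mm) _.
  by rewrite eintE// -EFinD -EFinM ltry.
have I1 : integrableR (at_density g1 h m).
  rewrite (_ : at_density g1 h m = fun x => at_density g h m x - at_density g2 h m x).
    by apply: RintB => //; exact: torus_Rint.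
  by apply/funext => x; rewrite /at_density gE ?addrK//; exact: EP.
have Im1 : integrableR (fun x => m x * at_density g1 h m x).
  rewrite (_ : (fun x => _) = fun x => at_density g1 h m x * m x); first exact: Rint_mult.
  by apply/funext => x; rewrite mulrC.
have Im2 : integrableR (fun x => m x * at_density g2 h m x).
  rewrite (_ : (fun x => _) = fun x => at_density g2 h m x * m x); first exact: Rint_mult.
  by apply/funext => x; rewrite mulrC.
have := Hk m Mm; rewrite !eintE// -EFinD -EFinM lee_fin => K2.
have := HD m Mm (Rint_has_integral I1) (Rint_has_integral Im1).
rewrite !eintE// -EFinM -EFinD -EFin_max lee_fin ge_max => /andP[K1 _].
have gD : at_density g h m = fun x => at_density g1 h m x + at_density g2 h m x.
  by apply/funext => x; rewrite /at_density gE//; exact: EP.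
have -> : Int (fun x => m x * at_density g h m x) =
    Int (fun x => m x * at_density g1 h m x) + Int (fun x => m x * at_density g2 h m x).
  rewrite -IntD//; congr Int; apply/funext => x.
  by rewrite gD mulrDr.
have -> : Int (at_density g h m) = Int (at_density g1 h m) + Int (at_density g2 h m).
  by rewrite -IntD// -gD.
have K3 : 0 <= Int (fun x => m x * at_density g2 h m x).
  rewrite -(@Int_cst R d 0); apply: Int_ae_le => //; first exact: Rint_cst.
  by apply: filterS g20 => x; apply: mulr_ge0; exact: ltW.
have K3a : 0 <= a * Int (fun x => m x * at_density g2 h m x) by rewrite mulr_ge0// ltW.
have K0 : 0 <= Int m by apply: Int_ge0 => x; exact: ltW.
have K1c := ler_wpM2l (ltW c0) K1; have K2c := ler_wpM2l (ltW c0) K2.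
have cac : c * (a / c * Int (fun x => m x * at_density g1 h m x) + D) =
  a * Int (fun x => m x * at_density g1 h m x) + c * D by field; exact: lt0r_neq0.
rewrite cac in K1c.
have p1 : 0 <= c * D * Int m by rewrite mulr_ge0// mulr_ge0// ltW.
lra.
Qed.

Lemma Rint_ae_eq f f' : measurable_fun setT f -> integrableR f' ->
  {ae mu, forall x, f x = f' x} -> integrableR f.
Proof.
move=> mf If' ff'; have mf' := Rint_measurable If'.
apply/integrableP; split; first exact/measurable_EFinP.
have /integrableP[_] := If'; apply: le_lt_trans.
rewrite (ae_eq_integral (fun x => `|(EFin \o f') x|%E))//.
- apply: measurableT_comp => //; exact/measurable_EFinP.
- apply: measurableT_comp => //; exact/measurable_EFinP.
- by apply: filterS ff' => x fx _ /=; rewrite fx.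
Qed.

Lemma lee_drop (x : \bar R) (r s : R) : (0 <= x)%E -> (x + r%:E <= s%:E)%E -> r <= s.
Proof. by case: x => [x| |]//; rewrite !lee_fin; lra. Qed.

Lemma growth_term_ge0 (tau gamma s : R) (p : 'rV[R]_d) : (0 <= growth_term tau gamma s p)%E.
Proof. by rewrite /growth_term mule_ge0// ?lee_fin ?powR_ge0// inve_ge0 lee_fin powR_ge0. Qed.

(** The growth condition is stated with arbitrary representatives of weak derivatives; for a
    trigonometric sum they agree almost everywhere with the classical ones. Weak second derivatives
    come with the reversed order, so symmetry of the Hessian is needed; it is read off the Hartley
    multipliers. *)
Lemma weak_jet_ae A c : let u := psum A c in
  {ae mu, forall x, wgrad u x = grad u x /\ whess u x = hess u x}.
Proof.
move=> u.
have pu : zperiodic u := zperiodic_psum A c.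
have W s : weak_partials s u (partials (rev s) u) by exact: Ck_weak_partials pu (Ck_psum _ _ _).
have Wae s v : v = partials (rev s) u -> {ae mu, forall x, wpartials s u x = v x}.
  by move=> ->; exact: weak_partials_unique (weak_partials_wpartials (W s)) (W s).
have sym i j : partials [:: i; j] u = partials [:: j; i] u.
  apply: etrans (partials_psum [:: i; j] A c) (etrans _ (esym (partials_psum [:: j; i] A c))).
  apply/funext => x; apply: eq_bigr => k _; apply: (congr1 (fun y => c k * y)).
  apply: (etrans (congr1 (@^~ x) (partials_hartley [:: i; j] k))).
  apply: (etrans _ (esym (congr1 (@^~ x) (partials_hartley [:: j; i] k)))).
  apply: (congr1 (fun y => y * _)).
  by rewrite /= /hsign /= !mxE; ring.
have W1 : {ae mu, forall x, forall i, wpartials [:: i] u x = partial i u x}.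
  by apply: near_forall => i; exact: Wae.
have W2 : {ae mu, forall x, forall i, forall j, wpartials [:: i; j] u x = partials [:: i; j] u x}.
  by apply: near_forall => i; apply: near_forall => j; apply: Wae; exact: sym.
apply: filterS2 W1 W2 => x H1 H2; split.
  by apply/rowP => i; apply: etrans (mxE _ _ _ _) (etrans (H1 i) (esym (gradE _ _ _))).
apply/matrixP => i j.
exact: etrans (mxE _ _ _ _) (etrans (H2 i j) (esym (hessE _ _ _ _))).
Qed.

(** The weak derivatives are only measurable functions, but the jets stay in the open set of
    positive densities, where the Hamiltonian is continuous. *)
Lemma measurable_weak_ham A c m : let u := psum A c in
  torus_continuous m -> (forall x, 0 < m x) ->
  measurable_fun setT (fun x => H x (wgrad u x) (whess u x) (m x) (h m x)).
Proof.
move=> u tm m0.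
have pu : zperiodic u := zperiodic_psum A c.
have mw s : measurable_fun setT (wpartials s u).
  apply: Rint_measurable.
  exact: weak_integrable (weak_partials_wpartials (Ck_weak_partials pu (Ck_psum (size s) A c))).
rewrite (_ : (fun x => _) = ham_jet H \o fun x => jet x (wgrad u x) (whess u x) (m x) (h m x)); last first.
  by apply/funext => x /=; rewrite ham_jetE.
apply: (measurable_fun_comp_open open_positive_jets).
- by move=> y Oy; have [] := @sH [::] y Oy.
- by move=> x; rewrite /positive_jets/= jet_densityE.
move=> a; have [[i jE]|[i jE]|[i [j jE]]|[jE|jE]] := @jet_coordP R d a.
- rewrite (_ : (fun x => _) = coord_rV i); first exact: measurable_coord_rV.
  by apply/funext => x; exact: jE.
- rewrite (_ : (fun x => _) = wpartials [:: i] u); first exact: mw.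
  by apply/funext => x; exact: etrans (jE _ _ _ _ _) (mxE _ _ _ _).
- rewrite (_ : (fun x => _) = wpartials [:: i; j] u); first exact: mw.
  by apply/funext => x; exact: etrans (jE _ _ _ _ _) (mxE _ _ _ _).
- rewrite (_ : (fun x => _) = m); first exact: torus_measurable.
  by apply/funext => x; exact: jE.
- rewrite (_ : (fun x => _) = h m).
    by apply: torus_measurable; apply: (torus_operator hop) => // x; exact: ltW.
  by apply/funext => x; exact: jE.
Qed.

(** The pointwise growth condition multiplied by m and integrated is added to the integral lower
    bound for H. The gradient terms are nonnegative and dropped; what remains is the combination of
    integrals of m g and g bounded by [g_bounds] with a = C2 and c = C3. *)
Lemma ham_coercive : exists2 C : R, 0 <= C & forall A c m, let u := psum A c in
  torus_continuous m -> (forall x, 0 < m x) ->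
  - C - C * Int m <=
  Int (fun x => m x * (- along H h m u x + \sum_i along (DpH H i) h m u x * partial i u x
    + \sum_i \sum_j along (DMH H i j) h m u x * partials [:: i; j] u x))
  + Int (along H h m u).
Proof.
have [gamma [tau [C1 [C2 [C3 [C4 [[gamma1 tau01 [C10 C20 C30 C40]] [Ha Hb]]]]]]]] := H_grow.
have [C C0 HC] := g_bounds C20 C30.
exists (C + C1); first by rewrite addr_ge0// ltW.
move=> A c m u tm m0.
have pu : zperiodic u := zperiodic_psum A c.
have Cu j : Ck j u := Ck_psum j A c.
have Mm : MacE E m.
  by split; [apply: torus_Mac => // x; exact: ltW|move=> x; exact: EP].
have tg := torus_at_density tm m0.
have tH' := torus_along EP hop tH sH tm m0 pu (Cu 2%N).
pose Hmu x := H x (wgrad u x) (whess u x) (m x) (h m x).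
have HmuE : {ae mu, forall x, Hmu x = along H h m u x}.
  by apply: filterS (weak_jet_ae A c) => x [e1 e2]; rewrite /Hmu e1 e2.
have mHmu : measurable_fun setT Hmu by exact: measurable_weak_ham.
have IHmu : integrableR Hmu by apply: Rint_ae_eq mHmu (torus_Rint tH') HmuE.
have su : sobolev 1 gamma u by apply: Ck_sobolev => //; exact: ltW.
have wu i j : exists v, weak_partials [:: i; j] u v.
  by eexists; exact: Ck_weak_partials pu (Cu _).
have Ig := torus_Rint tg.
(* The gradient term may a priori be infinite; finiteness of the integral of g ensures that the sum
   in the growth condition is well defined. *)
have fG : (- eint (at_density g h m))%E \is a fin_num by rewrite eintE.
have [Hb1 _] := Hb m u Mm su wu (Rint_has_integral Ig) (Rint_has_integral IHmu)
  (fin_num_adde_defr _ fG).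
move: Hb1; set W := (\int[mu]_x growth_term _ _ _ _)%E => Hb1.
have W0 : (0 <= (C1^-1)%:E * W)%E.
  rewrite mule_ge0// ?lee_fin ?invr_ge0 ?(ltW C10)//.
  by apply: integral_ge0 => x _; exact: growth_term_ge0.
have L1 : - (C3 * Int (at_density g h m)) - C1 <= Int (along H h m u).
  rewrite -(Int_ae_eq mHmu (torus_measurable tH') HmuE).
  apply: (lee_drop W0); rewrite -eintE//.
  by apply: le_trans Hb1; rewrite eintE// -EFinM -EFinN EFinB addeA [X in (X - _)%E]addeC.
have L2 : C2 * Int (fun x => m x * at_density g h m x) - C1 * Int m <=
  Int (fun x => m x * (- along H h m u x + \sum_i along (DpH H i) h m u x * partial i u x
    + \sum_i \sum_j along (DMH H i j) h m u x * partials [:: i; j] u x)).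
  have tF i := torus_along EP hop (torus_Ham_Dp i tH) (ham_smooth_Dp i sH) tm m0 pu (Cu 2%N).
  have tG i j := torus_along EP hop (torus_Ham_DM i j tH) (ham_smooth_DM i j sH) tm m0 pu (Cu 2%N).
  rewrite -!IntZ; [|exact: torus_Rint|exact/torus_Rint/torusM].
  rewrite -IntB; [|exact/torus_Rint/torusZ/torusM|exact/torus_Rint/torusZ].
  apply: Int_le.
  - by apply: torus_Rint; apply: torusB; apply: torusZ => //; exact: torusM.
  - apply: torus_Rint; apply: torusM; first exact: tm.
    apply: torusD; first apply: torusD.
    + exact: torusN tH'.
    + apply: torus_sum => i; apply: torusM; first exact: tF.
      exact: (torus_partials (s := [:: i]) pu (Cu 2%N)).
    + apply: torus_sum => i; apply: torus_sum => j; apply: torusM; first exact: tG.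
      exact: (torus_partials (s := [:: i; j]) pu (Cu 2%N)).
  move=> x; rewrite (_ : _ - _ = m x * (C2 * at_density g h m x - C1)); last by ring.
  rewrite ler_pM2l//.
  have G0 : (0 <= (C1^-1)%:E * growth_term tau gamma (m x) (grad u x))%E.
    by rewrite mule_ge0// ?growth_term_ge0// lee_fin invr_ge0 ltW.
  have := lee_drop G0 (Ha x (grad u x) (hess u x) (m x) (h m x) (EP (m0 x))).
  congr (_ <= _ + _ + _).
    by apply: eq_bigr => i _; congr (_ * _); exact: gradE.
  by apply: eq_bigr => i _; apply: eq_bigr => j _; congr (_ * _); exact: hessE.
have := HC m tm m0.
have : 0 <= C1 * Int m by rewrite mulr_ge0 ?(ltW C10)//; apply: Int_ge0 => x; exact: ltW.
by lra.
Qed.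

End Coercivity.

Section Apriori.
Context {R : realType} {d : nat} (E : set R)
  (H : 'rV[R]_d -> 'rV[R]_d -> 'M[R]_d -> R -> R -> R)
  (h : ('rV[R]_d -> R) -> 'rV[R]_d -> R) (g : 'rV[R]_d -> R -> R -> R)
  (N : nat) (q e1 e2 : R) (b : R -> R).
Local Notation freq := 'rV[int]_d.
Local Notation eig := (@reg_eig R d N e1 e2).
Hypotheses (EP : forall s, 0 < s -> E s) (tH : torus_Ham E H) (sH : ham_smooth H)
  (hop : Mac_operator h)
  (g_cont : torus_continuous_coef E g) (g_str : g_structure E h g)
  (H_grow : H_growth E h g H) (b_pen : penalty q e1 b)
  (e101 : 0 < e1 < 1) (e201 : 0 < e2 < 1).
Implicit Types (m u f : 'rV[R]_d -> R) (c : freq -> R) (A : seq freq).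

Let sb : smooth_open [set s : R^o | 0 < s] b. Proof. by have [] := b_pen. Qed.

Definition energy A c1 c2 : R := \sum_(k <- A) eig k * (c1 k ^+ 2 + c2 k ^+ 2).

Lemma eig_gt0 k : 0 < eig k.
Proof. by move: e101 e201 => /andP[? _] /andP[? _]; exact: reg_eig_gt0. Qed.

Lemma energy_ge0 A c1 c2 : 0 <= energy A c1 c2.
Proof.
apply: sumr_ge0 => k _; apply: mulr_ge0; first exact: ltW (eig_gt0 k).
by rewrite addr_ge0 ?sqr_ge0.
Qed.

Lemma torus_penalty m : torus_continuous m -> (forall x, 0 < m x) -> torus_continuous (b \o m).
Proof.
move=> tm m0; split; first by move=> x i /=; rewrite (tm.1 x i).
apply: (@Ck_continuous _ _ 0%N); apply: (Ck_penalty sb m0).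
by split=> //; exact: tm.2.
Qed.

(* The premise is the Galerkin system tested against (m - 1, u). *)
Lemma apriori_bound : exists2 B : R, 0 <= B & forall A c1 c2,
  let m := psum A c1 in let u := psum A c2 in
  uniq A -> 0 \in A -> (forall x, 0 < m x) ->
  Int (fun x => reduced1 H h b m u x * (m x - 1)) + weak2 H h m u u
    + \sum_(k <- A) eig k * (c1 k * (c1 k - (k == 0)%:R) + c2 k ^+ 2) <= 0 ->
  energy A c1 c2 <= 2 * B /\ (1 - e1) * Int (fun x => - b (m x)) <= B.
Proof.
have [C C0 HC] := ham_coercive EP tH sH hop g_cont g_str H_grow.
pose l0 := eig 0.
have l00 : 0 < l0 := eig_gt0 0.
(* Let c be the mean of m. Young's inequality bounds (C + l0) c by l0 / 2 * c^2 plus the second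
   summand, and half of the energy absorbs l0 / 2 * c^2. *)
exists (C + (C + l0) ^+ 2 / (2 * l0)).
  by rewrite addr_ge0// divr_ge0 ?sqr_ge0// mulr_ge0// ltW.
move=> A c1 c2 m u uA A0 m0.
have tm : torus_continuous m := torus_psum A c1.
have pu : zperiodic u := zperiodic_psum A c2.
have Cu j : Ck j u := Ck_psum j A c2.
have tu : torus_continuous u := torus_psum A c2.
have tb := torus_penalty tm m0.
have tL := torus_along EP hop tH sH tm m0 pu (Cu 2%N).
have tF i := torus_along EP hop (torus_Ham_Dp i tH) (ham_smooth_Dp i sH) tm m0 pu (Cu 2%N).
have tG i j := torus_along EP hop (torus_Ham_DM i j tH) (ham_smooth_DM i j sH) tm m0 pu (Cu 2%N).
have tr : torus_continuous (reduced1 H h b m u).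
  exact: (torus_reduced1 EP tH sH hop sb tm m0 pu (Cu 2%N)).
have tw : torus_continuous (weak2_density H h m u u).
  exact: (torus_weak2 EP tH sH hop tm m0 pu (Cu 2%N) pu (Cu 2%N)).
have tm1 : torus_continuous (fun x => m x - 1) by apply: torusB => //; exact: torus_cst.
pose Q x := - along H h m u x + \sum_i along (DpH H i) h m u x * partial i u x
    + \sum_i \sum_j along (DMH H i j) h m u x * partials [:: i; j] u x.
have tQ : torus_continuous Q.
  apply: torusD; first apply: torusD.
  - exact: torusN tL.
  - apply: torus_sum => i; apply: torusM; first exact: tF.
    exact: (torus_partials (s := [:: i]) pu (Cu 2%N)).
  - apply: torus_sum => i; apply: torus_sum => j; apply: torusM; first exact: tG.
    exact: (torus_partials (s := [:: i; j]) pu (Cu 2%N)).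
(* The coupling terms - u (m - 1) and (m - 1) u cancel; the Hamiltonian terms combine exactly into
   the quantity estimated by [ham_coercive]. *)
have F1 : Int (fun x => reduced1 H h b m u x * (m x - 1)) + weak2 H h m u u =
    Int (fun x => m x * Q x) + Int (along H h m u) + Int (fun x => b (m x) * (m x - 1)).
  have I1 : integrableR (fun x => reduced1 H h b m u x * (m x - 1)) := torus_Rint (torusM tr tm1).
  have I3 : integrableR (fun x => m x * Q x) := torus_Rint (torusM tm tQ).
  have I5 : integrableR (fun x => b (m x) * (m x - 1)) := torus_Rint (torusM tb tm1).
  have I34 := RintD I3 (torus_Rint tL).
  rewrite /weak2 -(IntD I1 (torus_Rint tw)) -(IntD I3 (torus_Rint tL)) -(IntD I34 I5).
  congr Int; apply/funext => x; rewrite /reduced1 /weak2_density /A1 /Q.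
  have -> : \sum_i m x * along (DpH H i) h m u x * partial i u x =
      m x * \sum_i along (DpH H i) h m u x * partial i u x.
    by rewrite mulr_sumr; apply: eq_bigr => i _; exact: esym (mulrA _ _ _).
  have -> : \sum_i \sum_j m x * along (DMH H i j) h m u x * partials [:: i; j] u x =
      m x * \sum_i \sum_j along (DMH H i j) h m u x * partials [:: i; j] u x.
    rewrite mulr_sumr; apply: eq_bigr => i _; rewrite mulr_sumr; apply: eq_bigr => j _.
    exact: esym (mulrA _ _ _).
  by ring.
(* The penalty vanishes for m >= e1; below e1, m - 1 <= e1 - 1 < 0 and the penalty is nonpositive.
   This is where e1 < 1 is used. *)
have F2 : (1 - e1) * Int (fun x => - b (m x)) <= Int (fun x => b (m x) * (m x - 1)).
  rewrite -IntZ; last by apply: torus_Rint; exact: torusN.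
  apply: Int_le; [by apply/torus_Rint/torusZ/torusN|exact/torus_Rint/torusM|].
  move=> x; have [_ _ b0 be _] := b_pen.
  have [le|/ltW ge] := leP e1 (m x); first by rewrite be// oppr0 mulr0 mul0r.
  have := b0 _ (m0 x) => bx.
  have : 0 <= (- b (m x)) * (e1 - m x) by rewrite mulr_ge0// ?oppr_ge0// subr_ge0.
  by lra.
have F3 : Int m = c1 0.
  transitivity (coef m 0).
    by rewrite /coef hartley0; congr Int; apply/funext => x; rewrite mulr1.
  by rewrite /m coef_psum// A0.
have F4 : \sum_(k <- A) eig k * (c1 k * (c1 k - (k == 0)%:R) + c2 k ^+ 2) =
    energy A c1 c2 - l0 * c1 0.
  have -> : l0 * c1 0 = \sum_(k <- A) eig k * (c1 k * (k == 0)%:R).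
    rewrite (bigD1_seq 0)//= eqxx mulr1 big1 ?addr0// => k /negbTE ->.
    by rewrite !mulr0.
  by rewrite /energy -sumrB; apply: eq_bigr => k _; ring.
have F5 : l0 * c1 0 ^+ 2 <= energy A c1 c2.
  rewrite /energy (bigD1_seq 0)//=.
  apply: (@le_trans _ _ (l0 * (c1 0 ^+ 2 + c2 0 ^+ 2))).
    by rewrite ler_wpM2l ?(ltW l00)// lerDl sqr_ge0.
  rewrite lerDl; apply: sumr_ge0 => k _.
  apply: mulr_ge0; first exact: ltW (eig_gt0 k).
  by rewrite addr_ge0 ?sqr_ge0.
have F6 : 0 <= c1 0 by rewrite -F3; apply: Int_ge0 => x; exact: ltW.
have F7 : 0 <= Int (fun x => - b (m x)).
  by apply: Int_ge0 => x; have [_ _ b0 _ _] := b_pen; rewrite oppr_ge0; exact: b0.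
have F8 := HC A c2 m tm m0; rewrite -/u -/(Q _) in F8.
have F9 : (C + l0) * c1 0 <= l0 / 2 * c1 0 ^+ 2 + (C + l0) ^+ 2 / (2 * l0).
  rewrite -subr_ge0.
  have -> : l0 / 2 * c1 0 ^+ 2 + (C + l0) ^+ 2 / (2 * l0) - (C + l0) * c1 0 =
      (l0 * c1 0 - (C + l0)) ^+ 2 / (2 * l0) by field; exact: lt0r_neq0.
  by rewrite divr_ge0 ?sqr_ge0// mulr_ge0// ltW.
have F10 : 0 <= (1 - e1) * Int (fun x => - b (m x)).
  by rewrite mulr_ge0// subr_ge0; move: e101 => /andP[_ /ltW].
rewrite F1 F4 F3 in F8 *; move=> F11.
have F12 := energy_ge0 A c1 c2.
have F13 : Int (fun x => m x * Q x) + Int (along H h m u) >= - C - C * c1 0 by exact: F8.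
split; lra.
Qed.

End Apriori.

(** * Lower bound for the density *)

Section LowerBound.
Context {R : realType} {d : nat} (N : nat) (q e1 e2 : R) (b : R -> R).
Local Notation freq := 'rV[int]_d.
Local Notation eig := (@reg_eig R d N e1 e2).
Hypotheses (N_large : (d + 5 <= 2 * (2 * N))%N) (q_gt : d%:R < q)
  (b_pen : penalty q e1 b) (e101 : 0 < e1 < 1) (e201 : 0 < e2 < 1).
Implicit Types (m : 'rV[R]_d -> R) (c : freq -> R) (A : seq freq).

Lemma energy_Wle c (R0 : R) : (forall A, uniq A -> \sum_(k <- A) eig k * c k ^+ 2 <= R0) ->
  Wle (2 * N) c (d.+1%:R ^+ (2 * (2 * N)).+1 / e1 * R0).
Proof.
move: e101 e201 => /andP[e10 _] /andP[e20 _] H A uA.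
apply: le_trans (ler_wpM2l _ (H A uA)); last by rewrite divr_ge0 ?exprn_ge0// ltW.
rewrite mulr_sumr; apply: ler_sum => k _; rewrite [leRHS]mulrA; apply: ler_wpM2r; first exact: sqr_ge0.
rewrite mulrAC ler_pdivlMr// mulrC.
by apply: reg_eig_ge; exact: ltW.
Qed.

Lemma smooth_lipschitz m (L : R) : (forall j, Ck j m) -> (forall i x, `|partial i m x| <= L) ->
  forall (x y : 'rV[R]_d) (r : R), (forall i, `|x ord0 i - y ord0 i| <= r) -> `|m x - m y| <= d%:R * (r * L).
Proof.
move=> Cm HL x y r xy.
pose e := x - y.
have D z : is_derive z e m (\sum_i e ord0 i * partial i m z).
  apply: (@is_derive_partial_chain _ _ _ m setT id z e e) => //.
  - exact: openT.
  - exact: Ck_smooth_part.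
  - by move=> i; exact: is_derive_coord.
have [c _] := @MVT_line _ _ m y e 1 (fun t _ => @ex_derive _ _ _ _ _ _ _ (D _)).
have [_ ->] := D (y + c *: e).
have yE : y + 1 *: e = x by rewrite scale1r /e addrC subrK.
rewrite yE mulr1 => ->.
apply: le_trans (ler_norm_sum _ _ _) _.
apply: (@le_trans _ _ (\sum_(i < d) r * L)).
  apply: ler_sum => i _; rewrite normrM; apply: ler_pM => //; rewrite ?normr_ge0//.
  by rewrite !mxE; exact: xy.
by rewrite sumr_const card_ord mulr_natl.
Qed.

(* If m x0 = s then m <= 2 s on a box of side of order s, because m is Lipschitz;
   so the integral of m^-q is at least of order s^(d - q), and d < q. *)
Lemma density_lower_bound (R0 B : R) : 0 <= R0 -> 0 <= B -> exists2 s1 : R, 0 < s1 & forall A c,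
  let m := psum A c in uniq A -> (\sum_(k <- A) eig k * c k ^+ 2 <= R0) ->
  (forall x, 0 < m x) -> Int (fun x => - b (m x)) <= B -> forall x, s1 <= m x.
Proof.
move=> R00 B0.
have [e10 e11] := andP e101.
pose C := d.+1%:R ^+ (2 * (2 * N)).+1 / e1 * R0.
pose L := 2 * (2 * pi) * (Num.sqrt C * 2 ^+ d).
have L0 : 0 <= L by rewrite !mulr_ge0 ?pi_ge0 ?sqrtr_ge0 ?exprn_ge0.
pose L1 := d%:R * L + 1.
have dL0 : 0 <= d%:R * L by rewrite mulr_ge0.
have L10 : 0 < L1 by rewrite /L1; lra.
(* On a box of side r = s / L1 one has m <= 2 s, whence (2 s)^-q r^d <= B, that is, 1 <= s^(q - d)
   (B1 - 1); this fails once s^(q - d) < 1 / B1. The other threshold e1 / 4 places 2 s in the range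
   where the penalty is the exact power and makes r <= 1/2. *)
pose B1 := B * 2 `^ q * L1 ^+ d + 1.
have h0 : 0 <= B * 2 `^ q * L1 ^+ d by rewrite !mulr_ge0 ?powR_ge0 ?exprn_ge0 ?(ltW L10).
have B10 : 0 < B1 by rewrite ltr_wpDl.
pose s1 := Num.min (e1 / 4) (B1 `^ (- (q - d%:R)^-1)).
have s10 : 0 < s1 by rewrite lt_min divr_gt0//= powR_gt0.
exists s1 => // A c m uA EA m0 IB x0.
rewrite leNgt; apply/negP => ms.
pose s := m x0.
have s0 : 0 < s := m0 x0.
have qd : 0 < q - d%:R by rewrite subr_gt0.
have se : s < e1 / 4 by apply: lt_le_trans ms _; rewrite ge_min lexx.
have sB : s < B1 `^ (- (q - d%:R)^-1) by apply: lt_le_trans ms _; rewrite ge_min lexx orbT.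
have Wm : Wle (2 * N) (coef m) C.
  apply: energy_Wle => A' uA'.
  apply: le_trans EA; apply: sum_psum_le => // k.
  by apply: ltW; exact: eig_gt0 e101 e201 _.
have dj : (d.+1 + 2 * 1 <= 2 * (2 * N))%N.
  by rewrite addSnnS; apply: leq_trans N_large; rewrite leq_add2l.
have [_ _ Hm] := sobolev_embedding dj (torus_psum A c) Wm.
have HL i x : `|partial i m x| <= L.
  by have := Hm [:: i] x isT; rewrite /= expr1.
pose r := s / L1.
have r0 : 0 < r by rewrite divr_gt0.
have r2 : r <= 2^-1.
  rewrite ler_pdivrMr//; have : 2^-1 <= 2^-1 * L1 by rewrite ler_peMr// /L1; lra.
  by lra.
have drL : d%:R * (r * L) <= s.
  rewrite (_ : _ * _ = s / L1 * (d%:R * L)); last by rewrite /r; ring.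
  by rewrite mulrAC ler_pdivrMr// ler_wpM2l ?(ltW s0)// /L1; lra.
have box (x : 'rV[R]_d) : (forall i, `|x ord0 i - x0 ord0 i| <= r) -> (2 * s) `^ (- q) <= - b (m x).
  move=> xr.
  have := smooth_lipschitz (fun j => Ck_psum j A c) HL xr; rewrite -/m => /ler_normlP[_ Lx].
  have mx2 : m x <= 2 * s by rewrite /s in drL *; lra.
  have [_ _ _ _ bq] := b_pen.
  rewrite bq//; last by lra.
  rewrite opprK.
  rewrite !powRN lef_pV2 ?posrE ?powR_gt0 ?mulr_gt0//.
  have q0 : 0 <= q by apply/ltW; exact: le_lt_trans q_gt.
  by apply: (ge0_ler_powR q0) mx2; rewrite nnegrE ltW// mulr_gt0.
have tb := torusN (torus_penalty b_pen (torus_psum A c) m0).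
have IB' : (2 * s) `^ (- q) * r ^+ d <= B.
  apply: le_trans IB.
  apply: (Int_ge_box (x0 := x0)) => //; [exact: tb.1|exact: torus_Rint|..].
  - by move=> x; have [_ _ b0 _ _] := b_pen; rewrite oppr_ge0; exact: b0.
  - exact: powR_ge0.
have : 1 <= s `^ (q - d%:R) * (B1 - 1).
  have -> : B1 - 1 = B * (2 `^ q * L1 ^+ d) by rewrite /B1; ring.
  have H1 : (2 * s) `^ (- q) * r ^+ d * (2 `^ q * L1 ^+ d) <= B * (2 `^ q * L1 ^+ d).
    by rewrite ler_wpM2r// mulr_ge0 ?powR_ge0// exprn_ge0// ltW.
  apply: le_trans (ler_wpM2l (powR_ge0 _ _) H1).
  suff -> : s `^ (q - d%:R) * ((2 * s) `^ (- q) * r ^+ d * (2 `^ q * L1 ^+ d)) = 1 by [].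
  have q2 : 2 `^ q != 0 :> R by rewrite gt_eqF// powR_gt0.
  have qs : s `^ q != 0 :> R by rewrite gt_eqF// powR_gt0.
  rewrite powRN powRM ?ltW// powRB ?gt_eqF// powR_mulrn ?ltW// /r.
  rewrite expr_div_n; field.
  by rewrite q2 qs !expf_neq0// ?gt_eqF.
apply/negP; rewrite -ltNge.
have : s `^ (q - d%:R) < B1^-1.
  have -> : B1^-1 = (B1 `^ (- (q - d%:R)^-1)) `^ (q - d%:R).
    by rewrite -powRrM mulNr mulVf ?gt_eqF// powR_inv1// ltW.
  by apply: gt0_ltr_powR; rewrite ?nnegrE ?powR_ge0 ?(ltW s0).
have sp : 0 <= s `^ (q - d%:R) := powR_ge0 _ _.
move=> /ltW sB1.
apply: (@le_lt_trans _ _ (B1^-1 * (B1 - 1))).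
  by rewrite ler_wpM2r// /B1 addrK !mulr_ge0 ?powR_ge0 ?exprn_ge0 ?(ltW L10).
by rewrite mulrC ltr_pdivrMr// mul1r; lra.
Qed.

End LowerBound.

(** * Galerkin approximation *)

Section Coordinates.
Context {R : realType} {d : nat} (A : seq 'rV[int]_d).
Hypothesis uA : uniq A.
Local Notation freq := 'rV[int]_d.
Local Notation M := (size A).
Implicit Types (v w : 'rV[R]_M) (k : freq).

(** Extension by zero to all frequencies, written as a sum so that linearity and continuity in v are
    immediate. *)
Definition coord_fun v k : R := \sum_(i < M) v ord0 i * (nth 0 A i == k)%:R.

Definition fun_coord (c : freq -> R) : 'rV[R]_M := \row_(i < M) c (nth 0 A i).

Lemma coord_fun_nth v (i : 'I_M) : coord_fun v (nth 0 A i) = v ord0 i.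
Proof.
rewrite /coord_fun (bigD1 i)//= eqxx mulr1 big1 ?addr0// => j ji.
by rewrite nth_uniq// (negbTE (ji : j != i :> nat)) mulr0.
Qed.

Lemma sum_nth (F : freq -> R) : \sum_(k <- A) F k = \sum_(i < M) F (nth 0 A i).
Proof. by rewrite (big_nth 0) big_mkord. Qed.

Lemma fun_coordK (c : freq -> R) k : k \in A -> coord_fun (fun_coord c) k = c k.
Proof.
move=> /(nthP 0)[i iA <-].
by rewrite -[i]/(val (Ordinal iA)) coord_fun_nth mxE.
Qed.

Lemma coord_fun_lincomb n (l : 'rV[R]_n) (v : 'I_n -> 'rV[R]_M) k :
  coord_fun (\sum_j l ord0 j *: v j) k = \sum_j l ord0 j * coord_fun (v j) k.
Proof.
rewrite /coord_fun; under [RHS]eq_bigr do rewrite mulr_sumr.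
rewrite exchange_big/=; apply: eq_bigr => i _.
by rewrite summxE mulr_suml; apply: eq_bigr => j _; rewrite mxE mulrA.
Qed.

Lemma coord_funD (a : R) v w k : coord_fun (v + a *: w) k = coord_fun v k + a * coord_fun w k.
Proof.
rewrite /coord_fun mulr_sumr -big_split/=; apply: eq_bigr => i _.
by rewrite !mxE mulrDl mulrA.
Qed.

Lemma continuous_coord_fun k : continuous (coord_fun^~ k).
Proof.
apply: (@Ck_continuous _ _ 0%N); apply: Ck_sum => i.
by apply: CkM; [exact: Ck_coord|exact: Ck_cst].
Qed.

Lemma psum_lincomb n (l : 'rV[R]_n) (v : 'I_n -> 'rV[R]_M) (x : 'rV[R]_d) :
  psum A (coord_fun (\sum_j l ord0 j *: v j)) x = \sum_j l ord0 j * psum A (coord_fun (v j)) x.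
Proof.
rewrite /psum; under [RHS]eq_bigr do rewrite mulr_sumr.
rewrite exchange_big/=; apply: eq_bigr => k _.
by rewrite coord_fun_lincomb mulr_suml; apply: eq_bigr => j _; rewrite mulrA.
Qed.

Lemma psumD (a : R) v w (x : 'rV[R]_d) :
  psum A (coord_fun (v + a *: w)) x = psum A (coord_fun v) x + a * psum A (coord_fun w) x.
Proof.
rewrite /psum mulr_sumr -big_split/=; apply: eq_bigr => k _.
by rewrite coord_funD; ring.
Qed.

Lemma continuous_psum (x : 'rV[R]_d) : continuous (fun v => psum A (coord_fun v) x).
Proof.
apply: (@Ck_continuous _ _ 0%N); apply: Ck_sum => k.
apply: CkM; last exact: Ck_cst.
by apply: Ck_sum => i; apply: CkM; [exact: Ck_coord|exact: Ck_cst].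
Qed.

End Coordinates.

Section QuadraticSet.
Context {R : realType} {d : nat} (A : seq 'rV[int]_d) (lam : 'rV[int]_d -> R).
Hypothesis (uA : uniq A) (lam0 : forall k, 0 < lam k).
Local Notation M := (size A).
Local Notation V := ('rV[R]_M * 'rV[R]_M)%type.
Local Notation cf := (@coord_fun R d A).

Definition quad (z : V) : R := \sum_(k <- A) lam k * (cf z.1 k ^+ 2 + cf z.2 k ^+ 2).

Definition quad_set (R0 s0 : R) : set V :=
  [set z | quad z <= R0 /\ forall x, s0 <= psum A (cf z.1) x].

Lemma quad_set_compact (R0 s0 : R) : compact (quad_set R0 s0).
Proof.
(* A coordinate a satisfies a^2 <= R0 / lam k <= r k - 1, hence |a| <= r k because r k >= 1. The
   maximum keeps r k >= 1 also for negative R0. *)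
pose r k : R := Num.max 0 (R0 / lam k) + 1.
pose box := [set v : 'rV[R]_M | forall i : 'I_M, `[- r (nth 0 A i), r (nth 0 A i)]%classic (v ord0 i)].
have cbox : compact box :=  (@rV_compact R M (fun i : 'I_M => `[- r (nth 0 A i), r (nth 0 A i)]%classic)
  (fun i => @segment_compact R _ _)).
apply: (subclosed_compact _ (compact_setX cbox cbox)); last first.
  move=> z [qz _].
  have H (i : 'I_M) (a : R) : a ^+ 2 <= cf z.1 (nth 0 A i) ^+ 2 + cf z.2 (nth 0 A i) ^+ 2 ->
      a \in `[- r (nth 0 A i), r (nth 0 A i)]%R.
    move=> ha; set k := nth 0 A i.
    have L1 : lam k * a ^+ 2 <= R0.
      apply: le_trans qz; rewrite /quad (sum_nth A) (bigD1 i)//=.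
      apply: (@le_trans _ _ (lam k * (cf z.1 k ^+ 2 + cf z.2 k ^+ 2))).
        by rewrite ler_wpM2l// ltW.
      rewrite lerDl; apply: sumr_ge0 => j _.
      by rewrite mulr_ge0 ?addr_ge0 ?sqr_ge0// ltW.
    have L2 : a ^+ 2 <= r k - 1.
      by rewrite /r addrK le_max ler_pdivlMr// mulrC L1 orbT.
    have r1 : 1 <= r k by rewrite /r lerDr le_max lexx.
    rewrite in_itv/= -ler_norml.
    have [//|ra] := leP `|a| (r k).
    have : r k ^+ 2 <= a ^+ 2.
      by rewrite -[leRHS]real_normK ?num_real// lerXn2r ?nnegrE ?ltW//; lra.
    have : r k <= r k ^+ 2 by rewrite expr2 ler_peMl//; lra.
    by move=> ? ?; lra.
  split=> i /=.
    have := H i (z.1 ord0 i); rewrite coord_fun_nth//; apply.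
    by rewrite lerDl sqr_ge0.
  have := H i (z.2 ord0 i); rewrite (coord_fun_nth uA z.2); apply.
  by rewrite lerDr sqr_ge0.
have -> : quad_set R0 s0 = (quad @^-1` [set y | y <= R0]) `&`
    \bigcap_(x in [set: 'rV[R]_d]) ((fun z : V => psum A (cf z.1) x) @^-1` [set y | s0 <= y]).
  by apply/seteqP; split=> z /= [h1 h2]; split=> // x; [move=> _|]; exact: h2.
apply: closedI.
  apply: closed_comp; last exact: closed_le.
  move=> z _; rewrite /quad.
  have c1 k : continuous (fun z : V => cf z.1 k).
    by move=> y; apply: (@continuous_comp _ _ _ fst (cf^~ k)); [exact: cvg_fst|exact: continuous_coord_fun].
  have c2 k : continuous (fun z : V => cf z.2 k).
    by move=> y; apply: (@continuous_comp _ _ _ snd (cf^~ k)); [exact: cvg_snd|exact: continuous_coord_fun].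
  suff Hs (s : seq 'rV[int]_d) : continuous (fun z : V => \sum_(k <- s) lam k * (cf z.1 k ^+ 2 + cf z.2 k ^+ 2)).
    exact: Hs.
  elim: s => [|k s IH] y; first by under eq_fun do rewrite big_nil; exact: cvg_cst.
  under eq_fun do rewrite big_cons; apply: cvgD; last exact: IH.
  by apply: cvgMr; apply: cvgD; rewrite expr2; apply: cvgM; [exact: c1|exact: c1|exact: c2|exact: c2].
apply: closed_bigI => x _; apply: closed_comp; last exact: closed_ge.
move=> z _; apply: (@continuous_comp _ _ _ fst (fun v => psum A (cf v) x)); first exact: cvg_fst.
exact: continuous_psum.
Qed.

(** The variance with respect to the weights l is nonnegative. *)
Lemma jensen_sqr n (l : 'rV[R]_n) (a : 'I_n -> R) : simplex l ->
  (\sum_j l ord0 j * a j) ^+ 2 <= \sum_j l ord0 j * a j ^+ 2.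
Proof.
move=> [l0 l1]; set X := \sum_j _.
have : 0 <= \sum_j l ord0 j * (a j - X) ^+ 2.
  by apply: sumr_ge0 => j _; rewrite mulr_ge0 ?sqr_ge0.
have E (Y : R) : \sum_j l ord0 j * (a j - Y) ^+ 2 =
    \sum_j l ord0 j * a j ^+ 2 - 2 * Y * (\sum_j l ord0 j * a j) + Y ^+ 2 * \sum_j l ord0 j.
  by rewrite !mulr_sumr -sumrB -big_split/=; apply: eq_bigr => j _; ring.
by rewrite E l1 -/X; lra.
Qed.

Lemma pair_sum1 n (F : 'I_n -> V) : (\sum_i F i).1 = \sum_i (F i).1.
Proof. by elim/big_rec2: _ => // i x y _ <-. Qed.

Lemma pair_sum2 n (F : 'I_n -> V) : (\sum_i F i).2 = \sum_i (F i).2.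
Proof. by elim/big_rec2: _ => // i x y _ <-. Qed.

Lemma quad_set_convex (R0 s0 : R) : convex_hull_closed (quad_set R0 s0).
Proof.
move=> n l w sl Hw; have [l0 l1] := sl; split=> [|x]; last first.
  rewrite pair_sum1 /= psum_lincomb -[s0]mul1r -l1 mulr_suml.
  by apply: ler_sum => j _; rewrite ler_wpM2l//; exact: (Hw j).2.
rewrite -[R0]mul1r -l1 mulr_suml.
apply: (@le_trans _ _ (\sum_j l ord0 j * quad (w j))); last first.
  by apply: ler_sum => j _; rewrite ler_wpM2l//; exact: (Hw j).1.
rewrite /quad; under [leRHS]eq_bigr do rewrite mulr_sumr.
rewrite exchange_big/=; apply: ler_sum => k _.
rewrite (_ : \sum_j _ = lam k * (\sum_j l ord0 j * cf (w j).1 k ^+ 2 + \sum_j l ord0 j * cf (w j).2 k ^+ 2)).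
  rewrite ler_wpM2l ?(ltW (lam0 k))// pair_sum1 pair_sum2/= !coord_fun_lincomb.
  by apply: lerD; exact: jensen_sqr.
by rewrite -big_split/= mulr_sumr; apply: eq_bigr => j _; ring.
Qed.

Lemma quadD (t : R) (z w : V) : quad (z + t *: w) =
  quad z + t * (\sum_(k <- A) 2 * lam k * (cf z.1 k * cf w.1 k + cf z.2 k * cf w.2 k)) + t ^+ 2 * quad w.
Proof.
rewrite /quad !mulr_sumr -!big_split/=; apply: eq_bigr => k _.
by rewrite (coord_funD t z.1 w.1) (coord_funD t z.2 w.2); ring.
Qed.

(** Strict inequalities leave room for a small step in any direction; at such a point a variational
    inequality becomes an equation. *)
Lemma quad_set_interior (R0 s0 R1 s1 : R) z w : R1 < R0 -> s0 < s1 ->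
  quad_set R1 s1 z -> exists2 t : R, 0 < t & quad_set R0 s0 (z + t *: w).
Proof.
move=> R10 s01 [qz pz].
have [Mw HMw] := periodic_bounded (torus_psum A (cf w.1)).
pose a := \sum_(k <- A) 2 * lam k * (cf z.1 k * cf w.1 k + cf z.2 k * cf w.2 k).
pose D := `|a| + `|quad w| + 1.
have D0 : 0 < D by rewrite ltr_wpDl// addr_ge0.
have M0 : 0 < `|Mw| + 1 by rewrite ltr_wpDl.
pose t := Num.min 1 (Num.min ((R0 - R1) / D) ((s1 - s0) / (`|Mw| + 1))).
have t0 : 0 < t by rewrite !lt_min ltr01 !divr_gt0// subr_gt0.
have t1 : t <= 1 by rewrite ge_min lexx.
have tD : t * D <= R0 - R1 by rewrite -ler_pdivlMr// !ge_min lexx orbT.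
have tM : t * (`|Mw| + 1) <= s1 - s0 by rewrite -ler_pdivlMr// !ge_min lexx !orbT.
exists t => //; split=> [|x].
  rewrite quadD -/a.
  have h1 : t * a <= t * `|a| by rewrite ler_wpM2l ?(ltW t0)// ler_norm.
  have h2 : t ^+ 2 * quad w <= t * `|quad w|.
    apply: (@le_trans _ _ (t ^+ 2 * `|quad w|)); first by rewrite ler_wpM2l ?sqr_ge0// ler_norm.
    by rewrite ler_wpM2r// expr2 ler_piMl// ltW.
  rewrite /D in tD; nra.
rewrite psumD.
have h : - (t * `|Mw|) <= t * psum A (cf w.1) x.
  rewrite -mulrN ler_wpM2l ?(ltW t0)//.
  have := HMw x; rewrite ler_norml => /andP[h _]; apply: le_trans h.
  by rewrite lerN2 ler_norm.
have := pz x; nra.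
Qed.

End QuadraticSet.

(** * The Galerkin system *)

Section Galerkin.
Context {R : realType} {d : nat} (E : set R)
  (H : 'rV[R]_d -> 'rV[R]_d -> 'M[R]_d -> R -> R -> R)
  (h : ('rV[R]_d -> R) -> 'rV[R]_d -> R) (g : 'rV[R]_d -> R -> R -> R)
  (N s : nat) (q e1 e2 : R) (b : R -> R).
Local Notation freq := 'rV[int]_d.
Local Notation eig := (@reg_eig R d N e1 e2).
Hypotheses (EP : forall s, 0 < s -> E s) (tH : torus_Ham E H) (sH : ham_smooth H)
  (hop : Mac_operator h) (hreg : h_regularity h)
  (g_cont : torus_continuous_coef E g) (g_str : g_structure E h g)
  (H_grow : H_growth E h g H) (mono : monotonicity E h H) (b_pen : penalty q e1 b)
  (e101 : 0 < e1 < 1) (e201 : 0 < e2 < 1) (q_gt : d%:R < q)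
  (N_large : (d + 5 <= 2 * (2 * N))%N)
  (ds : d%:R / 2 + 1 < s%:R :> R) (ds2 : (d.+1 + 2 * 2 <= 2 * s)%N).
Implicit Types (m u f : 'rV[R]_d -> R) (c : freq -> R).

Let sb : smooth_open [set s : R^o | 0 < s] b. Proof. by have [] := b_pen. Qed.

Lemma Int_mul_psum r A c : integrableR r ->
  Int (fun x : 'rV[R]_d => r x * psum A c x) = \sum_(k <- A) c k * coef r k.
Proof.
move=> Ir; rewrite (_ : (fun x => _) = fun x => \sum_(k <- A) c k * (r x * hartley k x)).
  rewrite Int_sum; last by move=> k; apply: RintZ; exact: Rint_coef.
  by apply: eq_bigr => k _; rewrite IntZ//; exact: Rint_coef.
apply/funext => x; rewrite /psum mulr_sumr; apply: eq_bigr => k _.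
by rewrite mulrCA.
Qed.

Lemma weak2_psum A c m u : torus_continuous m -> (forall x, 0 < m x) -> zperiodic u -> Ck 2 u ->
  weak2 H h m u (psum A c) = \sum_(k <- A) c k * weak2 H h m u (hartley k).
Proof.
move=> tm m0 pu Cu.
have It k : integrableR (weak2_density H h m u (hartley k)).
  exact: torus_Rint (torus_weak2 EP tH sH hop tm m0 pu Cu (zperiodic_hartley k) (Ck_hartley 2 k)).
transitivity (Int (fun x => \sum_(k <- A) c k * weak2_density H h m u (hartley k) x)).
  congr Int; apply/funext => x; rewrite /weak2_density.
  have L (I : Type) (r : seq I) (a : I -> R) (F : I -> 'rV[R]_d -> R) (G : I -> freq -> 'rV[R]_d -> R) :
      (forall i, F i x = \sum_(k <- A) c k * G i k x) ->
      \sum_(i <- r) a i * F i x = \sum_(k <- A) c k * \sum_(i <- r) a i * G i k x.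
    move=> FG; under [RHS]eq_bigr do rewrite mulr_sumr.
    rewrite exchange_big/=; apply: eq_bigr => i _.
    by rewrite FG mulr_sumr; apply: eq_bigr => k _; rewrite mulrCA.
  under [RHS]eq_bigr => k _ do rewrite 2!mulrDr.
  rewrite 2!big_split/=; congr (_ + _ + _).
  - by rewrite /psum mulr_sumr; apply: eq_bigr => k _; rewrite mulrCA.
  - apply: (L _ _ (fun i => m x * along (DpH H i) h m u x) (fun i => partial i (psum A c))
      (fun i k => partial i (hartley k))) => i.
    have := partials_psum [:: i] A c; move/(congr1 (fun f => f x)) => e.
    exact: e.
  - under [RHS]eq_bigr do rewrite mulr_sumr.
    rewrite [RHS]exchange_big/=; apply: eq_bigr => i _.
    apply: (L _ _ (fun j => m x * along (DMH H i j) h m u x) (fun j => partials [:: i; j] (psum A c))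
      (fun j k => partials [:: i; j] (hartley k))) => j.
    have := partials_psum [:: i; j] A c; move/(congr1 (fun f => f x)) => e.
    exact: e.
rewrite Int_sum; last by move=> k; exact: RintZ.
by apply: eq_bigr => k _; rewrite IntZ.
Qed.

Section Fixed.
Variable A : seq freq.
Hypothesis uA : uniq A.
Local Notation M := (size A).
Local Notation V := ('rV[R]_M * 'rV[R]_M)%type.
Local Notation cf := (@coord_fun R d A).
Local Notation P v := (psum A (cf v)).

Definition galerkin1 (z : V) k : R := coef (reduced1 H h b (P z.1) (P z.2)) k + eig k * cf z.1 k.

Definition galerkin2 (z : V) k : R := weak2 H h (P z.1) (P z.2) (hartley k) + eig k * cf z.2 k.

Definition galerkin_form (z w : V) : R :=
  \sum_(k <- A) (galerkin1 z k * cf w.1 k + galerkin2 z k * cf w.2 k).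

Let torus_r1 z : (forall x, 0 < P z.1 x) -> torus_continuous (reduced1 H h b (P z.1) (P z.2)).
Proof.
move=> m0.
exact: (torus_reduced1 EP tH sH hop sb (torus_psum _ _) m0 (zperiodic_psum _ _) (Ck_psum _ _ _)).
Qed.

(** Recombines the residuals mode by mode into integrals, the form to which monotonicity and the a
    priori bound apply. *)
Lemma galerkin_formE z w : (forall x, 0 < P z.1 x) -> galerkin_form z w =
  Int (fun x => reduced1 H h b (P z.1) (P z.2) x * P w.1 x) + weak2 H h (P z.1) (P z.2) (P w.2)
  + \sum_(k <- A) eig k * (cf z.1 k * cf w.1 k + cf z.2 k * cf w.2 k).
Proof.
move=> m0; rewrite Int_mul_psum; last exact: torus_Rint (torus_r1 m0).
rewrite weak2_psum//; [|exact: torus_psum|exact: zperiodic_psum|exact: Ck_psum].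
by rewrite -!big_split/=; apply: eq_bigr => k _; rewrite /galerkin1 /galerkin2; ring.
Qed.

Lemma galerkin_form_linear z (a : R) (v w : V) :
  galerkin_form z (a *: v + w) = a * galerkin_form z v + galerkin_form z w.
Proof.
rewrite /galerkin_form mulr_sumr -big_split/=; apply: eq_bigr => k _.
have E1 : cf (a *: v + w).1 k = a * cf v.1 k + cf w.1 k by rewrite /= addrC coord_funD addrC.
have E2 : cf (a *: v + w).2 k = a * cf v.2 k + cf w.2 k by rewrite /= addrC coord_funD addrC.
by rewrite E1 E2; ring.
Qed.

Lemma galerkin_form_continuous z : continuous (galerkin_form z).
Proof.
have c1 k : continuous (fun z : V => cf z.1 k).
  by move=> y; apply: (@continuous_comp _ _ _ fst (cf^~ k)); [exact: cvg_fst|exact: continuous_coord_fun].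
have c2 k : continuous (fun z : V => cf z.2 k).
  by move=> y; apply: (@continuous_comp _ _ _ snd (cf^~ k)); [exact: cvg_snd|exact: continuous_coord_fun].
suff Hs (r : seq freq) : continuous (fun w : V => \sum_(k <- r) (galerkin1 z k * cf w.1 k + galerkin2 z k * cf w.2 k)).
  exact: Hs.
elim: r => [|k r IH] y; first by under eq_fun do rewrite big_nil; exact: cvg_cst.
under eq_fun do rewrite big_cons; apply: cvgD; last exact: IH.
by apply: cvgD; apply: cvgMr; [exact: c1|exact: c2].
Qed.

Let psumB (v w : 'rV[R]_M) : P (v - w) = fun x => P v x - P w x.
Proof. by apply/funext => x; rewrite -scaleN1r psumD mulN1r. Qed.

Lemma galerkin_form_monotone z w : (forall x, 0 < P z.1 x) -> (forall x, 0 < P w.1 x) ->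
  0 <= galerkin_form z (z - w) - galerkin_form w (z - w).
Proof.
move=> z0 w0; rewrite !galerkin_formE//=.
have bmono : forall s s', 0 < s -> s <= s' -> b s <= b s' by have [] := b_pen.
have sp v : torus_smooth (P v).
  by apply: Ck_torus_smooth; [exact: zperiodic_psum|move=> j; exact: Ck_psum].
have := forms_monotone EP tH sH hop hreg sb mono bmono (sp z.1) z0 (sp z.2) (sp w.1) w0 (sp w.2).
rewrite -(psumB z.2 w.2).
have -> : (fun x => (reduced1 H h b (P z.1) (P z.2) x - reduced1 H h b (P w.1) (P w.2) x)
    * (P z.1 x - P w.1 x)) = fun x => reduced1 H h b (P z.1) (P z.2) x * P (z.1 - w.1) x
    - reduced1 H h b (P w.1) (P w.2) x * P (z.1 - w.1) x.
  by apply/funext => x; rewrite psumB mulrBl.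
have tq := torus_psum A (cf (z.1 - w.1)).
rewrite IntB; [|exact: torus_Rint (torusM (torus_r1 z0) tq)|exact: torus_Rint (torusM (torus_r1 w0) tq)].
have Q0 : 0 <= \sum_(k <- A) eig k * (cf z.1 k * cf (z.1 - w.1) k + cf z.2 k * cf (z.2 - w.2) k) -
  \sum_(k <- A) eig k * (cf w.1 k * cf (z.1 - w.1) k + cf w.2 k * cf (z.2 - w.2) k).
  rewrite -sumrB; apply: sumr_ge0 => k _.
  rewrite -[_ - w.1]/(z.1 - w.1) -!(scaleN1r w.1) -!(scaleN1r w.2) !coord_funD.
  rewrite (_ : _ - _ = eig k * ((cf z.1 k - cf w.1 k) ^+ 2 + (cf z.2 k - cf w.2 k) ^+ 2)); last by ring.
  apply: mulr_ge0; last by rewrite addr_ge0 ?sqr_ge0.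
  by apply: ltW; exact: eig_gt0 e101 e201 _.
move: Q0; set x1 := Int _; set x2 := Int _; set x3 := weak2 _ _ _ _ _; set x4 := weak2 _ _ _ _ _.
set x5 := \sum_(k <- A) _; set x6 := \sum_(k <- A) _.
by move: x1 x2 x3 x4 x5 x6 => *; lra.
Qed.

Lemma galerkin_form_hemicontinuous z w v : (forall (t : R) x, 0 <= t <= 1 -> 0 < P (z + t *: (w - z)).1 x) ->
  galerkin_form (z + t *: (w - z)) v @[t --> 0^'+] --> galerkin_form z v.
Proof.
move=> pos.
(* The limit lemmas require a positive density for every real t, whereas only t in [0, 1] is
   admissible; clamping t changes nothing near 0+. *)
pose cl (t : R) := Num.max 0 (Num.min 1 t).
have cl01 t : 0 <= cl t <= 1.
  by rewrite /cl le_max lexx/= ge_max ler01/= ge_min lexx.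
have clE : \forall t \near (0 : R)^'+, cl t = t.
  near=> t; have t0 : 0 < t by near: t; exact: nbhs_right_gt.
  have t1 : t <= 1 by near: t; exact: nbhs_right_le.
  by rewrite /cl min_r// max_r// ltW.
pose zt t := z + cl t *: (w - z).
suff L k : galerkin1 (zt t) k @[t --> 0^'+] --> galerkin1 z k /\
    galerkin2 (zt t) k @[t --> 0^'+] --> galerkin2 z k.
  apply: (@cvg_trans _ (galerkin_form (zt t) v @[t --> 0^'+])).
    by apply: near_eq_cvg; apply: filterS clE => t e; rewrite /zt e.
  suff Hs (r : seq freq) :
      \sum_(k <- r) (galerkin1 (zt t) k * cf v.1 k + galerkin2 (zt t) k * cf v.2 k) @[t --> 0^'+] -->
      \sum_(k <- r) (galerkin1 z k * cf v.1 k + galerkin2 z k * cf v.2 k) by exact: Hs.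
  elim: r => [|k r IH].
    by under eq_fun do rewrite big_nil; rewrite big_nil; exact: cvg_cst.
  under eq_fun do rewrite big_cons; rewrite big_cons.
  by apply: cvgD IH; apply: cvgD; apply: cvgMl; [exact: (L k).1|exact: (L k).2].
have small p : forall eps : R, 0 < eps -> \forall t \near (0 : R)^'+, Wle s (coef (fun x => cl t * psum A p x)) eps.
  move=> eps e0.
  have [C W] := Ck_Wle (zperiodic_psum A p) (Ck_psum s A p).
  have C0 := Wle_ge0 W.
  have C10 : 0 < C + 1 by rewrite ltr_wpDl.
  near=> t.
  have t0 : 0 < t by near: t; exact: nbhs_right_gt.
  have t1 : t <= 1 by near: t; exact: nbhs_right_le.
  have te : t <= eps / (C + 1) by near: t; apply: nbhs_right_le; rewrite divr_gt0.
  have -> : cl t = t by near: t.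
  rewrite (_ : coef _ = fun k => t * coef (psum A p) k); last first.
    by apply/funext => l; rewrite fcoefZ//; exact: torus_Rint (torus_psum _ _).
  apply: Wle_le (WleZ t W).
  have : t * (C + 1) <= eps by rewrite -ler_pdivlMr.
  have : t ^+ 2 <= t by rewrite expr2 ler_piMl// ltW.
  nra.
have diffE (v1 v2 : 'rV[R]_M) t : (fun x => P (v1 + cl t *: v2) x - P v1 x) = fun x => cl t * P v2 x.
  by apply/funext => x; rewrite psumD addrC addKr.
have exW p : exists C, Wle s (coef (psum A p : 'rV[R]_d -> R)) C.
  exact: Ck_Wle (zperiodic_psum A p) (Ck_psum s A p).
have [C1 W1] := exW (cf z.1). have [C2 W2] := exW (cf z.2).
have W1' : Wle s (coef (P z.1)) (Num.max C1 C2) by apply: Wle_le W1; rewrite le_max lexx.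
have W2' : Wle s (coef (P z.2)) (Num.max C1 C2) by apply: Wle_le W2; rewrite le_max lexx orbT.
have zE : P z.1 = P (z + 0 *: (w - z)).1 by rewrite scale0r addr0.
have z0 x : 0 < P z.1 x by rewrite zE; apply: pos; rewrite lexx ler01.
have zt0 t x : 0 < P (zt t).1 x by exact: pos.
have S1 : forall eps : R, 0 < eps -> \forall t \near (0 : R)^'+, Wle s (coef (fun x => P (zt t).1 x - P z.1 x)) eps.
  move=> eps e0; apply: filterS (small (cf (w - z).1) eps e0) => t.
  by rewrite diffE.
have S2 : forall eps : R, 0 < eps -> \forall t \near (0 : R)^'+, Wle s (coef (fun x => P (zt t).2 x - P z.2 x)) eps.
  move=> eps e0; apply: filterS (small (cf (w - z).2) eps e0) => t.
  by rewrite diffE.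
have clcvg : cl t @[t --> 0^'+] --> (0 : R).
  apply: (@cvg_trans _ (t @[t --> (0 : R)^'+])).
    by apply: near_eq_cvg; apply: filterS clE => t e; rewrite e.
  exact: cvg_at_right_filter.
have Lcf (v1 v2 : 'rV[R]_M) : eig k * cf (v1 + cl t *: v2) k @[t --> 0^'+] --> eig k * cf v1 k.
  have -> : (fun t => eig k * cf (v1 + cl t *: v2) k) =
      fun t => eig k * cf v1 k + (eig k * cf v2 k) * cl t.
    by apply/funext => t; rewrite coord_funD; ring.
  rewrite -[X in _ --> X]addr0; apply: cvgD; first exact: cvg_cst.
  have L : eig k * cf v2 k * cl t @[t --> 0^'+] --> eig k * cf v2 k * 0.
    by apply: cvgM; [exact: cvg_cst|exact: clcvg].
  by rewrite mulr0 in L; exact: L.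
split.
- apply: (@cvgD _ _ _ _ _ (fun t => coef (reduced1 H h b (P (zt t).1) (P (zt t).2)) k)
    (fun t => eig k * cf (zt t).1 k)); last exact: Lcf.
  exact: (reduced1_cvg EP tH sH hop hreg sb ds ds2 (torus_psum _ _) (torus_psum _ _) z0 W1' W2'
    (fun t => torus_psum _ _) (fun t => torus_psum _ _) zt0 (fun t => exW _) (fun t => exW _) S1 S2).
- apply: (@cvgD _ _ _ _ _ (fun t => weak2 H h (P (zt t).1) (P (zt t).2) (hartley k))
    (fun t => eig k * cf (zt t).2 k)); last exact: Lcf.
  exact: (weak2_cvg EP tH sH hop hreg ds ds2 (torus_psum _ _) (torus_psum _ _) z0 W1' W2'
    (fun t => torus_psum _ _) (fun t => torus_psum _ _) zt0 (fun t => exW _) (fun t => exW _) S1 S2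
    (zperiodic_hartley k) (Ck_hartley 2 k)).
Unshelve. all: by end_near.
Qed.

End Fixed.

Lemma galerkin_exists : exists R0 s1 : R, 0 < s1 /\ forall A : seq freq, uniq A -> 0 \in A ->
  exists c1 c2 : freq -> R,
  [/\ energy N e1 e2 A c1 c2 <= R0, forall x, s1 <= psum A c1 x,
      forall k, k \in A -> coef (reduced1 H h b (psum A c1) (psum A c2)) k + eig k * c1 k = 0 &
      forall k, k \in A -> weak2 H h (psum A c1) (psum A c2) (hartley k) + eig k * c2 k = 0].
Proof.
have [B B0 HB] := apriori_bound N EP tH sH hop g_cont g_str H_grow b_pen e101 e201.
have [e10 e11] := andP e101.
have l0 : 0 < eig 0 by exact: eig_gt0 e101 e201 _.
have R00 : 0 <= 2 * B + 1 + eig 0 by lra.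
have B10 : 0 <= B / (1 - e1) by rewrite divr_ge0// subr_ge0 ltW.
have [s1 s10 Hs1] := density_lower_bound N_large q_gt b_pen e101 e201 R00 B10.
(* The constraint set has slack: R0 > 2 B and s0 < s1. The summand [eig 0] in [R0] and the bound s0
   <= 1 make the pair (1, 0) admissible. B does not depend on the set, and s1 is computed from the
   larger bound R0, so there is no circularity. *)
exists (2 * B), s1; split=> // A uA A0.
pose s0 := Num.min s1 1 / 2.
have s00 : 0 < s0 by rewrite divr_gt0// lt_min s10 ltr01.
have s01 : s0 < s1.
  have : Num.min s1 1 <= s1 by rewrite ge_min lexx.
  by rewrite /s0; lra.
have s0le1 : s0 <= 1.
  have : Num.min s1 1 <= 1 by rewrite ge_min lexx orbT.
  by rewrite /s0; lra.
pose R0 := 2 * B + 1 + eig 0.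
pose K := quad_set (A := A) eig R0 s0.
pose cf := @coord_fun R d A.
pose delta k : freq -> R := fun l => (l == k)%:R.
have cf0 k : cf 0 k = 0 by rewrite /cf /coord_fun big1// => i _; rewrite mxE mul0r.
pose z0 : 'rV[R]_(size A) * 'rV[R]_(size A) := (fun_coord A (delta 0), 0).
have P0 x : psum A (cf z0.1) x = 1.
  rewrite /psum (bigD1_seq 0)//= /cf fun_coordK// /delta eqxx mul1r hartley0.
  rewrite big_seq_cond big1 ?addr0// => k /andP[kA k0].
  by rewrite fun_coordK// /delta (negbTE k0) mul0r.
have Kz0 : K z0.
  split=> [|x]; last by rewrite P0.
  rewrite /quad (bigD1_seq 0)//= big_seq_cond big1 => [|k /andP[kA k0]].
    rewrite addr0 /cf fun_coordK// /delta eqxx expr1n -/cf cf0 expr0n addr0 mulr1.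
    by rewrite /R0; lra.
  by rewrite fun_coordK// /delta (negbTE k0) -/cf cf0 !expr0n addr0 mulr0.
have lam0 : forall k, 0 < eig k by move=> k; exact: eig_gt0 e101 e201 _.
have Kpos z x : K z -> 0 < psum A (cf z.1) x.
  by move=> [_ /(_ x)]; exact: lt_le_trans.
have Kconv : convex_hull_closed K  by exact: quad_set_convex.
have Kcpt : compact K by exact: quad_set_compact.
have Kne : K !=set0 by exists z0.
have [z Kz Hz] := @variational_inequality R _ K (galerkin_form (A := A)) Kne
  Kcpt Kconv
  (fun z _ a p1 p2 => galerkin_form_linear z a p1 p2)
  (fun z _ => galerkin_form_continuous (z := z))
  (fun z w Kz Kw => galerkin_form_monotone (fun x => Kpos z x Kz) (fun x => Kpos w x Kw))
  (fun z w Kz Kw => galerkin_form_hemicontinuous (v := w - z)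
     (fun t x t01 => Kpos _ x (convex_segment Kconv Kz Kw t01))).
have mz x : 0 < psum A (cf z.1) x by exact: Kpos.
have FZ (a : R) v : galerkin_form z (a *: v) = a * galerkin_form z v.
  have F0 : galerkin_form z (0 : 'rV[R]_(size A) * 'rV[R]_(size A)) = 0.
    by rewrite /galerkin_form big1// => k _ /=; rewrite -/cf !cf0 !mulr0 addr0.
  by rewrite -[a *: v]addr0 galerkin_form_linear F0 addr0.
(* Taking the pair (1, 0) as competitor gives the premise of [apriori_bound]. *)
have Fz0 : galerkin_form z (z - z0) <= 0.
  have := Hz _ Kz0; rewrite -opprB -scaleN1r FZ; lra.
have zz1 : (z - z0).1 = z.1 + (-1) *: fun_coord A (delta 0) by rewrite scaleN1r.
have zz2 : (z - z0).2 = z.2 by rewrite /= subr0.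
have [E1 I1] : energy N e1 e2 A (cf z.1) (cf z.2) <= 2 * B /\
    (1 - e1) * Int (fun x => - b (psum A (cf z.1) x)) <= B.
  apply: HB => //; apply: le_trans Fz0; rewrite galerkin_formE//.
  have -> : (fun x => reduced1 H h b (psum A (cf z.1)) (psum A (cf z.2)) x * (psum A (cf z.1) x - 1)) =
      fun x => reduced1 H h b (psum A (coord_fun z.1)) (psum A (coord_fun z.2)) x * psum A (coord_fun (z - z0).1) x.
    apply/funext => x; congr (_ * _).
    by rewrite zz1 psumD -/cf P0 mulN1r.
  rewrite zz2.
  rewrite lerD2l big_seq_cond [leRHS]big_seq_cond; apply: ler_sum => k /andP[kA _].
  by rewrite zz1 coord_funD fun_coordK// mulN1r expr2.
have mlow x : s1 <= psum A (cf z.1) x.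
  apply: (Hs1 A) => //.
    apply: (@le_trans _ _ (energy N e1 e2 A (cf z.1) (cf z.2))).
      apply: ler_sum => k _; rewrite ler_wpM2l ?(ltW (lam0 k))//.
      by rewrite lerDl sqr_ge0.
    by apply: (le_trans E1); lra.
  by rewrite ler_pdivlMr ?subr_gt0// mulrC.
(* The a priori bounds hold strictly inside the constraint set, so every direction w is admissible
   after scaling; applying this to w and - w gives the equation. *)
have Fge0 w : 0 <= galerkin_form z w.
  have [||t t0 Kt] := quad_set_interior (lam := eig) (R0 := R0) (R1 := 2 * B) (z := z) w _ s01.
  - by rewrite /R0; lra.
  - by split=> //; exact: E1.
  by have := Hz _ Kt; rewrite addrC addKr FZ pmulr_rge0.
have Feq0 w : galerkin_form z w = 0.
  apply/eqP; rewrite eq_le Fge0 andbT.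
  by have := Fge0 (- w); rewrite -scaleN1r FZ mulN1r oppr_ge0.
exists (cf z.1), (cf z.2); split=> // k kA.
  have := Feq0 (fun_coord A (delta k), 0).
  rewrite /galerkin_form (bigD1_seq k)//= fun_coordK// /delta eqxx mulr1 -/cf cf0 mulr0 addr0.
  rewrite big_seq_cond big1 ?addr0// => l /andP[lA lk].
  by rewrite cf0 /cf fun_coordK// (negbTE lk) !mulr0 addr0.
have := Feq0 (0, fun_coord A (delta k)).
rewrite /galerkin_form (bigD1_seq k)//= fun_coordK// /delta eqxx mulr1 -/cf cf0 mulr0 add0r.
rewrite big_seq_cond big1 ?addr0// => l /andP[lA lk].
by rewrite cf0 /cf fun_coordK// (negbTE lk) !mulr0 addr0.
Qed.

End Galerkin.

(** * Passage to the limit *)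

Section WeightedLimits.
Context {R : realType} {d : nat}.
Local Notation freq := 'rV[int]_d.
Implicit Types (c : freq -> R) (A : seq freq).

(** The enumeration of modes is not ordered by size. Summability of wt^-(d+1) supplies a finite
    segment outside of which each single term is at most T^-(d+1). *)
Lemma wt_large (T : R) : 1 <= T -> exists n, forall k : freq, k \notin modes n -> T <= wt k.
Proof.
move=> T1; have T0 : 0 < T by lra.
have eta0 : 0 < T ^- d.+1 by rewrite invr_gt0 exprn_gt0.
have [n Hn] := @sum_tail_small R d (fun k => wt k ^- d.+1) (4 ^+ d)
  (fun k => ltW (eq_ind_r is_true (exprn_gt0 d.+1 (wt_gt0 k)) (invr_gt0 _))) (@sum_wt_le R d) _ eta0.
exists n => k kn; rewrite leNgt; apply/negP => kT.
have := Hn [:: k] isT; rewrite big_seq1 => /(_ _)/negP; apply => //.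
  by move=> l; rewrite inE => /eqP ->.
apply/negP; rewrite -ltNge ltf_pV2 ?posrE ?exprn_gt0 ?wt_gt0//.
by rewrite ltrXn2r// ?nnegrE ltW// wt_gt0.
Qed.

Lemma cvg_sum_seq (U : set_system nat) {FU : Filter U} (I : Type) (r : seq I)
    (f : I -> nat -> R) (g : I -> R) : (forall i, f i n @[n --> U] --> g i) ->
  \sum_(i <- r) f i n @[n --> U] --> \sum_(i <- r) g i.
Proof.
move=> H; elim: r => [|i r IH].
  by under eq_fun do rewrite big_nil; rewrite big_nil; exact: cvg_cst.
by under eq_fun do rewrite big_cons; rewrite big_cons; exact: cvgD.
Qed.

(** A Rellich argument: finitely many modes tend to 0 one by one, and beyond them wt k >= T turns
    the bound of order s + 1 into a factor 1 / T at order s, with T > 2 C / eps. *)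
Lemma Wle_interpolation (U : set_system nat) {FU : Filter U} s (c : nat -> freq -> R) (C : R) :
  (forall n, Wle s.+1 (c n) C) -> (forall k, c n k @[n --> U] --> (0 : R)) ->
  forall eps : R, 0 < eps -> \forall n \near U, Wle s (c n) eps.
Proof.
move=> W c0 eps eps0.
have C0 : 0 <= C := Wle_ge0 (W 0%N).
pose T := 2 * C / eps + 1.
have T1 : 1 <= T by rewrite lerDr divr_ge0 ?mulr_ge0// ltW.
have T0 : 0 < T by lra.
have [p Hp] := wt_large T1.
have fin : \sum_(k <- modes p) wt k ^+ (2 * s) * c n k ^+ 2 @[n --> U] -->
    \sum_(k <- (modes p : seq freq)) wt k ^+ (2 * s) * (0 : R) ^+ 2.
  apply: (@cvg_sum_seq U FU _ (modes p) (fun k n => wt k ^+ (2 * s) * c n k ^+ 2)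
    (fun k => wt k ^+ (2 * s) * (0 : R) ^+ 2)) => k.
  apply: cvgM; first exact: cvg_cst.
  by rewrite expr2; under eq_fun do rewrite expr2; apply: cvgM; exact: c0.
rewrite (_ : \sum_(k <- modes p) _ * 0 ^+ 2 = 0) in fin; last first.
  by rewrite big1// => k _; rewrite expr0n mulr0.
have e2 : 0 < eps / 2 by rewrite divr_gt0.
move/cvgrPdist_le : fin => /(_ _ e2); apply: filterS => n Hn A uA.
have t0 k : 0 <= wt k ^+ (2 * s) * c n k ^+ 2 by rewrite mulr_ge0 ?sqr_ge0// exprn_ge0// ltW// wt_gt0.
rewrite (bigID (fun k => k \in modes p))/= (splitr eps); apply: lerD.
  apply: (@le_trans _ _ (\sum_(k <- modes p) wt k ^+ (2 * s) * c n k ^+ 2)).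
    rewrite -big_filter; apply: sum_subset_le => //; first exact: filter_uniq.
    by move=> k; rewrite mem_filter => /andP[].
  apply: le_trans Hn; rewrite sub0r normrN; exact: ler_norm.
apply: (@le_trans _ _ (\sum_(k <- A | k \notin modes p) T^-1 * (wt k ^+ (2 * s.+1) * c n k ^+ 2))).
  apply: ler_sum => k kp; rewrite [leRHS]mulrA; apply: ler_wpM2r; first exact: sqr_ge0.
  rewrite ler_pdivlMl//.
  have w1 : 1 <= wt k :> R := wt_ge1 k.
  have w0 : 0 <= wt k :> R := ltW (wt_gt0 k).
  rewrite mulnS addnC exprD mulrC; apply: ler_wpM2l; first exact: exprn_ge0.
  apply: (le_trans (Hp k kp)); rewrite expr2; exact: ler_peMl.
rewrite -mulr_sumr -big_filter ler_pdivrMl//.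
apply: (le_trans (W n _ (filter_uniq _ uA))).
rewrite /T mulrDl mul1r -[2 * C / eps * _]mulrA (_ : eps^-1 * (eps / 2) = 2^-1).
  by rewrite mulrAC divff// mul1r lerDl ltW.
by field; rewrite lt0r_neq0.
Qed.

End WeightedLimits.

(** * Weak solution as an ultrafilter limit *)

Section WeakSolution.
Context {R : realType} {d : nat} (E : set R)
  (H : 'rV[R]_d -> 'rV[R]_d -> 'M[R]_d -> R -> R -> R)
  (h : ('rV[R]_d -> R) -> 'rV[R]_d -> R) (g : 'rV[R]_d -> R -> R -> R)
  (N s : nat) (q e1 e2 : R) (b : R -> R).
Local Notation freq := 'rV[int]_d.
Local Notation eig := (@reg_eig R d N e1 e2).
Hypotheses (EP : forall s, 0 < s -> E s) (tH : torus_Ham E H) (sH : ham_smooth H)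
  (hop : Mac_operator h) (hreg : h_regularity h)
  (g_cont : torus_continuous_coef E g) (g_str : g_structure E h g)
  (H_grow : H_growth E h g H) (mono : monotonicity E h H) (b_pen : penalty q e1 b)
  (e101 : 0 < e1 < 1) (e201 : 0 < e2 < 1) (q_gt : d%:R < q)
  (N_large : (d + 5 <= 2 * (2 * N))%N) (sN : s.+1 = (2 * N)%N)
  (ds : d%:R / 2 + 1 < s%:R :> R) (ds2 : (d.+1 + 2 * 2 <= 2 * s)%N).

Let sb : smooth_open [set s : R^o | 0 < s] b. Proof. by have [] := b_pen. Qed.

(** One ultrafilter makes all bounded coefficient sequences converge at once, which replaces a
    diagonal extraction. *)
Lemma ultra_bounded_cvg (U : set_system nat) (f : nat -> R) (C : R) : UltraFilter U ->
  (forall n, `|f n| <= C) -> exists l : R, f n @[n --> U] --> l.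
Proof.
move=> UU fC; have := @segment_compact R (- C) C.
have ultra_map : UltraFilter (f @ U).
  have FU : ProperFilter U by exact: ultra_proper.
  split=> [|G FG fG]; first exact: fmap_proper_filter.
  apply/seteqP; split=> [A GA|]; last exact: fG.
  have [//|UA] := in_ultra_setVsetC (f @^-1` A) UU.
  have GCA : G (~` A) by apply: fG.
  have := filter_ex (filterI GA GCA); by move=> [x [? ?]].
rewrite compact_ultra => /(_ (f @ U) ultra_map) K.
have [|l [_ fl]] := K; last by exists l.
by apply: nearW => n; rewrite /= in_itv/= -ler_norml.
Qed.

Lemma weak_solution : exists (m u : 'rV[R]_d -> R) (s1 C : R),
  [/\ 0 < s1, torus_continuous m /\ torus_continuous u,
      Wle (2 * N) (coef m) C /\ Wle (2 * N) (coef u) C, forall x, s1 <= m x &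
      forall k, coef (reduced1 H h b m u) k + eig k * coef m k = 0 /\
                weak2 H h m u (hartley k) + eig k * coef u k = 0].
Proof.
have [R0 [s1 [s10 G]]] := galerkin_exists EP tH sH hop hreg g_cont g_str H_grow mono b_pen
  e101 e201 q_gt N_large ds ds2.
(* The constant mode must belong to every approximation space, because the pair (1, 0) is the
   competitor there; the enumeration is therefore started at [n0]. *)
have [n0 Hn0] := modes_sub [:: (0 : freq)].
have A0 n : (0 : freq) \in modes (n0 + n).
  have := Hn0 0 (mem_head _ _); rewrite !mem_modes => h0; exact: leq_trans h0 (leq_addr _ _).
have [cc Hcc] := choice (fun n => let: ex_intro c1 (ex_intro c2 P) := G _ (modes_uniq (n0 + n)) (A0 n) in
  ex_intro (fun c : (freq -> R) * (freq -> R) => [/\ energy N e1 e2 (modes (n0 + n)) c.1 c.2 <= R0,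
      forall x, s1 <= psum (modes (n0 + n)) c.1 x,
      forall k, k \in modes (n0 + n) -> coef (reduced1 H h b (psum (modes (n0 + n)) c.1) (psum (modes (n0 + n)) c.2)) k + eig k * c.1 k = 0 &
      forall k, k \in modes (n0 + n) -> weak2 H h (psum (modes (n0 + n)) c.1) (psum (modes (n0 + n)) c.2) (hartley k) + eig k * c.2 k = 0]) (c1, c2) P).
pose mn n := psum (modes (n0 + n)) (cc n).1.
pose un n := psum (modes (n0 + n)) (cc n).2.
have lam0 k : 0 <= eig k by apply: ltW; exact: eig_gt0 e101 e201 _.
pose C := d.+1%:R ^+ (2 * (2 * N)).+1 / e1 * R0.
have Wm n : Wle (2 * N) (coef (mn n)) C.
  apply: (energy_Wle e101 e201) => A uA.
  apply: le_trans (sum_psum_le (cc n).1 lam0 (modes_uniq _) uA) _.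
  have [+ _ _ _] := Hcc n; apply: le_trans; apply: ler_sum => k _.
  by apply: ler_wpM2l => //; rewrite lerDl sqr_ge0.
have Wu n : Wle (2 * N) (coef (un n)) C.
  apply: (energy_Wle e101 e201) => A uA.
  apply: le_trans (sum_psum_le (cc n).2 lam0 (modes_uniq _) uA) _.
  have [+ _ _ _] := Hcc n; apply: le_trans; apply: ler_sum => k _.
  by apply: ler_wpM2l => //; rewrite lerDr sqr_ge0.
have [U [UU leU]] := @ultraFilterLemma _ (\oo : set_system nat) _.
have FU : ProperFilter U by exact: ultra_proper.
have bnd (a : nat -> freq -> R) : (forall n, Wle (2 * N) (a n) C) ->
    forall k, exists l : R, a n k @[n --> U] --> l.
  move=> Wa k; apply: (@ultra_bounded_cvg U (fun n => a n k) (C + 1)) => // n.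
  have := Wa n [:: k] isT; rewrite big_seq1 => h1.
  have C0 := Wle_ge0 (Wa n).
  have h2 : a n k ^+ 2 <= C.
    by apply: le_trans h1; rewrite ler_peMl ?sqr_ge0// exprn_ege1// wt_ge1.
  have [le|lt] := leP `|a n k| (C + 1); first by [].
  have h3 : (C + 1) ^+ 2 <= a n k ^+ 2.
    by rewrite -[leRHS]real_normK ?num_real// lerXn2r ?nnegrE ?(ltW lt)//; lra.
  have h4 : C + 1 <= (C + 1) ^+ 2 by rewrite expr2 ler_peMl//; lra.
  by lra.
have [cm Hcm] := choice (bnd _ Wm); have [cu Hcu] := choice (bnd _ Wu).
have Wlim (a : nat -> freq -> R) c : (forall n, Wle (2 * N) (a n) C) ->
    (forall k, a n k @[n --> U] --> (c k : R)) -> Wle (2 * N) c C.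
  move=> Wa ac A uA.
  have L : \sum_(k <- A) wt k ^+ (2 * (2 * N)) * a n k ^+ 2 @[n --> U] -->
      \sum_(k <- A) wt k ^+ (2 * (2 * N)) * c k ^+ 2.
    apply: (@cvg_sum_seq _ U _ _ A (fun k n => wt k ^+ (2 * (2 * N)) * a n k ^+ 2)
      (fun k => wt k ^+ (2 * (2 * N)) * c k ^+ 2)) => k.
    apply: cvgM; first exact: cvg_cst.
    by rewrite expr2; under eq_fun do rewrite expr2; apply: cvgM; exact: ac.
  rewrite -(cvg_lim _ L)//; apply: limr_le; first by apply/cvg_ex; eexists; exact: L.
  by apply: nearW => n; exact: Wa.
have Wcm := Wlim _ _ Wm Hcm; have Wcu := Wlim _ _ Wu Hcu.
have dj : (d.+1 + 2 * 0 <= 2 * (2 * N))%N.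
  by rewrite muln0 addn0; apply: leq_trans N_large; rewrite -addn1 leq_add2l.
have [m [pm Cm cmE _ _]] := synthesis dj Wcm.
have [u [pu Cu cuE _ _]] := synthesis dj Wcu.
have tm : torus_continuous m := Ck_torus pm Cm.
have tu : torus_continuous u := Ck_torus pu Cu.
have Wm' : Wle (2 * N) (coef m) C by move=> A uA; under eq_bigr do rewrite cmE; exact: Wcm.
have Wu' : Wle (2 * N) (coef u) C by move=> A uA; under eq_bigr do rewrite cuE; exact: Wcu.
have close (f : 'rV[R]_d -> R) (fn : nat -> 'rV[R]_d -> R) c : torus_continuous f -> (forall n, torus_continuous (fn n)) ->
    Wle (2 * N) (coef f) C -> (forall n, Wle (2 * N) (coef (fn n)) C) ->
    (forall k, coef (fn n) k @[n --> U] --> (c k : R)) -> (forall k, coef f k = c k) ->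
    forall eps : R, 0 < eps -> \forall n \near U, Wle s (coef (fun x => fn n x - f x)) eps.
  move=> tf tfn Wf Wfn fnc fc.
  apply: (@Wle_interpolation _ _ U _ s (fun n => coef (fun x => fn n x - f x)) (2 * C + 2 * C)).
    by move=> n; rewrite sN; apply: Wle_coefB => //; exact: torus_Rint.
  move=> k; have -> : (fun n => coef (fun x => fn n x - f x) k) = fun n => coef (fn n) k - c k.
    by apply/funext => n; rewrite fcoefB ?fc//; exact: torus_Rint.
  by rewrite -(subrr (c k)); apply: cvgB; [exact: fnc|exact: cvg_cst].
have tmn n : torus_continuous (mn n) := torus_psum _ _.
have tun n : torus_continuous (un n) := torus_psum _ _.
have Sm := close m mn cm tm tmn Wm' Wm Hcm cmE.
have Su := close u un cu tu tun Wu' Wu Hcu cuE.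
have mlow x : s1 <= m x.
  apply/ler_addgt0Pr => e e0.
  have a0 : 0 < (e / (2 * 2 ^+ d)) ^+ 2 by rewrite exprn_gt0// divr_gt0// mulr_gt0// exprn_gt0.
  have [n Wn] := @filter_ex _ _ FU _ (Sm _ a0).
  have dj' : (d.+1 + 2 * 0 <= 2 * s)%N by apply: leq_trans ds2; rewrite leq_add2l.
  have [_ _ /(_ [::] x isT)] := sobolev_embedding dj' (torusB (tmn n) tm) Wn.
  have ae : 0 <= e / (2 * 2 ^+ d) by rewrite divr_ge0 ?(ltW e0)// mulr_ge0// exprn_ge0.
  rewrite /= expr0 mulr1 sqrtr_sqr (ger0_norm ae).
  have p0 : 0 < 2 ^+ d :> R by rewrite exprn_gt0.
  rewrite (_ : 2 * (e / (2 * 2 ^+ d) * 2 ^+ d) = e); last by field; rewrite lt0r_neq0.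
  have [_ + _ _] := Hcc n => /(_ x); rewrite -/(mn n) => h1 /ler_normlP[_ h2].
  by lra.
have m0 x : 0 < m x by exact: lt_le_trans (mlow x).
have mn0 n x : 0 < mn n x by have [_ + _ _] := Hcc n => /(_ x); exact: lt_le_trans.
have leqs : (s <= 2 * N)%N by rewrite -sN.
have exW (f : freq -> R) : Wle (2 * N) f C -> exists C', Wle s f C' by move=> W; exists C; exact: Wle_leq W.
(* The ultrafilter refines the filter at infinity, so each fixed mode is eventually among those for
   which the projected equations hold. *)
have kmode (k : freq) : \forall n \near U, k \in modes (n0 + n).
  apply: leU; exists (choice.pickle k).+1 => // n /= kn.
  by rewrite mem_modes; apply: leq_trans kn _; exact: leq_addl.
exists m, u, s1, C; split=> // k; split.
- have L1 : coef (reduced1 H h b (mn n) (un n)) k + eig k * coef (mn n) k @[n --> U] -->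
      coef (reduced1 H h b m u) k + eig k * coef m k.
    apply: cvgD.
      exact: (reduced1_cvg EP tH sH hop hreg sb ds ds2 tm tu m0 (Wle_leq leqs Wm') (Wle_leq leqs Wu')
        tmn tun mn0 (fun n => exW _ (Wm n)) (fun n => exW _ (Wu n)) Sm Su).
    by apply: cvgM; [exact: cvg_cst|rewrite cmE; exact: Hcm].
  suff L2 : coef (reduced1 H h b (mn n) (un n)) k + eig k * coef (mn n) k @[n --> U] --> (0 : R).
    by rewrite -(cvg_lim _ L1)// (cvg_lim _ L2).
  apply: (@cvg_trans _ ((fun=> 0 : R) n @[n --> U])); last exact: cvg_cst.
  apply: near_eq_cvg; apply: filterS (kmode k) => n kn.
  have [_ _ + _] := Hcc n => /(_ k kn) <-.
  by rewrite /mn coef_psum ?modes_uniq// kn.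
- have L1 : weak2 H h (mn n) (un n) (hartley k) + eig k * coef (un n) k @[n --> U] -->
      weak2 H h m u (hartley k) + eig k * coef u k.
    apply: cvgD.
      exact: (weak2_cvg EP tH sH hop hreg ds ds2 tm tu m0 (Wle_leq leqs Wm') (Wle_leq leqs Wu')
        tmn tun mn0 (fun n => exW _ (Wm n)) (fun n => exW _ (Wu n)) Sm Su
        (zperiodic_hartley k) (Ck_hartley 2 k)).
    by apply: cvgM; [exact: cvg_cst|rewrite cuE; exact: Hcu].
  suff L2 : weak2 H h (mn n) (un n) (hartley k) + eig k * coef (un n) k @[n --> U] --> (0 : R).
    by rewrite -(cvg_lim _ L1)// (cvg_lim _ L2).
  apply: (@cvg_trans _ ((fun=> 0 : R) n @[n --> U])); last exact: cvg_cst.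
  apply: near_eq_cvg; apply: filterS (kmode k) => n kn.
  have [_ _ _ +] := Hcc n => /(_ k kn) <-.
  by rewrite /un coef_psum ?modes_uniq// kn.
Qed.

End WeakSolution.

(** * Regularity *)

Section WeightedGain.
Context {R : realType} {d : nat}.
Local Notation freq := 'rV[int]_d.
Implicit Types (c w : freq -> R) (A : seq freq) (k : freq).

(** A multiplier of order p costs p derivatives; this measures the derivatives left on the test
    function. *)
Lemma Wle_scale s p c c' (a C : R) : 0 <= a ->
  (forall k, `|c' k| <= a * wt k ^+ p * `|c k|) -> Wle (s + p) c C -> Wle s c' (a ^+ 2 * C).
Proof.
move=> a0 H W A uA; apply: le_trans (ler_wpM2l (sqr_ge0 a) (W A uA)).
rewrite mulr_sumr; apply: ler_sum => k _.
have w0 : 0 <= wt k :> R := ltW (wt_gt0 k).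
have h : c' k ^+ 2 <= (a * wt k ^+ p * `|c k|) ^+ 2.
  rewrite -[leLHS]real_normK ?num_real// lerXn2r ?nnegrE//.
  by apply: mulr_ge0 => //; apply: mulr_ge0 => //; exact: exprn_ge0.
apply: (@le_trans _ _ (wt k ^+ (2 * s) * (a * wt k ^+ p * `|c k|) ^+ 2)).
  by apply: ler_wpM2l => //; exact: exprn_ge0.
by rewrite !exprMn real_normK ?num_real// -exprM mulnDr exprD (mulnC p); lra.
Qed.

Lemma Wle_opp s c C : Wle s c C -> Wle s (fun k => c (- k)) C.
Proof.
move=> W A uA.
have -> : \sum_(k <- A) wt k ^+ (2 * s) * c (- k) ^+ 2 =
    \sum_(k <- [seq - k | k <- A]) wt k ^+ (2 * s) * c k ^+ 2.
  by rewrite big_map; apply: eq_bigr => k _; rewrite wtN.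
by apply: W; rewrite map_inj_uniq//; exact: oppr_inj.
Qed.

Lemma Wle_sum s (I : Type) (r : seq I) (c : I -> freq -> R) : (forall i, exists C, Wle s (c i) C) ->
  exists C, Wle s (fun k => \sum_(i <- r) c i k) C.
Proof.
move=> H; elim: r => [|i r [C IH]].
  exists 0 => A _; rewrite big1// => k _.
  by rewrite big_nil expr0n mulr0.
have [C' W] := H i; exists (2 * C' + 2 * C) => A uA.
have := WleD W IH uA; apply: le_trans.
by apply: ler_sum => k _; rewrite big_cons.
Qed.

(** Solving for c k divides w k by an eigenvalue bounded below by a multiple of wt k to the power
    4N, so the two orders add up. *)
Lemma Wle_gain N (e1 e2 : R) r c w C : 0 < e1 -> 0 < e2 ->
  (forall k, w k + reg_eig N e1 e2 k * c k = 0) -> Wle r w C ->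
  exists C', Wle (r + 2 * (2 * N)) c C'.
Proof.
move=> e10 e20 H W.
pose K : R := d.+1%:R ^+ (2 * (2 * N)).+1 / e1.
have K0 : 0 <= K by rewrite divr_ge0 ?exprn_ge0// ltW.
exists (K ^+ 2 * C) => A uA; apply: le_trans (ler_wpM2l (sqr_ge0 K) (W A uA)).
rewrite mulr_sumr; apply: ler_sum => k _.
have w0 : 0 <= wt k :> R := ltW (wt_gt0 k).
have g0 := reg_eig_gt0 N k e10 e20.
have L1 : wt k ^+ (2 * (2 * N)) <= K * reg_eig N e1 e2 k.
  by rewrite /K mulrAC ler_pdivlMr// mulrC; apply: reg_eig_ge; exact: ltW.
have -> : w k = - (reg_eig N e1 e2 k * c k) by apply/eqP; rewrite -addr_eq0; exact/eqP.
have -> : wt k ^+ (2 * (r + 2 * (2 * N))) = wt k ^+ (2 * r) * (wt k ^+ (2 * (2 * N))) ^+ 2 :> R.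
  by rewrite mulnDr exprD; congr (_ * _); rewrite mulnC exprM.
have L2 : (wt k ^+ (2 * (2 * N))) ^+ 2 <= (K * reg_eig N e1 e2 k) ^+ 2.
  rewrite lerXn2r ?nnegrE ?exprn_ge0//; apply: mulr_ge0 => //; exact: ltW.
have p0 : 0 <= wt k ^+ (2 * r) * c k ^+ 2 by rewrite mulr_ge0 ?sqr_ge0// exprn_ge0.
have := ler_wpM2l p0 L2; move: (wt k ^+ (2 * r)) (wt k ^+ (2 * (2 * N))) (reg_eig N e1 e2 k) => x y z.
by move: (K) (c k) => l v; rewrite sqrrN !exprMn; lra.
Qed.

End WeightedGain.

Section Bootstrap.
Context {R : realType} {d : nat} (E : set R)
  (H : 'rV[R]_d -> 'rV[R]_d -> 'M[R]_d -> R -> R -> R)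
  (h : ('rV[R]_d -> R) -> 'rV[R]_d -> R)
  (N : nat) (e1 e2 : R) (b : R -> R) (m u : 'rV[R]_d -> R).
Local Notation eig := (@reg_eig R d N e1 e2).
Hypotheses (EP : forall s, 0 < s -> E s) (tH : torus_Ham E H) (sH : ham_smooth H)
  (hop : Mac_operator h) (hreg : h_regularity h) (sb : smooth_open [set s : R^o | 0 < s] b)
  (e10 : 0 < e1) (e20 : 0 < e2)
  (N_large : (d + 10 < 2 * (2 * N))%N)
  (tm : torus_continuous m) (tu : torus_continuous u) (m0 : forall x, 0 < m x)
  (eq1 : forall k, coef (reduced1 H h b m u) k + eig k * coef m k = 0)
  (eq2 : forall k, weak2 H h m u (hartley k) + eig k * coef u k = 0).

Let smooth_at s := exists C, Wle s (coef m) C /\ Wle s (coef u) C.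

(** Tested against a Hartley function, the derivatives become multipliers: one derivative flips the
    frequency, two restore it. The residual is thus a combination of coefficients of functions whose
    regularity is known. *)
Lemma weak2_hartley k : Ck 2 u -> weak2 H h m u (hartley k) = coef (fun x => m x - 1) k
  + \sum_i hcoef [:: i] k * coef (fun x => m x * along (DpH H i) h m u x) (- k)
  + \sum_i \sum_j hcoef [:: i; j] k * coef (fun x => m x * along (DMH H i j) h m u x) k.
Proof.
move=> Cu.
have tF i : torus_continuous (fun x => m x * along (DpH H i) h m u x).
  apply: torusM; first exact: tm.
  exact: (torus_along EP hop (torus_Ham_Dp i tH) (ham_smooth_Dp i sH) tm m0 tu.1 Cu).
have tG i j : torus_continuous (fun x => m x * along (DMH H i j) h m u x).
  apply: torusM; first exact: tm.
  exact: (torus_along EP hop (torus_Ham_DM i j tH) (ham_smooth_DM i j sH) tm m0 tu.1 Cu).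
have I0 : integrableR (fun x => (m x - 1) * hartley k x).
  by apply: Rint_coef; apply: torus_Rint; apply: torusB => //; exact: torus_cst.
have P1 i : integrableR (fun x => m x * along (DpH H i) h m u x * partial i (hartley k) x).
  apply: Rint_mult; first exact: torus_Rint (tF i).
  exact: (torus_partials (s := [:: i]) (zperiodic_hartley k) (Ck_hartley 2 k)).
have P2 i j : integrableR (fun x => m x * along (DMH H i j) h m u x * partials [:: i; j] (hartley k) x).
  apply: Rint_mult; first exact: torus_Rint (tG i j).
  exact: (torus_partials (s := [:: i; j]) (zperiodic_hartley k) (Ck_hartley 2 k)).
have Q1 : integrableR (fun x => \sum_i m x * along (DpH H i) h m u x * partial i (hartley k) x).
  by apply: Rint_sum => i; exact: P1.
have Q2 i : integrableR (fun x => \sum_j m x * along (DMH H i j) h m u x * partials [:: i; j] (hartley k) x).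
  by apply: Rint_sum => j; exact: P2.
rewrite /weak2 /weak2_density IntD; [|exact: RintD|by apply: Rint_sum => i; exact: Q2].
rewrite IntD// Int_sum// Int_sum; last exact: Q2.
have shift (s : seq 'I_d) (f : 'rV[R]_d -> R) : torus_continuous f ->
    Int (fun x => f x * partials s (hartley k) x) = hcoef s k * coef f (hsign (size s) k).
  move=> tf; rewrite /coef -IntZ; last exact: Rint_coef (torus_Rint tf).
  by congr Int; apply/funext => x; rewrite partials_hartley mulrCA.
congr (_ + _ + _); first by apply: eq_bigr => i _; exact: shift [:: i] _ (tF i).
apply: eq_bigr => i _; rewrite Int_sum; last exact: P2.
by apply: eq_bigr => j _; exact: shift [:: i; j] _ (tG i j).
Qed.

(** The least integer above d / 2: the loss of derivatives in the Sobolev embedding. *)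
Let D := d./2.+1.

Let DP : (d.+1 <= 2 * D)%N. Proof. by rewrite /D mul2n doubleS -addn1 -{1}(odd_double_half d); case: (odd d); rewrite /= ?addn1 ?add0n ?add1n ?addn2//. Qed.

(* W^{s,2} embeds into C^{s-D}, the residuals lie in W^{s-D-4,2} at worst, and
   dividing by the eigenvalues gains 4 N >= D + 5 derivatives. *)
Lemma bootstrap_step s : (2 * N <= s)%N -> smooth_at s -> smooth_at s.+1.
Proof.
move=> Ns [C [Wm Wu]].
have DN : (D + 5 <= 2 * N)%N.
  have : (D <= d./2.+1)%N by [].
  have := odd_double_half d; move: N_large; rewrite -addnn; lia.
(* At order s the functions m, u and h(m) are of class C^(r + 4); the Hessian leaves the Hamiltonian
   terms in C^(r + 2), and two further derivatives put the second residual in W^{r,2}. *)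
have [r sE] : exists r, s = (D + 4 + r)%N.
  by exists (s - (D + 4))%N; rewrite subnKC//; apply: leq_trans Ns; apply: leq_trans DN; rewrite leq_add2l.
have dj : (d.+1 + 2 * (r + 4) <= 2 * s)%N.
  by rewrite sE; move: DP; lia.
have ds : d%:R / 2 + 1 < s%:R :> R.
  have : (d + 2 < 2 * s)%N by move: DP; rewrite sE; lia.
  by rewrite -(ltr_nat R) natrD natrM; lra.
have [Cm _ _] := sobolev_embedding dj tm Wm.
have [Cu _ _] := sobolev_embedding dj tu Wu.
have m0' x : 0 <= m x by exact: ltW.
have [C' Wh] := operator_Wle hreg ds tm m0' Wm.
have th := torus_operator hop tm m0'.
have [Ch _ _] := sobolev_embedding dj th Wh.
have Cj j : (j <= r + 4)%N -> [/\ Ck j m, Ck j u & Ck j (h m)].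
  by move=> jr; split; [exact: Ck_leq Cm|exact: Ck_leq Cu|exact: Ck_leq Ch].
have [Cm2 Cu2 Ch2] := Cj (r + 2)%N (leq_add (leqnn r) (isT : (2 <= 4)%N)).
have Cu4 : Ck (r + 2).+2 u by apply: Ck_leq Cu; rewrite -addn2 -addnA.
have CA F : ham_smooth F -> Ck (r + 2) (along F h m u).
  by move=> sF; exact: (Ck_ham sF m0 Cm2 Cu4 Ch2).
have Cu2' : Ck 2 u by apply: Ck_leq Cu; rewrite addn4.
have tF F : torus_Ham E F -> ham_smooth F -> torus_continuous (fun x => m x * along F h m u x).
  by move=> tF' sF; apply: torusM; [exact: tm|exact: (torus_along EP hop tF' sF tm m0 tu.1 Cu2')].
have WA F : torus_Ham E F -> ham_smooth F ->
    exists C, Wle (r + 2) (coef (fun x => m x * along F h m u x)) C.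
  move=> tF' sF; apply: Ck_Wle; first exact: (tF F tF' sF).1.
  by apply: CkM => //; exact: CA.
have [C1 W1] : exists C, Wle (r + 2) (coef (reduced1 H h b m u)) C.
  apply: Ck_Wle; first by apply: (torus_reduced1 EP tH sH hop sb tm m0 tu.1 Cu2').1.
  apply: CkD; last exact: (Ck_penalty sb m0 Cm2).
  by apply: CkB; [exact: CkN|exact: CA].
have [C2 W2] : exists C, Wle r (fun k => weak2 H h m u (hartley k)) C.
  have [K1 V1] : exists C, Wle r (coef (fun x => m x - 1)) C.
    apply: Ck_Wle; first by move=> x i; rewrite (tm.1 x i).
    by apply: CkB; [apply: Ck_leq Cm; exact: leq_addr|exact: Ck_cst].
  have [K2 V2] : exists C, Wle r (fun k => \sum_i hcoef [:: i] k * coef (fun x => m x * along (DpH H i) h m u x) (- k)) C.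
    apply: Wle_sum => i.
    have [K W] := WA _ (torus_Ham_Dp i tH) (ham_smooth_Dp i sH).
    exists ((2 * pi) ^+ 2 * K); apply: (@Wle_scale _ _ r 1 (fun k => coef (fun x => m x * along (DpH H i) h m u x) (- k))).
    - by rewrite mulr_ge0// pi_ge0.
    - move=> k; rewrite normrM; apply: ler_wpM2r => //; exact: hcoef_le [:: i] k.
    - by apply: Wle_opp; apply: Wle_leq W; rewrite leq_add2l.
  have [K3 V3] : exists C, Wle r (fun k => \sum_i \sum_j hcoef [:: i; j] k * coef (fun x => m x * along (DMH H i j) h m u x) k) C.
    apply: Wle_sum => i; apply: Wle_sum => j.
    have [K W] := WA _ (torus_Ham_DM i j tH) (ham_smooth_DM i j sH).
    exists (((2 * pi) ^+ 2) ^+ 2 * K); apply: (@Wle_scale _ _ r 2 (coef (fun x => m x * along (DMH H i j) h m u x))) => //.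
    - by rewrite exprn_ge0// mulr_ge0// pi_ge0.
    - move=> k; rewrite normrM; apply: ler_wpM2r => //; exact: hcoef_le [:: i; j] k.
  eexists => A uA; apply: le_trans (WleD (WleD V1 V2) V3 uA).
  by apply: ler_sum => k _; rewrite (weak2_hartley k Cu2').
have [C3 W3] := Wle_gain e10 e20 eq1 W1.
have [C4 W4] := Wle_gain e10 e20 eq2 W2.
exists (Num.max C3 C4); split.
  apply: (@Wle_le _ _ _ _ C3); first by rewrite le_max lexx.
  by apply: Wle_leq W3; rewrite sE; move: DN; lia.
apply: (@Wle_le _ _ _ _ C4); first by rewrite le_max lexx orbT.
by apply: Wle_leq W4; rewrite sE; move: DN; lia.
Qed.

Lemma bootstrap_smooth : smooth_at (2 * N) -> torus_smooth m /\ torus_smooth u.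
Proof.
move=> W0.
have W n : smooth_at (2 * N + n)%N.
  elim: n => [|n IH]; first by rewrite addn0.
  by rewrite addnS; apply: bootstrap_step IH; exact: leq_addr.
have C j : Ck j m /\ Ck j u.
  have [C [Wm Wu]] := W (D + j)%N.
  have dj : (d.+1 + 2 * j <= 2 * (2 * N + (D + j)))%N by move: DP; lia.
  by have [? _ _] := sobolev_embedding dj tm Wm; have [? _ _] := sobolev_embedding dj tu Wu.
by split; apply: Ck_torus_smooth => [|j]; [exact: tm.1|exact: (C j).1|exact: tu.1|exact: (C j).2].
Qed.

(** The left-hand sides are continuous and all their coefficients vanish, so completeness of the
    Hartley system gives the equations at every point. *)
Lemma smooth_system : torus_smooth m -> torus_smooth u -> regularized_system N H h b e1 e2 m u.
Proof.
move=> sm su.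
have Cm j : Ck j m := torus_smooth_Ck j sm.
have Cu j : Ck j u := torus_smooth_Ck j su.
have treg f : torus_continuous f -> (forall j, Ck j f) ->
    torus_continuous (fun x => e1 * (f x + iter (2 * N) laplacian f x) + e2 * (f x - laplacian f x)).
  move=> tf Cf; apply: torusD; apply: torusZ.
    apply: torusD; first exact: tf.
    by apply: (@Ck_torus _ _ 0%N); [exact: zperiodic_iter_laplacian tf.1|exact: Ck_iter_laplacian].
  apply: torusB; first exact: tf.
  by apply: (@Ck_torus _ _ 0%N); [exact: zperiodic_laplacian tf.1|exact: Ck_laplacian].
have tr := torus_reduced1 EP tH sH hop sb tm m0 tu.1 (Cu 2%N).
have c0 k : coef (fun _ : 'rV[R]_d => 0) k = 0 :> R.
  rewrite /coef (_ : (fun x => _) = fun=> 0) ?Int_cst//.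
  by apply/funext => x; exact: mul0r.
split.
- suff e : (fun x => reduced1 H h b m u x +
      (e1 * (m x + iter (2 * N) laplacian m x) + e2 * (m x - laplacian m x))) = fun=> 0.
    by move=> x; have := congr1 (fun f => f x) e; rewrite /reduced1 => <-; ring.
  apply: coef_inj; [exact: torusD tr (treg _ _ tm Cm)|exact: torus_cst|].
  move=> k; rewrite fcoefD; [|exact: torus_Rint tr|exact: torus_Rint (treg _ _ tm Cm)].
  by rewrite coef_reg ?c0//; exact: tm.1.
- have [_ tA] := weak2_A2 EP tH sH hop hreg Cm tm.1 m0 Cu tu.1 (fun j => Ck_hartley j 0) (zperiodic_hartley 0).
  suff e : (fun x => A2 H h m u x +
      (e1 * (u x + iter (2 * N) laplacian u x) + e2 * (u x - laplacian u x))) = fun=> 0.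
    by move=> x; have := congr1 (fun f => f x) e => <-; ring.
  apply: coef_inj; [exact: torusD tA (treg _ _ tu Cu)|exact: torus_cst|].
  move=> k; rewrite fcoefD; [|exact: torus_Rint tA|exact: torus_Rint (treg _ _ tu Cu)].
  rewrite coef_reg//; last exact: tu.1.
  have [e _] := weak2_A2 EP tH sH hop hreg Cm tm.1 m0 Cu tu.1 (fun j => Ck_hartley j k) (zperiodic_hartley k).
  by rewrite [coef (A2 _ _ _ _) k](esym e) eq2 c0.
Qed.

End Bootstrap.

Theorem proposition3p1 (R : realType) (d : nat) (E : set R)
    (H : 'rV[R]_d -> 'rV[R]_d -> 'M[R]_d -> R -> R -> R)
    (h : ('rV[R]_d -> R) -> ('rV[R]_d -> R))
    (g : 'rV[R]_d -> R -> R -> R)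
    (N : nat) (q : R) (beta : R -> R -> R)
    (d_ge1 : (1 <= d)%N)
    (E_eq : E = [set s | 0 < s] \/ E = [set s | 0 <= s])
    (H_torus : torus_Ham E H)
    (h_op : Mac_operator h)
    (g_cont : torus_continuous_coef E g)
    (N_large : d%:R / 2 + 1 < (2 * N)%:R - 4 :> R)
    (q_gt : d%:R < q)
    (beta_pen : forall e1, 0 < e1 < 1 -> penalty q e1 (beta e1))
    (h_reg : h_regularity h)
    (g_str : g_structure E h g)
    (H_grow : H_growth E h g H)
    (H_smooth : H_smoothness E H)
    (A_mono : monotonicity E h H) :
  forall e1 e2 : R, 0 < e1 < 1 -> 0 < e2 < 1 ->
    exists m u : 'rV[R]_d -> R,
      [/\ torus_smooth m, torus_smooth u, 0 < inf (range m) &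
          regularized_system N H h (beta e1) e1 e2 m u].
Proof.
move=> e1 e2 e101 e201.
have EP s : 0 < s -> E s by case: E_eq => -> //=; exact: ltW.
have sH := smooth_on_ham EP H_smooth.
have bp := beta_pen e1 e101.
have sb : smooth_open [set s : R^o | 0 < s] (beta e1) by have [] := bp.
(* This is twice 2N > d/2 + 5. It is the margin of the bootstrap, and with s = 2N - 1 it gives d + 5
   <= 2 s, the embedding into C^2. *)
have N10 : (d + 10 < 2 * (2 * N))%N.
  by rewrite -(ltr_nat R) natrD [(2 * (2 * N))%:R]natrM; lra.
have [s sN] : exists s, s.+1 = (2 * N)%N.
  by exists (2 * N).-1; rewrite prednK//; move: N10; case: (N).
have NR : (2 * N)%:R = s%:R + 1 :> R by rewrite -sN -natr1.
have ds : d%:R / 2 + 1 < s%:R :> R by rewrite NR in N_large; lra.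
have N5 : (d + 5 <= 2 * (2 * N))%N by apply: ltnW; apply: leq_ltn_trans N10; rewrite leq_add2l.
have ds2 : (d.+1 + 2 * 2 <= 2 * s)%N by move: N10; rewrite -sN; lia.
have [m [u [s1 [C [s10 [tm tu] [Wm Wu] mlow eqs]]]]] := weak_solution EP H_torus sH h_op h_reg
  g_cont g_str H_grow A_mono bp e101 e201 q_gt N5 sN ds ds2.
have m0 x : 0 < m x by exact: lt_le_trans (mlow x).
have [e10 _] := andP e101; have [e20 _] := andP e201.
have [sm su] := bootstrap_smooth EP H_torus sH h_op h_reg sb e10 e20 N10 tm tu m0
  (fun k => (eqs k).1) (fun k => (eqs k).2) (ex_intro _ C (conj Wm Wu)).
exists m, u; split => //.
  apply: (lt_le_trans s10); apply: lb_le_inf; first by exists (m 0), 0.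
  by move=> _ [x _ <-]; exact: mlow.
exact: (smooth_system EP H_torus sH h_op h_reg sb tm tu m0 (fun k => (eqs k).1) (fun k => (eqs k).2)
  sm su).
Qed.
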